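(* Let $a\in C^\infty(\mathbb S)$ be positive with $\int_0^{2\pi}a^{-1}d\theta=2\pi$ and $\hat a_k=0$ for $|k|>N$, for some $N\in\mathbb N$. Then there is a unique $\alpha\in C^\infty([0,\infty),C^\infty(\mathbb S))$ such that each $\alpha_\tau$ is positive, $\alpha_0=a$, $\frac{\partial\alpha_\tau}{\partial\tau}=-\alpha_\tau(\Lambda\alpha_\tau)+(\mathcal H\alpha_\tau)(D\alpha_\tau)$ for $\tau\ge0$, and $\widehat{(\alpha_\tau)}_k=0$ for all $\tau\ge0$ and $|k|>N$. Moreover, if $c=\{c_k\}_{k\ge0}$ is a sequence of positive reals with $c_0\ge\hat a_0$, $c_1\ge\zeta_a(-1)$ and $c_{m+1}\ge\zeta_a(-2m)$ for $m\ge1$, then $\alpha_\tau\in\mathcal K_c$ for every $\tau\ge0$.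
   Context: $u=\sum\hat u_ke^{ik\theta}$. $D=-i\,d/d\theta$, $\Lambda e^{in\theta}=|n|e^{in\theta}$, $\mathcal H\mathbf 1=0$, $\mathcal He^{in\theta}=\mathrm{sgn}(n)e^{in\theta}$ ($n\ne0$). For positive $b$ with $\int b^{-1}=2\pi$, $\zeta_b$ is the meromorphic continuation of $\sum_{k\ge1}\lambda_k(b)^{-s}$ over the positive eigenvalues of $b^{1/2}\Lambda b^{1/2}$. $\mathcal K_c=\{b\in C^\infty(\mathbb S): b>0,\ \int_0^{2\pi}b^{-1}=2\pi,\ \hat b_0\le c_0,\ \zeta_b(-1)\le c_1,\ \zeta_b(-2m)\le c_{m+1}\ (m\ge1)\}$. *)

(* Defs.v *)
From Stdlib Require Import Reals ZArith.
From Coquelicot Require Import Coquelicot.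
Open Scope R_scope.

Definition per (u : R -> R) : Prop := forall x, u (x + 2 * PI) = u x.
Definition smooth (u : R -> R) : Prop := forall (n : nat) (x : R), ex_derive_n u n x.
Definition Cinf (u : R -> R) : Prop := smooth u /\ per u.
Definition cCinf (u : R -> C) : Prop :=
  Cinf (fun t => Re (u t)) /\ Cinf (fun t => Im (u t)).

Definition cexpi (x : R) : C := (cos x, sin x).

(* Fourier coefficient  \hat u_k = (1/2pi) \int_0^{2pi} u(t) e^{-ikt} dt *)
Definition uhat (u : R -> C) (k : Z) : C :=
  (/ (2 * PI) * RInt (fun t => Re (u t) * cos (IZR k * t) + Im (u t) * sin (IZR k * t)) 0 (2 * PI),
   / (2 * PI) * RInt (fun t => Im (u t) * cos (IZR k * t) - Re (u t) * sin (IZR k * t)) 0 (2 * PI)).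

Definition rC (u : R -> R) : R -> C := fun t => RtoC (u t).

Fixpoint csum (f : nat -> C) (n : nat) : C :=
  match n with O => RtoC 0 | S n => Cplus (csum f n) (f n) end.

Definition psum (m : Z -> C) (u : R -> C) (M : nat) (th : R) : C :=
  csum (fun j => let k := (Z.of_nat j - Z.of_nat M)%Z in
                 Cmult (Cmult (m k) (uhat u k)) (cexpi (IZR k * th))) (2 * M + 1).

Definition fmult (m : Z -> C) (u : R -> C) (th : R) : C :=
  (real (Lim_seq (fun M => Re (psum m u M th))),
   real (Lim_seq (fun M => Im (psum m u M th)))).

Definition Lam (u : R -> C) : R -> C := fmult (fun k => RtoC (IZR (Z.abs k))) u.
Definition Hil (u : R -> C) : R -> C := fmult (fun k => RtoC (IZR (Z.sgn k))) u.
(* D = -i d/d theta, on real functions *)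
Definition Dop (u : R -> R) (th : R) : C := (0, - Derive u th).

Definition eigsp (b : R -> R) (x : R) (u : R -> C) : Prop :=
  cCinf u /\
  forall th, Cmult (RtoC (sqrt (b th))) (Lam (fun t => Cmult (RtoC (sqrt (b t))) (u t)) th)
             = Cmult (RtoC x) (u th).

Definition has_dim_ge (E : (R -> C) -> Prop) (n : nat) : Prop :=
  exists f : nat -> (R -> C),
    (forall i, (i < n)%nat -> E (f i)) /\
    (forall c : nat -> C,
       (forall th, csum (fun i => Cmult (c i) (f i th)) n = RtoC 0) ->
       forall i, (i < n)%nat -> c i = RtoC 0).

Definition idx_ge (lam : nat -> R) (x : R) (n : nat) : Prop :=
  exists g : nat -> nat,
    (forall i j, (i < n)%nat -> (j < n)%nat -> g i = g j -> i = j) /\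
    (forall i, (i < n)%nat -> lam (g i) = x).

(* lam = nondecreasing enumeration of the positive eigenvalues of
   b^{1/2} Lambda b^{1/2}, repeated according to multiplicity *)
Definition eig_seq (b : R -> R) (lam : nat -> R) : Prop :=
  (forall k, 0 < lam k) /\ (forall k, lam k <= lam (S k)) /\
  (forall x n, 0 < x -> (idx_ge lam x n <-> has_dim_ge (eigsp b x) n)).

Definition cpow (x : R) (s : C) : C :=
  Cmult (RtoC (exp (Re s * ln x))) (cexpi (Im s * ln x)).

Definition loc_finite (P : C -> Prop) : Prop :=
  forall z : C, exists r, 0 < r /\ exists l : list C,
    forall w, P w -> Cmod (Cminus w z) < r -> List.In w l.

(* zeta_b is regular at s0 and zeta_b(s0) = z :  the meromorphic continuation of
   sum_k lam_k^{-s}, i.e. Z holomorphic off a closed discrete set P, agreeing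
   with the convergent series on a right half-plane; s0 not in P. *)
Definition zeta_at (b : R -> R) (s0 z : C) : Prop :=
  exists lam : nat -> R, eig_seq b lam /\
  exists (P : C -> Prop) (Z : C -> C) (sig : R),
    loc_finite P /\ ~ P s0 /\
    (forall s, ~ P s -> ex_derive (K := C_AbsRing) (V := C_NormedModule) Z s) /\
    (forall s, sig < Re s -> ~ P s /\
        is_series (K := C_AbsRing) (V := C_NormedModule)
                  (fun k => cpow (lam k) (Copp s)) (Z s)) /\
    Z s0 = z.

Definition zeta_le (b : R -> R) (s0 : R) (c : R) : Prop :=
  exists z : C, zeta_at b (RtoC s0) z /\ Im z = 0 /\ Re z <= c.

Definition Kc (c : nat -> R) (b : R -> R) : Prop :=
  Cinf b /\ (forall th, 0 < b th) /\
  RInt (fun t => / b t) 0 (2 * PI) = 2 * PI /\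
  Re (uhat (rC b) 0) <= c 0%nat /\
  zeta_le b (-1) (c 1%nat) /\
  (forall m : nat, (1 <= m)%nat -> zeta_le b (- 2 * INR m) (c (S m))).

(* beta is the derivative of the curve alpha in the Frechet topology of
   C^infty(S) (seminorms sup |d^j/dtheta^j .|), one-sided at tau = 0 *)
Definition fder (al be : R -> R -> R) : Prop :=
  forall tau, 0 <= tau -> forall (j : nat) (eps : R), 0 < eps ->
  exists delta, 0 < delta /\
  forall h, h <> 0 -> Rabs h < delta -> 0 <= tau + h -> forall th,
    Rabs (Derive_n (fun t => (al (tau + h) t - al tau t) / h - be tau t) j th) <= eps.

Definition fcont (al : R -> R -> R) : Prop :=
  forall tau, 0 <= tau -> forall (j : nat) (eps : R), 0 < eps ->
  exists delta, 0 < delta /\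
  forall tau', 0 <= tau' -> Rabs (tau' - tau) < delta -> forall th,
    Rabs (Derive_n (fun t => al tau' t - al tau t) j th) <= eps.

Definition curve_smooth (al : R -> R -> R) (B : nat -> R -> R -> R) : Prop :=
  (forall tau, 0 <= tau -> B O tau = al tau) /\
  (forall n tau, 0 <= tau -> Cinf (B n tau)) /\
  (forall n, fcont (B n)) /\
  (forall n, fder (B n) (B (S n))).

Definition sol (a : R -> R) (N : nat) (al : R -> R -> R) : Prop :=
  (exists B, curve_smooth al B /\
     forall tau th, 0 <= tau ->
       RtoC (B 1%nat tau th) =
       Cplus (Copp (Cmult (RtoC (al tau th)) (Lam (rC (al tau)) th)))
             (Cmult (Hil (rC (al tau)) th) (Dop (al tau) th))) /\
  (forall tau th, 0 <= tau -> 0 < al tau th) /\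
  al 0 = a /\
  (forall tau k, 0 <= tau -> (Z.of_nat N < Z.abs k)%Z -> uhat (rC (al tau)) k = RtoC 0).

(* Main.v *)
(** In real form the flow is [b' = h b_x - b h_x] with [h = J b] the conjugate function and
  [h_x = Lambda b].  It is a quadratic ODE on trigonometric polynomials of degree [N]; the minimum
  of [b] decays at most exponentially and the mean is nonincreasing, hence global positive solutions.
  Since [(1/b)' = (h/b)_x], the coordinate [s] with [s_x = 1/b] can be transported along the flow.

  The positive eigenvalues of [b^{1/2} Lambda b^{1/2}] are those of [b Lambda], and
  [(b Lambda)^2 = (b D)^2 + b G] with [G] of finite rank.  In the orthonormal basis
  [sqrt 2 cos (mu_k s + p_k)] of [L^2(dx / b)] the operator [(b Lambda)^2] becomes
  [diag (mu_k^2) + F], where [F] decreases rapidly; so [lam_j - mu_j] decreases rapidly and two zeta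
  functions along the flow differ by the entire function [sum_j (lam_j^{-s} - lam'_j^{-s})].
  Its values at [s = -1, -2m] are monotone in time: the derivative of [F] satisfies
  [(F' psi_j, psi_j) = - 2 lam_j (F psi_j, psi_j)], Klein's inequality bounds the increments of
  [sum_j (lam_j^p - mu_j^p)] by [- p sum_j lam_j^{p-1} (F psi_j, psi_j)] up to quadratic errors, and
  this sum is nonnegative because [lam^{p-1} (lam^2 - mu^2) >= 2 mu^p (lam - mu)] and the diagonal
  entries of [b Lambda] for the cosine and sine of equal frequency add up to at least [2 mu]. *)

From Stdlib Require Import Reals Lra Lia Psatz ZArith List FunctionalExtensionality Classical ClassicalEpsilon.
From Coquelicot Require Import Coquelicot.
Require Import Defs.
Open Scope R_scope.

Tactic Notation "use" constr(t) := pose proof t.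
Tactic Notation "use" constr(t) "as" simple_intropattern(p) := pose proof t as p.
Tactic Notation "upto" uconstr(t) := eapply Rle_trans; [apply t|].
Tactic Notation "below" uconstr(t) := eapply Rle_trans; [|apply t].
Tactic Notation "via" constr(t) := apply Rle_trans with t.
Ltac mul_l := apply Rmult_le_compat_l.
Ltac mul_r := apply Rmult_le_compat_r.
Ltac mul_lr := apply Rmult_le_compat.
Ltac fext := apply functional_extensionality.

(** * Finite sums, series and rapidly decreasing sequences *)

(** The eigenvalues are asymptotically double and may cross, so no single eigenvalue is ever
    differentiated in time. Klein's inequality compares whole spectral sums at two times through the
    squared overlaps of the two eigenbases, and increments bounded by [K (b - a)^2] already force
    monotonicity. Convexity enters in the variable [lam^2], for the powers [x^(m+1)] and for
    [- sqrt x], because it is the square of [b Lambda] that becomes a diagonal matrix plus a rapidly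
    decreasing one. The basis moves with the flow: the diagonal part [mu_k^2] is then constant in
    time, and since [s] is transported, differentiating the entries of [F] in time costs no factor
    [mu_k]. Sums are cut after an even number [2 n] of terms; this keeps each cosine with its sine
    and leaves a spectral gap at the cut, so that the overlaps across it are small. All decay
    constants are explicit functions of those of [F], which makes the estimates uniform on bounded
    time intervals. *)

Fixpoint sm (f : nat -> R) (n : nat) : R := match n with O => 0 | S m => sm f m + f m end.

Lemma sm_ext f g n : (forall k, (k < n)%nat -> f k = g k) -> sm f n = sm g n.
Proof.
 induction n as [|n IH]; intros H; simpl; [reflexivity|]. rewrite IH by (intros; apply H; lia). rewrite (H n) by lia. reflexivity.
Qed.

Lemma sm_plus f g n : sm (fun k => f k + g k) n = sm f n + sm g n.
Proof. induction n as [|n IH]; simpl; [ring|rewrite IH; ring]. Qed.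

Lemma sm_minus f g n : sm (fun k => f k - g k) n = sm f n - sm g n.
Proof. induction n as [|n IH]; simpl; [ring|rewrite IH; ring]. Qed.

Lemma sm_scal c f n : sm (fun k => c * f k) n = c * sm f n.
Proof. induction n as [|n IH]; simpl; [ring|rewrite IH; ring]. Qed.

Lemma sm_scal_r c f n : sm (fun k => f k * c) n = sm f n * c.
Proof. induction n as [|n IH]; simpl; [ring|rewrite IH; ring]. Qed.

Lemma sm_const c n : sm (fun _ => c) n = INR n * c.
Proof. induction n as [|n IH]; [simpl; ring|]. rewrite S_INR; simpl; rewrite IH; ring. Qed.

Lemma sm_le f g n : (forall k, (k < n)%nat -> f k <= g k) -> sm f n <= sm g n.
Proof.
 induction n as [|n IH]; intros H; simpl; [lra|]. use (H n ltac:(lia)). use (IH ltac:(intros; apply H; lia)). lra.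
Qed.

Lemma sm_zero f n : (forall k, (k < n)%nat -> f k = 0) -> sm f n = 0.
Proof. intros H. rewrite (sm_ext f (fun _ => 0) n H), sm_const. ring. Qed.

Lemma sm_pos f n : (forall k, (k < n)%nat -> 0 <= f k) -> 0 <= sm f n.
Proof. intros H. rewrite <- (sm_zero (fun _ => 0) n) by reflexivity. apply sm_le, H. Qed.

Lemma sm_abs f n : Rabs (sm f n) <= sm (fun k => Rabs (f k)) n.
Proof.
 induction n as [|n IH]; simpl; [rewrite Rabs_R0; lra|]. eapply Rle_trans; [apply Rabs_triang|lra].
Qed.

Lemma sm_swap (f : nat -> nat -> R) n m : sm (fun j => sm (f j) m) n = sm (fun k => sm (fun j => f j k) n) m.
Proof.
 induction n as [|n IH]; simpl; [symmetry; apply sm_zero; reflexivity|]. rewrite IH, <- sm_plus. reflexivity.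
Qed.

Lemma sm_add f n m : sm f (n + m) = sm f n + sm (fun k => f (n + k)%nat) m.
Proof.
 induction m as [|m IH]; [rewrite Nat.add_0_r; simpl; ring|]. rewrite Nat.add_succ_r; simpl. rewrite IH; ring.
Qed.

Lemma sm_single f n i : (i < n)%nat -> (forall k, (k < n)%nat -> k <> i -> f k = 0) -> sm f n = f i.
Proof.
 induction n as [|n IH]; intros Hi H; [lia|simpl]. destruct (Nat.eq_dec i n) as [->|Hn].
 - rewrite sm_zero; [ring|]. intros k Hk; apply H; lia.
 - rewrite IH by (try lia; intros; apply H; lia). rewrite (H n) by lia. ring.
Qed.

Lemma sm_mono f n m : (forall k, 0 <= f k) -> (n <= m)%nat -> sm f n <= sm f m.
Proof.
 intros H Hnm. replace m with (n + (m - n))%nat by lia. rewrite sm_add.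
 use (sm_pos (fun k => f (n + k)%nat) (m - n) ltac:(intros; apply H)). lra.
Qed.

Lemma sm_double f n : sm f (2 * n) = sm (fun k => f (2 * k)%nat + f (2 * k + 1)%nat) n.
Proof.
 induction n as [|n IH]; [reflexivity|]. replace (2 * S n)%nat with (S (S (2 * n))) by lia.
 cbn [sm]. rewrite IH. replace (2 * n + 1)%nat with (S (2 * n)) by lia. ring.
Qed.

Lemma sum_n_sm (a : nat -> R) n : sum_n a n = sm a (S n).
Proof.
 induction n as [|n IH]; [rewrite sum_O; simpl; ring|]. rewrite sum_Sn, IH. reflexivity.
Qed.

Lemma is_series_sm (a : nat -> R) (l : R) : is_series a l <-> is_lim_seq (sm a) l.
Proof.
 split; intros H.
 - apply is_lim_seq_incr_1. eapply is_lim_seq_ext; [intros n; apply sum_n_sm|]. exact H.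
 - apply (is_lim_seq_incr_1 (sm a)) in H. assert (H' : is_lim_seq (sum_n a) l).
  { eapply is_lim_seq_ext; [intros n; symmetry; apply sum_n_sm|]. exact H. } exact H'.
Qed.

Lemma sm_le_series a l n : (forall k, 0 <= a k) -> is_series a l -> sm a n <= l.
Proof.
 intros H Hs. apply is_series_sm in Hs. apply (is_lim_seq_incr_compare _ _ Hs). intros m; simpl; specialize (H m); lra.
Qed.

Lemma ex_series_bounded a M : (forall k, 0 <= a k) -> (forall n, sm a n <= M) -> ex_series a.
Proof.
 intros H HM. destruct (ex_finite_lim_seq_incr (sm a) M) as [l Hl]; auto.
 - intros n; simpl; specialize (H n); lra.
 - exists l. apply is_series_sm, Hl.
Qed.

Lemma series_le_bound a l M : is_series a l -> (forall n, sm a n <= M) -> l <= M.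
Proof.
 intros Hs HM. apply is_series_sm in Hs. apply (is_lim_seq_le (sm a) (fun _ => M) l M); auto. apply is_lim_seq_const.
Qed.

Lemma is_series_sm_fin (f : nat -> nat -> R) (l : nat -> R) n : (forall j, (j < n)%nat -> is_series (f j) (l j)) ->
 is_series (fun k => sm (fun j => f j k) n) (sm l n).
Proof.
 induction n as [|n IH]; intros H; simpl.
 - apply is_series_sm. apply is_lim_seq_ext with (fun _ => 0); [|apply is_lim_seq_const]. intros m. symmetry. apply sm_zero; reflexivity.
 - apply (is_series_plus (fun k => sm (fun j => f j k) n) (f n)).
  + apply IH. intros; apply H; lia.
  + apply H; lia.
Qed.

Definition w (k : nat) : R := INR (S k).

Lemma w_ge1 k : 1 <= w k.
Proof. unfold w. rewrite S_INR. use (pos_INR k); lra. Qed.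

Lemma w_pos k : 0 < w k.
Proof. use (w_ge1 k); lra. Qed.

Lemma w_S k : w (S k) = w k + 1.
Proof. unfold w. rewrite (S_INR (S k)). reflexivity. Qed.

Lemma wp_pos k r : 0 < w k ^ r.
Proof. apply pow_lt, w_pos. Qed.

Lemma wp_ge1 k r : 1 <= w k ^ r.
Proof. apply pow_R1_Rle, w_ge1. Qed.

(** Since [x (x + 1) <= 2 x^2] for [x >= 1], the majorant [1 / w^2] is dominated by a telescoping
    one. Most convergence below is reduced to this comparison, which also gives the explicit tails
    [2 C / w n]. *)
Lemma div_w2_telescope k : / w k ^ 2 <= 2 / w k - 2 / w (S k).
Proof.
 rewrite w_S. use (w_ge1 k). set (x := w k) in *. assert (0 < x * x) by nra. assert (0 < x + 1) by lra. apply Rminus_le_0.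
 replace (2 / x - 2 / (x + 1) - / x ^ 2) with ((x - 1) / (x * x * (x + 1))) by (field; lra). apply Rle_mult_inv_pos; [lra|nra].
Qed.

Lemma sm_tail_w2 a C n m : (n <= m)%nat -> (forall k, Rabs (a k) <= C / w k ^ 2) -> Rabs (sm a m - sm a n) <= 2 * C / w n - 2 * C / w m.
Proof.
 intros Hnm H. assert (HC : 0 <= C). { specialize (H 0%nat). use (Rabs_pos (a 0%nat)). unfold w in H; simpl in H. lra. }
 induction Hnm as [|m Hnm IH].
 - rewrite Rminus_diag_eq, Rabs_R0 by reflexivity. lra.
 - simpl sm. replace (sm a m + a m - sm a n) with ((sm a m - sm a n) + a m) by ring. upto Rabs_triang.
  specialize (H m). use (Rmult_le_compat_l C _ _ HC (div_w2_telescope m)). unfold Rdiv in *. lra.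
Qed.

Lemma w_lim : is_lim_seq (fun n => / w n) 0.
Proof.
 apply is_lim_seq_spec. intros eps. destruct (archimed_cor1 eps (cond_pos eps)) as [n [Hn Hn0]].
 exists n. intros m Hm. rewrite Rminus_0_r, Rabs_pos_eq.
 - eapply Rle_lt_trans; [|apply Hn]. apply Rinv_le_contravar; [apply lt_0_INR; lia|]. apply le_INR; lia.
 - left; apply Rinv_0_lt_compat, w_pos.
Qed.

Lemma w_lim_scal C : is_lim_seq (fun n => C / w n) 0.
Proof.
 replace (Finite 0) with (Rbar_mult C 0) by (simpl; f_equal; ring). apply (is_lim_seq_scal_l (fun n => / w n) C 0), w_lim.
Qed.

Lemma small_eq x C : (forall n, Rabs x <= C / w n) -> x = 0.
Proof.
 intros H. assert (Rabs x <= 0). { apply (is_lim_seq_le (fun _ => Rabs x) (fun n => C / w n) (Rabs x) 0); auto.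
  apply is_lim_seq_const. apply w_lim_scal. } destruct (Req_dec x 0) as [|Hx]; auto. use (Rabs_pos_lt x Hx); lra.
Qed.

Lemma is_series_w2 a C : (forall k, Rabs (a k) <= C / w k ^ 2) -> is_series a (Series a).
Proof.
 intros H. apply Series_correct. apply ex_series_Rabs. apply ex_series_bounded with (2 * C).
 - intros; apply Rabs_pos.
 - intros n. use (sm_tail_w2 (fun k => Rabs (a k)) C 0 n ltac:(lia)) as HH.
  assert (H' : forall k, Rabs (Rabs (a k)) <= C / w k ^ 2) by (intros; rewrite Rabs_Rabsolu; auto).
  specialize (HH H'). simpl in HH. rewrite Rminus_0_r in HH. use (Rle_abs (sm (fun k => Rabs (a k)) n)).
  assert (0 <= C). { specialize (H 0%nat). use (Rabs_pos (a 0%nat)). unfold w in H; simpl in H. lra. }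
  assert (0 <= 2 * C / w n) by (apply Rle_mult_inv_pos; [lra|apply w_pos]). unfold w at 1 in HH. simpl in HH. lra.
Qed.

Lemma series_tail a C n : (forall k, Rabs (a k) <= C / w k ^ 2) -> Rabs (Series a - sm a n) <= 2 * C / w n.
Proof.
 intros H. use (is_series_w2 a C H) as Hs. apply is_series_sm in Hs. assert (HC : 0 <= C).
 { specialize (H 0%nat). use (Rabs_pos (a 0%nat)). unfold w in H; simpl in H. lra. }
 assert (Hl : is_lim_seq (fun m => Rabs (sm a m - sm a n)) (Rabs (Series a - sm a n))).
 { apply (is_lim_seq_abs (fun m => sm a m - sm a n) (Series a - sm a n)). apply is_lim_seq_minus'; [exact Hs|apply is_lim_seq_const]. }
 apply (is_lim_seq_le_loc (fun m => Rabs (sm a m - sm a n)) (fun _ => 2 * C / w n)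
   (Rabs (Series a - sm a n)) (2 * C / w n)); [|exact Hl|apply is_lim_seq_const]. exists n. intros m Hm. use (sm_tail_w2 a C n m Hm H).
 assert (0 <= 2 * C / w m) by (apply Rle_mult_inv_pos; [lra|apply w_pos]). lra.
Qed.

Lemma series_bound a C : (forall k, Rabs (a k) <= C / w k ^ 2) -> Rabs (Series a) <= 2 * C.
Proof.
 intros H. use (series_tail a C 0 H) as H0. unfold w in H0; simpl in H0. rewrite Rminus_0_r in H0. lra.
Qed.

Lemma div_w2_mult C D k : C / (w k ^ 2 * D) = (C / D) / w k ^ 2.
Proof.
 unfold Rdiv. rewrite Rinv_mult. ring.
Qed.

(** Cutting the outer summation after [n] rows changes either side by a multiple of [1 / w n], and a
    finite sum of series commutes with summation. *)
Lemma fubini_w2 (a : nat -> nat -> R) C : (forall j k, Rabs (a j k) <= C / (w j ^ 2 * w k ^ 2)) ->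
 Series (fun j => Series (a j)) = Series (fun k => Series (fun j => a j k)).
Proof.
 intros H. assert (Hj : forall j k, Rabs (a j k) <= (C / w j ^ 2) / w k ^ 2). { intros j k. upto H. rewrite Rmult_comm, div_w2_mult. lra. }
 assert (Hk : forall k j, Rabs (a j k) <= (C / w k ^ 2) / w j ^ 2). { intros j k. upto H. rewrite div_w2_mult. lra. }
 assert (Sj : forall j, Rabs (Series (a j)) <= (2 * C) / w j ^ 2).
 { intros j. eapply Rle_trans; [apply series_bound, Hj|]. unfold Rdiv; lra. }
 assert (Sk : forall k, Rabs (Series (fun j => a j k)) <= (2 * C) / w k ^ 2).
 { intros k. eapply Rle_trans; [apply (series_bound (fun j => a j k)), Hk|]. unfold Rdiv; lra. }
 apply Rminus_diag_uniq. apply small_eq with (C := 8 * C). intros n.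
 assert (E : sm (fun j => Series (a j)) n = Series (fun k => sm (fun j => a j k) n)).
 { symmetry. apply is_series_unique, is_series_sm_fin. intros j _. eapply is_series_w2, Hj. }
 assert (T1 : Rabs (Series (fun j => Series (a j)) - sm (fun j => Series (a j)) n) <= 2 * (2 * C) / w n) by (apply series_tail, Sj).
 assert (T2 : Rabs (Series (fun k => Series (fun j => a j k)) - Series (fun k => sm (fun j => a j k) n)) <= 2 * (2 * C / w n)).
 { rewrite <- Series_minus.
  - apply series_bound. intros k. eapply Rle_trans; [apply (series_tail (fun j => a j k) (C / w k ^ 2) n), Hk|]. unfold Rdiv; lra.
  - eexists. eapply is_series_w2, Sk.
  - eexists. apply (is_series_sm_fin a (fun j => Series (a j))). intros j _. eapply is_series_w2, Hj. } rewrite E in T1.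
 eapply Rle_trans; [|apply Req_le; instantiate (1 := 2 * (2 * C) / w n + 2 * (2 * C / w n)); unfold Rdiv; ring].
 eapply Rle_trans; [|apply Rplus_le_compat; [exact T1|exact T2]].
 set (X := Series (fun j => Series (a j))) in *. set (Y := Series (fun k => Series (fun j => a j k))) in *.
 set (Z := Series (fun k => sm (fun j => a j k) n)) in *. replace (X - Y) with ((X - Z) - (Y - Z)) by ring.
 upto Rabs_triang. rewrite Rabs_Ropp. lra.
Qed.

(** * Square summable sequences, rapid decrease and rapidly decreasing matrices *)

Definition l2 (x : nat -> R) : Prop := ex_series (fun k => x k * x k).
Definition rapid (x : nat -> R) : Prop := forall r, exists C, forall k, Rabs (x k) <= C / w k ^ r.
(** The constants form an explicit function of the exponent instead of being hidden by a quantifier: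
    along the flow one [C] has to serve all times of an interval. *)
Definition bdd (M : nat -> nat -> R) (C : nat -> R) : Prop := forall r j k, Rabs (M j k) <= C r / (w j ^ r * w k ^ r).
Definition ip (x y : nat -> R) : R := Series (fun k => x k * y k).
Definition mv (M : nat -> nat -> R) (x : nat -> R) (k : nat) : R := Series (fun l => M k l * x l).
(** Kronecker's symbol; the partial application [dl k] also serves as the [k]-th unit vector. *)
Definition dl (k l : nat) : R := if Nat.eq_dec k l then 1 else 0.

Lemma dl_same k : dl k k = 1.
Proof. unfold dl; destruct (Nat.eq_dec k k); [reflexivity|lia]. Qed.

Lemma dl_diff k l : k <> l -> dl k l = 0.
Proof. intros; unfold dl; destruct (Nat.eq_dec k l); [lia|reflexivity]. Qed.

Lemma le_div_w a C k r : Rabs a <= C / w k ^ r <-> Rabs a * w k ^ r <= C.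
Proof.
 use (wp_pos k r). split; intros H1.
 - apply (Rmult_le_compat_r (w k ^ r)) in H1; [|lra]. unfold Rdiv in H1. rewrite Rmult_assoc, Rinv_l, Rmult_1_r in H1 by lra. exact H1.
 - apply Rle_div_r; auto.
Qed.

Lemma ex_series_le_R (a b : nat -> R) : (forall k, Rabs (a k) <= b k) -> ex_series b -> ex_series a.
Proof. intros H Hb. apply (ex_series_le a b); auto. Qed.

Lemma ex_series_scal_R c (a : nat -> R) : ex_series a -> ex_series (fun k => c * a k).
Proof. intros H. exact (ex_series_scal_l (V := R_NormedModule) c a H). Qed.

Lemma ex_series_ext_R (a b : nat -> R) : (forall k, a k = b k) -> ex_series a -> ex_series b.
Proof. intros H. apply (ex_series_ext a b H). Qed.

Lemma is_series_ext_R (a b : nat -> R) l : (forall k, a k = b k) -> is_series a l -> is_series b l.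
Proof. intros H. apply (is_series_ext a b l H). Qed.

Lemma rapid_l2 x : rapid x -> l2 x.
Proof.
 intros H. destruct (H 1%nat) as [C HC]. eexists. apply (is_series_w2 _ (C * C)). intros k. rewrite Rabs_mult. specialize (HC k).
 replace (C * C / w k ^ 2) with ((C / w k ^ 1) * (C / w k ^ 1)) by (field; use (w_pos k); lra). mul_lr; auto using Rabs_pos.
Qed.

Lemma l2_prod x y : l2 x -> l2 y -> ex_series (fun k => Rabs (x k * y k)).
Proof.
 intros Hx Hy. apply ex_series_le_R with (fun k => x k * x k + y k * y k).
 - intros k. rewrite Rabs_Rabsolu. apply Rabs_le. use (Rle_0_sqr (x k - y k)); use (Rle_0_sqr (x k + y k)); unfold Rsqr in *; split; nra.
 - apply (ex_series_plus (fun k => x k * x k) (fun k => y k * y k)); auto.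
Qed.

Lemma ip_is_series x y : l2 x -> l2 y -> is_series (fun k => x k * y k) (ip x y).
Proof. intros Hx Hy. apply Series_correct, ex_series_Rabs, l2_prod; auto. Qed.

Lemma l2_plus x y : l2 x -> l2 y -> l2 (fun k => x k + y k).
Proof.
 intros Hx Hy. apply ex_series_le_R with (fun k => 2 * (x k * x k) + 2 * (y k * y k)).
 - intros k. apply Rabs_le. use (Rle_0_sqr (x k - y k)); use (Rle_0_sqr (x k + y k)); unfold Rsqr in *; split; nra.
 - apply (ex_series_plus (fun k => 2 * (x k * x k)) (fun k => 2 * (y k * y k))); apply ex_series_scal_R; auto.
Qed.

Lemma l2_scal c x : l2 x -> l2 (fun k => c * x k).
Proof.
 intros Hx. apply ex_series_ext_R with (fun k => (c * c) * (x k * x k)); [intros; ring|]. apply ex_series_scal_R; auto.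
Qed.

Lemma l2_ext x y : (forall k, x k = y k) -> l2 x -> l2 y.
Proof. intros H. apply ex_series_ext_R. intros; rewrite H; reflexivity. Qed.

Lemma l2_minus x y : l2 x -> l2 y -> l2 (fun k => x k - y k).
Proof.
 intros Hx Hy. apply l2_ext with (fun k => x k + (-1) * y k); [intros; ring|]. apply l2_plus; auto. apply l2_scal; auto.
Qed.

Lemma l2_sm (x : nat -> nat -> R) n : (forall i, (i < n)%nat -> l2 (x i)) -> l2 (fun k => sm (fun i => x i k) n).
Proof.
 induction n as [|n IH]; intros H; simpl.
 - exists 0. apply is_series_sm. apply is_lim_seq_ext with (fun _ => 0); [|apply is_lim_seq_const].
  intros m. symmetry. apply sm_zero; intros; ring.
 - apply l2_plus; [apply IH; intros; apply H; lia|apply H; lia].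
Qed.

Lemma rapid_dl k : rapid (dl k).
Proof.
 intros r. exists (w k ^ r). intros l. unfold dl. destruct (Nat.eq_dec k l) as [<-|_].
 - rewrite Rabs_R1. unfold Rdiv. rewrite Rinv_r; [lra|]. use (wp_pos k r); lra.
 - rewrite Rabs_R0. apply Rle_mult_inv_pos; [|apply wp_pos]. left; apply wp_pos.
Qed.

Lemma l2_dl k : l2 (dl k).
Proof. apply rapid_l2, rapid_dl. Qed.

Lemma ip_sym x y : ip x y = ip y x.
Proof. apply Series_ext; intros; ring. Qed.

Lemma ip_plus_l x y z : l2 x -> l2 y -> l2 z -> ip (fun k => x k + y k) z = ip x z + ip y z.
Proof.
 intros. unfold ip. rewrite <- Series_plus; try (eexists; apply ip_is_series; assumption). apply Series_ext; intros; ring.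
Qed.

Lemma ip_minus_l x y z : l2 x -> l2 y -> l2 z -> ip (fun k => x k - y k) z = ip x z - ip y z.
Proof.
 intros. unfold ip. rewrite <- Series_minus; try (eexists; apply ip_is_series; assumption). apply Series_ext; intros; ring.
Qed.

Lemma ip_scal_l c x z : ip (fun k => c * x k) z = c * ip x z.
Proof. unfold ip. rewrite <- Series_scal_l. apply Series_ext; intros; ring. Qed.

Lemma ip_ext x x' y y' : (forall k, x k = x' k) -> (forall k, y k = y' k) -> ip x y = ip x' y'.
Proof. intros H1 H2. apply Series_ext; intros; rewrite H1, H2; reflexivity. Qed.

Lemma ip_sm_l (x : nat -> nat -> R) n z : (forall i, (i < n)%nat -> l2 (x i)) -> l2 z ->
 ip (fun k => sm (fun i => x i k) n) z = sm (fun i => ip (x i) z) n.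
Proof.
 intros H Hz. induction n as [|n IH]; simpl.
 - unfold ip. rewrite (Series_ext _ (fun k => 0 * 0)) by (intros; ring). rewrite Series_scal_l; ring.
 - rewrite (ip_plus_l (fun k => sm (fun i => x i k) n) (x n)); auto.
  + rewrite IH; auto.
  + apply l2_sm; auto.
Qed.

Lemma ip_pos x : l2 x -> 0 <= ip x x.
Proof.
 intros H. use (sm_le_series (fun k => x k * x k) (ip x x) 0) as HH. simpl in HH. apply HH; [intros; nra|apply ip_is_series; auto].
Qed.

Lemma ip_coord x k : l2 x -> x k * x k <= ip x x.
Proof.
 intros H. eapply Rle_trans; [|apply (sm_le_series (fun k => x k * x k) (ip x x) (S k)); [intros; nra|apply ip_is_series; auto]].
 simpl. use (sm_pos (fun k => x k * x k) k ltac:(intros; nra)). lra.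
Qed.

Lemma ip_dl_r x k : ip x (dl k) = x k.
Proof.
 apply is_series_unique, is_series_sm. apply is_lim_seq_incr_n with (N := S k).
 apply is_lim_seq_ext with (fun _ => x k); [|apply is_lim_seq_const].
 intros n. symmetry. rewrite (sm_single _ _ k); [rewrite dl_same; ring|lia|]. intros l _ Hl. rewrite dl_diff by auto. ring.
Qed.

Lemma ip_cs x y : l2 x -> l2 y -> ip x y * ip x y <= ip x x * ip y y.
Proof.
 intros Hx Hy. assert (HQ : forall t, 0 <= ip x x + 2 * t * ip x y + t * t * ip y y). { intros t.
  assert (H : l2 (fun k => x k + t * y k)) by (apply l2_plus; auto; apply l2_scal; auto). use (ip_pos _ H) as HH.
  rewrite ip_plus_l in HH; auto; [|apply l2_scal; auto]. rewrite ip_scal_l, (ip_sym x), (ip_sym y) in HH.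
  rewrite !ip_plus_l in HH; auto using l2_scal. rewrite !ip_scal_l, (ip_sym y x) in HH. lra. }
 use (ip_pos y Hy) as Hyy. use (ip_pos x Hx) as Hxx. destruct (Req_dec (ip y y) 0) as [E|E].
 (* For [ip y y = 0] the polynomial in [t] is affine; with a nonzero slope it would take the value
    -1 at the chosen argument. *)
 - rewrite E in *. rewrite Rmult_0_r. destruct (Req_dec (ip x y) 0) as [->|Ne]; [lra|]. specialize (HQ (- (ip x x + 1) / (2 * ip x y))).
  replace (2 * (- (ip x x + 1) / (2 * ip x y)) * ip x y) with (- (ip x x + 1)) in HQ by (field; auto). lra.
 - specialize (HQ (- ip x y / ip y y)).
  replace (ip x x + 2 * (- ip x y / ip y y) * ip x y + - ip x y / ip y y * (- ip x y / ip y y) * ip y y)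
   with ((ip x x * ip y y - ip x y * ip x y) / ip y y) in HQ by (field; auto). assert (0 < ip y y) by lra.
  apply (Rmult_le_compat_r (ip y y)) in HQ; [|lra]. unfold Rdiv in HQ. rewrite Rmult_assoc, Rinv_l in HQ by auto. lra.
Qed.

Lemma bdd_nonneg M C r : bdd M C -> 0 <= C r.
Proof.
 intros H. specialize (H r 0%nat 0%nat). use (Rabs_pos (M 0%nat 0%nat)). unfold w in H; simpl in H. rewrite !pow1 in H. lra.
Qed.

(** The vector may grow polynomially. Of the exponent [r + t + 2] taken from the matrix, [r] gives
    decay in the row index, [t] pays for the growth of [x] and 2 for summability. Growing vectors
    arise when powers of an eigenvalue are put onto its eigenvector. *)
Lemma mv_term_bound M C x D r t k : bdd M C -> (forall l, Rabs (x l) <= D * w l ^ t) ->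
 forall l, Rabs (M k l * x l) <= (C (r + t + 2)%nat * D / w k ^ r) / w l ^ 2.
Proof.
 intros HM HD l. rewrite Rabs_mult. assert (HD0 : 0 <= D).
 { specialize (HD 0%nat). use (Rabs_pos (x 0%nat)). unfold w in HD; simpl in HD. rewrite pow1 in HD; lra. }
 use (bdd_nonneg M C (r + t + 2) HM) as HC0.
 eapply Rle_trans; [mul_lr; [apply Rabs_pos|apply Rabs_pos|apply (HM (r + t + 2)%nat)|apply HD]|].
 use (wp_pos k r). use (wp_pos k (t + 2)). use (wp_pos l r). use (wp_pos l t). use (wp_pos l 2).
 replace (r + t + 2)%nat with (r + (t + 2))%nat at 2 by lia. rewrite (pow_add (w k)).
 replace (w l ^ (r + t + 2)) with (w l ^ r * w l ^ t * w l ^ 2) by (rewrite !pow_add; ring).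
 replace (C (r + t + 2)%nat / (w k ^ r * w k ^ (t + 2) * (w l ^ r * w l ^ t * w l ^ 2)) * (D * w l ^ t))
  with ((C (r + t + 2)%nat * D / w k ^ r / w l ^ 2) * (/ (w k ^ (t + 2) * w l ^ r))).
 2:{ generalize dependent (w k ^ r); generalize dependent (w k ^ (t + 2)); generalize dependent (w l ^ r);
   generalize dependent (w l ^ t); generalize dependent (w l ^ 2); intros. field; lra. }
 rewrite <- (Rmult_1_r (C (r + t + 2)%nat * D / w k ^ r / w l ^ 2)) at 2. mul_l.
 - apply Rle_mult_inv_pos; [|auto]. apply Rle_mult_inv_pos; [|auto]. nra.
 - rewrite <- Rinv_1. apply Rinv_le_contravar; [lra|]. use (wp_ge1 k (t + 2)). use (wp_ge1 l r). nra.
Qed.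

Lemma mv_is_series M C x D t k : bdd M C -> (forall l, Rabs (x l) <= D * w l ^ t) -> is_series (fun l => M k l * x l) (mv M x k).
Proof. intros HM HD. eapply is_series_w2. apply (mv_term_bound M C x D 0 t k HM HD). Qed.

Lemma mv_bound M C x D r t k : bdd M C -> (forall l, Rabs (x l) <= D * w l ^ t) -> Rabs (mv M x k) <= 2 * (C (r + t + 2)%nat * D) / w k ^ r.
Proof.
 intros HM HD. eapply Rle_trans; [apply series_bound; apply (mv_term_bound M C x D r t k HM HD)|]. unfold Rdiv; lra.
Qed.

Lemma l2_bdd x : l2 x -> exists D, forall l, Rabs (x l) <= D * w l ^ 0.
Proof.
 intros H. exists (ip x x + 1). intros l. rewrite pow_O, Rmult_1_r. use (ip_coord x l H). apply Rabs_le. split; nra.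
Qed.

Lemma mv_rapid M C x : bdd M C -> l2 x -> rapid (mv M x).
Proof.
 intros HM Hx r. destruct (l2_bdd x Hx) as [D HD]. exists (2 * (C (r + 0 + 2)%nat * D)). intros k. apply mv_bound; auto.
Qed.

Lemma mv_l2_series M C x k : bdd M C -> l2 x -> is_series (fun l => M k l * x l) (mv M x k).
Proof. intros HM Hx. destruct (l2_bdd x Hx) as [D HD]. eapply mv_is_series; eauto. Qed.

Lemma mv_sym M C x y : bdd M C -> (forall j k, M j k = M k j) -> l2 x -> l2 y -> ip (mv M x) y = ip x (mv M y).
Proof.
 intros HM Hs Hx Hy. destruct (l2_bdd x Hx) as [D HD]. destruct (l2_bdd y Hy) as [D' HD']. unfold ip, mv.
 rewrite (Series_ext _ (fun k => Series (fun l => M k l * x l * y k))) by (intros; symmetry; apply Series_scal_r).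
 rewrite (Series_ext (fun k => x k * _) (fun k => Series (fun l => M l k * x k * y l))).
 2:{ intros k. rewrite <- Series_scal_l. apply Series_ext. intros l. rewrite (Hs k l); ring. }
 apply (fubini_w2 (fun k l => M k l * x l * y k) (C 2%nat * D * D')). intros j k. rewrite !Rabs_mult.
 replace (C 2%nat * D * D' / (w j ^ 2 * w k ^ 2)) with (C 2%nat / (w j ^ 2 * w k ^ 2) * D * D') by (unfold Rdiv; ring).
 specialize (HD k); specialize (HD' j). rewrite pow_O, Rmult_1_r in HD, HD'. use (HM 2%nat j k). mul_lr; auto using Rabs_pos.
 - apply Rmult_le_pos; apply Rabs_pos.
 - mul_lr; auto using Rabs_pos.
Qed.

Lemma mv_scal M c x k : mv M (fun l => c * x l) k = c * mv M x k.
Proof. unfold mv. rewrite <- Series_scal_l. apply Series_ext; intros; ring. Qed.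

(** * Spectral theorem for [diag (mu^2) + F] *)

(** The frequencies 1, 1, 2, 2, 3, 3, ...: index [2 i] is reserved for the cosine and [2 i + 1] for
    the sine of frequency [i + 1]. *)
Definition mu (k : nat) : R := INR (S (Nat.div2 k)).

Lemma div2_bounds k : (2 * Nat.div2 k <= k <= 2 * Nat.div2 k + 1)%nat.
Proof.
 use (Nat.div2_odd k). destruct (Nat.odd k); simpl Nat.b2n in *; lia.
Qed.

Lemma mu_ge1 k : 1 <= mu k.
Proof. apply w_ge1. Qed.

Lemma mu_le_w k : mu k <= w k.
Proof. unfold mu, w. apply le_INR. use (div2_bounds k). lia. Qed.

Lemma w_le_mu k : w k <= 2 * mu k.
Proof.
 unfold mu, w. replace 2 with (INR 2) by (simpl; ring). rewrite <- mult_INR. apply le_INR. use (div2_bounds k). lia.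
Qed.

Lemma mu_mono j k : (j <= k)%nat -> mu j <= mu k.
Proof. intros. unfold mu. apply le_INR. use (div2_bounds k). use (div2_bounds j). lia. Qed.

Lemma mu_even n : mu (2 * n) = INR (S n).
Proof. unfold mu. rewrite Nat.div2_double. reflexivity. Qed.

Lemma mu_odd n : mu (2 * n + 1) = INR (S n).
Proof. unfold mu. replace (2 * n + 1)%nat with (S (2 * n)) by lia. rewrite Nat.div2_succ_double. reflexivity. Qed.

(** * Compactness by diagonal extraction *)

Lemma bolzano_subseq (u : nat -> R) : (forall n, Rabs (u n) <= 1) ->
 exists s : nat -> nat, (forall n, (s n < s (S n))%nat) /\ ex_finite_lim_seq (fun n => u (s n)).
Proof.
 intros H. destruct (Bolzano_Weierstrass u (fun x => -1 <= x <= 1) (compact_P3 (-1) 1)) as [l Hl]. { intros n. apply Rabs_le_between, H. }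
 assert (Hc : forall N n : nat, exists p, (N <= p)%nat /\ Rabs (u p - l) < / w n).
 { intros N n. destruct (Hl (fun x => Rabs (x - l) < / w n) N) as [p Hp].
  - exists (mkposreal (/ w n) (Rinv_0_lt_compat _ (w_pos n))). intros x Hx. exact Hx.
  - exists p; exact Hp. } pose (g := fun N n => proj1_sig (constructive_indefinite_description _ (Hc N n))).
 assert (Hg : forall N n, (N <= g N n)%nat /\ Rabs (u (g N n) - l) < / w n).
 { intros. unfold g. destruct constructive_indefinite_description; auto. }
 pose (s := fix s n := match n with O => g O O | S m => g (S (s m)) (S m) end). exists s. split.
 - intros n. simpl. destruct (Hg (S (s n)) (S n)). lia.
 - exists l. apply is_lim_seq_spec. intros eps. use (proj2 (is_lim_seq_spec _ _) w_lim eps) as [N HN].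
  exists N. intros n Hn. specialize (HN n Hn). rewrite Rminus_0_r, Rabs_pos_eq in HN by (left; apply Rinv_0_lt_compat, w_pos).
  eapply Rlt_trans; [|exact HN]. destruct n; simpl; apply Hg.
Qed.

Lemma strict_ge (s : nat -> nat) : (forall n, (s n < s (S n))%nat) -> forall n, (n <= s n)%nat.
Proof. intros H n. induction n; [lia|specialize (H n); lia]. Qed.

Lemma diagonal_extraction (x : nat -> nat -> R) : (forall m k, Rabs (x m k) <= 1) -> exists s : nat -> nat, (forall m, (m <= s m)%nat) /\
  forall k, ex_finite_lim_seq (fun m => x (s m) k).
Proof.
 intros H. pose (bw := fun (r : nat -> nat) (k : nat) => proj1_sig (constructive_indefinite_description _
   (bolzano_subseq (fun n => x (r n) k) (fun n => H (r n) k)))). assert (Hbw : forall r k, (forall n, (bw r k n < bw r k (S n))%nat) /\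
       ex_finite_lim_seq (fun n => x (r (bw r k n)) k)). { intros. unfold bw. destruct constructive_indefinite_description; auto. }
 pose (rho := fix rho k : nat -> nat := match k with | O => bw (fun n => n) O | S k' => fun n => rho k' (bw (rho k') (S k') n) end).
 assert (Hlim : forall k, ex_finite_lim_seq (fun n => x (rho k n) k)). { intros [|k]; simpl; [apply (Hbw (fun n => n))|apply Hbw]. }
 assert (Hinc : forall k n, (rho k n < rho k (S n))%nat). { induction k as [|k IH]; intros n; simpl; [apply Hbw|].
  assert (Hm : forall a b, (a < b)%nat -> (rho k a < rho k b)%nat).
  { intros a b Hab. induction Hab; [apply IH|]. specialize (IH m). lia. } apply Hm, Hbw. }
 (* From position [k] on, the diagonal runs through values of [rho k] at positions that tend to
    infinity, so it inherits the limit of the [k]-th coordinate. *)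
 assert (Hsub : forall d k n, exists p, (n <= p)%nat /\ rho (d + k)%nat n = rho k p).
 { induction d as [|d IH]; intros k n; [exists n; split; auto|]. simpl. destruct (IH k (bw (rho (d + k)%nat) (S (d + k)) n)) as [p [Hp E]].
  exists p. split; auto. eapply Nat.le_trans; [|apply Hp]. apply strict_ge, Hbw. } exists (fun m => rho m m). split.
 - intros m. apply strict_ge. apply Hinc.
 - intros k. destruct (Hlim k) as [l Hl]. exists l. apply is_lim_seq_spec. intros eps.
  apply is_lim_seq_spec in Hl. destruct (Hl eps) as [N HN]. exists (Nat.max N k). intros m Hm.
  destruct (Hsub (m - k)%nat k m) as [p [Hp E]]. replace (m - k + k)%nat with m in E by lia. rewrite E. apply HN. lia.
Qed.

Lemma sm_lim (u : nat -> nat -> R) (l : nat -> R) n : (forall k, (k < n)%nat -> is_lim_seq (fun m => u m k) (l k)) ->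
 is_lim_seq (fun m => sm (u m) n) (sm l n).
Proof.
 induction n as [|n IH]; intros H; simpl; [apply is_lim_seq_const|]. apply is_lim_seq_plus'; [apply IH; intros; apply H; lia|apply H; lia].
Qed.

(** * The quadratic form of a diagonal matrix plus a rapidly decreasing one *)

Section FormOnSequences.
Variables (F : nat -> nat -> R) (C : nat -> R).
Hypothesis HF : bdd F C.
Hypothesis Fsym : forall j k, F j k = F k j.

(** The square root of the diagonal part. Accordingly [edom] is the form domain, and [qf] the form
    of the operator [diag (mu^2) + F]. *)
Definition mul_mu (x : nat -> R) (k : nat) : R := mu k * x k.
Definition edom (x : nat -> R) : Prop := l2 (mul_mu x).
Definition qf (x y : nat -> R) : R := ip (mul_mu x) (mul_mu y) + ip x (mv F y).

Lemma edom_l2 x : edom x -> l2 x.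
Proof.
 intros H. apply ex_series_le_R with (fun k => mul_mu x k * mul_mu x k); auto.
 intros k. unfold mul_mu. use (mu_ge1 k). rewrite Rabs_pos_eq by nra.
 replace (mu k * x k * (mu k * x k)) with ((mu k * mu k) * (x k * x k)) by ring.
 assert (0 <= x k * x k) by nra. assert (1 <= mu k * mu k) by nra. nra.
Qed.

Lemma rapid_edom x : rapid x -> edom x.
Proof.
 intros H. apply rapid_l2. intros r. destruct (H (S r)) as [D HD]. exists D. intros k.
 apply le_div_w. unfold mul_mu. rewrite Rabs_mult, (Rabs_pos_eq (mu k)) by (use (mu_ge1 k); lra).
 specialize (HD k). apply le_div_w in HD. simpl in HD. use (mu_le_w k). use (wp_pos k r). use (Rabs_pos (x k)).
 assert (0 <= Rabs (x k) * w k ^ r) by nra. nra.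
Qed.

Lemma edom_plus x y : edom x -> edom y -> edom (fun k => x k + y k).
Proof. intros Hx Hy. eapply l2_ext; [|apply (l2_plus _ _ Hx Hy)]. intros; unfold mul_mu; simpl; ring. Qed.

Lemma edom_scal c x : edom x -> edom (fun k => c * x k).
Proof. intros Hx. eapply l2_ext; [|apply (l2_scal c _ Hx)]. intros; unfold mul_mu; simpl; ring. Qed.

Lemma edom_minus x y : edom x -> edom y -> edom (fun k => x k - y k).
Proof. intros Hx Hy. eapply l2_ext; [|apply (l2_minus _ _ Hx Hy)]. intros; unfold mul_mu; simpl; ring. Qed.

Lemma edom_sm (x : nat -> nat -> R) n : (forall i, (i < n)%nat -> edom (x i)) -> edom (fun k => sm (fun i => x i k) n).
Proof.
 intros H. eapply l2_ext; [|apply (l2_sm (fun i => mul_mu (x i)) n H)]. intros k. simpl. unfold mul_mu. rewrite <- sm_scal. reflexivity.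
Qed.

Lemma mv_l2 x : l2 x -> l2 (mv F x).
Proof. intros H. apply rapid_l2. eapply mv_rapid; eauto. Qed.

Lemma qf_sym x y : l2 x -> l2 y -> qf x y = qf y x.
Proof.
 intros Hx Hy. unfold qf. rewrite (ip_sym (mul_mu x)). f_equal. rewrite <- (mv_sym F C) by auto. apply ip_sym.
Qed.

Lemma qf_plus_l x y z : edom x -> edom y -> edom z -> qf (fun k => x k + y k) z = qf x z + qf y z.
Proof.
 intros Hx Hy Hz. unfold qf. rewrite ip_plus_l; auto using edom_l2, mv_l2.
 rewrite (ip_ext (mul_mu (fun k => x k + y k)) (fun k => mul_mu x k + mul_mu y k) (mul_mu z) (mul_mu z));
  [|intros; unfold mul_mu; ring|reflexivity]. rewrite ip_plus_l; auto. ring.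
Qed.

Lemma qf_scal_l c x z : qf (fun k => c * x k) z = c * qf x z.
Proof.
 unfold qf. rewrite ip_scal_l. rewrite (ip_ext (mul_mu (fun k => c * x k)) (fun k => c * mul_mu x k) (mul_mu z) (mul_mu z));
  [|intros; unfold mul_mu; ring|reflexivity]. rewrite ip_scal_l. ring.
Qed.

Lemma qf_sm_l (x : nat -> nat -> R) n z : (forall i, (i < n)%nat -> edom (x i)) -> edom z ->
 qf (fun k => sm (fun i => x i k) n) z = sm (fun i => qf (x i) z) n.
Proof.
 intros H Hz. induction n as [|n IH]; simpl.
 - transitivity (qf (fun k => 0 * dl 0 k) z); [|rewrite qf_scal_l; ring].
  unfold qf, ip. f_equal; apply Series_ext; intros; unfold mul_mu; ring.
 - rewrite (qf_plus_l (fun k => sm (fun i => x i k) n) (x n)); auto.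
  + rewrite IH; auto.
  + apply edom_sm; auto.
Qed.

Lemma form_bound x y : l2 x -> l2 y -> ip x x <= 1 -> ip y y <= 1 -> Rabs (ip x (mv F y)) <= 4 * C 4%nat.
Proof.
 intros Hx Hy H1 H2. assert (Hb : forall z, l2 z -> ip z z <= 1 -> forall l, Rabs (z l) <= 1 * w l ^ 0).
 { intros z Hz Hz1 l. simpl. use (ip_coord z l Hz). apply Rabs_le. nra. }
 unfold ip. replace (4 * C 4%nat) with (2 * (2 * (C 4%nat * 1))) by ring. apply series_bound. intros k. rewrite Rabs_mult.
 use (mv_bound F C y 1 2 0 k HF (Hb y Hy H2)) as B. simpl (2 + 0 + 2)%nat in B.
 specialize (Hb x Hx H1 k). simpl in Hb. use (Rabs_pos (x k)). use (Rabs_pos (mv F y k)). nra.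
Qed.

Lemma form_bound_gen x : l2 x -> Rabs (ip x (mv F x)) <= 4 * C 4%nat * ip x x.
Proof.
 intros Hx. use (ip_pos x Hx) as [Hp|Hz].
 - pose (c := / sqrt (ip x x)). use (sqrt_lt_R0 _ Hp) as Hs. assert (Hc : c * c * ip x x = 1).
  { assert (E : sqrt (ip x x) * sqrt (ip x x) = ip x x) by (apply sqrt_sqrt; lra).
   unfold c. set (q := sqrt (ip x x)) in *. rewrite <- E. field. lra. } assert (Hcx : ip (fun k => c * x k) (fun k => c * x k) = 1).
  { rewrite ip_scal_l, ip_sym, ip_scal_l. rewrite <- Hc; ring. } use (form_bound (fun k => c * x k) (fun k => c * x k)
    (l2_scal c x Hx) (l2_scal c x Hx) ltac:(lra) ltac:(lra)) as B. rewrite ip_scal_l in B.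
  rewrite (ip_ext x x (mv F (fun k => c * x k)) (fun k => c * mv F x k)) in B; [|reflexivity|intros; apply mv_scal].
  rewrite ip_sym, ip_scal_l, ip_sym in B. replace (c * (c * ip x (mv F x))) with ((c * c) * ip x (mv F x)) in B by ring.
  rewrite Rabs_mult, (Rabs_pos_eq (c * c)) in B by nra. use (Rmult_le_compat_r (ip x x) _ _ ltac:(lra) B) as B'.
  replace (c * c * Rabs (ip x (mv F x)) * ip x x) with (Rabs (ip x (mv F x)) * (c * c * ip x x)) in B' by ring. rewrite Hc in B'. lra.
 - assert (E : forall k, x k = 0). { intros k. use (ip_coord x k Hx). rewrite <- Hz in H. nra. }
  rewrite <- Hz. unfold ip. rewrite (Series_ext _ (fun k => 0 * 0)) by (intros; rewrite E; ring).
  rewrite Series_scal_l, Rmult_0_l, Rabs_R0. lra.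
Qed.

Lemma qf_lower x : edom x -> ip (mul_mu x) (mul_mu x) - 4 * C 4%nat * ip x x <= qf x x.
Proof.
 intros H. unfold qf. use (form_bound_gen x (edom_l2 x H)) as B. apply Rabs_le_between in B. lra.
Qed.

Definition is_eig (x : nat -> R) (v : R) : Prop := forall k, mu k ^ 2 * x k + mv F x k = v * x k.

Lemma qf_eig x z v : rapid x -> l2 z -> is_eig x v -> qf z x = v * ip z x.
Proof.
 intros Hx Hz He. unfold qf. assert (Hm : rapid (fun k => mu k ^ 2 * x k)).
 { intros r. destruct (Hx (r + 2)%nat) as [D HD]. exists D. intros k.
  apply le_div_w. rewrite Rabs_mult. specialize (HD k). apply le_div_w in HD. rewrite pow_add in HD.
  rewrite Rabs_pos_eq by (apply pow_le; use (mu_ge1 k); lra).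
  use (pow_incr (mu k) (w k) 2 (conj (Rle_trans _ _ _ Rle_0_1 (mu_ge1 k)) (mu_le_w k))).
  use (wp_pos k r). use (Rabs_pos (x k)). assert (0 <= Rabs (x k) * w k ^ r) by nra. nra. } rewrite (ip_sym z (mv F x)).
 replace (ip (mul_mu z) (mul_mu x)) with (ip (fun k => mu k ^ 2 * x k) z) by (apply Series_ext; intros; unfold mul_mu; ring).
 rewrite <- ip_plus_l; auto using rapid_l2, mv_l2. rewrite (ip_ext _ (fun k => v * x k) z z) by (auto; reflexivity).
 rewrite ip_scal_l, ip_sym. reflexivity.
Qed.

(** Where [mu k >= |v| + 1] the factor [mu k ^ 2 - v] is at least 1, so [x k] is dominated by
    [mv F x k], which decreases rapidly. The remaining indices satisfy [w k <= 2 (|v| + 1)] and only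
    enlarge the constant. *)
Lemma eig_rapid x v : l2 x -> is_eig x v -> rapid x.
Proof.
 intros Hx He r. destruct (mv_rapid F C x HF Hx r) as [D HD]. destruct (l2_bdd x Hx) as [B HB].
 assert (HB0 : 0 <= B). { specialize (HB 0%nat). simpl in HB. use (Rabs_pos (x 0%nat)). lra. }
 assert (HD0 : 0 <= D). { specialize (HD 0%nat). use (Rabs_pos (mv F x 0%nat)). unfold w in HD; simpl in HD. rewrite pow1 in HD. lra. }
 use (Rabs_pos v). exists (D + B * (2 * (Rabs v + 1)) ^ r). intros k. apply le_div_w. destruct (Rle_dec (Rabs v + 1) (mu k)) as [Hk|Hk].
 - assert (E : (mu k ^ 2 - v) * x k = - mv F x k) by (rewrite Rmult_minus_distr_r, <- (He k); ring).
  specialize (HD k). apply le_div_w in HD. assert (Rabs (x k) <= Rabs (mv F x k)). { rewrite <- (Rabs_Ropp (mv F x k)), <- E, Rabs_mult.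
   assert (1 <= Rabs (mu k ^ 2 - v)). { use (Rle_abs v). below Rle_abs. nra. } use (Rabs_pos (x k)). nra. }
  use (wp_pos k r). assert (0 <= (2 * (Rabs v + 1)) ^ r) by (apply pow_le; lra). nra.
 - specialize (HB k). simpl in HB. use (w_le_mu k). assert (w k ^ r <= (2 * (Rabs v + 1)) ^ r) by (apply pow_incr; use (w_pos k); lra).
  use (wp_pos k r). use (Rabs_pos (x k)). assert (Rabs (x k) * w k ^ r <= B * (2 * (Rabs v + 1)) ^ r) by (mul_lr; lra). lra.
Qed.

End FormOnSequences.

Lemma ip_sq_lin x y t : l2 x -> l2 y -> ip (fun k => x k + t * y k) (fun k => x k + t * y k) = ip x x + 2 * t * ip x y + t * t * ip y y.
Proof.
 intros Hx Hy. rewrite ip_plus_l; auto using l2_plus, l2_scal.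
 rewrite ip_scal_l, (ip_sym x), (ip_sym y). rewrite !ip_plus_l; auto using l2_scal. rewrite !ip_scal_l, (ip_sym y x). ring.
Qed.

Lemma ip_sq_minus x y : l2 x -> l2 y -> ip (fun k => x k - y k) (fun k => x k - y k) = ip x x - 2 * ip x y + ip y y.
Proof.
 intros Hx Hy. rewrite (ip_ext _ (fun k => x k + (-1) * y k) _ (fun k => x k + (-1) * y k)) by (intros; ring).
 rewrite ip_sq_lin by auto. ring.
Qed.

(** Rellich's compactness argument: a bound on the energy makes the tails of the norm uniformly
    small, so coordinatewise convergence becomes convergence in norm. *)
Lemma edom_limit (y : nat -> nat -> R) (x : nat -> R) (K : R) :
 (forall m, edom (y m)) -> (forall m, ip (mul_mu (y m)) (mul_mu (y m)) <= K) -> (forall k, is_lim_seq (fun m => y m k) (x k)) ->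
 edom x /\ (forall n, sm (fun k => mul_mu x k * mul_mu x k) n <= K) /\
 is_lim_seq (fun m => ip (fun k => y m k - x k) (fun k => y m k - x k)) 0.
Proof.
 intros Hy HK Hl. assert (Hx : forall n, sm (fun k => mul_mu x k * mul_mu x k) n <= K). { intros n.
  apply (is_lim_seq_le (fun m => sm (fun k => mul_mu (y m) k * mul_mu (y m) k) n) (fun _ => K)
   (sm (fun k => mul_mu x k * mul_mu x k) n) K); [|apply sm_lim|apply is_lim_seq_const].
  - intros m. below (HK m). apply sm_le_series; [intros; nra|]. apply ip_is_series; apply Hy.
  - intros k _. unfold mul_mu. apply is_lim_seq_mult'; apply (is_lim_seq_scal_l (fun m => y m k) (mu k) (x k)); apply Hl. }
 assert (Ex : edom x) by (apply ex_series_bounded with K; [intros; nra|exact Hx]). split; [exact Ex|]. split; [exact Hx|].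
 assert (HK0 : 0 <= K) by (specialize (Hx O); exact Hx). assert (Hxx : ip (mul_mu x) (mul_mu x) <= K).
 { eapply series_le_bound; [apply ip_is_series; apply Ex|exact Hx]. }
 assert (Hz : forall m, ip (mul_mu (fun k => y m k - x k)) (mul_mu (fun k => y m k - x k)) <= 4 * K). { intros m.
  rewrite (ip_ext _ (fun k => mul_mu (y m) k - mul_mu x k) _ (fun k => mul_mu (y m) k - mul_mu x k)) by (intros; unfold mul_mu; ring).
  rewrite ip_sq_minus; [|apply Hy|apply Ex]. use (ip_sq_lin (mul_mu (y m)) (mul_mu x) 1 (Hy m) Ex) as E.
  use (ip_pos (fun k => mul_mu (y m) k + 1 * mul_mu x k) (l2_plus _ _ (Hy m) (l2_scal 1 _ Ex))). specialize (HK m). lra. }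
 (* Beyond [n] one has [w n <= 4 mu^2]; hence the tail of the norm is at most [4 / w n] times the
    energy of the difference, itself at most [4 K] by the parallelogram law. *)
 assert (Ht : forall m n, ip (fun k => y m k - x k) (fun k => y m k - x k)
   <= sm (fun k => (y m k - x k) * (y m k - x k)) n + 16 * K / w n). { intros m n.
  assert (Edz : edom (fun k => y m k - x k)) by (apply edom_minus; auto).
  eapply series_le_bound; [apply ip_is_series; apply edom_l2; auto|]. intros N. set (z := fun k => y m k - x k) in *.
  assert (HKn : 0 <= 16 * K / w n) by (apply Rle_mult_inv_pos; [lra|apply w_pos]). destruct (le_lt_dec N n) as [HN|HN].
  - use (sm_mono (fun k => z k * z k) N n ltac:(intros; nra) HN).
   change (sm (fun k => (y m k - x k) * (y m k - x k)) n) with (sm (fun k => z k * z k) n). lra.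
  - replace N with (n + (N - n))%nat by lia. rewrite sm_add. apply Rplus_le_compat_l.
   via (4 / w n * sm (fun k => mul_mu z (n + k) * mul_mu z (n + k)) (N - n)).
   + rewrite <- sm_scal. apply sm_le. intros k _. unfold mul_mu. use (w_pos n). use (w_ge1 n). use (w_le_mu (n + k)).
    assert (w n <= w (n + k)) by (unfold w; apply le_INR; lia). assert (Hq : w n <= 4 * (mu (n + k) * mu (n + k))) by nra.
    replace (4 / w n * (mu (n + k) * z (n + k)%nat * (mu (n + k) * z (n + k)%nat)))
     with ((4 * (mu (n + k) * mu (n + k)) / w n) * (z (n + k)%nat * z (n + k)%nat)) by (field; lra).
    assert (1 <= 4 * (mu (n + k) * mu (n + k)) / w n) by (apply Rle_div_r; lra). use (Rle_0_sqr (z (n + k)%nat)); unfold Rsqr in *. nra.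
   + assert (sm (fun k => mul_mu z (n + k) * mul_mu z (n + k)) (N - n) <= 4 * K). { below (Hz m).
     eapply Rle_trans; [|apply (sm_le_series (fun k => mul_mu z k * mul_mu z k) _ N); [intros; nra|apply ip_is_series; apply Edz]].
     replace N with (n + (N - n))%nat at 2 by lia. rewrite sm_add.
     use (sm_pos (fun k => mul_mu z k * mul_mu z k) n ltac:(intros; nra)). lra. }
    replace (16 * K / w n) with (4 / w n * (4 * K)) by (field; use (w_pos n); lra).
    mul_l; auto. apply Rle_mult_inv_pos; [lra|apply w_pos]. } apply is_lim_seq_spec. intros eps.
 use (proj2 (is_lim_seq_spec _ _) (w_lim_scal (16 * K)) (mkposreal (eps / 2) ltac:(use (cond_pos eps); lra))) as [n Hn].
 specialize (Hn n (Nat.le_refl _)). simpl in Hn.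
 assert (Hs : is_lim_seq (fun m => sm (fun k => (y m k - x k) * (y m k - x k)) n) (sm (fun k => (x k - x k) * (x k - x k)) n)).
 { apply sm_lim. intros k _. apply is_lim_seq_mult'; (apply is_lim_seq_minus'; [apply Hl|apply is_lim_seq_const]). }
 rewrite (sm_zero (fun k => (x k - x k) * (x k - x k))) in Hs by (intros; ring).
 use (proj2 (is_lim_seq_spec _ _) Hs (mkposreal (eps / 2) ltac:(use (cond_pos eps); lra))) as [M HM].
 exists M. intros m Hm. specialize (HM m Hm). simpl in HM. rewrite Rminus_0_r in *. use (Rle_abs (16 * K / w n)).
 use (Rle_abs (sm (fun k => (y m k - x k) * (y m k - x k)) n)). rewrite Rabs_pos_eq; [|apply ip_pos, edom_l2, edom_minus; auto].
 specialize (Ht m n). lra.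
Qed.

(** * Minimizers of the form on orthogonal complements *)

Section Minimizer.
Variables (F : nat -> nat -> R) (C : nat -> R).
Hypothesis HF : bdd F C.
Hypothesis Fsym : forall j k, F j k = F k j.

Definition ortho (n : nat) (psi : nat -> nat -> R) (y : nat -> R) : Prop := forall i, (i < n)%nat -> ip y (psi i) = 0.

Definition onsys (n : nat) (psi : nat -> nat -> R) : Prop := (forall i, (i < n)%nat -> rapid (psi i)) /\
 (forall i j, (i < n)%nat -> (j < n)%nat -> ip (psi i) (psi j) = dl i j).

Definition proj_rem (n : nat) (psi : nat -> nat -> R) (x : nat -> R) : nat -> R := fun k => x k - sm (fun i => ip x (psi i) * psi i k) n.

Lemma proj_rem_edom n psi x : onsys n psi -> edom x -> edom (proj_rem n psi x).
Proof.
 intros [H1 _] Hx. apply edom_minus; auto. apply (edom_sm (fun i k => ip x (psi i) * psi i k)). intros. apply edom_scal, rapid_edom; auto.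
Qed.

Lemma ip_proj_rem_l n psi x z : onsys n psi -> l2 x -> l2 z ->
 ip (proj_rem n psi x) z = ip x z - sm (fun i => ip x (psi i) * ip (psi i) z) n.
Proof.
 intros [H1 _] Hx Hz. unfold proj_rem. rewrite ip_minus_l; auto.
 - rewrite (ip_sm_l (fun i k => ip x (psi i) * psi i k)); auto.
  + f_equal. apply sm_ext. intros; apply ip_scal_l.
  + intros; apply l2_scal, rapid_l2; auto.
 - apply (l2_sm (fun i k => ip x (psi i) * psi i k)). intros; apply l2_scal, rapid_l2; auto.
Qed.

Lemma proj_rem_ortho n psi x : onsys n psi -> l2 x -> ortho n psi (proj_rem n psi x).
Proof.
 intros H Hx i Hi. rewrite ip_proj_rem_l; auto; [|apply rapid_l2, H, Hi]. destruct H as [H1 H2]. rewrite (sm_single _ _ i); auto.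
 - rewrite H2, dl_same; auto. ring.
 - intros k Hk Hki. rewrite H2, dl_diff; auto. ring.
Qed.

Lemma proj_rem_norm n psi x : onsys n psi -> edom x ->
 ip (proj_rem n psi x) (proj_rem n psi x) = ip x x - sm (fun i => ip x (psi i) * ip x (psi i)) n.
Proof.
 intros H Hx. use (edom_l2 _ Hx) as Hx2. use (edom_l2 _ (proj_rem_edom n psi x H Hx)) as Hp. rewrite ip_proj_rem_l by auto.
 rewrite (sm_zero (fun i => ip x (psi i) * ip (psi i) (proj_rem n psi x))).
 - rewrite ip_sym, ip_proj_rem_l by auto. rewrite Rminus_0_r. f_equal. apply sm_ext. intros; rewrite (ip_sym (psi k)); ring.
 - intros k Hk. rewrite (ip_sym (psi k)), proj_rem_ortho by auto. ring.
Qed.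

Lemma bessel n psi x : onsys n psi -> edom x -> sm (fun i => ip x (psi i) * ip x (psi i)) n <= ip x x.
Proof.
 intros H Hx. use (ip_pos _ (edom_l2 _ (proj_rem_edom n psi x H Hx))) as HH. rewrite proj_rem_norm in HH by auto. lra.
Qed.

Lemma bessel_coord n psi k : onsys n psi -> sm (fun i => psi i k * psi i k) n <= 1.
Proof.
 intros H. use (bessel n psi (dl k) H (rapid_edom _ (rapid_dl k))) as B. rewrite ip_dl_r, dl_same in B. erewrite sm_ext; [exact B|].
 intros i _. simpl. rewrite (ip_sym (dl k)), ip_dl_r. reflexivity.
Qed.

Lemma normalize x : edom x -> 0 < ip x x -> exists c, 0 < c /\ c * c * ip x x = 1 /\ ip (fun k => c * x k) (fun k => c * x k) = 1.
Proof.
 intros Hx Hp. exists (/ sqrt (ip x x)). use (sqrt_lt_R0 _ Hp) as Hs. split; [apply Rinv_0_lt_compat; auto|].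
 assert (E : sqrt (ip x x) * sqrt (ip x x) = ip x x) by (apply sqrt_sqrt; lra).
 assert (E2 : / sqrt (ip x x) * / sqrt (ip x x) * ip x x = 1). { set (q := sqrt (ip x x)) in *. rewrite <- E. field. lra. }
 split; auto. generalize dependent (/ sqrt (ip x x)). intros c E2. rewrite ip_scal_l, (ip_sym x), ip_scal_l. rewrite <- E2. ring.
Qed.

(* The projections of the first n+1 unit vectors onto the span of psi_0..psi_(n-1) have total squared length at most n. *)
Lemma exists_ortho_unit n psi : onsys n psi -> exists y, edom y /\ ip y y = 1 /\ ortho n psi y.
Proof.
 intros H. assert (Hk : exists k, 0 < ip (proj_rem n psi (dl k)) (proj_rem n psi (dl k))). { apply NNPP. intros Hn.
  assert (H0 : forall k, 1 <= sm (fun i => psi i k * psi i k) n). { intros k. apply Rnot_lt_le. intros Hlt. apply Hn. exists k.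
   rewrite proj_rem_norm by (auto; apply rapid_edom, rapid_dl). rewrite ip_dl_r, dl_same.
   rewrite (sm_ext _ (fun i => psi i k * psi i k)); [lra|]. intros i _. rewrite (ip_sym (dl k)), ip_dl_r. reflexivity. }
  use (sm_le (fun _ => 1) (fun k => sm (fun i => psi i k * psi i k) n) (S n) (fun k _ => H0 k)) as HH. rewrite sm_const, sm_swap in HH.
  assert (sm (fun i => sm (fun k => psi i k * psi i k) (S n)) n <= sm (fun _ => 1) n). { apply sm_le. intros i Hi. destruct H as [H1 H2].
   rewrite <- (dl_same i), <- (H2 i i Hi Hi). apply sm_le_series; [intros; nra|]. apply ip_is_series; apply rapid_l2, H1, Hi. }
  rewrite sm_const, S_INR in *. lra. } destruct Hk as [k Hk].
 assert (Hd : edom (proj_rem n psi (dl k))) by (apply proj_rem_edom; auto; apply rapid_edom, rapid_dl).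
 destruct (normalize _ Hd Hk) as [c [Hc [_ E]]].
 exists (fun l => c * proj_rem n psi (dl k) l). split; [apply edom_scal; auto|]. split; auto.
 intros i Hi. rewrite ip_scal_l, proj_rem_ortho; auto; [ring|apply l2_dl].
Qed.

(** The direct method: the form is bounded below on unit vectors, a minimizing sequence has bounded
    energy, and a coordinatewise limit of a subsequence is a strong limit by [edom_limit]. *)
Lemma minimizer n psi : onsys n psi -> exists x, edom x /\ ip x x = 1 /\ ortho n psi x /\
  forall y, edom y -> ortho n psi y -> qf F x x * ip y y <= qf F y y.
Proof.
 intros Hon. pose (P := fun v => exists y, edom y /\ ip y y = 1 /\ ortho n psi y /\ v = - qf F y y). assert (HP1 : bound P).
 { exists (4 * C 4%nat). intros v [y [Hy [Hy1 [_ ->]]]]. use (qf_lower F C HF y Hy) as B. use (ip_pos _ Hy). rewrite Hy1 in B. lra. }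
 assert (HP2 : exists v, P v). { destruct (exists_ortho_unit n psi Hon) as [y [H1 [H2 H3]]]. eexists; exists y; eauto. }
 destruct (completeness P HP1 HP2) as [M [HM1 HM2]].
 assert (Hseq : forall m : nat, exists y, edom y /\ ip y y = 1 /\ ortho n psi y /\ qf F y y <= - M + / w m).
 { intros m. apply NNPP. intros Hn. use (Rinv_0_lt_compat _ (w_pos m)).
  assert (M <= M - / w m); [|lra]. apply HM2. intros v [y [H1 [H2 [H3 ->]]]].
  apply Rnot_lt_le. intros Hlt. apply Hn. exists y. repeat split; auto. lra. }
 pose (y0 := fun m => proj1_sig (constructive_indefinite_description _ (Hseq m))).
 assert (Hy0 : forall m, edom (y0 m) /\ ip (y0 m) (y0 m) = 1 /\ ortho n psi (y0 m) /\ qf F (y0 m) (y0 m) <= - M + / w m).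
 { intros m. unfold y0. destruct constructive_indefinite_description; auto. } destruct (diagonal_extraction y0) as [s [Hs Hlim]].
 { intros m k. destruct (Hy0 m) as [Hd [H1 _]]. use (ip_coord (y0 m) k (edom_l2 _ Hd)) as B. rewrite H1 in B. apply Rabs_le. nra. }
 pose (y := fun m => y0 (s m)). pose (x := fun k => real (Lim_seq (fun m => y m k))).
 assert (Hcv : forall k, is_lim_seq (fun m => y m k) (x k)). { intros k. apply Lim_seq_correct', (Hlim k). }
 assert (Hw : forall m, / w (s m) <= / w m).
 { intros m. apply Rinv_le_contravar; [apply w_pos|]. unfold w. apply le_INR. specialize (Hs m). lia. }
 assert (Hw1 : forall m, / w m <= 1). { intros m. rewrite <- Rinv_1. apply Rinv_le_contravar; [lra|apply w_ge1]. }
 assert (Hy : forall m, edom (y m) /\ ip (y m) (y m) = 1 /\ ortho n psi (y m) /\ qf F (y m) (y m) <= - M + / w m).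
 { intros m. unfold y. destruct (Hy0 (s m)) as [A1 [A2 [A3 A4]]]. repeat split; auto. specialize (Hw m). lra. }
 destruct (edom_limit y x (- M + 1 + 4 * C 4%nat)) as [Hx [_ Hz]]; auto. { intros m. apply Hy. }
 { intros m. destruct (Hy m) as [A1 [A2 [_ A4]]]. use (qf_lower F C HF (y m) A1) as B. rewrite A2 in B. specialize (Hw1 m). lra. }
 pose (z := fun m k => y m k - x k). assert (Hze : forall m, edom (z m)) by (intros; apply edom_minus; auto; apply Hy). fold z in Hz.
 (* Cauchy-Schwarz against bounded vectors. Every limit of an inner product below is split so that
    it follows from this one. *)
 assert (Hcs : forall (v : nat -> nat -> R) B, (forall m, l2 (v m)) -> (forall m, ip (v m) (v m) <= B) ->
   is_lim_seq (fun m => ip (z m) (v m)) 0). { intros v B Hv HB.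
  assert (HB0 : 0 <= B) by (eapply Rle_trans; [apply (ip_pos _ (Hv O))|apply HB]).
  apply is_lim_seq_spec. intros eps. use (cond_pos eps) as He. assert (Hd : 0 < eps * eps / (B + 1)) by (apply Rdiv_lt_0_compat; nra).
  destruct (proj2 (is_lim_seq_spec _ _) Hz (mkposreal _ Hd)) as [N HN]. exists N. intros m Hm.
  specialize (HN m Hm). simpl in HN. rewrite Rminus_0_r, Rabs_pos_eq in HN by (apply ip_pos, edom_l2, Hze).
  rewrite Rminus_0_r. use (ip_cs (z m) (v m) (edom_l2 _ (Hze m)) (Hv m)) as CS.
  use (ip_pos _ (edom_l2 _ (Hze m))). use (ip_pos _ (Hv m)). specialize (HB m).
  apply (Rmult_lt_compat_r (B + 1)) in HN; [|lra]. unfold Rdiv in HN. rewrite (Rmult_assoc (eps * eps)), Rinv_l, Rmult_1_r in HN by lra.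
  assert (Hsq : ip (z m) (v m) * ip (z m) (v m) < eps * eps).
  { eapply Rle_lt_trans; [exact CS|]. eapply Rle_lt_trans; [|exact HN]. mul_l; [apply ip_pos, edom_l2, Hze|lra]. }
  rewrite <- (Rabs_pos_eq eps) by lra. apply Rsqr_lt_abs_0. exact Hsq. } assert (Hxl : l2 x) by (apply edom_l2; auto).
 assert (Hyl : forall m, l2 (y m)) by (intros; apply edom_l2, Hy). assert (Hzl : forall m, l2 (z m)) by (intros; apply edom_l2, Hze).
 assert (Ex : forall m v, l2 v -> ip x v = ip (y m) v - ip (z m) v). { intros m v Hv. unfold z. rewrite ip_minus_l; auto. ring. }
 assert (Hconst : forall (a : R) (u : nat -> R), (forall m, a = u m) -> forall b : R, is_lim_seq u b -> a = b).
 { intros a u Hu b Hb. assert (E : Finite a = Finite b); [|congruence].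
  rewrite <- (is_lim_seq_unique u b Hb). symmetry. apply is_lim_seq_unique. eapply is_lim_seq_ext; [exact Hu|]. apply is_lim_seq_const. }
 assert (Hx1 : ip x x = 1). { apply (Hconst _ (fun m => 1 - ip (z m) (y m) - ip (z m) x)).
  - intros m. rewrite (Ex m x Hxl), (ip_sym (y m)), (Ex m (y m) (Hyl m)). replace (ip (y m) (y m)) with 1 by (symmetry; apply Hy). ring.
  - replace (Finite 1) with (Finite (1 - 0 - 0)) by (f_equal; ring).
   apply is_lim_seq_minus'; [apply is_lim_seq_minus'; [apply is_lim_seq_const|]|].
   + apply (Hcs y 1); auto. intros m; right; apply Hy.
   + apply (Hcs (fun _ => x) (ip x x)); auto. intros; lra. } assert (Hxo : ortho n psi x).
 { intros i Hi. assert (Hp : l2 (psi i)) by (apply rapid_l2, Hon, Hi). apply (Hconst _ (fun m => 0 - ip (z m) (psi i))).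
  - intros m. rewrite (Ex m _ Hp). destruct (Hy m) as [_ [_ [A _]]]. rewrite A by auto. ring.
  - replace (Finite 0) with (Finite (0 - 0)) by (f_equal; ring). apply is_lim_seq_minus'; [apply is_lim_seq_const|].
   apply (Hcs (fun _ => psi i) (ip (psi i) (psi i))); auto. intros; lra. }
 assert (Hfx : is_lim_seq (fun m => ip (y m) (mv F (y m))) (ip x (mv F x))).
 { apply is_lim_seq_ext with (fun m => ip x (mv F x) + ip (z m) (mv F x) + ip (z m) (mv F (y m))).
  - intros m. rewrite (Ex m _ (mv_l2 F C HF x Hxl)). replace (ip (y m) (mv F x)) with (ip x (mv F (y m)))
    by (rewrite <- (mv_sym F C (y m) x) by auto; apply ip_sym). rewrite (Ex m _ (mv_l2 F C HF _ (Hyl m))). ring.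
  - replace (Finite (ip x (mv F x))) with (Finite (ip x (mv F x) + 0 + 0)) by (f_equal; ring).
   apply is_lim_seq_plus'; [apply is_lim_seq_plus'; [apply is_lim_seq_const|]|].
   + apply (Hcs (fun _ => mv F x) (ip (mv F x) (mv F x))); [intros; apply (mv_l2 F C); auto|intros; lra].
   + apply (Hcs (fun m => mv F (y m)) (2 * ((2 * (C 3%nat * 1)) * (2 * (C 3%nat * 1))))).
    * intros; apply (mv_l2 F C); auto.
    * intros m. upto Rle_abs. apply series_bound. intros k. assert (Hb : forall l, Rabs (y m l) <= 1 * w l ^ 0).
     { intros l. simpl. use (ip_coord (y m) l (Hyl m)) as B.
      replace (ip (y m) (y m)) with 1 in B by (symmetry; apply Hy). apply Rabs_le. nra. }
     use (mv_bound F C (y m) 1 1 0 k HF Hb) as B. simpl (1 + 0 + 2)%nat in B. rewrite Rabs_mult.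
     replace (2 * (C 3%nat * 1) * (2 * (C 3%nat * 1)) / w k ^ 2) with ((2 * (C 3%nat * 1) / w k ^ 1) * (2 * (C 3%nat * 1) / w k ^ 1))
      by (field; use (w_pos k); lra). mul_lr; auto using Rabs_pos. } assert (Hqx : qf F x x <= - M). { unfold qf.
  (* The energy is only lower semicontinuous, so its partial sums are passed to the limit one by
     one; the [F] part converges. *)
  assert (ip (mul_mu x) (mul_mu x) <= - M - ip x (mv F x)); [|lra]. eapply series_le_bound; [apply ip_is_series; apply Hx|]. intros N.
  assert (Hl1 : is_lim_seq (fun m => sm (fun k => mul_mu (y m) k * mul_mu (y m) k) N) (sm (fun k => mul_mu x k * mul_mu x k) N)).
  { apply sm_lim. intros k _. unfold mul_mu. apply is_lim_seq_mult'; apply (is_lim_seq_scal_l (fun m => y m k) (mu k) (x k)); apply Hcv. }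
  assert (Hl2 : is_lim_seq (fun m => - M + / w m - ip (y m) (mv F (y m))) (- M + 0 - ip x (mv F x))).
  { apply is_lim_seq_minus'; auto. apply is_lim_seq_plus'; [apply is_lim_seq_const|apply w_lim]. }
  assert (Hle : Rbar_le (sm (fun k => mul_mu x k * mul_mu x k) N) (- M + 0 - ip x (mv F x))).
  { apply (fun H => is_lim_seq_le _ _ _ _ H Hl1 Hl2). intros m. destruct (Hy m) as [A1 [_ [_ A4]]].
  assert (sm (fun k => mul_mu (y m) k * mul_mu (y m) k) N <= ip (mul_mu (y m)) (mul_mu (y m))).
  { apply sm_le_series; [intros; nra|apply ip_is_series; apply A1]. } unfold qf in A4. lra. } simpl in Hle. lra. }
 exists x. repeat split; auto. intros u Hu Huo. use (ip_pos u (edom_l2 _ Hu)) as [Hp|Hp].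
 - destruct (normalize u Hu Hp) as [c [Hc [Hc1 Hc2]]]. assert (B : - qf F (fun k => c * u k) (fun k => c * u k) <= M).
  { apply HM1. exists (fun k => c * u k). split; [apply edom_scal; auto|]. split; auto. split; auto.
   intros i Hi. rewrite ip_scal_l, Huo by auto. ring. } rewrite qf_scal_l, (qf_sym F C), qf_scal_l in B; auto using l2_scal, edom_l2.
  assert (0 < c * c) by nra. apply (Rmult_le_reg_l (c * c)); auto.
  replace (c * c * (qf F x x * ip u u)) with (qf F x x * (c * c * ip u u)) by ring. rewrite Hc1. lra.
 - assert (E : forall k, u k = 0). { intros k. use (ip_coord u k (edom_l2 _ Hu)) as B. rewrite <- Hp in B. nra. }
  rewrite <- Hp, Rmult_0_r. right. symmetry. transitivity (qf F (fun k => 0 * u k) u); [|rewrite qf_scal_l; ring].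
  unfold qf, ip, mul_mu. f_equal; apply Series_ext; intros; rewrite E; ring.
Qed.

End Minimizer.

(** The first variation of a minimum. The test value [- a / (|b| + 1)] is small enough for the
    linear term to outweigh the quadratic one. *)
Lemma linear_part_zero a b : (forall t, 0 <= 2 * t * a + t * t * b) -> a = 0.
Proof.
 intros H. destruct (Req_dec a 0) as [|Ha]; auto. exfalso. use (Rabs_pos b). use (Rle_abs b). specialize (H (- a / (Rabs b + 1))).
 replace (2 * (- a / (Rabs b + 1)) * a + - a / (Rabs b + 1) * (- a / (Rabs b + 1)) * b)
  with ((a * a) * ((b - 2 * (Rabs b + 1)) / ((Rabs b + 1) * (Rabs b + 1)))) in H by (field; lra). assert (0 < a * a) by nra.
 assert ((b - 2 * (Rabs b + 1)) / ((Rabs b + 1) * (Rabs b + 1)) < 0); [|nra].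
 apply Ropp_lt_cancel. rewrite Ropp_0. unfold Rdiv. rewrite Ropp_mult_distr_l. apply Rdiv_lt_0_compat; nra.
Qed.

(** Completeness is recorded as Parseval's identity on rapidly decreasing vectors, which are the
    coefficient sequences of smooth functions. *)
Record eigsys (F : nat -> nat -> R) (psi : nat -> nat -> R) (nu : nat -> R) : Prop := {
 es_rapid : forall j, rapid (psi j);
 es_on : forall i j, ip (psi i) (psi j) = dl i j;
 es_eig : forall j, is_eig F (psi j) (nu j);
 es_mono : forall j, nu j <= nu (S j);
 es_complete : forall x, rapid x -> is_series (fun j => ip x (psi j) * ip x (psi j)) (ip x x) }.

(** * Inductive construction of the eigenbasis, growth of the eigenvalues and completeness *)

Section Construction.
Variables (F : nat -> nat -> R) (C : nat -> R).
Hypothesis HF : bdd F C.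
Hypothesis Fsym : forall j k, F j k = F k j.

Lemma qf_sq_lin x y t : edom x -> edom y ->
 qf F (fun k => x k + t * y k) (fun k => x k + t * y k) = qf F x x + 2 * t * qf F x y + t * t * qf F y y.
Proof.
 intros Hx Hy. use (edom_scal t y Hy). use (edom_plus x _ Hx H). rewrite (qf_plus_l F C); auto.
 rewrite qf_scal_l, (qf_sym F C HF Fsym x), (qf_sym F C HF Fsym y); auto using edom_l2. rewrite !(qf_plus_l F C); auto.
 rewrite !qf_scal_l, (qf_sym F C HF Fsym y x); auto using edom_l2. ring.
Qed.

(** The variational equation is tested on projected unit vectors. The part removed by the projection
    contributes to neither side, because [x] is orthogonal to the earlier eigenvectors for [ip] and
    therefore also for [qf]. *)
Lemma min_is_eig n psi nu x : onsys n psi -> (forall i, (i < n)%nat -> is_eig F (psi i) (nu i)) -> edom x -> ip x x = 1 -> ortho n psi x ->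
 (forall y, edom y -> ortho n psi y -> qf F x x * ip y y <= qf F y y) -> is_eig F x (qf F x x).
Proof.
 intros Hon He Hx Hx1 Hxo Hmin. assert (EL : forall y, edom y -> ortho n psi y -> qf F x y = qf F x x * ip x y).
 { intros y Hy Hyo. apply Rminus_diag_uniq. apply (linear_part_zero _ (qf F y y - qf F x x * ip y y)). intros t.
  use (edom_l2 _ Hx). use (edom_l2 _ Hy). assert (B : qf F x x * ip (fun k => x k + t * y k) (fun k => x k + t * y k)
        <= qf F (fun k => x k + t * y k) (fun k => x k + t * y k)). { apply Hmin; [apply edom_plus; auto; apply edom_scal; auto|].
   intros i Hi. rewrite ip_plus_l; auto using l2_scal.
   - rewrite ip_scal_l, Hxo, Hyo by auto. ring.
   - apply rapid_l2, Hon, Hi. } rewrite qf_sq_lin, ip_sq_lin, Hx1 in B by auto. lra. } intros k.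
 assert (Hd : edom (dl k)) by apply rapid_edom, rapid_dl.
 use (EL (proj_rem n psi (dl k)) (proj_rem_edom n psi _ Hon Hd) (proj_rem_ortho n psi _ Hon (l2_dl k))) as E.
 assert (E1 : ip x (proj_rem n psi (dl k)) = x k). { rewrite ip_sym, ip_proj_rem_l; auto using l2_dl, edom_l2.
  rewrite sm_zero; [rewrite ip_sym, ip_dl_r; ring|]. intros i Hi. rewrite (ip_sym (psi i)), Hxo by auto. ring. }
 assert (E2 : qf F x (proj_rem n psi (dl k)) = qf F x (dl k)).
 { rewrite (qf_sym F C HF Fsym x) by (apply edom_l2; auto; apply proj_rem_edom; auto). unfold proj_rem.
  transitivity (qf F (fun l => dl k l + (-1) * sm (fun i => ip (dl k) (psi i) * psi i l) n) x). { f_equal. fext. intros; ring. }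
  assert (Hs : edom (fun l => sm (fun i => ip (dl k) (psi i) * psi i l) n)).
  { apply (edom_sm (fun i l => ip (dl k) (psi i) * psi i l)). intros; apply edom_scal, rapid_edom, Hon; auto. }
  rewrite (qf_plus_l F C), qf_scal_l; auto using edom_scal. rewrite (qf_sm_l F C HF (fun i l => ip (dl k) (psi i) * psi i l)); auto.
  - rewrite sm_zero; [rewrite (qf_sym F C); auto using edom_l2; ring|].
   intros i Hi. rewrite qf_scal_l, (qf_sym F C); auto using edom_l2; [|apply rapid_l2, Hon, Hi].
   rewrite (qf_eig F C HF (psi i) x (nu i)); auto using edom_l2; [|apply Hon, Hi]. rewrite Hxo by auto. ring.
  - intros; apply edom_scal, rapid_edom, Hon; auto. } rewrite E1, E2 in E. rewrite <- E. unfold qf.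
 rewrite <- (mv_sym F C) by auto using l2_dl, edom_l2. rewrite ip_dl_r. f_equal. symmetry.
 transitivity (ip (fun l => mu l ^ 2 * x l) (dl k)); [|apply ip_dl_r]. apply Series_ext. intros l. unfold mul_mu. ring.
Qed.

(** A bathtub argument. The column masses [t k], the sums over [i < n] of [psi i k ^ 2], lie in
    [[0, 1]] and have total [n]; the sum of [mu k ^ 2 * t k] is therefore smallest when the mass
    fills the first [n] columns. *)
Lemma sum_nu_lower n psi nu : onsys n psi -> (forall i, (i < n)%nat -> is_eig F (psi i) (nu i)) ->
 sm (fun k => mu k ^ 2) n - INR n * (4 * C 4%nat) <= sm nu n.
Proof.
 intros Hon He. destruct Hon as [H1 H2]. assert (Hon : onsys n psi) by (split; auto).
 assert (Hq : forall i, (i < n)%nat -> ip (mul_mu (psi i)) (mul_mu (psi i)) <= nu i + 4 * C 4%nat).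
 { intros i Hi. use (qf_lower F C HF (psi i) (rapid_edom _ (H1 i Hi))) as B.
  rewrite (qf_eig F C HF (psi i) (psi i) (nu i)) in B; auto using rapid_l2. rewrite (H2 i i Hi Hi), dl_same in B. lra. }
 apply sm_le in Hq. rewrite sm_plus, sm_const in Hq.
 assert (sm (fun k => mu k ^ 2) n <= sm (fun i => ip (mul_mu (psi i)) (mul_mu (psi i))) n); [|lra].
 pose (t := fun k => sm (fun i => psi i k * psi i k) n). assert (Ht : is_series t (INR n)).
 { replace (INR n) with (sm (fun i => ip (psi i) (psi i)) n).
  - apply is_series_sm_fin. intros i Hi. apply ip_is_series; apply rapid_l2; auto.
  - rewrite (sm_ext _ (fun _ => 1)); [rewrite sm_const; ring|]. intros i Hi; rewrite H2, dl_same; auto. }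
 assert (Hmt : is_series (fun k => mu k ^ 2 * t k) (sm (fun i => ip (mul_mu (psi i)) (mul_mu (psi i))) n)).
 { eapply is_series_ext_R; [|apply (is_series_sm_fin (fun i k => mul_mu (psi i) k * mul_mu (psi i) k)
    (fun i => ip (mul_mu (psi i)) (mul_mu (psi i))) n)].
  - intros k. simpl. unfold t. rewrite <- sm_scal. apply sm_ext. intros; unfold mul_mu; ring.
  - intros i Hi. apply ip_is_series; apply rapid_edom; auto. } assert (Ht01 : forall k, 0 <= t k <= 1).
 { intros k. split; [apply sm_pos; intros; nra|apply bessel_coord; auto]. } apply is_series_sm in Ht, Hmt.
 assert (Hl : is_lim_seq (fun L => sm t L * mu n ^ 2 - INR n * mu n ^ 2 + sm (fun k => mu k ^ 2) n)
   (INR n * mu n ^ 2 - INR n * mu n ^ 2 + sm (fun k => mu k ^ 2) n)).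
 { apply is_lim_seq_plus'; [|apply is_lim_seq_const]. apply is_lim_seq_minus'; [|apply is_lim_seq_const].
  apply (is_lim_seq_scal_r (sm t) (mu n ^ 2) (INR n)), Ht. }
 assert (HR : Rbar_le (INR n * mu n ^ 2 - INR n * mu n ^ 2 + sm (fun k => mu k ^ 2) n)
   (sm (fun i => ip (mul_mu (psi i)) (mul_mu (psi i))) n)). { apply (fun H => is_lim_seq_le_loc _ _ _ _ H Hl Hmt). exists n. intros L HL.
  assert (E : sm (fun k => (mu k ^ 2 - mu n ^ 2) * t k) L = sm (fun k => mu k ^ 2 * t k) L - sm t L * mu n ^ 2).
  { rewrite Rmult_comm, <- sm_scal, <- sm_minus. apply sm_ext. intros; ring. }
  assert (B : sm (fun k => mu k ^ 2 - mu n ^ 2) n <= sm (fun k => (mu k ^ 2 - mu n ^ 2) * t k) L).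
  { replace L with (n + (L - n))%nat by lia. rewrite sm_add.
   assert (0 <= sm (fun k => (mu (n + k) ^ 2 - mu n ^ 2) * t (n + k)%nat) (L - n)).
   { apply sm_pos. intros k _. use (mu_mono n (n + k) ltac:(lia)). use (mu_ge1 n).
    destruct (Ht01 (n + k)%nat). assert (0 <= mu (n + k) ^ 2 - mu n ^ 2) by nra. nra. }
   assert (sm (fun k => mu k ^ 2 - mu n ^ 2) n <= sm (fun k => (mu k ^ 2 - mu n ^ 2) * t k) n); [|lra].
   apply sm_le. intros k Hk. use (mu_mono k n ltac:(lia)). use (mu_ge1 k).
   destruct (Ht01 k). assert (mu k ^ 2 - mu n ^ 2 <= 0) by nra. nra. } rewrite sm_minus, sm_const in B. lra. }
 cbv beta iota delta [Rbar_le] in HR. lra.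
Qed.

Lemma sm_w2_lower n : INR n ^ 3 / 3 <= sm (fun k => w k ^ 2) n.
Proof.
 induction n as [|n IH]; [simpl; lra|]. cbn [sm]. unfold w at 2. rewrite S_INR. use (pos_INR n). nra.
Qed.

(** The last of the first [n + 1] eigenvalues is at least their average. The constant 12 is the
    product of the 3 in [sm_w2_lower] and the 4 in [w^2 <= 4 mu^2]. *)
Lemma nu_lower n psi nu : onsys (S n) psi -> (forall i, (i < S n)%nat -> is_eig F (psi i) (nu i)) ->
 (forall i, (i < n)%nat -> nu i <= nu (S i)) -> w n ^ 2 / 12 - 4 * C 4%nat <= nu n.
Proof.
 intros Hon He Hm. use (sum_nu_lower (S n) psi nu Hon He) as B. assert (Hle : forall i, (i <= n)%nat -> nu i <= nu n).
 { intros i Hi. remember (n - i)%nat as d eqn:Hd. revert i Hi Hd. induction d; intros i Hi Hd.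
  - replace i with n by lia. lra.
  - eapply Rle_trans; [apply Hm; lia|]. apply IHd; lia. } assert (sm nu (S n) <= INR (S n) * nu n).
 { rewrite <- sm_const. apply sm_le. intros; apply Hle; lia. } assert (sm (fun k => w k ^ 2) (S n) <= 4 * sm (fun k => mu k ^ 2) (S n)).
 { rewrite <- sm_scal. apply sm_le. intros k _. use (w_le_mu k). use (w_pos k). nra. }
 use (sm_w2_lower (S n)). fold (w n) in *. use (w_pos n). apply (Rmult_le_reg_l (w n)); auto. nra.
Qed.

(** Keeping the minimality of each vector among those orthogonal to its predecessors gives both the
    monotonicity of the eigenvalues and the control of projection remainders used for
    completeness. *)
Definition good (n : nat) (psi : nat -> nat -> R) : Prop :=
 onsys n psi /\ (forall i, (i < n)%nat -> is_eig F (psi i) (qf F (psi i) (psi i))) /\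
 (forall i, (i < n)%nat -> forall y, edom y -> ortho i psi y -> qf F (psi i) (psi i) * ip y y <= qf F y y).

Lemma good_ext n psi psi' : (forall i, (i < n)%nat -> psi i = psi' i) -> good n psi -> good n psi'.
Proof.
 intros E [[H1 H2] [H3 H4]]. split; [split|split].
 - intros i Hi. rewrite <- E; auto.
 - intros i j Hi Hj. rewrite <- !E; auto.
 - intros i Hi. rewrite <- E; auto.
 - intros i Hi y Hy Ho. rewrite <- E; auto. apply H4; auto. intros j Hj. rewrite E by lia. apply Ho; auto.
Qed.

Lemma good_step n psi : good n psi -> exists x, forall psi', (forall i, (i < n)%nat -> psi' i = psi i) -> psi' n = x -> good (S n) psi'.
Proof.
 intros [Hon [He Hm]]. destruct (minimizer F C HF Fsym n psi Hon) as [x [Hx [Hx1 [Hxo Hxm]]]]. exists x. intros psi' E En.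
 assert (Hxe : is_eig F x (qf F x x)) by (apply (min_is_eig n psi (fun i => qf F (psi i) (psi i))); auto).
 assert (Hxr : rapid x) by (eapply eig_rapid; eauto using edom_l2).
 assert (G : good n psi') by (apply good_ext with psi; [intros; symmetry; auto|split; [|split]; auto]). destruct G as [[G1 G2] [G3 G4]].
 assert (Cs : forall i, (i < S n)%nat -> (i < n)%nat \/ i = n) by (intros; lia). split; [split|split].
 - intros i Hi. destruct (Cs i Hi) as [Hi'|Hi']; [|subst i]; auto. rewrite En; auto.
 - intros i j Hi Hj. destruct (Cs i Hi) as [Hi'|Hi']; destruct (Cs j Hj) as [Hj'|Hj']; try subst i; try subst j; auto.
  + rewrite En, E, ip_sym, dl_diff by lia. apply Hxo; auto.
  + rewrite En, E, dl_diff by lia. apply Hxo; auto.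
  + rewrite En, dl_same; auto.
 - intros i Hi. destruct (Cs i Hi) as [Hi'|Hi']; [|subst i]; auto. rewrite En; auto.
 - intros i Hi. destruct (Cs i Hi) as [Hi'|Hi']; [|subst i]; auto. rewrite En. intros y Hy Ho. apply Hxm; auto.
  intros j Hj. rewrite <- E by auto. apply Ho; auto.
Qed.

Lemma good_sequence : exists psi, forall n, good n psi.
Proof.
 (* The premise [good n psi] is moved under the existential so that a choice function is available
    for arbitrary families. *)
 assert (Hc : forall n psi, exists x, good n psi -> forall psi', (forall i, (i < n)%nat -> psi' i = psi i) -> psi' n = x -> good (S n) psi').
 { intros n psi. destruct (classic (good n psi)) as [G|G].
  - destruct (good_step n psi G) as [x Hx]. exists x; auto.
  - exists (fun _ => 0). intros; contradiction. } pose (nx := fun n psi => proj1_sig (constructive_indefinite_description _ (Hc n psi))).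
 assert (Hnx : forall n psi, good n psi -> forall psi', (forall i, (i < n)%nat -> psi' i = psi i) -> psi' n = nx n psi -> good (S n) psi').
 { intros n psi. unfold nx. destruct constructive_indefinite_description; auto. } pose (bld := fix bld n : nat -> nat -> R := match n with
   | O => fun _ _ => 0 | S m => fun i => if Nat.eq_dec i m then nx m (bld m) else bld m i end). assert (Hb : forall n, good n (bld n)).
 { induction n as [|n IH].
  - split; [split|split]; intros; lia.
  - apply Hnx with (bld n); auto; simpl.
   + intros i Hi. destruct (Nat.eq_dec i n); [lia|reflexivity].
   + destruct (Nat.eq_dec n n); [reflexivity|lia]. } exists (fun i => bld (S i) i). intros n. apply good_ext with (bld n); auto.
 intros i Hi. clear -Hi. induction Hi as [|n Hi IH]; [reflexivity|]. rewrite <- IH. simpl. destruct (Nat.eq_dec i n); [lia|reflexivity].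
Qed.

Theorem spectral_theorem : exists psi nu, eigsys F psi nu.
Proof.
 destruct good_sequence as [psi G]. exists psi, (fun i => qf F (psi i) (psi i)). assert (Hon : forall n, onsys n psi) by (intros; apply G).
 assert (Hr : forall j, rapid (psi j)) by (intros j; apply (proj1 (Hon (S j))); lia).
 assert (Ho : forall i j, ip (psi i) (psi j) = dl i j). { intros i j. apply (proj2 (Hon (S (i + j)))); lia. }
 assert (He : forall j, is_eig F (psi j) (qf F (psi j) (psi j))). { intros j. apply (proj1 (proj2 (G (S j)))). lia. }
 assert (Hm : forall j, qf F (psi j) (psi j) <= qf F (psi (S j)) (psi (S j))).
 { intros j. use (proj2 (proj2 (G (S j))) j ltac:(lia) (psi (S j)) (rapid_edom _ (Hr (S j)))) as B.
  rewrite Ho, dl_same in B. rewrite Rmult_1_r in B. apply B. intros i Hi. rewrite Ho, dl_diff by lia. reflexivity. } split; auto.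
 intros x Hx. apply is_series_sm. assert (Hxe : edom x) by (apply rapid_edom; auto). assert (Hx2 : l2 x) by (apply edom_l2; auto).
 set (nu := fun j => qf F (psi j) (psi j)) in *. assert (Hlow : forall n, w n ^ 2 / 12 - 4 * C 4%nat <= nu n).
 { intros n. apply (nu_lower n psi nu); auto; intros; apply Hm. }
 pose (K := 4 * C 4%nat). assert (HK0 : 0 <= K) by (unfold K; use (bdd_nonneg F C 4 HF); lra). assert (Hnu : forall j, - K <= nu j).
 { intros j. use (Hlow j). use (pow2_ge_0 (w j)). unfold K. lra. } pose (S0 := fun n => sm (fun j => ip x (psi j) * ip x (psi j)) n).
 (* The remainder of the projection onto the first [n] eigenvectors competes in the minimum that
    defines [nu n], and its form value is bounded independently of [n]. As [nu n] tends to infinity,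
    its norm must tend to 0. *)
 assert (Hb : forall n, nu n * (ip x x - S0 n) <= qf F x x + K * ip x x). { intros n. unfold S0. rewrite <- (proj_rem_norm n psi x); auto.
  assert (Hpe : edom (proj_rem n psi x)) by (apply proj_rem_edom; auto).
  use (proj2 (proj2 (G (S n))) n ltac:(lia) _ Hpe (proj_rem_ortho n psi x (Hon n) Hx2)) as B. fold (nu n) in B. upto B.
  pose (z := fun k => sm (fun i => ip x (psi i) * psi i k) n). assert (Hze : edom z).
  { apply (edom_sm (fun i k => ip x (psi i) * psi i k)). intros; apply edom_scal, rapid_edom; auto. }
  assert (Eqz : forall y, edom y -> qf F z y = sm (fun i => nu i * (ip x (psi i) * ip y (psi i))) n).
  { intros y Hy. unfold z. rewrite (qf_sm_l F C HF (fun i k => ip x (psi i) * psi i k)); auto.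
   - apply sm_ext. intros i Hi. rewrite qf_scal_l, (qf_sym F C); auto using edom_l2, rapid_l2.
    rewrite (qf_eig F C HF (psi i) y (nu i)); auto using edom_l2. ring.
   - intros; apply edom_scal, rapid_edom; auto. } assert (Eip : forall j, (j < n)%nat -> ip z (psi j) = ip x (psi j)).
  { intros j Hj. unfold z. rewrite (ip_sm_l (fun i k => ip x (psi i) * psi i k)); auto using rapid_l2.
   - rewrite (sm_single _ _ j); auto.
    + rewrite ip_scal_l, Ho, dl_same. ring.
    + intros i Hi Hij. rewrite ip_scal_l, Ho, dl_diff by auto. ring.
   - intros; apply l2_scal, rapid_l2; auto. } replace (proj_rem n psi x) with (fun k => x k + (-1) * z k)
   by (fext; intros; unfold proj_rem, z; ring). rewrite qf_sq_lin by auto. rewrite (qf_sym F C HF Fsym x z) by auto using edom_l2.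
  rewrite !Eqz by auto. rewrite (sm_ext (fun i => nu i * (ip x (psi i) * ip z (psi i))) (fun i => nu i * (ip x (psi i) * ip x (psi i))))
   by (intros; rewrite Eip; auto). use (bessel n psi x (Hon n) Hxe) as Bs.
  assert (- K * sm (fun i => ip x (psi i) * ip x (psi i)) n <= sm (fun i => nu i * (ip x (psi i) * ip x (psi i))) n).
  { rewrite <- sm_scal. apply sm_le. intros i _. specialize (Hnu i). mul_r; [nra|lra]. } use (Rmult_le_compat_l K _ _ HK0 Bs). lra. }
 set (B := qf F x x + K * ip x x) in *.
 assert (Hd0 : forall n, 0 <= ip x x - S0 n) by (intros n; use (bessel n psi x (Hon n) Hxe); unfold S0; lra).
 apply is_lim_seq_spec. intros eps. use (cond_pos eps). assert (HwI : is_lim_seq (fun n => / w n) 0) by apply w_lim.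
 pose (T := 12 * (Rabs B / eps + K + 1)).
 assert (HT : 0 < T). { unfold T. assert (0 <= Rabs B / eps) by (apply Rle_mult_inv_pos; [apply Rabs_pos|lra]). lra. }
 destruct (proj2 (is_lim_seq_spec _ _) HwI (mkposreal (/ T) (Rinv_0_lt_compat _ HT))) as [N HN].
 exists N. intros n Hn. specialize (HN n Hn). simpl in HN. rewrite Rminus_0_r, Rabs_pos_eq in HN by (left; apply Rinv_0_lt_compat, w_pos).
 assert (HwT : T < w n). { use (w_pos n). apply Rinv_lt_cancel in HN; auto. }
 specialize (Hlow n). specialize (Hb n). specialize (Hd0 n). use (w_ge1 n). assert (Hnb : Rabs B / eps + 1 <= nu n).
 { fold K in Hlow. unfold T in HwT. assert (w n <= w n ^ 2) by nra. lra. } fold (S0 n). rewrite Rabs_minus_sym, Rabs_pos_eq by auto.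
 assert (Hq : 0 <= Rabs B / eps) by (apply Rle_mult_inv_pos; [apply Rabs_pos|lra]). apply Rnot_le_lt. intros Hge. use (Rle_abs B).
 assert (Hk : (Rabs B / eps + 1) * eps <= nu n * (ip x x - S0 n)). { mul_lr; lra. }
 replace ((Rabs B / eps + 1) * eps) with (Rabs B + eps) in Hk by (field; lra). lra.
Qed.

End Construction.

(** * Asymptotics of the eigenvalues *)

Lemma le_div_intro a b c : 0 < c -> a * c <= b -> a <= b / c.
Proof. intros Hc H. apply (proj1 (Rle_div_r a b c Hc)), H. Qed.

Lemma le_div_elim a b c : 0 < c -> a <= b / c -> a * c <= b.
Proof. intros Hc H. apply (proj2 (Rle_div_r a b c Hc)), H. Qed.

(** The matrix represents the square of [b Lambda], so its eigenvalues are recorded as squares of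
    positive numbers. *)
Record lsys (F : nat -> nat -> R) (psi : nat -> nat -> R) (lam : nat -> R) : Prop := {
 ls_sys : eigsys F psi (fun j => lam j ^ 2);
 ls_pos : forall j, 0 < lam j }.

(** [Kd] is what [w^2 / 12 - 4 C 4 <= lam^2] yields for the ratio of [w^2] to [1 + lam^2]. [Kf] and
    [Cpsi] likewise depend only on the decay constants of the matrices and on no particular
    eigensystem. *)
Definition Kd (C : nat -> R) : R := 12 + 48 * C 4%nat.
Fixpoint Kf (C : nat -> R) (t : nat) : R := match t with O => 1 | S t => Kf C t * (2 + 2 * C (2 * t + 2)%nat) end.
Definition Cpsi (C C' : nat -> R) (r : nat) : R := 2 * (C' (r + 4 * r + 2)%nat * (Kf C (2 * r) * Kd C ^ r)).

Lemma ls_rapid F psi lam j : lsys F psi lam -> rapid (psi j).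
Proof. intros H. apply (es_rapid _ _ _ (ls_sys _ _ _ H)). Qed.

Lemma ls_l2 F psi lam j : lsys F psi lam -> l2 (psi j).
Proof. intros H. apply rapid_l2. eapply ls_rapid; eauto. Qed.

Lemma ls_on F psi lam i j : lsys F psi lam -> ip (psi i) (psi j) = dl i j.
Proof. intros H. apply (es_on _ _ _ (ls_sys _ _ _ H)). Qed.

Lemma ls_eig F psi lam j k : lsys F psi lam -> mu k ^ 2 * psi j k + mv F (psi j) k = lam j ^ 2 * psi j k.
Proof. intros H. apply (es_eig _ _ _ (ls_sys _ _ _ H)). Qed.

Lemma ls_mono F psi lam j : lsys F psi lam -> lam j <= lam (S j).
Proof.
 intros H. use (es_mono _ _ _ (ls_sys _ _ _ H) j) as B. simpl in B. use (ls_pos _ _ _ H j). use (ls_pos _ _ _ H (S j)). nra.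
Qed.

Lemma ls_mono_le F psi lam i j : lsys F psi lam -> (i <= j)%nat -> lam i <= lam j.
Proof. intros H Hij. induction Hij; [lra|]. use (ls_mono _ _ _ m H). lra. Qed.

Lemma ls_coord F psi lam j k : lsys F psi lam -> Rabs (psi j k) <= 1.
Proof.
 intros H. use (ip_coord (psi j) k (ls_l2 _ _ _ j H)) as B. rewrite (ls_on _ _ _ j j H), dl_same in B. apply Rabs_le. nra.
Qed.

Lemma ls_growth F psi lam C n : bdd F C -> lsys F psi lam -> w n ^ 2 <= Kd C * (1 + lam n ^ 2).
Proof.
 intros HF H. use (nu_lower F C HF n psi (fun j => lam j ^ 2)) as B. assert (B' : w n ^ 2 / 12 - 4 * C 4%nat <= lam n ^ 2). { apply B.
  - split; intros; [eapply ls_rapid; eauto|eapply ls_on; eauto].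
  - intros i _ k. eapply ls_eig; eauto.
  - intros i _. apply (es_mono _ _ _ (ls_sys _ _ _ H)). } use (bdd_nonneg F C 4 HF). unfold Kd. use (pow2_ge_0 (lam n)). nra.
Qed.

Lemma Kf_pos C F t : bdd F C -> 1 <= Kf C t.
Proof.
 intros HF. induction t as [|t IH]; cbn [Kf]; [lra|]. use (bdd_nonneg F C (2 * t + 2) HF). nra.
Qed.

(** The eigenvalue equation reads [(1 + lam^2) psi = (1 + mu^2) psi + F psi]: each power of
    [1 + lam^2] is traded for two powers of [w k]. The resulting growth in [k] is harmless once a
    rapidly decreasing matrix is applied. *)
Lemma psi_weak_decay F psi lam C t j k : bdd F C -> lsys F psi lam -> (1 + lam j ^ 2) ^ t * Rabs (psi j k) <= Kf C t * w k ^ (2 * t).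
Proof.
 intros HF H. revert k. induction t as [|t IH]; intros k.
 - simpl. rewrite !Rmult_1_l, ?Rmult_1_r. eapply ls_coord; eauto.
 - use (pow2_ge_0 (lam j)) as Hl. set (L := 1 + lam j ^ 2) in *. assert (HL : 0 <= L ^ t) by (apply pow_le; unfold L; lra).
  assert (E : L ^ S t * psi j k = (1 + mu k ^ 2) * (L ^ t * psi j k) + mv F (fun l => L ^ t * psi j l) k).
  { rewrite mv_scal. simpl pow at 1. use (ls_eig _ _ _ j k H) as Ee. unfold L at 1.
   replace ((1 + lam j ^ 2) * L ^ t * psi j k) with (L ^ t * (psi j k + lam j ^ 2 * psi j k)) by ring. rewrite <- Ee. ring. }
  replace (L ^ S t * Rabs (psi j k)) with (Rabs (L ^ S t * psi j k)).
  2:{ rewrite Rabs_mult, Rabs_pos_eq; auto. apply pow_le; unfold L; lra. } rewrite E. upto Rabs_triang.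
  assert (IH' : forall l, Rabs (L ^ t * psi j l) <= Kf C t * w l ^ (2 * t)).
  { intros l. rewrite Rabs_mult, Rabs_pos_eq by auto. apply IH. } use (mv_bound F C _ (Kf C t) 0 (2 * t) k HF IH') as B.
  replace (0 + 2 * t + 2)%nat with (2 * t + 2)%nat in B by lia. rewrite pow_O in B.
  rewrite Rabs_mult. rewrite (Rabs_pos_eq (1 + mu k ^ 2)) by (use (pow2_ge_0 (mu k)); lra).
  specialize (IH' k). cbn [Kf]. replace (2 * S t)%nat with (2 * t + 2)%nat by lia. rewrite pow_add.
  use (mu_le_w k). use (mu_ge1 k). use (w_ge1 k). assert (Hm : 1 + mu k ^ 2 <= 2 * w k ^ 2) by nra.
  use (wp_ge1 k (2 * t)). use (wp_ge1 k 2). use (Kf_pos C F t HF). use (bdd_nonneg F C (2 * t + 2) HF).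
  assert (B1 : (1 + mu k ^ 2) * Rabs (L ^ t * psi j k) <= (2 * w k ^ 2) * (Kf C t * w k ^ (2 * t))).
  { mul_lr; auto using Rabs_pos. use (pow2_ge_0 (mu k)); lra. }
  assert (B2 : 2 * (C (2 * t + 2)%nat * Kf C t) / 1 <= (Kf C t * (2 * C (2 * t + 2)%nat)) * (w k ^ (2 * t) * w k ^ 2)).
  { unfold Rdiv. rewrite Rinv_1, Rmult_1_r. assert (1 <= w k ^ (2 * t) * w k ^ 2) by nra.
   assert (0 <= Kf C t * (2 * C (2 * t + 2)%nat)) by nra. nra. } lra.
Qed.

Lemma pow_le_weak x n m : 1 <= x -> (n <= m)%nat -> x ^ n <= x ^ m.
Proof. intros. apply Rle_pow; auto. Qed.

(** [M] is applied to [psi j] multiplied by [2 r] powers of [1 + lam j ^ 2]; it absorbs the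
    polynomial growth in [k]. Half of these powers are then converted into [w j ^ r] by [ls_growth],
    the other half is kept. *)
Lemma mv_psi_decay F psi lam C M C' r j k : bdd F C -> lsys F psi lam -> bdd M C' ->
 (1 + lam j ^ 2) ^ r * Rabs (mv M (psi j) k) <= Cpsi C C' r / (w j ^ r * w k ^ r).
Proof.
 intros HF H HM. use (pow2_ge_0 (lam j)) as Hl. use (ls_growth F psi lam C j HF H) as Hg. set (L := 1 + lam j ^ 2) in *.
 assert (HL : 1 <= L) by (unfold L; lra). assert (HL2 : 0 <= L ^ (2 * r)) by (apply pow_le; lra).
 assert (HK : 0 < Kd C) by (unfold Kd; use (bdd_nonneg F C 4 HF); lra).
 assert (Hb : forall l, Rabs (L ^ (2 * r) * psi j l) <= Kf C (2 * r) * w l ^ (4 * r)).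
 { intros l. rewrite Rabs_mult, Rabs_pos_eq by auto. replace (4 * r)%nat with (2 * (2 * r))%nat by lia.
  apply (psi_weak_decay F psi lam C); auto. } use (mv_bound M C' _ (Kf C (2 * r)) r (4 * r) k HM Hb) as B.
 rewrite mv_scal, Rabs_mult, Rabs_pos_eq in B by auto. unfold Cpsi. assert (Hw : w j ^ r <= Kd C ^ r * L ^ r). { via ((w j ^ 2) ^ r).
  - rewrite <- pow_mult. apply pow_le_weak; [apply w_ge1|lia].
  - rewrite <- Rpow_mult_distr. apply pow_incr. split; [apply pow_le; left; apply w_pos|exact Hg]. } use (wp_pos j r). use (wp_pos k r).
 assert (HLr : 0 < L ^ r) by (apply pow_lt; lra). assert (HKr : 0 < Kd C ^ r) by (apply pow_lt; lra).
 apply le_div_intro; [apply Rmult_lt_0_compat; auto|]. apply le_div_elim in B; auto.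
 replace (2 * r)%nat with (r + r)%nat in B at 1 by lia. rewrite pow_add in B.
 set (P := Rabs (mv M (psi j) k)) in *. assert (0 <= P) by apply Rabs_pos. set (Q := C' (r + 4 * r + 2)%nat * Kf C (2 * r)) in *.
 replace (L ^ r * P * (w j ^ r * w k ^ r)) with ((L ^ r * P * w k ^ r) * w j ^ r) by ring.
 replace (2 * (C' (r + 4 * r + 2)%nat * (Kf C (2 * r) * Kd C ^ r))) with ((2 * Q) * Kd C ^ r) by (unfold Q; ring).
 via ((L ^ r * P * w k ^ r) * (Kd C ^ r * L ^ r)).
 - mul_l; auto. apply Rmult_le_pos; [apply Rmult_le_pos|]; lra.
 - replace (L ^ r * P * w k ^ r * (Kd C ^ r * L ^ r)) with ((L ^ r * L ^ r * P * w k ^ r) * Kd C ^ r) by ring. mul_r; lra.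
Qed.

Lemma mv_psi_bdd F psi lam C M C' : bdd F C -> lsys F psi lam -> bdd M C' -> bdd (fun j k => mv M (psi j) k) (Cpsi C C').
Proof.
 intros HF H HM r j k. eapply Rle_trans; [|apply (mv_psi_decay F psi lam C M C'); eauto].
 assert (1 <= (1 + lam j ^ 2) ^ r) by (apply pow_R1_Rle; use (pow2_ge_0 (lam j)); lra). use (Rabs_pos (mv M (psi j) k)). nra.
Qed.

Lemma ip_unit_bound P C j x r : bdd P C -> (forall k, Rabs (x k) <= 1) -> Rabs (ip (P j) x) <= 2 * C (r + 2)%nat / w j ^ r.
Proof.
 intros HP Hx. replace (2 * C (r + 2)%nat / w j ^ r) with (2 * (C (r + 2)%nat / w j ^ r)) by (unfold Rdiv; ring).
 apply series_bound. intros k. rewrite Rabs_mult. use (bdd_nonneg P C (r + 2) HP).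
 eapply Rle_trans; [mul_lr; [apply Rabs_pos|apply Rabs_pos|apply (HP (r + 2)%nat)|apply Hx]|]. rewrite Rmult_1_r, !pow_add.
 use (wp_pos k r); use (wp_pos j r); use (wp_pos j 2); use (wp_pos k 2). apply le_div_intro; auto. apply le_div_intro; auto.
 replace (C (r + 2)%nat / (w j ^ r * w j ^ 2 * (w k ^ r * w k ^ 2)) * w k ^ 2 * w j ^ r) with (C (r + 2)%nat * / (w j ^ 2 * w k ^ r)).
 - rewrite <- (Rmult_1_r (C (r + 2)%nat)) at 2. mul_l; auto. rewrite <- Rinv_1. apply Rinv_le_contravar; [lra|].
  use (wp_ge1 j 2); use (wp_ge1 k r). nra.
 - generalize dependent (w k ^ r); generalize dependent (w j ^ r); generalize dependent (w j ^ 2);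
   generalize dependent (w k ^ 2); intros; field; lra.
Qed.

(** Polarization of the completeness relation, applied to [x], [y] and [x + y]. *)
Lemma parseval F psi lam x y : lsys F psi lam -> rapid x -> rapid y -> is_series (fun j => ip x (psi j) * ip y (psi j)) (ip x y).
Proof.
 intros H Hx Hy. use (ls_sys _ _ _ H) as E. use (rapid_l2 x Hx) as Lx. use (rapid_l2 y Hy) as Ly.
 assert (Hp : rapid (fun k => x k + 1 * y k)). { intros r. destruct (Hx r) as [A HA]. destruct (Hy r) as [B HB]. exists (A + B). intros k.
  rewrite Rmult_1_l. upto Rabs_triang. specialize (HA k). specialize (HB k). unfold Rdiv in *. lra. }
 use (es_complete _ _ _ E _ Hx) as Sx. use (es_complete _ _ _ E _ Hy) as Sy. use (es_complete _ _ _ E _ Hp) as Sp. simpl in Sx, Sy, Sp.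
 rewrite (ip_sq_lin x y 1 Lx Ly) in Sp. apply is_series_sm. apply is_series_sm in Sx, Sy, Sp.
 apply is_lim_seq_ext with (fun n => / 2 * (sm (fun j => ip (fun k => x k + 1 * y k) (psi j) * ip (fun k => x k + 1 * y k) (psi j)) n
   - sm (fun j => ip x (psi j) * ip x (psi j)) n - sm (fun j => ip y (psi j) * ip y (psi j)) n)).
 - intros n. rewrite <- !sm_minus, <- sm_scal. apply sm_ext. intros j _.
  rewrite ip_plus_l; auto using l2_scal; [|eapply ls_l2; eauto]. rewrite ip_scal_l. field.
 - replace (Finite (ip x y)) with (Rbar_mult (/ 2) (ip x x + 2 * 1 * ip x y + 1 * 1 * ip y y - ip x x - ip y y))
   by (simpl; f_equal; field). apply (is_lim_seq_scal_l _ (/ 2) (ip x x + 2 * 1 * ip x y + 1 * 1 * ip y y - ip x x - ip y y)).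
  apply is_lim_seq_minus'; auto. apply is_lim_seq_minus'; auto.
Qed.

Lemma ls_gap_eq F psi lam j k : lsys F psi lam -> (lam j ^ 2 - mu k ^ 2) * psi j k = mv F (psi j) k.
Proof. intros H. use (ls_eig _ _ _ j k H). lra. Qed.

Lemma ls_row F psi lam k : lsys F psi lam -> is_series (fun j => psi j k * psi j k) 1.
Proof.
 intros H. use (parseval F psi lam (dl k) (dl k) H (rapid_dl k) (rapid_dl k)) as S.
 rewrite ip_dl_r, dl_same in S. eapply is_series_ext_R; [|exact S]. intros j. simpl. rewrite (ip_sym (dl k)), ip_dl_r. reflexivity.
Qed.

Lemma ls_col F psi lam j : lsys F psi lam -> is_series (fun k => psi j k * psi j k) 1.
Proof.
 intros H. rewrite <- (dl_same j), <- (ls_on F psi lam j j H). apply ip_is_series; eapply ls_l2; eauto.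
Qed.

Lemma tail_bound_w2 a l n B : is_series a l -> (forall k, (n <= k)%nat -> Rabs (a k) <= B / w k ^ 2) -> Rabs (l - sm a n) <= 2 * B / w n.
Proof.
 intros Hs Hb. pose (a' := fun k => if le_lt_dec n k then a k else 0). assert (HB : 0 <= B).
 { specialize (Hb n (Nat.le_refl n)). apply le_div_w in Hb. use (Rabs_pos (a n)). use (wp_pos n 2). nra. }
 assert (Ha' : forall k, Rabs (a' k) <= B / w k ^ 2). { intros k. unfold a'. destruct (le_lt_dec n k); auto. rewrite Rabs_R0.
  apply Rle_mult_inv_pos; auto. apply wp_pos. } assert (E : forall N, (n <= N)%nat -> sm a N - sm a n = sm a' N - sm a' n).
 { intros N HN. replace N with (n + (N - n))%nat by lia. rewrite !sm_add.
  replace (sm (fun k => a' (n + k)%nat) (N - n)) with (sm (fun k => a (n + k)%nat) (N - n)); [ring|].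
  apply sm_ext. intros k _. unfold a'. destruct (le_lt_dec n (n + k)); [reflexivity|lia]. } use (series_tail a' B n Ha') as T.
 replace (l - sm a n) with (Series a' - sm a' n); auto. use (is_series_w2 a' B Ha') as Hs'. apply is_series_sm in Hs, Hs'.
 assert (H1 : is_lim_seq (fun N => sm a N - sm a n) (l - sm a n)) by (apply is_lim_seq_minus'; auto using is_lim_seq_const).
 assert (H2 : is_lim_seq (fun N => sm a N - sm a n) (Series a' - sm a' n)). { apply is_lim_seq_ext_loc with (fun N => sm a' N - sm a' n).
  - exists n. intros N HN. symmetry. auto.
  - apply is_lim_seq_minus'; auto using is_lim_seq_const. } apply is_lim_seq_unique in H1, H2. rewrite H1 in H2. injection H2; auto.
Qed.

Lemma sm_inv_w2 n : sm (fun k => / w k ^ 2) n <= 2.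
Proof.
 use (sm_tail_w2 (fun k => / w k ^ 2) 1 0 n ltac:(lia)) as B. simpl sm in B. rewrite Rminus_0_r in B. upto Rle_abs. upto B.
 - intros k. rewrite Rabs_pos_eq; [unfold Rdiv; lra|]. left. apply Rinv_0_lt_compat, wp_pos.
 - unfold w at 1. simpl. assert (0 <= 2 * 1 / w n) by (apply Rle_mult_inv_pos; [lra|apply w_pos]). lra.
Qed.

Lemma sm_w2_bound f A n : (forall k, (k < n)%nat -> Rabs (f k) <= A / w k ^ 2) -> 0 <= A -> Rabs (sm f n) <= 2 * A.
Proof.
 intros H HA. upto sm_abs. eapply Rle_trans; [apply sm_le, H|]. unfold Rdiv. rewrite sm_scal. use (sm_inv_w2 n). nra.
Qed.

Lemma eventually_lt_w (A eps : R) : 0 < eps -> exists N, forall n, (N <= n)%nat -> A / w n < eps.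
Proof.
 intros He. destruct (proj2 (is_lim_seq_spec _ _) (w_lim_scal A) (mkposreal _ He)) as [N HN].
 exists N. intros n Hn. specialize (HN n Hn). simpl in HN. rewrite Rminus_0_r in HN. eapply Rle_lt_trans; [apply Rle_abs|exact HN].
Qed.

Lemma ls_cut F psi lam C A : bdd F C -> lsys F psi lam -> exists m, forall j, (j < m)%nat <-> lam j < A.
Proof.
 intros HF H. assert (HN : exists N, A <= lam N). { use (bdd_nonneg F C 4 HF) as HC. set (K := Kd C).
  assert (HK : 0 < K) by (unfold K, Kd; lra). destruct (INR_unbounded (K * (1 + A ^ 2))) as [N HN]. exists N.
  apply Rnot_lt_le. intros Hlt. use (ls_growth F psi lam C N HF H) as G. fold K in G.
  use (ls_pos _ _ _ H N). assert (lam N ^ 2 <= A ^ 2) by nra.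
  use (w_ge1 N). assert (INR N <= w N) by (unfold w; rewrite S_INR; lra). nra. } destruct HN as [N HN].
 assert (Hm : forall N, exists m, (m <= N)%nat /\ (forall j, (j < m)%nat -> lam j < A) /\ ((m < N)%nat -> A <= lam m)).
 { induction N0 as [|N0 [m [Hm [H1 H2]]]].
  - exists O. repeat split; intros; lia.
  - destruct (Nat.eq_dec m N0) as [->|Hne].
   + destruct (Rlt_dec (lam N0) A) as [Hl|Hl].
    * exists (S N0). split; [lia|]. split; [|lia]. intros j Hj. destruct (Nat.eq_dec j N0) as [->|]; auto. apply H1; lia.
    * exists N0. split; [lia|]. split; auto. intros _. lra.
   + exists m. split; [lia|]. split; auto. intros _. apply H2; lia. }
 destruct (Hm (S N)) as [m [Hm1 [H1 H2]]]. exists m. intros j. split; auto. intros Hj. apply Nat.nle_gt. intros Hmj.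
 assert (Hm' : A <= lam m). { destruct (Nat.eq_dec m (S N)) as [->|]; [|apply H2; lia]. use (H1 N ltac:(lia)). lra. }
 use (ls_mono_le _ _ _ m j H Hmj). lra.
Qed.

Lemma sq_le_of_gap x P g c : g * x = P -> c <= Rabs g -> 0 < c -> x * x <= P * P / (c * c).
Proof.
 intros E Hg Hc. apply le_div_intro; [nra|]. rewrite <- E. assert (c * c <= g * g).
 { use (Rsqr_abs g) as Q. unfold Rsqr in Q. rewrite Q. nra. } assert (0 <= x * x) by nra. nra.
Qed.

Lemma bdd_sq P C r j k : bdd P C -> (2 <= r)%nat -> P j k * P j k <= C r * C r / (w j ^ 2 * w k ^ 2 * (w j * w k)).
Proof.
 intros HP Hr. use (bdd_nonneg P C r HP). use (HP r j k) as B. use (w_ge1 j). use (w_ge1 k).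
 assert (Hw : forall i, w i ^ 2 <= w i ^ r) by (intros; apply pow_le_weak; auto; apply w_ge1).
 assert (E : P j k * P j k = Rabs (P j k) * Rabs (P j k)). { use (Rsqr_abs (P j k)) as Q. exact Q. } rewrite E.
 assert (B2 : Rabs (P j k) <= C r / (w j ^ 2 * w k ^ 2)). { upto B. mul_l; auto. apply Rinv_le_contravar.
  - use (wp_pos j 2); use (wp_pos k 2); nra.
  - mul_lr; auto; apply pow_le; left; apply w_pos. } eapply Rle_trans; [mul_lr; [apply Rabs_pos|apply Rabs_pos|exact B2|exact B2]|].
 replace (C r / (w j ^ 2 * w k ^ 2) * (C r / (w j ^ 2 * w k ^ 2)))
  with (C r * C r / (w j ^ 2 * w k ^ 2 * (w j * w k)) * / (w j * w k)) by (field; lra).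
 rewrite <- (Rmult_1_r (C r * C r / _)) at 2. mul_l.
 - apply Rle_mult_inv_pos; [nra|]. apply Rmult_lt_0_compat; [|nra]. use (wp_pos j 2); use (wp_pos k 2); nra.
 - rewrite <- Rinv_1. apply Rinv_le_contravar; nra.
Qed.

(* Counting: both [j < m] rows and [k < 2n] columns of the doubly stochastic matrix
  [psi j k ^ 2] carry all but a small mass inside the common block. *)
Lemma ls_count F psi lam C : bdd F C -> lsys F psi lam ->
 exists n0, forall n, (n0 <= n)%nat -> forall j, (j < 2 * n)%nat <-> lam j < INR n + / 2.
Proof.
 intros HF H. use (mv_psi_bdd F psi lam C F C HF H HF) as HP. set (C1 := Cpsi C C) in *. set (P := fun j k => mv F (psi j) k) in *.
 pose (D := C1 2%nat * C1 2%nat). pose (E := C1 2%nat). assert (HE : 0 <= E) by (apply (bdd_nonneg P C1 2 HP)).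
 destruct (eventually_lt_w (16 * D) 1 ltac:(lra)) as [n1 Hn1]. destruct (eventually_lt_w (1 + 64 * (E * E)) 1 ltac:(lra)) as [n2 Hn2].
 exists (S (S (n1 + n2))). intros n Hn. destruct (ls_cut F psi lam C (INR n + / 2) HF H) as [m Hm].
 assert (HD : 0 <= D) by (unfold D; nra). assert (Hnn : 2 <= INR n) by (replace 2 with (INR 2) by (simpl; ring); apply le_INR; lia).
 (* For rows below the cut, [mu k >= n + 1] against [lam j < n + 1/2] leaves a gap of at least 1/2
    between the squares, so that [psi j k] is at most twice [P j k] in absolute value; the tail
    starting at [2 n] makes the sum small. *)
 assert (T1 : forall j, (j < m)%nat -> Rabs (1 - sm (fun k => psi j k * psi j k) (2 * n)) <= (8 * D / w (2 * n)) / w j ^ 2).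
 { intros j Hj. use (proj1 (Hm j) Hj) as Hlj. use (ls_pos _ _ _ H j). use (w_pos (2 * n)). use (wp_pos j 2).
  replace (8 * D / w (2 * n) / w j ^ 2) with (2 * (4 * D / w j ^ 2) / w (2 * n)) by (field; use (w_pos j); lra).
  apply tail_bound_w2; [eapply ls_col; eauto|]. intros k Hk. rewrite Rabs_pos_eq by nra. assert (Hmk : INR n + 1 <= mu k).
  { use (mu_mono _ _ Hk) as B. rewrite mu_even, S_INR in B. lra. }
  eapply Rle_trans; [apply (sq_le_of_gap _ _ _ (/ 2) (ls_gap_eq F psi lam j k H)); [|lra]|].
  - rewrite Rabs_minus_sym. below Rle_abs. nra.
  - use (bdd_sq P C1 2 j k HP ltac:(lia)) as B. fold (P j k). fold D in B.
   replace (P j k * P j k / (/ 2 * / 2)) with (4 * (P j k * P j k)) by field. use (w_ge1 j). use (w_ge1 k). use (wp_pos k 2).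
   eapply Rle_trans; [mul_l; [lra|exact B]|].
   replace (4 * (D / (w j ^ 2 * w k ^ 2 * (w j * w k)))) with (4 * D / w j ^ 2 / w k ^ 2 * / (w j * w k)) by (field; lra).
   rewrite <- (Rmult_1_r (4 * D / w j ^ 2 / w k ^ 2)) at 2. mul_l.
   + apply Rle_mult_inv_pos; auto. apply Rle_mult_inv_pos; auto. lra.
   + rewrite <- Rinv_1. apply Rinv_le_contravar; nra. }
 (* Here the tail starts at the still unknown count [m], which gives no smallness. The factor
    [1 / n] comes instead from the power of [1 + lam j ^ 2] kept in [mv_psi_decay], as [lam j >= n]
    beyond the cut. *)
 assert (T2 : forall k, (k < 2 * n)%nat -> Rabs (1 - sm (fun j => psi j k * psi j k) m) <= (32 * (E * E) / (INR n)) / w k ^ 2).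
 { intros k Hk. assert (Hmk : mu k <= INR n). { use (mu_mono k (2 * (n - 1) + 1) ltac:(lia)) as B. rewrite mu_odd in B.
   replace (S (n - 1)) with n in B by lia. exact B. } use (wp_pos k 2). use (w_pos k). via (2 * (16 * (E * E) / INR n / w k ^ 2) / w m).
  2:{ use (w_ge1 m). replace (2 * (16 * (E * E) / INR n / w k ^ 2) / w m) with (32 * (E * E) / INR n / w k ^ 2 * / w m) by (field; lra).
    rewrite <- (Rmult_1_r (32 * (E * E) / INR n / w k ^ 2)) at 2. mul_l.
    - apply Rle_mult_inv_pos; auto. apply Rle_mult_inv_pos; [nra|lra].
    - rewrite <- Rinv_1. apply Rinv_le_contravar; lra. } apply tail_bound_w2; [eapply ls_row; eauto|].
  intros j Hj. rewrite Rabs_pos_eq by nra. assert (Hlj : INR n + / 2 <= lam j). { apply Rnot_lt_le. intros Hl. apply Hm in Hl. lia. }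
  use (mu_ge1 k). eapply Rle_trans; [apply (sq_le_of_gap _ _ _ (/ 4) (ls_gap_eq F psi lam j k H)); [|lra]|].
  - below Rle_abs. nra.
  - use (mv_psi_decay F psi lam C F C 2 j k HF H HF) as B. fold C1 E in B.
   fold (P j k) in B |- *. use (wp_pos j 2). use (wp_ge1 j 2). use (wp_ge1 k 2). apply le_div_elim in B; [|nra].
   assert (Hsq : P j k * P j k = Rabs (P j k) * Rabs (P j k)) by apply (Rsqr_abs (P j k)).
   apply le_div_intro; [lra|]. apply le_div_intro; [lra|]. apply le_div_intro; [lra|].
   set (p := Rabs (P j k)) in *. assert (0 <= p) by apply Rabs_pos. assert (Hll : INR n <= (1 + lam j ^ 2) ^ 2) by nra.
   assert (B1 : INR n * p * (w j ^ 2 * w k ^ 2) <= E). { below B. mul_r; [nra|]. mul_r; auto. }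
   assert (B2 : p * (w j ^ 2 * w k ^ 2) <= E). { below B1. mul_r; [nra|]. nra. }
   assert (B3 : p <= E). { below B2. rewrite <- (Rmult_1_r p) at 1. mul_l; auto. nra. }
   rewrite Hsq. replace (p * p / (/ 4 * / 4) * w j ^ 2 * w k ^ 2 * INR n) with (16 * (p * (INR n * p * (w j ^ 2 * w k ^ 2)))) by field.
   assert (0 <= INR n * p * (w j ^ 2 * w k ^ 2)) by (apply Rmult_le_pos; nra). mul_l; [lra|]. mul_lr; auto. }
 (* Each of [m] and [2 n] exceeds the mass of the common block by an amount in [[0, 1)]; being
    integers, they coincide. *)
 assert (Em : m = (2 * n)%nat).
 { assert (S1 : Rabs (sm (fun j => 1 - sm (fun k => psi j k * psi j k) (2 * n)) m) <= 2 * (8 * D / w (2 * n))).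
  { apply sm_w2_bound; auto. apply Rle_mult_inv_pos; [lra|apply w_pos]. }
  assert (S2 : Rabs (sm (fun k => 1 - sm (fun j => psi j k * psi j k) m) (2 * n)) <= 2 * (32 * (E * E) / INR n)).
  { apply sm_w2_bound; auto. apply Rle_mult_inv_pos; [nra|lra]. }
  rewrite sm_minus, sm_const in S1, S2. rewrite sm_swap in S1. rewrite Rmult_1_r in S1, S2. assert (P1 : 2 * (8 * D / w (2 * n)) < 1).
  { specialize (Hn1 (2 * n)%nat ltac:(lia)). unfold Rdiv in *. lra. } assert (P2 : 2 * (32 * (E * E) / INR n) < 1).
  { specialize (Hn2 (n - 1)%nat ltac:(lia)). unfold w in Hn2. replace (S (n - 1)) with n in Hn2 by lia.
   assert (0 < / INR n) by (apply Rinv_0_lt_compat; lra). unfold Rdiv in *. lra. }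
  (* pointwise the two defects are nonnegative, so the difference is small *)
  assert (N1 : 0 <= INR m - sm (fun k => sm (fun j => psi j k * psi j k) m) (2 * n)).
  { rewrite <- (sm_swap (fun j k => psi j k * psi j k)). rewrite <- (Rmult_1_r (INR m)), <- sm_const, <- sm_minus.
   apply sm_pos. intros j _. use (sm_le_series (fun k => psi j k * psi j k) 1 (2 * n) ltac:(intros; nra) (ls_col _ _ _ j H)). lra. }
  assert (N2 : 0 <= INR (2 * n) - sm (fun k => sm (fun j => psi j k * psi j k) m) (2 * n)).
  { rewrite <- (Rmult_1_r (INR (2 * n))), <- sm_const, <- sm_minus. apply sm_pos. intros k _.
   use (sm_le_series (fun j => psi j k * psi j k) 1 m ltac:(intros; nra) (ls_row _ _ _ k H)). lra. }
  rewrite Rabs_pos_eq in S1, S2 by auto. destruct (lt_eq_lt_dec m (2 * n)) as [[Hlt|]|Hlt]; auto; exfalso.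
  - apply (le_INR (S m)) in Hlt. rewrite S_INR in Hlt. lra.
  - apply (le_INR (S (2 * n))) in Hlt. rewrite S_INR in Hlt. lra. } rewrite <- Em. exact Hm.
Qed.

Lemma nearest_int (x : R) (p q : nat) : Rabs (x - INR p) <= / 2 -> Rabs (x - INR p) <= Rabs (x - INR q).
Proof.
 intros H. destruct (Nat.eq_dec p q) as [->|Hne]; [lra|]. assert (1 <= Rabs (INR p - INR q)). { destruct (Nat.lt_ge_cases p q) as [Hl|Hl].
  - apply (le_INR (S p)) in Hl. rewrite S_INR in Hl. rewrite Rabs_minus_sym. below Rle_abs. lra.
  - assert (Hl' : (S q <= p)%nat) by lia. apply le_INR in Hl'. rewrite S_INR in Hl'. below Rle_abs. lra. }
 use (Rabs_triang (x - INR q) (INR p - x)) as T. replace (x - INR q + (INR p - x)) with (INR p - INR q) in T by ring.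
 rewrite (Rabs_minus_sym (INR p) x) in T. lra.
Qed.

(** By the count, [lam j] lies within 1/2 of the integer [mu j] for large [j], so [|lam j - mu j|]
    is at most [|lam j ^ 2 - mu k ^ 2|] for every [k]. Weighting with [psi j k ^ 2] and summing over
    [k] bounds it by the norm of [F psi j], which decreases rapidly in [j]. *)
Theorem lam_asymptotics F psi lam C : bdd F C -> lsys F psi lam -> rapid (fun j => lam j - mu j).
Proof.
 intros HF H. destruct (ls_count F psi lam C HF H) as [n0 Hn0]. use (mv_psi_bdd F psi lam C F C HF H HF) as HP.
 set (C1 := Cpsi C C) in *. set (P := fun j k => mv F (psi j) k) in *.
 assert (Hlarge : forall r j, (2 * n0 <= j)%nat -> Rabs (lam j - mu j) <= 2 * C1 (r + 1)%nat / w j ^ r).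
 { intros r j Hj. use (div2_bounds j) as Hd. set (i := Nat.div2 j) in *. assert (Hni : (n0 <= i)%nat) by lia.
  assert (L1 : INR i + / 2 <= lam j). { apply Rnot_lt_le. intros Hl. apply (Hn0 i Hni) in Hl. lia. }
  assert (L2 : lam j < INR (S i) + / 2) by (apply Hn0; lia). assert (Em : mu j = INR (S i)) by reflexivity.
  assert (Hnear : Rabs (lam j - mu j) <= / 2). { rewrite Em in *. rewrite S_INR in *. apply Rabs_le. lra. }
  assert (Hall : forall k, (lam j - mu j) * (lam j - mu j) * (psi j k * psi j k) <= P j k * P j k).
  { intros k. unfold P. rewrite <- (ls_gap_eq F psi lam j k H). assert (Hk : Rabs (lam j - mu j) <= Rabs (lam j - mu k)).
   { apply nearest_int. exact Hnear. } assert (Hk2 : (lam j - mu j) * (lam j - mu j) <= (lam j - mu k) * (lam j - mu k)).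
   { use (Rsqr_abs (lam j - mu j)) as Q1. use (Rsqr_abs (lam j - mu k)) as Q2.
    unfold Rsqr in Q1, Q2. rewrite Q1, Q2. use (Rabs_pos (lam j - mu j)). nra. } use (mu_ge1 k). use (ls_pos _ _ _ H j).
   assert (Hg : (lam j - mu k) * (lam j - mu k) <= (lam j ^ 2 - mu k ^ 2) * (lam j ^ 2 - mu k ^ 2)).
   { replace ((lam j ^ 2 - mu k ^ 2) * (lam j ^ 2 - mu k ^ 2)) with
     (((lam j - mu k) * (lam j - mu k)) * ((lam j + mu k) * (lam j + mu k))) by ring.
    assert (1 <= (lam j + mu k) * (lam j + mu k)) by nra. use (Rle_0_sqr (lam j - mu k)). unfold Rsqr in *. nra. }
   assert (0 <= psi j k * psi j k) by nra. replace ((lam j ^ 2 - mu k ^ 2) * psi j k * ((lam j ^ 2 - mu k ^ 2) * psi j k))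
    with ((lam j ^ 2 - mu k ^ 2) * (lam j ^ 2 - mu k ^ 2) * (psi j k * psi j k)) by ring. mul_r; lra. }
  assert (HPl : l2 (P j)). { apply rapid_l2. apply (mv_rapid F C); auto. eapply ls_l2; eauto. } use (bdd_nonneg P C1 (r + 1) HP) as HC1.
  assert (Hle : (lam j - mu j) * (lam j - mu j) <= ip (P j) (P j)).
  { rewrite <- (Rmult_1_r ((lam j - mu j) * (lam j - mu j))), <- (dl_same j), <- (ls_on F psi lam j j H).
   assert (Hs : is_series (fun k => (lam j - mu j) * (lam j - mu j) * (psi j k * psi j k))
          ((lam j - mu j) * (lam j - mu j) * ip (psi j) (psi j))).
   { apply (is_series_scal_l (K := R_AbsRing) (V := R_NormedModule) ((lam j - mu j) * (lam j - mu j))).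
    apply ip_is_series; eapply ls_l2; eauto. } eapply series_le_bound; [exact Hs|]. intros N.
   eapply Rle_trans; [apply sm_le; intros; apply Hall|]. apply sm_le_series; [intros; nra|]. apply ip_is_series; auto. }
  assert (Hub : ip (P j) (P j) <= 2 * (C1 (r + 1)%nat / w j ^ r * (C1 (r + 1)%nat / w j ^ r))).
  { upto Rle_abs. apply series_bound. intros k. rewrite Rabs_mult. assert (B : Rabs (P j k) <= C1 (r + 1)%nat / w j ^ r / w k).
   { upto (HP (r + 1)%nat). use (wp_ge1 j r). use (wp_ge1 k r). use (w_ge1 j). use (w_ge1 k).
    unfold Rdiv. rewrite Rmult_assoc. mul_l; auto. rewrite <- Rinv_mult. apply Rinv_le_contravar; [nra|]. rewrite !pow_add, !pow_1.
    mul_lr; nra. } replace (C1 (r + 1)%nat / w j ^ r * (C1 (r + 1)%nat / w j ^ r) / w k ^ 2) with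
    ((C1 (r + 1)%nat / w j ^ r / w k) * (C1 (r + 1)%nat / w j ^ r / w k))
    by (use (w_pos k); use (wp_pos j r); generalize dependent (w j ^ r); intros; field; lra). mul_lr; auto using Rabs_pos. }
  set (X := C1 (r + 1)%nat / w j ^ r) in *. assert (0 <= X) by (apply Rle_mult_inv_pos; auto; apply wp_pos).
  replace (2 * C1 (r + 1)%nat / w j ^ r) with (2 * X) by (unfold X, Rdiv; ring). apply Rsqr_incr_0_var; [|lra]. unfold Rsqr.
  use (Rsqr_abs (lam j - mu j)) as Q. unfold Rsqr in Q. rewrite <- Q. nra. } intros r.
 exists (2 * C1 (r + 1)%nat + sm (fun j => Rabs (lam j - mu j) * w j ^ r) (2 * n0)). intros j. apply le_div_w.
 assert (Hnn : forall k, 0 <= Rabs (lam k - mu k) * w k ^ r). { intros; apply Rmult_le_pos; [apply Rabs_pos|left; apply wp_pos]. }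
 use (bdd_nonneg P C1 (r + 1) HP) as HC1. destruct (le_lt_dec (2 * n0) j) as [Hj|Hj].
 - specialize (Hlarge r j Hj). apply le_div_w in Hlarge.
  use (sm_pos (fun j => Rabs (lam j - mu j) * w j ^ r) (2 * n0) ltac:(intros; apply Hnn)). lra.
 - use (sm_mono (fun j => Rabs (lam j - mu j) * w j ^ r) (S j) (2 * n0) Hnn ltac:(lia)) as B.
  simpl sm at 1 in B. use (sm_pos (fun j => Rabs (lam j - mu j) * w j ^ r) j ltac:(intros; apply Hnn)). lra.
Qed.

(** * Klein's inequality and monotonicity of the spectral sums *)

Lemma rapid_eventually x eps : rapid x -> 0 < eps -> exists N, forall j, (N <= j)%nat -> Rabs (x j) <= eps.
Proof.
 intros Hx He. destruct (Hx 1%nat) as [B HB]. destruct (eventually_lt_w B eps He) as [N HN].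
 exists N. intros j Hj. specialize (HB j). rewrite pow_1 in HB. specialize (HN j Hj). lra.
Qed.

Lemma lam_upper F psi lam C : bdd F C -> lsys F psi lam -> exists A, 1 <= A /\ forall j, lam j <= A * w j.
Proof.
 intros HF H. destruct (lam_asymptotics F psi lam C HF H 0%nat) as [B HB].
 exists (Rabs B + 1). split; [use (Rabs_pos B); lra|]. intros j. specialize (HB j). simpl in HB.
 use (mu_le_w j). use (w_ge1 j). use (Rle_abs (lam j - mu j)). use (Rle_abs B).
 use (Rabs_pos B). unfold Rdiv in HB. rewrite Rinv_1 in HB. nra.
Qed.

(** A cut at an even index separates frequency [n] from [n + 1], and both spectra are eventually
    within 1/4 of [mu]. *)
Lemma sys_gap F psi lam C F' psi' lam' C' : bdd F C -> lsys F psi lam -> bdd F' C' -> lsys F' psi' lam' ->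
 exists N, forall n, (N <= n)%nat -> forall j k, (j < 2 * n)%nat -> (2 * n <= k)%nat -> / 2 <= lam' k ^ 2 - lam j ^ 2.
Proof.
 intros HF H HF' H'. destruct (rapid_eventually _ (/ 4) (lam_asymptotics _ _ _ _ HF H) ltac:(lra)) as [N1 HN1].
 destruct (rapid_eventually _ (/ 4) (lam_asymptotics _ _ _ _ HF' H') ltac:(lra)) as [N2 HN2]. exists (S (N1 + N2)). intros n Hn j k Hj Hk.
 use (ls_mono_le _ _ _ j (2 * (n - 1) + 1) H ltac:(lia)) as Hjn.
 use (HN1 (2 * (n - 1) + 1)%nat ltac:(lia)) as B1. apply Rabs_le_between in B1. rewrite mu_odd in B1.
 use (HN2 k ltac:(lia)) as B2. apply Rabs_le_between in B2. use (mu_mono _ _ Hk) as Hm. rewrite mu_even in Hm.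
 replace (S (n - 1)) with n in B1 by lia. rewrite S_INR in Hm.
 use (ls_pos _ _ _ H j). assert (1 <= INR n) by (replace 1 with (INR 1) by reflexivity; apply le_INR; lia). nra.
Qed.

Section Klein.
Variables (F F' M psi psi' : nat -> nat -> R) (lam lam' C C' CM : nat -> R).
Hypothesis HF : bdd F C.
Hypothesis HF' : bdd F' C'.
Hypothesis HM : bdd M CM.
Hypothesis Fsym : forall j k, F j k = F k j.
Hypothesis Fsym' : forall j k, F' j k = F' k j.
Hypothesis EM : forall j k, M j k = F' j k - F j k.
Hypothesis H : lsys F psi lam.
Hypothesis H' : lsys F' psi' lam'.

(** The squared overlaps of the two eigenbases; by Parseval they form a doubly stochastic matrix
    ([cc_row], [cc_col]). *)
Let cc j k := ip (psi j) (psi' k) * ip (psi j) (psi' k).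
Let dd j k := ip (mv M (psi j)) (psi' k).

Lemma Msym j k : M j k = M k j.
Proof. rewrite !EM, (Fsym j), (Fsym' j). reflexivity. Qed.

Lemma mv_M x k : l2 x -> mv M x k = mv F' x k - mv F x k.
Proof.
 intros Hx. unfold mv. rewrite <- Series_minus; try (eexists; eapply mv_l2_series; eauto); try (eexists; eapply mv_l2_series; eauto).
 apply Series_ext. intros l. rewrite EM. ring.
Qed.

(** Each eigenvalue equation is tested on the eigenvector of the other system, and the two are
    subtracted. *)
Lemma cross_eq j k : (lam' k ^ 2 - lam j ^ 2) * ip (psi j) (psi' k) = dd j k.
Proof.
 use (ls_l2 _ _ _ j H) as L. use (ls_l2 _ _ _ k H') as L'. use (qf_eig F' C' HF' (psi' k) (psi j) (lam' k ^ 2) (ls_rapid _ _ _ k H') L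
   (fun l => ls_eig _ _ _ k l H')) as E1. use (qf_eig F C HF (psi j) (psi' k) (lam j ^ 2) (ls_rapid _ _ _ j H) L'
   (fun l => ls_eig _ _ _ j l H)) as E2. rewrite Rmult_minus_distr_r, <- E1. rewrite (ip_sym (psi j)), <- E2.
 unfold qf, dd. rewrite (ip_sym (mul_mu (psi' k))).
 rewrite (ip_ext (mv M (psi j)) (fun l => mv F' (psi j) l - mv F (psi j) l) (psi' k) (psi' k)); [|intros; apply mv_M; auto|reflexivity].
 rewrite ip_minus_l; auto; try (eapply mv_l2; eauto). rewrite (mv_sym F' C') by auto. rewrite (ip_sym (psi' k)). ring.
Qed.

Lemma dd_bound_l r j k : Rabs (dd j k) <= 2 * Cpsi C CM (r + 2)%nat / w j ^ r.
Proof.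
 apply (ip_unit_bound (fun j k => mv M (psi j) k)).
 - apply (mv_psi_bdd F psi lam); auto.
 - intros l. eapply ls_coord; eauto.
Qed.

Lemma dd_bound_r r j k : Rabs (dd j k) <= 2 * Cpsi C' CM (r + 2)%nat / w k ^ r.
Proof.
 unfold dd. rewrite (mv_sym M CM), ip_sym; auto using Msym; try (eapply ls_l2; eauto). apply (ip_unit_bound (fun j k => mv M (psi' j) k)).
 - apply (mv_psi_bdd F' psi' lam'); auto.
 - intros l. eapply ls_coord; eauto.
Qed.

Definition Kdd (r : nat) : R := 4 * (Cpsi C CM (r + 2)%nat * Cpsi C' CM (r + 2)%nat).

Lemma Kdd_nonneg r : 0 <= Kdd r.
Proof.
 use (bdd_nonneg _ _ (r + 2) (mv_psi_bdd F psi lam C M CM HF H HM)).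
 use (bdd_nonneg _ _ (r + 2) (mv_psi_bdd F' psi' lam' C' M CM HF' H' HM)). unfold Kdd. nra.
Qed.

(** Each of the two bounds on [dd] decays in one index only; their product decays in both. *)
Lemma dd_sq r j k : dd j k * dd j k <= Kdd r / (w j ^ r * w k ^ r).
Proof.
 use (Rsqr_abs (dd j k)) as Q. unfold Rsqr in Q. rewrite Q.
 eapply Rle_trans; [mul_lr; [apply Rabs_pos|apply Rabs_pos|apply (dd_bound_l r)|apply (dd_bound_r r)]|].
 unfold Kdd. right. use (wp_pos j r). use (wp_pos k r). generalize dependent (w j ^ r). generalize dependent (w k ^ r). intros. field. lra.
Qed.

Lemma cc_row j : is_series (fun k => cc j k) 1.
Proof.
 rewrite <- (dl_same j), <- (ls_on F psi lam j j H). apply (parseval F' psi' lam' (psi j) (psi j) H'); eapply ls_rapid; eauto.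
Qed.

Lemma cc_col k : is_series (fun j => cc j k) 1.
Proof.
 rewrite <- (dl_same k), <- (ls_on F' psi' lam' k k H').
 eapply is_series_ext_R; [|apply (parseval F psi lam (psi' k) (psi' k) H); eapply ls_rapid; eauto].
 intros j. simpl. unfold cc. rewrite (ip_sym (psi' k)). reflexivity.
Qed.

Lemma cc_dd_row j : is_series (fun k => cc j k * (lam' k ^ 2 - lam j ^ 2)) (ip (mv M (psi j)) (psi j)).
Proof.
 use (ls_l2 _ _ _ j H) as L. eapply is_series_ext_R; [|apply (parseval F' psi' lam' (mv M (psi j)) (psi j) H');
  [eapply mv_rapid; eauto|eapply ls_rapid; eauto]]. intros k. simpl. unfold cc.
 use (cross_eq j k) as E. unfold dd in E. rewrite <- E. ring.
Qed.

Lemma le_w_absorb a B j k r : 0 <= B -> (2 <= r)%nat -> a <= B / (w j ^ r * w k ^ r) -> a <= (B / w j ^ r) / w k ^ 2.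
Proof.
 intros HB Hr Ha. upto Ha. unfold Rdiv. rewrite Rmult_assoc. mul_l; auto.
 use (wp_pos j r). use (wp_pos k 2). rewrite <- Rinv_mult. apply Rinv_le_contravar; [nra|].
 mul_l; [lra|]. apply pow_le_weak; auto. apply w_ge1.
Qed.

Lemma sum_weight_tail (f t : nat -> R) A a B D n : (forall j, Rabs (f j) <= A * w j ^ a) -> 0 <= B -> 0 <= D ->
 (forall j, (j < n)%nat -> Rabs (t j) <= 2 * (B / w j ^ (a + 2)) / D) -> 0 < D -> Rabs (sm (fun j => f j * t j) n) <= 4 * A * B / D.
Proof.
 intros Hf HB _ Ht HD.
 assert (HA : 0 <= A). { specialize (Hf 0%nat). use (Rabs_pos (f 0%nat)). unfold w in Hf. simpl in Hf. rewrite pow1 in Hf. lra. }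
 replace (4 * A * B / D) with (2 * (2 * A * B / D)) by (field; lra). apply sm_w2_bound.
 - intros j Hj. rewrite Rabs_mult. eapply Rle_trans; [mul_lr; [apply Rabs_pos|apply Rabs_pos|apply Hf|apply Ht, Hj]|].
  right. rewrite pow_add. use (wp_pos j a). use (wp_pos j 2).
  generalize dependent (w j ^ a). generalize dependent (w j ^ 2). intros. field. lra.
 - apply Rle_mult_inv_pos; auto. nra.
Qed.

(** [fA] and [fB] stand for the values of one convex function at the two spectra and [wA] for its
    slopes at the first. The tangent line inequality is averaged with the weights [cc j k] over the
    leading block of size [2 n]. The weights missing from the block are small, because across the
    cut an overlap is [dd j k] divided by a gap of at least 1/2. *)
Lemma klein (fA fB wA : nat -> R) A a : (forall j, Rabs (fA j) <= A * w j ^ a) -> (forall j, Rabs (fB j) <= A * w j ^ a) ->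
 (forall j, Rabs (wA j) <= A * w j ^ a) -> (forall j k, fA j + wA j * (lam' k ^ 2 - lam j ^ 2) <= fB k) ->
 forall eps, 0 < eps -> exists N, forall n, (N <= n)%nat ->
  sm (fun j => wA j * ip (mv M (psi j)) (psi j)) (2 * n) - eps <= sm (fun j => fB j - fA j) (2 * n).
Proof.
 intros HfA HfB HwA Hconv eps Heps. destruct (sys_gap F psi lam C F' psi' lam' C' HF H HF' H') as [N1 HN1].
 destruct (sys_gap F' psi' lam' C' F psi lam C HF' H' HF H) as [N2 HN2].
 (* The 4 is the inverse square of the gap 1/2; the exponent [a + 2] pays for the growth of order
    [a] of the values and slopes and for summability. *)
 pose (B := 4 * Kdd (a + 2)). assert (HB : 0 <= B) by (use (Kdd_nonneg (a + 2)); unfold B; lra).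
 destruct (eventually_lt_w (12 * A * B) eps Heps) as [N3 HN3]. exists (N1 + N2 + N3)%nat. intros n Hn. use (w_pos (2 * n)) as HD.
 assert (Hcc1 : forall j k, (j < 2 * n)%nat -> (2 * n <= k)%nat -> cc j k <= B / w j ^ (a + 2) / w k ^ 2).
 { intros j k Hj Hk. apply le_w_absorb; auto; [lia|]. use (HN1 n ltac:(lia) j k Hj Hk) as G.
  eapply Rle_trans; [apply (sq_le_of_gap _ _ _ (/ 2) (cross_eq j k)); [eapply Rle_trans; [exact G|apply Rle_abs]|lra]|].
  use (dd_sq (a + 2) j k). unfold B, Rdiv in *. lra. } assert (Hcd1 : forall j k, (j < 2 * n)%nat -> (2 * n <= k)%nat ->
   Rabs (cc j k * (lam' k ^ 2 - lam j ^ 2)) <= B / w j ^ (a + 2) / w k ^ 2). { intros j k Hj Hk. apply le_w_absorb; auto; [lia|].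
  use (HN1 n ltac:(lia) j k Hj Hk) as G. use (cross_eq j k) as E.
  set (g := lam' k ^ 2 - lam j ^ 2) in *. set (x := ip (psi j) (psi' k)) in *. assert (Hx : 0 <= x * x) by nra.
  rewrite Rabs_pos_eq by (unfold cc; fold x; nra). eapply Rle_trans; [|instantiate (1 := 4 * (dd j k * dd j k))].
  - unfold cc. fold x. rewrite <- E. nra.
  - use (dd_sq (a + 2) j k). unfold B, Rdiv in *. lra. }
 assert (Hcc2 : forall k j, (k < 2 * n)%nat -> (2 * n <= j)%nat -> cc j k <= B / w k ^ (a + 2) / w j ^ 2).
 { intros k j Hk Hj. apply le_w_absorb; auto; [lia|]. use (HN2 n ltac:(lia) k j Hk Hj) as G.
  eapply Rle_trans; [apply (sq_le_of_gap _ _ _ (/ 2) (cross_eq j k)); [|lra]|].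
  - rewrite Rabs_minus_sym. eapply Rle_trans; [exact G|apply Rle_abs].
  - use (dd_sq (a + 2) j k) as Q. rewrite (Rmult_comm (w k ^ _)). unfold B, Rdiv in *. lra. }
 assert (Hcpos : forall j k, 0 <= cc j k) by (intros; unfold cc; nra). pose (t1 := fun j => 1 - sm (fun k => cc j k) (2 * n)).
 pose (t2 := fun k => 1 - sm (fun j => cc j k) (2 * n)).
 pose (t3 := fun j => ip (mv M (psi j)) (psi j) - sm (fun k => cc j k * (lam' k ^ 2 - lam j ^ 2)) (2 * n)).
 assert (T1 : forall j, (j < 2 * n)%nat -> Rabs (t1 j) <= 2 * (B / w j ^ (a + 2)) / w (2 * n)).
 { intros j Hj. apply tail_bound_w2; [apply cc_row|]. intros k Hk. rewrite Rabs_pos_eq; auto. }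
 assert (T2 : forall j, (j < 2 * n)%nat -> Rabs (t2 j) <= 2 * (B / w j ^ (a + 2)) / w (2 * n)).
 { intros j Hj. apply tail_bound_w2; [apply cc_col|]. intros k Hk. rewrite Rabs_pos_eq; auto. }
 assert (T3 : forall j, (j < 2 * n)%nat -> Rabs (t3 j) <= 2 * (B / w j ^ (a + 2)) / w (2 * n)).
 { intros j Hj. apply (tail_bound_w2 (fun k => cc j k * (lam' k ^ 2 - lam j ^ 2))); [apply cc_dd_row|]. intros k Hk. auto. }
 use (sum_weight_tail fA t1 A a B (w (2 * n)) (2 * n) HfA HB ltac:(lra) T1 HD) as E1.
 use (sum_weight_tail fB t2 A a B (w (2 * n)) (2 * n) HfB HB ltac:(lra) T2 HD) as E2.
 use (sum_weight_tail wA t3 A a B (w (2 * n)) (2 * n) HwA HB ltac:(lra) T3 HD) as E3. specialize (HN3 (2 * n)%nat ltac:(lia)).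
 assert (EA : sm fA (2 * n) = sm (fun j => sm (fun k => cc j k * fA j) (2 * n)) (2 * n) + sm (fun j => fA j * t1 j) (2 * n)).
 { rewrite <- sm_plus. apply sm_ext. intros j _. rewrite (sm_scal_r (fA j) (fun k => cc j k)). unfold t1. ring. }
 assert (EB : sm fB (2 * n) = sm (fun j => sm (fun k => cc j k * fB k) (2 * n)) (2 * n) + sm (fun j => fB j * t2 j) (2 * n)).
 { rewrite (sm_swap (fun j k => cc j k * fB k)). rewrite <- sm_plus. apply sm_ext. intros j _. rewrite (sm_scal_r (fB j) (fun i => cc i j)). unfold t2. ring. }
 assert (EW : sm (fun j => wA j * ip (mv M (psi j)) (psi j)) (2 * n) =
   sm (fun j => sm (fun k => cc j k * (wA j * (lam' k ^ 2 - lam j ^ 2))) (2 * n)) (2 * n) + sm (fun j => wA j * t3 j) (2 * n)).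
 { rewrite <- sm_plus. apply sm_ext. intros j _. unfold t3.  replace (sm (fun k => cc j k * (wA j * (lam' k ^ 2 - lam j ^ 2))) (2 * n))
   with (wA j * sm (fun k => cc j k * (lam' k ^ 2 - lam j ^ 2)) (2 * n)); [ring|]. rewrite <- sm_scal. apply sm_ext. intros; ring. }
 assert (Main : sm (fun j => sm (fun k => cc j k * (wA j * (lam' k ^ 2 - lam j ^ 2))) (2 * n)) (2 * n)
   <= sm (fun j => sm (fun k => cc j k * fB k) (2 * n)) (2 * n) - sm (fun j => sm (fun k => cc j k * fA j) (2 * n)) (2 * n)).
 { rewrite <- sm_minus. apply sm_le. intros j _. rewrite <- sm_minus. apply sm_le. intros k _.
  rewrite <- Rmult_minus_distr_l. mul_l; auto. specialize (Hconv j k). lra. }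
 rewrite sm_minus, EA, EB, EW. apply Rabs_le_between in E1, E2, E3. unfold Rdiv in *. lra.
Qed.

End Klein.

(** With [n + 1] equal steps the quadratic errors add up to [K T^2 / w n]. This replaces
    differentiation in time. *)
Lemma quadratic_decrease (g : R -> R) T K : 0 <= T -> (forall a b, 0 <= a -> a < b -> b <= T -> g b - g a <= K * (b - a) ^ 2) -> g T <= g 0.
Proof.
 intros HT H. destruct HT as [HT|<-]; [|lra]. assert (Hn : forall n, g T - g 0 <= (K * T ^ 2) / w n). { intros n. use (w_pos n) as Hw.
  assert (Hi : forall i, (i <= S n)%nat -> g (INR i * (T / w n)) - g 0 <= INR i * (K * (T / w n) ^ 2)).
  { induction i as [|i IH]; intros Hi.
   - simpl. rewrite !Rmult_0_l. lra.
   - assert (Hd : 0 < T / w n) by (apply Rdiv_lt_0_compat; auto). use (pos_INR i). specialize (IH ltac:(lia)).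
    assert (B : g (INR (S i) * (T / w n)) - g (INR i * (T / w n)) <= K * (INR (S i) * (T / w n) - INR i * (T / w n)) ^ 2).
    { apply H; [nra| |].
     - rewrite S_INR. nra.
     - apply le_INR in Hi. fold (w n) in Hi. via (w n * (T / w n)).
      + mul_r; lra.
      + right. field. lra. } rewrite S_INR in *.
    replace ((INR i + 1) * (T / w n) - INR i * (T / w n)) with (T / w n) in B by ring. lra. }
  specialize (Hi (S n) (Nat.le_refl _)). fold (w n) in Hi. replace (w n * (T / w n)) with T in Hi by (field; lra).
  replace (w n * (K * (T / w n) ^ 2)) with (K * T ^ 2 / w n) in Hi by (field; lra). exact Hi. } assert (Hle : g T - g 0 <= 0); [|lra].
 apply Rnot_lt_le. intros Hpos. destruct (eventually_lt_w (K * T ^ 2) (g T - g 0) Hpos) as [N HN].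
 specialize (HN N (Nat.le_refl _)). specialize (Hn N). lra.
Qed.

Lemma rapid_mult x f B a : rapid x -> (forall k, Rabs (f k) <= B * w k ^ a) -> rapid (fun k => f k * x k).
Proof.
 intros Hx Hf r. destruct (Hx (r + a)%nat) as [D HD]. exists (B * D). intros k. apply le_div_w.
 rewrite Rabs_mult. specialize (HD k). apply le_div_w in HD. specialize (Hf k). rewrite pow_add in HD.
 use (wp_pos k a). use (wp_pos k r). use (Rabs_pos (x k)). use (Rabs_pos (f k)). assert (HB : 0 <= B) by nra.
 via (B * (Rabs (x k) * (w k ^ r * w k ^ a))); [|mul_l; auto].
 replace (B * (Rabs (x k) * (w k ^ r * w k ^ a))) with ((B * w k ^ a) * (Rabs (x k) * w k ^ r)) by ring.
 replace (Rabs (f k) * Rabs (x k) * w k ^ r) with (Rabs (f k) * (Rabs (x k) * w k ^ r)) by ring. mul_r; auto. nra.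
Qed.

Lemma rapid_plus x y : rapid x -> rapid y -> rapid (fun k => x k + y k).
Proof.
 intros Hx Hy r. destruct (Hx r) as [A HA]. destruct (Hy r) as [B HB]. exists (A + B). intros k.
 upto Rabs_triang. specialize (HA k). specialize (HB k). unfold Rdiv in *. lra.
Qed.

Lemma rapid_ext x y : (forall k, x k = y k) -> rapid x -> rapid y.
Proof. intros E Hx r. destruct (Hx r) as [B HB]. exists B. intros k. rewrite <- E. apply HB. Qed.

Lemma rapid_is_series x : rapid x -> is_series x (Series x).
Proof. intros Hx. destruct (Hx 2%nat) as [B HB]. eapply is_series_w2; eauto. Qed.

Lemma rapid_minus x y : rapid x -> rapid y -> rapid (fun k => x k - y k).
Proof.
 intros Hx Hy. apply rapid_ext with (fun k => x k + (-1) * y k); [intros; ring|].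
 apply rapid_plus; auto. apply (rapid_mult y (fun _ => -1) 1 0); auto. intros. rewrite pow_O, Rabs_left; lra.
Qed.

Lemma pow_upper A x k p : 0 <= x -> x <= A * w k -> Rabs (x ^ p) <= A ^ p * w k ^ p.
Proof. intros H1 H2. rewrite Rabs_pos_eq by (apply pow_le; auto). rewrite <- Rpow_mult_distr. apply pow_incr; auto. Qed.

(** Induction on [lam^(p+1) - mu^(p+1) = lam (lam^p - mu^p) + mu^p (lam - mu)]; factors of
    polynomial growth do not spoil rapid decrease. *)
Lemma lam_pow_rapid F psi lam C p : bdd F C -> lsys F psi lam -> rapid (fun j => lam j ^ p - mu j ^ p).
Proof.
 intros HF H. destruct (lam_upper _ _ _ _ HF H) as [A [HA1 HA]]. use (lam_asymptotics _ _ _ _ HF H) as Hr. induction p as [|p IH].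
 - intros r. exists 0. intros k. simpl. rewrite Rminus_diag_eq, Rabs_R0 by reflexivity. unfold Rdiv. lra.
 - apply rapid_ext with (fun j => lam j * (lam j ^ p - mu j ^ p) + mu j ^ p * (lam j - mu j)); [intros; simpl; ring|]. apply rapid_plus.
  + apply (rapid_mult _ lam A 1); auto. intros k. rewrite pow_1, Rabs_pos_eq; auto. left; apply (ls_pos _ _ _ H).
  + apply (rapid_mult _ (fun j => mu j ^ p) (1 ^ p) p); auto. intros k. apply pow_upper.
   * use (mu_ge1 k); lra.
   * rewrite Rmult_1_l. apply mu_le_w.
Qed.

(** The difference of the sides is [(l - m) (l^q (l + m) - m^q (m + m))], a product of two factors
    of equal sign. It is what leads from the square of the operator back to the operator itself. *)
Lemma power_gap_ineq l m q : 0 <= l -> 0 <= m -> 2 * m ^ S q * (l - m) <= l ^ q * (l ^ 2 - m ^ 2).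
Proof.
 intros Hl Hm. apply Rminus_le_0.
 replace (l ^ q * (l ^ 2 - m ^ 2) - 2 * m ^ S q * (l - m)) with ((l - m) * (l ^ q * (l + m) - m ^ q * (m + m))) by (simpl; ring).
 destruct (Rle_dec m l) as [H|H].
 - assert (m ^ q <= l ^ q) by (apply pow_incr; lra). assert (0 <= m ^ q) by (apply pow_le; lra). apply Rmult_le_pos; [lra|]. nra.
 - assert (l ^ q <= m ^ q) by (apply pow_incr; lra). assert (0 <= l ^ q) by (apply pow_le; lra).
  assert (l ^ q * (l + m) <= m ^ q * (m + m)) by (mul_lr; lra). nra.
Qed.

(** [Ak k] stands for the diagonal entry of [b Lambda]. Since [mv F (psi j) k] equals
    [(lam j ^ 2 - mu k ^ 2) psi j k], [power_gap_ineq] bounds the double sum below by the sum over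
    [k] of [2 mu k ^ (q + 1) (Ak k - mu k)], whose terms of equal frequency add up to something
    nonnegative. The errors come from restricting both indices to the leading block. *)
Lemma pos_trace F psi lam C (Ak : nat -> R) q : bdd F C -> lsys F psi lam ->
 (forall k, is_series (fun j => lam j * (psi j k * psi j k)) (Ak k)) -> (forall i, 2 * INR (S i) <= Ak (2 * i)%nat + Ak (2 * i + 1)%nat) ->
 forall eps, 0 < eps -> exists N, forall n, (N <= n)%nat -> - eps <= sm (fun j => lam j ^ q * ip (mv F (psi j)) (psi j)) (2 * n).
Proof.
 intros HF H HA HA2 eps Heps. destruct (lam_upper _ _ _ _ HF H) as [A [HA1 HAu]]. use (mv_psi_bdd F psi lam C F C HF H HF) as HP.
 set (C1 := Cpsi C C) in *. set (P := fun j k => mv F (psi j) k) in *. pose (B1 := C1 (q + 2)%nat). pose (B2 := C1 (q + 1 + 2)%nat).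
 assert (HB1 : 0 <= B1) by apply (bdd_nonneg _ _ _ HP). assert (HB2 : 0 <= B2) by apply (bdd_nonneg _ _ _ HP).
 destruct (eventually_lt_w (4 * A ^ q * B1 + 4 * 2 * B2) eps Heps) as [N HN].
 exists N. intros n Hn. specialize (HN (2 * n)%nat ltac:(lia)). use (w_pos (2 * n)) as HD.
 pose (t1 := fun j => ip (P j) (psi j) - sm (fun k => P j k * psi j k) (2 * n)).
 pose (t2 := fun k => Ak k - mu k - sm (fun j => psi j k * psi j k * (lam j - mu k)) (2 * n)).
 assert (T1 : forall j, (j < 2 * n)%nat -> Rabs (t1 j) <= 2 * (B1 / w j ^ (q + 2)) / w (2 * n)).
 { intros j Hj. apply (tail_bound_w2 (fun k => P j k * psi j k)).
  - apply ip_is_series; [|eapply ls_l2; eauto]. apply rapid_l2, (mv_rapid F C); auto. eapply ls_l2; eauto.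
  - intros k _. apply le_w_absorb; auto; [lia|]. rewrite Rabs_mult. use (HP (q + 2)%nat j k) as Q. use (ls_coord F psi lam j k H).
   use (Rabs_pos (P j k)). fold B1 in Q. below Q. fold (P j k). nra. }
 assert (T2 : forall k, (k < 2 * n)%nat -> Rabs (t2 k) <= 2 * (B2 / w k ^ (q + 1 + 2)) / w (2 * n)).
 { intros k Hk. apply (tail_bound_w2 (fun j => psi j k * psi j k * (lam j - mu k))).
  - apply is_series_ext_R with (fun j => lam j * (psi j k * psi j k) - mu k * (psi j k * psi j k)); [intros; ring|].
   replace (Ak k - mu k) with (Ak k - mu k * 1) by ring.
   apply (is_series_minus (fun j => lam j * (psi j k * psi j k)) (fun j => mu k * (psi j k * psi j k))); auto.
   apply (is_series_scal_l (K := R_AbsRing) (V := R_NormedModule) (mu k)). eapply ls_row; eauto.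
  - intros j _. apply le_w_absorb; auto; [lia|]. rewrite (Rmult_comm (w k ^ _)). below (HP (q + 1 + 2)%nat j k).
   use (ls_gap_eq F psi lam j k H) as E. fold (P j k) in E. use (ls_coord F psi lam j k H) as Hc. use (ls_pos _ _ _ H j). use (mu_ge1 k).
   rewrite <- E. replace (lam j ^ 2 - mu k ^ 2) with ((lam j - mu k) * (lam j + mu k)) by ring.
   rewrite !Rabs_mult. rewrite (Rabs_pos_eq (lam j + mu k)) by lra. use (Rabs_pos (psi j k)). use (Rabs_pos (lam j - mu k)).
   assert (Rabs (psi j k) * Rabs (psi j k) <= Rabs (psi j k)) by nra. assert (0 <= Rabs (lam j - mu k) * Rabs (psi j k)) by nra. nra. }
 assert (HlA : forall j, Rabs (lam j ^ q) <= A ^ q * w j ^ q). { intros j. apply pow_upper; auto. left; apply (ls_pos _ _ _ H). }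
 assert (HmA : forall k, Rabs (2 * mu k ^ (q + 1)) <= 2 * w k ^ (q + 1)).
 { intros k. use (mu_ge1 k). rewrite Rabs_pos_eq by (use (pow_le (mu k) (q + 1) ltac:(lra)); lra).
  mul_l; [lra|]. apply pow_incr. split; [lra|apply mu_le_w]. }
 use (sum_weight_tail (fun j => lam j ^ q) t1 (A ^ q) q B1 (w (2 * n)) (2 * n) HlA HB1 ltac:(lra) T1 HD) as E1.
 use (sum_weight_tail (fun k => 2 * mu k ^ (q + 1)) t2 2 (q + 1) B2 (w (2 * n)) (2 * n) HmA HB2 ltac:(lra) T2 HD) as E2.
 assert (EA : sm (fun j => lam j ^ q * ip (P j) (psi j)) (2 * n) =
   sm (fun j => sm (fun k => lam j ^ q * (P j k * psi j k)) (2 * n)) (2 * n) + sm (fun j => lam j ^ q * t1 j) (2 * n)).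
 { rewrite <- sm_plus. apply sm_ext. intros j _. rewrite sm_scal. unfold t1. ring. }
 assert (EB : sm (fun k => 2 * mu k ^ (q + 1) * (Ak k - mu k)) (2 * n) =
   sm (fun k => sm (fun j => 2 * mu k ^ (q + 1) * (psi j k * psi j k * (lam j - mu k))) (2 * n)) (2 * n)
   + sm (fun k => 2 * mu k ^ (q + 1) * t2 k) (2 * n)). { rewrite <- sm_plus. apply sm_ext. intros j _. rewrite sm_scal. unfold t2. ring. }
 assert (Main : sm (fun k => sm (fun j => 2 * mu k ^ (q + 1) * (psi j k * psi j k * (lam j - mu k))) (2 * n)) (2 * n)
   <= sm (fun j => sm (fun k => lam j ^ q * (P j k * psi j k)) (2 * n)) (2 * n)).
 { rewrite (sm_swap (fun k j => 2 * mu k ^ (q + 1) * (psi j k * psi j k * (lam j - mu k)))).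
  apply sm_le. intros j _. apply sm_le. intros k _. unfold P. rewrite <- (ls_gap_eq F psi lam j k H).
  use (power_gap_ineq (lam j) (mu k) q ltac:(left; apply (ls_pos _ _ _ H)) ltac:(use (mu_ge1 k); lra)) as G.
  replace (S q) with (q + 1)%nat in G by lia. assert (0 <= psi j k * psi j k) by nra.
  apply (Rmult_le_compat_r (psi j k * psi j k)) in G; auto. lra. }
 assert (Hpos : 0 <= sm (fun k => 2 * mu k ^ (q + 1) * (Ak k - mu k)) (2 * n)).
 { rewrite sm_double. apply sm_pos. intros i _. rewrite mu_even, mu_odd. specialize (HA2 i).
  assert (0 <= INR (S i) ^ (q + 1)) by (apply pow_le, pos_INR). nra. }
 change (fun j => lam j ^ q * ip (mv F (psi j)) (psi j)) with (fun j => lam j ^ q * ip (P j) (psi j)).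
 apply Rabs_le_between in E1, E2. rewrite EA. unfold Rdiv in *. lra.
Qed.

(** Weights growing like a power of [1 + lam^2] are absorbed by the power that [mv_psi_decay] leaves
    on the left; the small factor [h] of the matrix passes through unchanged. *)
Lemma remainder_bound F psi lam C Rm CR h (wA : nat -> R) W r : bdd F C -> lsys F psi lam ->
 0 <= W -> bdd Rm (fun r => CR r * h) -> (2 <= r)%nat -> (forall j, Rabs (wA j) <= W * (1 + lam j ^ 2) ^ r) ->
 forall n, Rabs (sm (fun j => wA j * ip (mv Rm (psi j)) (psi j)) n) <= 4 * W * Cpsi C CR r * h.
Proof.
 intros HF H HW HR Hr Hw n. assert (EC : Cpsi C (fun r => CR r * h) r = Cpsi C CR r * h) by (unfold Cpsi; ring).
 assert (HC0 : 0 <= Cpsi C CR r * h). { rewrite <- EC. apply (bdd_nonneg _ _ r (mv_psi_bdd F psi lam C Rm _ HF H HR)). }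
 replace (4 * W * Cpsi C CR r * h) with (2 * (2 * W * (Cpsi C CR r * h))) by ring. apply sm_w2_bound; [|nra]. intros j _.
 set (L := (1 + lam j ^ 2) ^ r). assert (HL : 1 <= L) by (apply pow_R1_Rle; use (pow2_ge_0 (lam j)); lra).
 assert (B : Rabs (ip (fun k => L * mv Rm (psi j) k) (psi j)) <= 2 * ((Cpsi C CR r * h) / w j ^ 2)).
 { apply series_bound. intros k. rewrite !Rabs_mult. rewrite (Rabs_pos_eq L) by lra.
  use (mv_psi_decay F psi lam C Rm _ r j k HF H HR) as D. fold L in D. rewrite EC in D.
  use (ls_coord F psi lam j k H). use (Rabs_pos (mv Rm (psi j) k)). use (Rabs_pos (psi j k)). via (Cpsi C CR r * h / (w j ^ r * w k ^ r)).
  - below D. assert (0 <= L * Rabs (mv Rm (psi j) k)) by nra. nra.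
  - unfold Rdiv. rewrite (Rmult_assoc (Cpsi C CR r * h)). mul_l; auto.
   use (wp_pos j 2). use (wp_pos k 2). rewrite <- Rinv_mult. apply Rinv_le_contravar; [nra|].
   mul_lr; try lra; apply pow_le_weak; auto; apply w_ge1. } rewrite ip_scal_l, Rabs_mult, Rabs_pos_eq in B by lra.
 rewrite Rabs_mult. specialize (Hw j). fold L in Hw. use (Rabs_pos (ip (mv Rm (psi j)) (psi j))).
 via (W * (L * Rabs (ip (mv Rm (psi j)) (psi j)))).
 - rewrite <- Rmult_assoc. mul_r; auto.
 - via (W * (2 * (Cpsi C CR r * h / w j ^ 2))); [mul_l; auto|]. right. unfold Rdiv. ring.
Qed.

Section Monotonicity.
Variables (T ell : R) (F F1 psi : R -> nat -> nat -> R) (lam Ak : R -> nat -> R) (C CR : nat -> R).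
Hypothesis HT : 0 <= T.
Hypothesis Hell : 0 < ell.
Hypothesis HF : forall t, 0 <= t <= T -> bdd (F t) C.
Hypothesis Fsym : forall t j k, F t j k = F t k j.
Hypothesis HF1 : forall t, 0 <= t <= T -> exists C1, bdd (F1 t) C1.
Hypothesis HS : forall t, 0 <= t <= T -> lsys (F t) (psi t) (lam t).
(** The expansion is required at either end of the interval: the even powers are compared from the
    later time and the first power from the earlier one. *)
Hypothesis HR : forall a b t, 0 <= a -> a < b -> b <= T -> t = a \/ t = b ->
 bdd (fun k l => F b k l - F a k l - (b - a) * F1 t k l) (fun r => CR r * (b - a) ^ 2).
Hypothesis Hdot : forall t j, 0 <= t <= T -> ip (mv (F1 t) (psi t j)) (psi t j) = - 2 * lam t j * ip (mv (F t) (psi t j)) (psi t j).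
Hypothesis Hlow : forall t j, 0 <= t <= T -> ell <= lam t j.
Hypothesis HA : forall t k, 0 <= t <= T -> is_series (fun j => lam t j * (psi t j k * psi t j k)) (Ak t k).
Hypothesis HA2 : forall t i, 0 <= t <= T -> 2 * INR (S i) <= Ak t (2 * i)%nat + Ak t (2 * i + 1)%nat.

Definition spec_sum (p : nat) (t : R) : R := Series (fun j => lam t j ^ p - mu j ^ p).

Lemma spec_sum_diff p a b : 0 <= a <= T -> 0 <= b <= T ->
 is_lim_seq (fun n => sm (fun j => lam b j ^ p - lam a j ^ p) (2 * n)) (spec_sum p b - spec_sum p a).
Proof.
 intros Ha Hb. use (rapid_is_series _ (lam_pow_rapid _ _ _ _ p (HF a Ha) (HS a Ha))) as S1.
 use (rapid_is_series _ (lam_pow_rapid _ _ _ _ p (HF b Hb) (HS b Hb))) as S2. apply is_series_sm in S1, S2.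
 use (is_lim_seq_minus' _ _ _ _ S2 S1) as L. apply (is_lim_seq_subseq _ _ (fun n => (2 * n)%nat)) in L.
 - eapply is_lim_seq_ext; [|exact L]. intros n. cbv beta. rewrite <- sm_minus. apply sm_ext. intros; ring.
 - apply eventually_subseq. intros; lia.
Qed.

Lemma bdd_sub M1 M2 A1 A2 : bdd M1 A1 -> bdd M2 A2 -> bdd (fun j k => M1 j k - M2 j k) (fun r => A1 r + A2 r).
Proof.
 intros H1 H2 r j k. unfold Rminus. upto Rabs_triang. rewrite Rabs_Ropp.
 specialize (H1 r j k). specialize (H2 r j k). unfold Rdiv in *. lra.
Qed.

Lemma mv_lin3 M1 M2 M3 A1 A2 A3 c x k : bdd M1 A1 -> bdd M2 A2 -> bdd M3 A3 -> l2 x ->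
 (forall j l, M1 j l = c * M2 j l + M3 j l) -> mv M1 x k = c * mv M2 x k + mv M3 x k.
Proof.
 intros H1 H2 H3 Hx E. unfold mv. rewrite <- Series_scal_l. rewrite <- Series_plus.
 - apply Series_ext. intros l. rewrite E. ring.
 - apply ex_series_scal_R. eexists; eapply mv_l2_series; eauto.
 - eexists; eapply mv_l2_series; eauto.
Qed.

(* [sg] is the sign of [t1 - t0]: the convexity inequality is used from either endpoint. *)
Lemma klein_step (q : nat) (pp W : R) (r : nat) (sg : R) : 0 <= W -> (2 <= r)%nat -> 0 <= pp ->
 forall t0 t1, 0 <= t0 <= T -> 0 <= t1 <= T -> sg = 1 /\ t0 < t1 \/ sg = -1 /\ t1 < t0 -> forall (f : R -> R) (wA : nat -> R),
 (exists A a, (forall j, Rabs (f (lam t0 j)) <= A * w j ^ a) /\ (forall j, Rabs (f (lam t1 j)) <= A * w j ^ a) /\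
   (forall j, Rabs (wA j) <= A * w j ^ a)) -> (forall j, Rabs (wA j) <= W * (1 + lam t0 j ^ 2) ^ r) ->
 (forall j, - sg * wA j * (2 * lam t0 j) = pp * lam t0 j ^ q) ->
 (forall j k, f (lam t0 j) + wA j * (lam t1 k ^ 2 - lam t0 j ^ 2) <= f (lam t1 k)) ->
 forall L, is_lim_seq (fun n => sm (fun j => f (lam t1 j) - f (lam t0 j)) (2 * n)) (Finite L) ->
 - (4 * W * Cpsi C CR r * (t1 - t0) ^ 2) <= L.
Proof.
 intros HW Hr Hpp t0 t1 H0 H1 Hsg f wA [A [a [B1 [B2 B3]]]] HwW Hw Hconv L HL.
 pose (Rm := fun k l => F t1 k l - F t0 k l - (t1 - t0) * F1 t0 k l). assert (HRm : bdd Rm (fun r => CR r * (t1 - t0) ^ 2)).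
 { destruct Hsg as [[_ Hlt]|[_ Hlt]].
  - apply HR; auto; lra.
  - use (HR t1 t0 t0 ltac:(lra) Hlt ltac:(lra) ltac:(right; reflexivity)) as Q.
   intros r' j k. specialize (Q r' j k). cbv beta in *. unfold Rm. replace ((t1 - t0) ^ 2) with ((t0 - t1) ^ 2) by ring.
   replace (F t1 j k - F t0 j k - (t1 - t0) * F1 t0 j k) with (- (F t0 j k - F t1 j k - (t0 - t1) * F1 t0 j k)) by ring.
   rewrite Rabs_Ropp. exact Q. } pose (M := fun j k => F t1 j k - F t0 j k).
 assert (HM : bdd M (fun r => C r + C r)) by (apply bdd_sub; apply HF; auto). destruct (HF1 t0 H0) as [C1 HC1].
 assert (EM : forall j, ip (mv M (psi t0 j)) (psi t0 j) =
   (t1 - t0) * (- 2 * lam t0 j * ip (mv (F t0) (psi t0 j)) (psi t0 j)) + ip (mv Rm (psi t0 j)) (psi t0 j)).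
 { intros j. use (ls_l2 _ _ _ j (HS t0 H0)) as Lj. rewrite <- Hdot by auto. rewrite <- ip_scal_l, <- ip_plus_l; auto.
  - apply ip_ext; [|reflexivity]. intros k. eapply mv_lin3; eauto. intros; unfold M, Rm; ring.
  - apply l2_scal. eapply mv_l2; eauto.
  (* The factor [pp * T + 1] collects the error of Klein's inequality and that of [pos_trace], the
     latter multiplied by at most [pp * T]. *)
  - eapply mv_l2; eauto. } assert (Hall : forall eps, 0 < eps -> - (4 * W * Cpsi C CR r * (t1 - t0) ^ 2) - (pp * T + 1) * eps <= L).
 { intros eps He. destruct (klein (F t0) (F t1) M (psi t0) (psi t1) (lam t0) (lam t1) C C _ (HF t0 H0) (HF t1 H1) HM
   (Fsym t0) (Fsym t1) (fun j k => eq_refl) (HS t0 H0) (HS t1 H1) (fun j => f (lam t0 j)) (fun j => f (lam t1 j)) wA A a B1 B2 B3 Hconv eps He) as [N1 HN1].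
  destruct (pos_trace (F t0) (psi t0) (lam t0) C (Ak t0) q (HF t0 H0) (HS t0 H0) (fun k => HA t0 k H0) (fun i => HA2 t0 i H0) eps He) as [N2 HN2].
  apply (fun Q => is_lim_seq_le_loc (fun _ => - (4 * W * Cpsi C CR r * (t1 - t0) ^ 2) - (pp * T + 1) * eps) _ (Finite _) (Finite L) Q (is_lim_seq_const _) HL).
  exists (N1 + N2)%nat. intros n Hn. specialize (HN1 n ltac:(lia)). specialize (HN2 n ltac:(lia)). below HN1.
  use (remainder_bound (F t0) (psi t0) (lam t0) C Rm CR ((t1 - t0) ^ 2) wA W r (HF t0 H0) (HS t0 H0) HW HRm Hr HwW (2 * n)) as RB.
  apply Rabs_le_between in RB. rewrite (sm_ext (fun j => wA j * ip (mv M (psi t0 j)) (psi t0 j))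
   (fun j => (sg * (t1 - t0) * pp) * (lam t0 j ^ q * ip (mv (F t0) (psi t0 j)) (psi t0 j)) + wA j * ip (mv Rm (psi t0 j)) (psi t0 j))).
  2:{ intros j _. rewrite EM. specialize (Hw j).
    replace (sg * (t1 - t0) * pp * (lam t0 j ^ q * ip (mv (F t0) (psi t0 j)) (psi t0 j))) with
     (sg * (t1 - t0) * (pp * lam t0 j ^ q) * ip (mv (F t0) (psi t0 j)) (psi t0 j)) by ring.
    rewrite <- Hw. assert (Es : sg * sg = 1) by (destruct Hsg as [[-> _]|[-> _]]; ring).
    replace (sg * (t1 - t0) * (- sg * wA j * (2 * lam t0 j))) with (- (sg * sg) * ((t1 - t0) * wA j * (2 * lam t0 j))) by ring.
    rewrite Es. ring. } rewrite sm_plus, sm_scal. assert (Hc : 0 <= sg * (t1 - t0) * pp <= pp * T).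
  { assert (0 <= sg * (t1 - t0) <= T) by (destruct Hsg as [[-> ?]|[-> ?]]; lra). nra. }
  set (X := sm (fun j => lam t0 j ^ q * ip (mv (F t0) (psi t0 j)) (psi t0 j)) (2 * n)) in *.
  assert (- (pp * T) * eps <= sg * (t1 - t0) * pp * X) by nra. lra. } apply Rnot_lt_le. intros Hlt.
 set (Y := - (4 * W * Cpsi C CR r * (t1 - t0) ^ 2)) in *. assert (HpT : 0 <= pp * T) by nra.
 specialize (Hall ((Y - L) / (2 * (pp * T + 1))) ltac:(apply Rdiv_lt_0_compat; lra)).
 replace ((pp * T + 1) * ((Y - L) / (2 * (pp * T + 1)))) with ((Y - L) / 2) in Hall by (field; lra). lra.
Qed.

(** The tangent line inequality for the power [m + 1] in the variable [x ^ 2]; in the induction step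
    the defect is a nonnegative multiple of a square. *)
Lemma even_convex m x y : 0 <= x -> 0 <= y -> (x ^ 2) ^ S m + INR (S m) * (x ^ 2) ^ m * (y ^ 2 - x ^ 2) <= (y ^ 2) ^ S m.
Proof.
 intros Hx Hy. assert (Hx2 : 0 <= x ^ 2) by (apply pow_le; auto). assert (Hy2 : 0 <= y ^ 2) by (apply pow_le; auto).
 generalize dependent (x ^ 2). generalize dependent (y ^ 2). clear. intros y Hy x Hx. induction m as [|m IH]; [simpl; lra|].
 apply (Rmult_le_compat_r y) in IH; auto. assert (0 <= x ^ m) by (apply pow_le; auto).
 assert (0 <= INR (S m) * x ^ m * ((y - x) * (y - x))).
 { apply Rmult_le_pos; [apply Rmult_le_pos; auto; apply pos_INR|]. use (Rle_0_sqr (y - x)). exact H0. }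
 rewrite (S_INR (S m)). cbn [pow] in *. replace (y * (y * y ^ m)) with (y * y ^ m * y) by ring. below IH. apply Rminus_le_0.
 replace ((x * x ^ m + INR (S m) * x ^ m * (y - x)) * y - (x * (x * x ^ m) + (INR (S m) + 1) * (x * x ^ m) * (y - x)))
  with (INR (S m) * x ^ m * ((y - x) * (y - x))) by ring. exact H0.
Qed.

(** The slope is positive here, so the expansion has to start at the later time [b] for the trace
    term to have the favourable sign. The exponent [2 m + 1] is that of the slope
    [(m + 1) lam^(2 m)] multiplied by [2 lam]. *)
Theorem spec_sum_even m : spec_sum (2 * S m) T <= spec_sum (2 * S m) 0.
Proof.
 apply quadratic_decrease with (4 * INR (S m) * Cpsi C CR (m + 2)); auto. intros a b Ha Hab Hb. use (pos_INR (S m)) as Hm.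
 assert (Hb' : 0 <= b <= T) by lra. assert (Ha' : 0 <= a <= T) by lra.
 assert (B : - (4 * INR (S m) * Cpsi C CR (m + 2) * (a - b) ^ 2) <= spec_sum (2 * S m) a - spec_sum (2 * S m) b).
 { apply (klein_step (2 * m + 1) (2 * INR (S m)) (INR (S m)) (m + 2) (-1) Hm ltac:(lia) ltac:(lra) b a Hb' Ha'
   ltac:(right; split; [reflexivity|lra]) (fun x => x ^ (2 * S m)) (fun j => INR (S m) * (lam b j ^ 2) ^ m)).
  - destruct (lam_upper _ _ _ _ (HF a Ha') (HS a Ha')) as [A1 [HA11 HA1]].
   destruct (lam_upper _ _ _ _ (HF b Hb') (HS b Hb')) as [A2' [HA21 HA2']]. pose (A := A1 + A2' + 1).
   assert (Hp : forall t j, lam t j <= A1 * w j \/ lam t j <= A2' * w j -> 0 <= lam t j -> Rabs (lam t j ^ (2 * S m)) <= A ^ (2 * S m) * w j ^ (2 * S m)).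
   { intros t j Ht H0. apply pow_upper; auto. use (w_pos j). unfold A. destruct Ht; nra. }
   exists (INR (S m) * A ^ (2 * S m) + A ^ (2 * S m)), (2 * S m)%nat. assert (HAp : 0 <= A ^ (2 * S m)) by (apply pow_le; unfold A; lra).
   assert (Hfin : forall x j, Rabs x <= A ^ (2 * S m) * w j ^ (2 * S m) -> Rabs x <= (INR (S m) * A ^ (2 * S m) + A ^ (2 * S m)) * w j ^ (2 * S m)).
   { intros x j Hx. use (wp_pos j (2 * S m)). upto Hx. mul_r; [lra|]. nra. } split; [|split].
   + intros j. apply Hfin. apply Hp; auto. left; apply (ls_pos _ _ _ (HS b Hb')).
   + intros j. apply Hfin. apply Hp; auto. left; apply (ls_pos _ _ _ (HS a Ha')).
   + intros j. rewrite Rabs_mult, (Rabs_pos_eq (INR (S m))) by auto. rewrite <- pow_mult.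
    use (ls_pos _ _ _ (HS b Hb') j) as Hl. use (w_ge1 j). assert (Q : Rabs (lam b j ^ (2 * m)) <= A ^ (2 * m) * w j ^ (2 * m)).
    { apply pow_upper; [lra|]. specialize (HA2' j). unfold A. nra. }
    assert (Q2 : A ^ (2 * m) * w j ^ (2 * m) <= A ^ (2 * S m) * w j ^ (2 * S m)). { mul_lr; try (apply pow_le; unfold A; lra).
     - apply pow_le_weak; [unfold A; lra|lia].
     - apply pow_le_weak; [lra|lia]. } via (INR (S m) * (A ^ (2 * S m) * w j ^ (2 * S m))).
    * mul_l; auto. lra.
    * use (wp_pos j (2 * S m)). rewrite Rmult_plus_distr_r, <- Rmult_assoc. assert (0 <= A ^ (2 * S m) * w j ^ (2 * S m)) by nra. lra.
  - intros j. use (pow2_ge_0 (lam b j)). rewrite Rabs_pos_eq.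
   + mul_l; auto. via ((1 + lam b j ^ 2) ^ m).
    * apply pow_incr. lra.
    * apply pow_le_weak; [lra|lia].
   + apply Rmult_le_pos; auto. apply pow_le; auto.
  - intros j. rewrite <- pow_mult, pow_add, pow_1. ring.
  - intros j k. rewrite !pow_mult. apply even_convex; left.
   + apply (ls_pos _ _ _ (HS b Hb')).
   + apply (ls_pos _ _ _ (HS a Ha')).
  - apply spec_sum_diff; auto. } replace ((b - a) ^ 2) with ((a - b) ^ 2) by ring. lra.
Qed.

(** The convex function is [- sqrt] in the variable [lam^2], with the negative slope
    [- 1 / (2 lam)], expanded at the earlier time. The lower bound [ell] keeps the slopes
    bounded. *)
Theorem spec_sum_one : spec_sum 1 T <= spec_sum 1 0.
Proof.
 apply quadratic_decrease with (4 * / (2 * ell) * Cpsi C CR 2); auto. intros a b Ha Hab Hb.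
 assert (Hb' : 0 <= b <= T) by lra. assert (Ha' : 0 <= a <= T) by lra. assert (He : 0 < / (2 * ell)) by (apply Rinv_0_lt_compat; lra).
 assert (Hinv : forall j, 0 < / (2 * lam a j) <= / (2 * ell)). { intros j. use (Hlow a j Ha'). split; [apply Rinv_0_lt_compat; lra|].
  apply Rinv_le_contravar; lra. } assert (B : - (4 * / (2 * ell) * Cpsi C CR 2 * (b - a) ^ 2) <= spec_sum 1 a - spec_sum 1 b).
 { apply (klein_step 0 1 (/ (2 * ell)) 2 1 ltac:(lra) ltac:(lia) ltac:(lra) a b Ha' Hb'
   ltac:(left; split; [reflexivity|lra]) (fun x => - x) (fun j => - / (2 * lam a j))).
  - destruct (lam_upper _ _ _ _ (HF a Ha') (HS a Ha')) as [A1 [HA11 HA1]].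
   destruct (lam_upper _ _ _ _ (HF b Hb') (HS b Hb')) as [A2' [HA21 HA2']]. exists (A1 + A2' + / (2 * ell)), 1%nat.
   split; [|split]; intros j; rewrite pow_1, Rabs_Ropp; use (w_ge1 j); use (Hinv j).
   + rewrite Rabs_pos_eq by (left; apply (ls_pos _ _ _ (HS a Ha'))). specialize (HA1 j). nra.
   + rewrite Rabs_pos_eq by (left; apply (ls_pos _ _ _ (HS b Hb'))). specialize (HA2' j). nra.
   + rewrite Rabs_pos_eq by lra. nra.
  - intros j. rewrite Rabs_Ropp, Rabs_pos_eq by (left; apply Hinv).
   assert (1 <= (1 + lam a j ^ 2) ^ 2) by (apply pow_R1_Rle; use (pow2_ge_0 (lam a j)); lra). use (Hinv j). nra.
  - intros j. use (Hlow a j Ha'). simpl. field. lra.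
  - intros j k. use (Hlow a j Ha'). set (x := lam a j) in *. set (y := lam b k) in *.
   apply Rminus_le_0. replace (- y - (- x + - / (2 * x) * (y ^ 2 - x ^ 2))) with ((y - x) ^ 2 * / (2 * x)) by (field; lra).
   apply Rmult_le_pos; [apply pow2_ge_0|]. left. apply Rinv_0_lt_compat. lra.
  - use (spec_sum_diff 1 b a Hb' Ha') as L. eapply is_lim_seq_ext; [|exact L]. intros n. apply sm_ext. intros; simpl; ring. } lra.
Qed.

End Monotonicity.

(** * Smooth periodic functions *)

(** Derivatives are peeled off from the inside, whereas [Derive_n] adds them on the outside; in this
    form closure under products, composition and inversion is a plain induction. *)
Fixpoint Ck (n : nat) (u : R -> R) : Prop := match n with O => True | S m => (forall x, ex_derive u x) /\ Ck m (Derive u) end.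

Lemma Derive_n_Derive u n x : Derive_n (Derive u) n x = Derive_n u (S n) x.
Proof.
 use (Derive_n_comp u n 1 x) as E. rewrite Nat.add_1_r in E. rewrite <- E. reflexivity.
Qed.

Lemma smooth_Ck u : smooth u <-> forall n, Ck n u.
Proof.
 split.
 - intros H n. revert u H. induction n as [|n IH]; intros u H; simpl; auto. split.
  + intros x. exact (H 1%nat x).
  + apply IH. intros m x. destruct m as [|m]; simpl; auto. apply (ex_derive_ext (Derive_n u (S m))); [|exact (H (S (S m)) x)].
   intros t. symmetry. apply Derive_n_Derive.
 - intros H n. revert u H. induction n as [|n IH]; intros u H x; simpl; auto. destruct n as [|n]; [apply (H 1%nat)|].
  assert (H' : forall m, Ck m (Derive u)) by (intros m; apply (H (S m))). specialize (IH (Derive u) H' x). simpl in IH.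
  apply (ex_derive_ext (Derive_n (Derive u) n)); auto. intros t. apply Derive_n_Derive.
Qed.

Lemma Ck_weaken n u : Ck (S n) u -> Ck n u.
Proof.
 revert u. induction n as [|n IH]; intros u H; [exact I|]. destruct H as [H1 H2]. split; auto.
Qed.

Lemma Derive_eq u v : (forall x, is_derive u x (v x)) -> Derive u = v.
Proof. intros H. fext. intros x. apply is_derive_unique, H. Qed.

Lemma Ck_S n u v : (forall x, is_derive u x (v x)) -> Ck n v -> Ck (S n) u.
Proof. intros H Hv. split; [intros x; eexists; apply H|]. rewrite (Derive_eq u v H). exact Hv. Qed.

Lemma Ck_const n c : Ck n (fun _ => c).
Proof.
 revert c. induction n as [|n IH]; intros c; [exact I|]. apply Ck_S with (fun _ => 0); auto. intros x. apply (is_derive_const c x).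
Qed.

Lemma Ck_plus n u v : Ck n u -> Ck n v -> Ck n (fun x => u x + v x).
Proof.
 revert u v. induction n as [|n IH]; intros u v Hu Hv; [exact I|]. destruct Hu as [Hu1 Hu2]. destruct Hv as [Hv1 Hv2].
 apply Ck_S with (fun x => Derive u x + Derive v x); auto. intros x. apply (is_derive_plus u v); apply Derive_correct; auto.
Qed.

Lemma Ck_mult n u v : Ck n u -> Ck n v -> Ck n (fun x => u x * v x).
Proof.
 revert u v. induction n as [|n IH]; intros u v Hu Hv; [exact I|]. use (Ck_weaken _ _ Hu). use (Ck_weaken _ _ Hv).
 destruct Hu as [Hu1 Hu2]. destruct Hv as [Hv1 Hv2]. apply Ck_S with (fun x => Derive u x * v x + u x * Derive v x).
 - intros x. apply (is_derive_mult u v x); try (apply Derive_correct; auto). intros; apply Rmult_comm.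
 - apply Ck_plus; auto.
Qed.

Lemma Ck_comp n f g : Ck n f -> Ck n g -> Ck n (fun x => f (g x)).
Proof.
 revert f g. induction n as [|n IH]; intros f g Hf Hg; [exact I|].
 use (Ck_weaken _ _ Hg). destruct Hf as [Hf1 Hf2]. destruct Hg as [Hg1 Hg2]. apply Ck_S with (fun x => Derive g x * Derive f (g x)).
 - intros x. apply (is_derive_comp f g); apply Derive_correct; auto.
 - apply Ck_mult; auto.
Qed.

Lemma Ck_inv n u : (forall x, u x <> 0) -> Ck n u -> Ck n (fun x => / u x).
Proof.
 intros H0. induction n as [|n IH]; intros Hu; [exact I|]. use (IH (Ck_weaken _ _ Hu)) as Hi. destruct Hu as [Hu1 Hu2].
 apply Ck_S with (fun x => (-1) * Derive u x * (/ u x * / u x)).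
 - intros x. replace (-1 * Derive u x * (/ u x * / u x)) with (- Derive u x / u x ^ 2) by (field; auto).
  apply is_derive_inv; auto. apply Derive_correct; auto.
 - apply Ck_mult; [apply Ck_mult; auto; apply Ck_const|apply Ck_mult; auto].
Qed.

Lemma Ck_sqrt n u : (forall x, 0 < u x) -> Ck n u -> Ck n (fun x => sqrt (u x)).
Proof.
 intros H0. induction n as [|n IH]; intros Hu; [exact I|]. use (IH (Ck_weaken _ _ Hu)) as Hi. destruct Hu as [Hu1 Hu2].
 assert (Hs : forall x, 0 < sqrt (u x)) by (intros; apply sqrt_lt_R0; auto). apply Ck_S with (fun x => Derive u x * / (2 * sqrt (u x))).
 - intros x. apply (is_derive_sqrt u x); auto. apply Derive_correct; auto.
 - apply Ck_mult; auto. apply (Ck_inv n (fun x => 2 * sqrt (u x))).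
  + intros x. specialize (Hs x). lra.
  + apply Ck_mult; auto. apply Ck_const.
Qed.

(** Smoothness is proved by naming a class closed under differentiation: phase shifted cosines,
    series with rapidly decreasing coefficients, or algebras of functions of time and angle. *)
Lemma smooth_class (P : (R -> R) -> Prop) : (forall u, P u -> exists v, P v /\ forall x, is_derive u x (v x)) -> forall u, P u -> smooth u.
Proof.
 intros H u Hu. apply smooth_Ck. intros n. revert u Hu. induction n as [|n IH]; intros u Hu; [exact I|].
 destruct (H u Hu) as [v [Hv Hd]]. apply Ck_S with v; auto.
Qed.

Lemma smooth_const c : smooth (fun _ => c).
Proof. apply smooth_Ck; intros; apply Ck_const. Qed.

Lemma smooth_plus u v : smooth u -> smooth v -> smooth (fun x => u x + v x).
Proof. rewrite !smooth_Ck. intros; apply Ck_plus; auto. Qed.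

Lemma smooth_mult u v : smooth u -> smooth v -> smooth (fun x => u x * v x).
Proof. rewrite !smooth_Ck. intros; apply Ck_mult; auto. Qed.

Lemma smooth_comp f g : smooth f -> smooth g -> smooth (fun x => f (g x)).
Proof. rewrite !smooth_Ck. intros; apply Ck_comp; auto. Qed.

Lemma smooth_inv u : (forall x, u x <> 0) -> smooth u -> smooth (fun x => / u x).
Proof. intros H. rewrite !smooth_Ck. intros; apply Ck_inv; auto. Qed.

Lemma smooth_sqrt u : (forall x, 0 < u x) -> smooth u -> smooth (fun x => sqrt (u x)).
Proof. intros H. rewrite !smooth_Ck. intros; apply Ck_sqrt; auto. Qed.

Lemma smooth_Derive u : smooth u -> smooth (Derive u).
Proof. rewrite !smooth_Ck. intros H n. apply (H (S n)). Qed.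

Lemma smooth_is_derive u x : smooth u -> is_derive u x (Derive u x).
Proof. intros H. apply Derive_correct. exact (H 1%nat x). Qed.

Lemma smooth_primitive u v : (forall x, is_derive u x (v x)) -> smooth v -> smooth u.
Proof.
 intros H Hv. apply smooth_Ck. intros [|n]; [exact I|]. apply Ck_S with v; auto. apply smooth_Ck; auto.
Qed.

Lemma smooth_cos_aff a p : smooth (fun x => cos (a * x + p)).
Proof.
 apply (smooth_class (fun u => exists c p, u = fun x => c * cos (a * x + p))).
 - intros u [c [q ->]]. exists (fun x => (c * a) * cos (a * x + (q + PI / 2))). split; [eauto|].
  intros x. auto_derive; auto. replace (a * x + (q + PI / 2)) with (PI / 2 + (a * x + q)) by ring. rewrite (sin_cos (a * x + q)). ring.
 - exists 1, p. fext; intros; ring.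
Qed.

Definition cont (u : R -> R) : Prop := forall x, continuous u x.

Lemma is_derive_cont u v : (forall x, is_derive u x (v x)) -> cont u.
Proof. intros H x. apply (ex_derive_continuous u x). eexists; apply H. Qed.

Lemma smooth_cont u : smooth u -> cont u.
Proof. intros H. apply (is_derive_cont u (Derive u)). intros; apply smooth_is_derive; auto. Qed.

Lemma cont_const c : cont (fun _ => c).
Proof. intros x. apply continuous_const. Qed.

Lemma cont_plus u v : cont u -> cont v -> cont (fun x => u x + v x).
Proof. intros Hu Hv x. apply (continuous_plus u v); auto. Qed.

Lemma cont_minus u v : cont u -> cont v -> cont (fun x => u x - v x).
Proof. intros Hu Hv x. apply (continuous_minus u v); auto. Qed.

Lemma cont_mult u v : cont u -> cont v -> cont (fun x => u x * v x).
Proof. intros Hu Hv x. apply (continuous_mult u v); auto. Qed.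

Lemma cont_sm (u : nat -> R -> R) n : (forall k, cont (u k)) -> cont (fun x => sm (fun k => u k x) n).
Proof. intros H. induction n as [|n IH]; simpl; [apply cont_const|]. apply (cont_plus (fun x => sm (fun k => u k x) n)); auto. Qed.

Lemma cont_pow u n : cont u -> cont (fun x => u x ^ n).
Proof. intros H. induction n as [|n IH]; simpl; [apply cont_const|]. apply cont_mult; auto. Qed.

Lemma per_Derive u : smooth u -> per u -> per (Derive u).
Proof.
 intros Hs Hp x. symmetry. apply is_derive_unique. apply (is_derive_ext (fun y => u (y + 2 * PI))); [intros; apply Hp|].
 replace (Derive u (x + 2 * PI)) with (scal 1 (Derive u (x + 2 * PI))) by (unfold scal; simpl; unfold mult; simpl; ring).
 apply (is_derive_comp u (fun y => y + 2 * PI)).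
 - apply smooth_is_derive; auto.
 - auto_derive; auto.
Qed.

Lemma Cinf_const c : Cinf (fun _ => c).
Proof. split; [apply smooth_const|intros x; reflexivity]. Qed.
Lemma Cinf_plus u v : Cinf u -> Cinf v -> Cinf (fun x => u x + v x).
Proof. intros [H1 H2] [H3 H4]. split; [apply smooth_plus; auto|intros x; rewrite H2, H4; reflexivity]. Qed.
Lemma Cinf_mult u v : Cinf u -> Cinf v -> Cinf (fun x => u x * v x).
Proof. intros [H1 H2] [H3 H4]. split; [apply smooth_mult; auto|intros x; rewrite H2, H4; reflexivity]. Qed.
Lemma Cinf_ext u v : (forall x, u x = v x) -> Cinf u -> Cinf v.
Proof. intros H. apply functional_extensionality in H. subst. auto. Qed.
Lemma Cinf_scal c u : Cinf u -> Cinf (fun x => c * u x).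
Proof. intros H. apply (Cinf_mult (fun _ => c)); auto. apply Cinf_const. Qed.
Lemma Cinf_minus u v : Cinf u -> Cinf v -> Cinf (fun x => u x - v x).
Proof.
 intros Hu Hv. apply Cinf_ext with (fun x => u x + (-1) * v x); [intros; ring|]. apply Cinf_plus; auto. apply Cinf_scal; auto.
Qed.
Lemma Cinf_Derive u : Cinf u -> Cinf (Derive u).
Proof. intros [H1 H2]. split; [apply smooth_Derive|apply per_Derive]; auto. Qed.
Lemma Cinf_inv u : (forall x, 0 < u x) -> Cinf u -> Cinf (fun x => / u x).
Proof.
 intros H [H1 H2]. split; [apply smooth_inv; auto|intros x; rewrite H2; reflexivity]. intros x. specialize (H x). lra.
Qed.
Lemma Cinf_sqrt u : (forall x, 0 < u x) -> Cinf u -> Cinf (fun x => sqrt (u x)).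
Proof. intros H [H1 H2]. split; [apply smooth_sqrt; auto|intros x; rewrite H2; reflexivity]. Qed.
Lemma Cinf_cont u : Cinf u -> cont u.
Proof. intros [H _]. apply smooth_cont; auto. Qed.
Lemma Cinf_sm (u : nat -> R -> R) n : (forall k, (k < n)%nat -> Cinf (u k)) -> Cinf (fun x => sm (fun k => u k x) n).
Proof.
 intros H. induction n as [|n IH]; simpl; [apply Cinf_const|]. apply (Cinf_plus (fun x => sm (fun k => u k x) n)); auto.
Qed.
Lemma Cinf_is_derive u x : Cinf u -> is_derive u x (Derive u x).
Proof. intros [H _]. apply smooth_is_derive; auto. Qed.

(** * Means over one period *)

Definition avg (u : R -> R) : R := / (2 * PI) * RInt u 0 (2 * PI).

Lemma two_pi_pos : 0 < 2 * PI.
Proof. use PI_RGT_0; lra. Qed.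

Lemma cont_ex_RInt u a b : cont u -> ex_RInt u a b.
Proof. intros H. apply (ex_RInt_continuous u). intros; apply H. Qed.

Lemma avg_ext u v : (forall x, u x = v x) -> avg u = avg v.
Proof. intros H. apply functional_extensionality in H. subst. reflexivity. Qed.

Lemma avg_plus u v : cont u -> cont v -> avg (fun x => u x + v x) = avg u + avg v.
Proof.
 intros Hu Hv. unfold avg. rewrite (RInt_plus u v); try (apply cont_ex_RInt; auto). unfold plus; simpl. ring.
Qed.

Lemma avg_scal c u : cont u -> avg (fun x => c * u x) = c * avg u.
Proof.
 intros Hu. unfold avg. rewrite (RInt_scal u); try (apply cont_ex_RInt; auto). unfold scal; simpl; unfold mult; simpl. ring.
Qed.

Lemma avg_minus u v : cont u -> cont v -> avg (fun x => u x - v x) = avg u - avg v.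
Proof.
 intros Hu Hv. rewrite (avg_ext _ (fun x => u x + (-1) * v x)) by (intros; ring).
 rewrite avg_plus; auto; [rewrite avg_scal; auto; ring|]. apply (cont_mult (fun _ => -1)); auto. apply cont_const.
Qed.

Lemma avg_const c : avg (fun _ => c) = c.
Proof.
 unfold avg. rewrite RInt_const. unfold scal; simpl; unfold mult; simpl. field. use two_pi_pos; lra.
Qed.

Lemma avg_le u v : cont u -> cont v -> (forall x, u x <= v x) -> avg u <= avg v.
Proof.
 intros Hu Hv H. unfold avg. mul_l; [left; apply Rinv_0_lt_compat, two_pi_pos|].
 apply RInt_le; try (apply cont_ex_RInt; auto); auto. left; apply two_pi_pos.
Qed.

Lemma avg_abs_le u B : cont u -> (forall x, Rabs (u x) <= B) -> Rabs (avg u) <= B.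
Proof.
 intros Hu H. apply Rabs_le. use (avg_le u (fun _ => B) Hu (cont_const B) (fun x => proj2 (proj1 (Rabs_le_between _ _) (H x)))) as H1.
 use (avg_le (fun _ => - B) u (cont_const _) Hu (fun x => proj1 (proj1 (Rabs_le_between _ _) (H x)))) as H2.
 rewrite avg_const in H1, H2. lra.
Qed.

Lemma avg_derive u v : (forall x, is_derive u x (v x)) -> cont v -> u (2 * PI) = u 0 -> avg v = 0.
Proof.
 intros H Hv E. unfold avg. assert (Q : is_RInt v 0 (2 * PI) (minus (u (2 * PI)) (u 0))). { apply (is_RInt_derive u v); intros; auto. }
 rewrite (is_RInt_unique _ _ _ _ Q), E. unfold minus, plus, opp; simpl. ring.
Qed.

Lemma per_2pi u : per u -> u (2 * PI) = u 0.
Proof. intros H. rewrite <- (H 0). f_equal; ring. Qed.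

Lemma avg_Derive u : Cinf u -> avg (Derive u) = 0.
Proof.
 intros H. apply (avg_derive u); [intros; apply Cinf_is_derive; auto|apply Cinf_cont, Cinf_Derive; auto|]. apply per_2pi, H.
Qed.

Lemma Derive_mult_fun u v : Cinf u -> Cinf v -> Derive (fun x => u x * v x) = fun x => Derive u x * v x + u x * Derive v x.
Proof.
 intros Hu Hv. apply Derive_eq. intros x. apply (is_derive_mult u v x); try (apply Cinf_is_derive; auto). intros; apply Rmult_comm.
Qed.

Lemma avg_by_parts u v : Cinf u -> Cinf v -> avg (fun x => Derive u x * v x) = - avg (fun x => u x * Derive v x).
Proof.
 intros Hu Hv. use (avg_Derive _ (Cinf_mult u v Hu Hv)) as E. rewrite Derive_mult_fun in E; auto.
 rewrite avg_plus in E; [lra| |]; apply cont_mult; apply Cinf_cont; auto using Cinf_Derive.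
Qed.

Lemma per_IZR u : per u -> forall (z : Z) x, u (x + IZR z * (2 * PI)) = u x.
Proof.
 intros H. assert (Hn : forall (n : nat) x, u (x + INR n * (2 * PI)) = u x). { induction n as [|n IH]; intros x; [simpl; f_equal; ring|].
  rewrite S_INR. replace (x + (INR n + 1) * (2 * PI)) with (x + INR n * (2 * PI) + 2 * PI) by ring. rewrite H. apply IH. }
 intros z x. destruct (Z_le_gt_dec 0 z) as [Hz|Hz].
 - rewrite <- (Z2Nat.id z Hz), <- INR_IZR_INZ. apply Hn.
 - rewrite <- (Hn (Z.to_nat (- z)) (x + IZR z * (2 * PI))). f_equal. rewrite INR_IZR_INZ, Z2Nat.id, opp_IZR by lia. ring.
Qed.

(** A single representative serves all periodic functions at once, so several of them can be moved
    to the same point. *)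
Lemma per_reduce (x a : R) : exists y, a <= y <= a + 2 * PI /\ forall u, per u -> u y = u x.
Proof.
 use two_pi_pos as Hp. set (t := (x - a) / (2 * PI)). destruct (base_Int_part t) as [H1 H2]. set (z := Int_part t) in *.
 exists (x + IZR (- z) * (2 * PI)). split.
 - rewrite opp_IZR. assert (E : x = a + t * (2 * PI)) by (unfold t; field; lra). nra.
 - intros u Hu. apply per_IZR; auto.
Qed.

Lemma cont_per_bounded u : cont u -> per u -> exists B, forall x, Rabs (u x) <= B.
Proof.
 intros Hc Hp. destruct (continuity_ab_maj (fun x => Rabs (u x)) 0 (0 + 2 * PI)) as [m [Hm _]].
 - use two_pi_pos; lra.
 - intros c _. apply continuity_pt_filterlim. apply (continuous_comp u Rabs); [apply Hc|apply continuous_Rabs].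
 - exists (Rabs (u m)). intros x. destruct (per_reduce x 0) as [y [Hy E]]. rewrite <- (E u Hp). apply Hm; auto.
Qed.

(** Two applications of the mean value theorem, without the optimal factor 1/2. Derivatives are
    asked for in the open interval only, since in time they exist for [t > 0]; continuity covers the
    endpoint 0, and [a], [b] may come in either order. *)
Lemma taylor2 (f f1 f2 : R -> R) a b K : (forall x, Rmin a b < x < Rmax a b -> is_derive f x (f1 x)) ->
 (forall x, Rmin a b < x < Rmax a b -> is_derive f1 x (f2 x)) -> (forall x, Rmin a b <= x <= Rmax a b -> continuous f x) ->
 (forall x, Rmin a b <= x <= Rmax a b -> continuous f1 x) -> (forall x, Rmin a b <= x <= Rmax a b -> Rabs (f2 x) <= K) ->
 Rabs (f b - f a - (b - a) * f1 a) <= K * (b - a) ^ 2.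
Proof.
 intros H1 H2 C1 C2 HK. destruct (MVT_gen f a b f1) as [c [Hc E]]; auto. { intros x Hx. apply continuity_pt_filterlim, C1, Hx. }
 assert (Hsub : forall x, Rmin a c <= x <= Rmax a c -> Rmin a b <= x <= Rmax a b).
 { intros x. unfold Rmin, Rmax in *. destruct (Rle_dec a b); destruct (Rle_dec a c); lra. } destruct (MVT_gen f1 a c f2) as [d [Hd E2]].
 { intros x Hx. apply H2. unfold Rmin, Rmax in *. destruct (Rle_dec a b); destruct (Rle_dec a c); lra. }
 { intros x Hx. apply continuity_pt_filterlim, C2, Hsub, Hx. }
 rewrite E. replace (f1 c * (b - a) - (b - a) * f1 a) with ((f1 c - f1 a) * (b - a)) by ring.
 rewrite E2, !Rabs_mult. specialize (HK d (Hsub d Hd)). assert (Hca : Rabs (c - a) <= Rabs (b - a)).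
 { unfold Rmin, Rmax in Hc. destruct (Rle_dec a b); [rewrite !Rabs_pos_eq by lra; lra|]. rewrite !Rabs_left1 by lra. lra. }
 use (Rabs_pos (f2 d)). use (Rabs_pos (c - a)). use (Rabs_pos (b - a)).
 rewrite <- (pow2_abs (b - a)). assert (Rabs (f2 d) * Rabs (c - a) <= K * Rabs (b - a)) by (mul_lr; lra). nra.
Qed.

Lemma cos_taylor2 x y : Rabs (cos y - cos x - (y - x) * (- sin x)) <= (y - x) ^ 2.
Proof.
 rewrite <- (Rmult_1_l ((y - x) ^ 2)). apply (taylor2 cos (fun x => - sin x) (fun x => - cos x)).
 - intros. apply is_derive_cos.
 - intros. auto_derive; auto. ring.
 - intros. apply continuous_cos.
 - intros. apply (continuous_opp sin). apply continuous_sin.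
 - intros t _. rewrite Rabs_Ropp. apply Rabs_le, COS_bound.
Qed.

Lemma is_derive_quadratic (f : R -> R) x l B r : 0 < r ->
 (forall y, Rabs (y - x) < r -> Rabs (f y - f x - (y - x) * l) <= B * (y - x) ^ 2) -> is_derive f x l.
Proof.
 intros Hr H. apply is_derive_Reals. intros eps He. assert (HB : 0 <= B).
 { specialize (H (x + r / 2)). replace (x + r / 2 - x) with (r / 2) in H by ring. rewrite (Rabs_pos_eq (r / 2)) in H by lra.
  specialize (H ltac:(lra)). use (Rabs_pos (f (x + r / 2) - f x - r / 2 * l)).
  assert (0 < (r / 2) ^ 2) by (apply pow_lt; lra). apply Rnot_lt_le. intros HB. nra. }
 assert (Hd : 0 < Rmin r (eps / (B + 1))) by (apply Rmin_glb_lt; auto; apply Rdiv_lt_0_compat; lra).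
 exists (mkposreal _ Hd). intros h Hh Hlt. simpl in Hlt. specialize (H (x + h)). replace (x + h - x) with h in H by ring.
 use (Rlt_le_trans _ _ _ Hlt (Rmin_l _ _)) as H1. apply (Rlt_le_trans _ _ (eps / (B + 1))) in Hlt; [|apply Rmin_r]. specialize (H H1).
 replace ((f (x + h) - f x) / h - l) with ((f (x + h) - f x - h * l) / h) by (field; auto).
 unfold Rdiv. rewrite Rabs_mult, Rabs_inv. use (Rabs_pos_lt h Hh). apply Rle_lt_trans with (B * Rabs h).
 - apply (Rmult_le_reg_r (Rabs h)); auto. rewrite Rmult_assoc, Rinv_l, Rmult_1_r by lra. rewrite <- (pow2_abs h) in H. simpl in H. lra.
 - apply Rle_lt_trans with ((B + 1) * Rabs h); [nra|].
  apply (Rmult_lt_compat_l (B + 1)) in Hlt; [|lra]. replace ((B + 1) * (eps / (B + 1))) with eps in Hlt by (field; lra). lra.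
Qed.

(** * Fourier series in the coordinate [s] with [ds = dx / b] *)

(** The phase that turns the cosine into the sine at odd indices. *)
Definition ph (k : nat) : R := if Nat.even k then 0 else - (PI / 2).
Definition muz (k : nat) : Z := Z.of_nat (S (Nat.div2 k)).
Definition ee (k : nat) (x : R) : R := sqrt 2 * cos (mu k * x + ph k).

Lemma mu_IZR k : mu k = IZR (muz k).
Proof. unfold mu, muz. apply INR_IZR_INZ. Qed.

Lemma muz_pos k : (0 < muz k)%Z.
Proof. unfold muz. generalize (Nat.div2 k). intros; lia. Qed.

Lemma sqrt2_sq : sqrt 2 * sqrt 2 = 2.
Proof. apply sqrt_sqrt. lra. Qed.

Lemma sqrt2_pos : 0 < sqrt 2.
Proof. apply sqrt_lt_R0; lra. Qed.

Lemma sqrt2_le : sqrt 2 <= 2.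
Proof. use sqrt2_sq. use sqrt2_pos. nra. Qed.

Lemma ee_bound k x : Rabs (ee k x) <= 2.
Proof.
 unfold ee. rewrite Rabs_mult. use sqrt2_pos. use sqrt2_le. rewrite (Rabs_pos_eq (sqrt 2)) by lra.
 assert (Rabs (cos (mu k * x + ph k)) <= 1) by (apply Rabs_le, COS_bound). use (Rabs_pos (cos (mu k * x + ph k))). nra.
Qed.

(** A coordinate on the circle with [ds = dx / b]. The last clause encodes both the degree one and
    the normalization of the integral of [1 / b]. *)
Record frame (s b : R -> R) : Prop := {
 fr_b : Cinf b;
 fr_pos : forall x, 0 < b x;
 fr_s : forall x, is_derive s x (/ b x);
 fr_per : forall x, s (x + 2 * PI) = s x + 2 * PI }.

Definition wavg (b u : R -> R) : R := avg (fun x => u x * / b x).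
(** With arbitrary frequency and phase, [d/ds] becomes a shift of the phase by [PI / 2] and a
    product becomes a sum of two members of the family. *)
Definition cs (s : R -> R) (z : Z) (p x : R) : R := cos (IZR z * s x + p).
Definition phi (s : R -> R) (k : nat) (x : R) : R := ee k (s x).
Definition coef (s b v : R -> R) (k : nat) : R := wavg b (fun x => v x * phi s k x).

Lemma phi_cs s k : phi s k = fun x => sqrt 2 * cs s (muz k) (ph k) x.
Proof. fext. intros x. unfold phi, ee, cs. rewrite mu_IZR. reflexivity. Qed.

Section Frame.
Variables s b : R -> R.
Hypothesis Hf : frame s b.

Lemma fr_inv : Cinf (fun x => / b x).
Proof. apply Cinf_inv; apply Hf. Qed.

Lemma fr_inv_cont : cont (fun x => / b x).
Proof. apply Cinf_cont, fr_inv. Qed.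

Lemma fr_inv_pos x : 0 < / b x.
Proof. apply Rinv_0_lt_compat, Hf. Qed.

Lemma smooth_s : smooth s.
Proof. apply (smooth_primitive s (fun x => / b x)); [apply Hf|apply fr_inv]. Qed.

Lemma cs_Cinf z p : Cinf (cs s z p).
Proof.
 split.
 - apply (smooth_comp (fun y => cos (IZR z * y + p)) s); [apply smooth_cos_aff|apply smooth_s].
 - intros x. unfold cs. rewrite (fr_per s b Hf).
  assert (Hc : per (fun y => cos y)) by (intros y; rewrite cos_plus, cos_2PI, sin_2PI; ring).
  rewrite <- (per_IZR _ Hc z (IZR z * s x + p)). f_equal. ring.
Qed.

Lemma cs_derive z p x : is_derive (cs s z p) x (IZR z * cs s z (p + PI / 2) x * / b x).
Proof.
 unfold cs. use (fr_s s b Hf x) as Hs. replace (IZR z * s x + (p + PI / 2)) with (PI / 2 + (IZR z * s x + p)) by ring. evar_last.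
 - apply (is_derive_comp cos (fun y => IZR z * s y + p)); [apply is_derive_cos|].
  apply (is_derive_plus (fun y => IZR z * s y) (fun _ => p)); [|apply is_derive_const]. apply (is_derive_scal s x (IZR z)). exact Hs.
 - unfold scal, plus, zero; simpl; unfold mult; simpl. rewrite (sin_cos (IZR z * s x + p)). ring.
Qed.

Lemma wavg_cont u : cont u -> cont (fun x => u x * / b x).
Proof. intros H. apply cont_mult; auto. apply fr_inv_cont. Qed.

Lemma wavg_plus u v : cont u -> cont v -> wavg b (fun x => u x + v x) = wavg b u + wavg b v.
Proof.
 intros Hu Hv. unfold wavg. rewrite <- avg_plus; try (apply wavg_cont; auto). apply avg_ext; intros; ring.
Qed.

Lemma wavg_scal c u : cont u -> wavg b (fun x => c * u x) = c * wavg b u.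
Proof.
 intros Hu. unfold wavg. rewrite <- avg_scal; try (apply wavg_cont; auto). apply avg_ext; intros; ring.
Qed.

Lemma wavg_ext u v : (forall x, u x = v x) -> wavg b u = wavg b v.
Proof. intros H. apply functional_extensionality in H. subst. reflexivity. Qed.

Lemma wavg_minus u v : cont u -> cont v -> wavg b (fun x => u x - v x) = wavg b u - wavg b v.
Proof.
 intros Hu Hv. unfold wavg. rewrite <- avg_minus; try (apply wavg_cont; auto). apply avg_ext; intros; ring.
Qed.

Lemma wavg_le u v : cont u -> cont v -> (forall x, u x <= v x) -> wavg b u <= wavg b v.
Proof.
 intros Hu Hv H. apply avg_le; try (apply wavg_cont; auto). intros x. mul_r; auto. left; apply fr_inv_pos.
Qed.

Lemma wavg_one : wavg b (fun _ => 1) = 1.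
Proof.
 unfold wavg. rewrite (avg_ext _ (fun x => / b x)) by (intros; ring). unfold avg.
 assert (Q : is_RInt (fun x => / b x) 0 (2 * PI) (minus (s (2 * PI)) (s 0))).
 { apply (is_RInt_derive s); intros; [apply Hf|apply fr_inv_cont]. }
 rewrite (is_RInt_unique _ _ _ _ Q). replace (2 * PI) with (0 + 2 * PI) at 2 by ring. rewrite (fr_per s b Hf).
 unfold minus, plus, opp; simpl. field. use two_pi_pos; lra.
Qed.

Lemma wavg_const c : wavg b (fun _ => c) = c.
Proof.
 rewrite (wavg_ext _ (fun x => c * (fun _ => 1) x)) by (intros; ring). rewrite wavg_scal, wavg_one; [ring|apply cont_const].
Qed.

Lemma wavg_abs_le u B : cont u -> (forall x, Rabs (u x) <= B) -> Rabs (wavg b u) <= B.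
Proof.
 intros Hu H. apply Rabs_le. use (wavg_le u (fun _ => B) Hu (cont_const B) (fun x => proj2 (proj1 (Rabs_le_between _ _) (H x)))) as H1.
 use (wavg_le (fun _ => - B) u (cont_const _) Hu (fun x => proj1 (proj1 (Rabs_le_between _ _) (H x)))) as H2.
 rewrite wavg_const in H1, H2. lra.
Qed.

Lemma cs_cont z p : cont (cs s z p).
Proof. apply Cinf_cont, cs_Cinf. Qed.

(** Integration by parts in the coordinate [s], in which [b d/dx] is [d/ds]. *)
Lemma wavg_cs_parts z p v : Cinf v ->
 IZR z * wavg b (fun x => v x * cs s z p x) = - wavg b (fun x => (b x * Derive v x) * cs s z (p - PI / 2) x).
Proof.
 intros Hv. use (avg_by_parts (cs s z (p - PI / 2)) v (cs_Cinf _ _) Hv) as E. rewrite (Derive_eq _ _ (cs_derive z (p - PI / 2))) in E.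
 replace (p - PI / 2 + PI / 2) with p in E by ring. unfold wavg. rewrite <- avg_scal.
 - rewrite (avg_ext _ (fun x => IZR z * cs s z p x * / b x * v x)) by (intros; ring). rewrite E.
  f_equal. apply avg_ext. intros x. field. use (fr_pos s b Hf x); lra.
 - apply wavg_cont, cont_mult; [apply Cinf_cont; auto|apply cs_cont].
Qed.

Lemma wavg_cs z p : z <> 0%Z -> wavg b (cs s z p) = 0.
Proof.
 intros Hz. use (wavg_cs_parts z p (fun _ => 1) (Cinf_const 1)) as E. rewrite (wavg_ext _ (cs s z p)) in E by (intros; ring).
 rewrite (wavg_ext (fun x => b x * Derive (fun _ => 1) x * cs s z (p - PI / 2) x) (fun _ => 0)) in E
  by (intros; rewrite Derive_const; ring). rewrite wavg_const in E. apply not_0_IZR in Hz. nra.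
Qed.

Lemma wavg_cs0 p : wavg b (cs s 0 p) = cos p.
Proof. rewrite (wavg_ext _ (fun _ => cos p)); [apply wavg_const|]. intros; unfold cs. f_equal; ring. Qed.

Lemma cs_mult z p z' p' x : cs s z p x * cs s z' p' x = / 2 * (cs s (z + z') (p + p') x + cs s (z - z') (p - p') x).
Proof.
 unfold cs. rewrite plus_IZR, minus_IZR.
 replace ((IZR z + IZR z') * s x + (p + p')) with ((IZR z * s x + p) + (IZR z' * s x + p')) by ring.
 replace ((IZR z - IZR z') * s x + (p - p')) with ((IZR z * s x + p) - (IZR z' * s x + p')) by ring.
 generalize (IZR z * s x + p) (IZR z' * s x + p'). intros u v. rewrite cos_plus, cos_minus. field.
Qed.

Lemma phi_Cinf k : Cinf (phi s k).
Proof. rewrite phi_cs. apply Cinf_scal, cs_Cinf. Qed.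

Lemma phi_cont k : cont (phi s k).
Proof. apply Cinf_cont, phi_Cinf. Qed.

Lemma wavg_phi k : wavg b (phi s k) = 0.
Proof.
 rewrite phi_cs, wavg_scal, wavg_cs; [ring| |apply cs_cont]. use (muz_pos k); lia.
Qed.

Lemma ph_diff j k : Nat.div2 j = Nat.div2 k -> cos (ph j - ph k) = dl j k.
Proof.
 intros E. use (Nat.div2_odd j) as Ej. use (Nat.div2_odd k) as Ek. rewrite <- !Nat.negb_even in *. unfold ph, dl.
 destruct (Nat.even j); destruct (Nat.even k); simpl in Ej, Ek; destruct (Nat.eq_dec j k); try lia.
 - rewrite Rminus_0_r. apply cos_0.
 - replace (0 - - (PI / 2)) with (PI / 2) by ring. apply cos_PI2.
 - rewrite Rminus_0_r, cos_neg. apply cos_PI2.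
 - rewrite Rminus_diag_eq by reflexivity. apply cos_0.
Qed.

Lemma phi_orthonormal j k : wavg b (fun x => phi s j x * phi s k x) = dl j k.
Proof.
 rewrite (wavg_ext _ (fun x => cs s (muz j + muz k) (ph j + ph k) x + cs s (muz j - muz k) (ph j - ph k) x)).
 2:{ intros x. rewrite !phi_cs. replace (sqrt 2 * cs s (muz j) (ph j) x * (sqrt 2 * cs s (muz k) (ph k) x))
    with ((sqrt 2 * sqrt 2) * (cs s (muz j) (ph j) x * cs s (muz k) (ph k) x)) by ring. rewrite sqrt2_sq, cs_mult. field. }
 rewrite wavg_plus by apply cs_cont. rewrite (wavg_cs (muz j + muz k)) by (use (muz_pos j); use (muz_pos k); lia).
 destruct (Z.eq_dec (muz j) (muz k)) as [E|E].
 - rewrite E, Z.sub_diag, wavg_cs0, ph_diff; [ring|]. unfold muz in E. lia.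
 - rewrite wavg_cs by lia. rewrite dl_diff; [ring|]. intros ->. lia.
Qed.

(** The bump [cos^2 ((s x - s x0) / 2)], with maximum 1 at [x0]. *)
Let PP (x0 x : R) : R := / 2 * (1 + cs s 1 (- s x0) x).

Lemma PP_Cinf x0 : Cinf (PP x0).
Proof. apply Cinf_scal, Cinf_plus; [apply Cinf_const|apply cs_Cinf]. Qed.

Lemma PPn_cont x0 n : cont (fun x => PP x0 x ^ n).
Proof. apply cont_pow, Cinf_cont, PP_Cinf. Qed.

Lemma PP_range x0 x : 0 <= PP x0 x <= 1.
Proof. unfold PP, cs. use (COS_bound (1 * s x + - s x0)). lra. Qed.

(** The difference of the sides is the mean of the derivative of [sin (s - s x0) P^n], computed with
    [sin^2 = 4 P (1 - P)] and [cos = 2 P - 1]. *)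
Lemma wallis x0 n : (2 * INR n + 2) * wavg b (fun x => PP x0 x ^ S n) = (2 * INR n + 1) * wavg b (fun x => PP x0 x ^ n).
Proof.
 use (PPn_cont x0) as HP. pose (U := fun x => cs s 1 (- s x0 - PI / 2) x * PP x0 x ^ n).
 pose (V := fun x => ((2 * INR n + 2) * PP x0 x ^ S n - (2 * INR n + 1) * PP x0 x ^ n) * / b x). assert (HV : cont V).
 { apply wavg_cont, (cont_minus (fun x => (2 * INR n + 2) * PP x0 x ^ S n) (fun x => (2 * INR n + 1) * PP x0 x ^ n));
   apply (cont_mult (fun _ => _)); auto using cont_const. } assert (E : avg V = 0). { apply (avg_derive U); auto.
  - intros x. unfold U. evar_last.
   + apply (is_derive_mult (cs s 1 (- s x0 - PI / 2)) (fun x => PP x0 x ^ n)).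
    * apply cs_derive.
    * apply (is_derive_pow (PP x0) n). apply (is_derive_scal (fun x => 1 + cs s 1 (- s x0) x)).
     apply (is_derive_plus (fun _ => 1)); [apply is_derive_const|apply cs_derive].
    * intros; apply Rmult_comm.
   + unfold plus, zero, mult, scal; simpl; unfold mult; simpl. replace (- s x0 - PI / 2 + PI / 2) with (- s x0) by ring.
    assert (Es : cs s 1 (- s x0 - PI / 2) x = sin (s x - s x0)).
    { unfold cs. rewrite (sin_cos (s x - s x0)). replace (1 * s x + (- s x0 - PI / 2)) with (- PI + (PI / 2 + (s x - s x0))) by field.
     rewrite (Rplus_comm (- PI)). change (PI / 2 + (s x - s x0) + - PI) with (PI / 2 + (s x - s x0) - PI). rewrite cos_minus, cos_PI, sin_PI. ring. }
    assert (Es2 : cs s 1 (- s x0 + PI / 2) x = - sin (s x - s x0)).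
    { unfold cs. rewrite (sin_cos (s x - s x0)). replace (1 * s x + (- s x0 + PI / 2)) with (PI / 2 + (s x - s x0)) by field. ring. }
    assert (Ec : cs s 1 (- s x0) x = 2 * PP x0 x - 1) by (unfold PP; field).
    rewrite Es, Es2, Ec. unfold V. set (P := PP x0 x) in *. set (S0 := sin (s x - s x0)). assert (ESS : S0 * S0 = 4 * P * (1 - P)).
    { unfold S0. use (sin2_cos2 (s x - s x0)) as Q. unfold Rsqr in Q.
     assert (Hc : cos (s x - s x0) = 2 * P - 1) by (rewrite <- Ec; unfold cs; f_equal; ring). rewrite Hc in Q. lra. }
    destruct n as [|n]; [simpl; ring|]. replace (Init.Nat.pred (S n)) with n by reflexivity.
    replace (S0 * (INR (S n) * (/ 2 * (0 + 1 * - S0 * / b x)) * P ^ n)) with (- (S0 * S0) * (INR (S n) * / 2 * / b x * P ^ n)) by ring.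
    rewrite ESS. change (match n with O => 1 | S _ => INR n + 1 end) with (INR (S n)). simpl pow. field. use (fr_pos s b Hf x); lra.
  - apply per_2pi. intros x. unfold U. rewrite (proj2 (cs_Cinf 1 (- s x0 - PI / 2)) x), (proj2 (PP_Cinf x0) x). reflexivity. }
 apply Rminus_diag_uniq. rewrite <- E, <- !wavg_scal by auto.
 rewrite <- wavg_minus; [reflexivity| |]; apply (cont_mult (fun _ => _)); auto using cont_const.
Qed.

Lemma wallis_pos x0 n : 0 < wavg b (fun x => PP x0 x ^ n).
Proof.
 induction n as [|n IH].
 - simpl. rewrite wavg_one. lra.
 - use (wallis x0 n) as E. use (pos_INR n). nra.
Qed.

Lemma s_incr x y : x < y -> s x < s y.
Proof.
 intros Hxy. destruct (MVT_gen s x y (fun t => / b t)) as [c [_ E]].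
 - intros; apply Hf.
 - intros t _. apply continuity_pt_filterlim, (smooth_cont _ smooth_s).
 - use (fr_inv_pos c). nra.
Qed.

Lemma cos_away t eta : 0 <= eta <= PI -> eta <= t <= 2 * PI - eta -> cos t <= cos eta.
Proof.
 intros H1 H2. destruct (Rle_dec t PI) as [H|H].
 - apply cos_decr_1; lra.
 - replace t with (- (2 * PI - t) + 2 * PI) by ring. rewrite cos_plus, cos_2PI, sin_2PI, cos_neg.
  replace (cos (2 * PI - t) * 1 - sin (- (2 * PI - t)) * 0) with (cos (2 * PI - t)) by ring. apply cos_decr_1; lra.
Qed.

(* If v(x0) > 0 then v dominates an affine function of the bump P peaked at x0, so the moments of P^n
  would decay geometrically, against Wallis' recursion. *)
Lemma no_positive_value v x0 : cont v -> per v -> (forall z p, wavg b (fun x => v x * cs s z p x) = 0) -> ~ 0 < v x0.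
Proof.
 (* Multiplication by the bump mixes the frequency [z] with [z + 1] and [z - 1] only, so
    orthogonality to every [cs] passes from [v P^n] to [v P^(n+1)]. *)
 intros Hc Hp Hz Hpos. assert (Hall : forall n z p, wavg b (fun x => v x * PP x0 x ^ n * cs s z p x) = 0).
 { induction n as [|n IH]; intros z p.
  - rewrite <- (Hz z p). apply wavg_ext. intros; simpl; ring.
  - assert (Hcc : forall z p, cont (fun x => v x * PP x0 x ^ n * cs s z p x)).
   { intros z0 p0. apply cont_mult; [apply cont_mult; auto; apply PPn_cont|apply cs_cont]. }
   rewrite (wavg_ext _ (fun x => / 2 * (v x * PP x0 x ^ n * cs s z p x) +
    / 4 * (v x * PP x0 x ^ n * cs s (z + 1) (p + - s x0) x + v x * PP x0 x ^ n * cs s (z - 1) (p - - s x0) x))).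
   2:{ intros x. simpl. use (cs_mult z p 1 (- s x0) x) as E. unfold PP at 1.
     replace (v x * (/ 2 * (1 + cs s 1 (- s x0) x) * PP x0 x ^ n) * cs s z p x) with
      (/ 2 * v x * PP x0 x ^ n * cs s z p x + / 2 * v x * PP x0 x ^ n * (cs s z p x * cs s 1 (- s x0) x)) by ring. rewrite E. field. }
   rewrite wavg_plus, !wavg_scal, wavg_plus, !IH; auto.
   + ring.
   + apply cont_plus; auto.
   + apply (cont_mult (fun _ => _)); auto using cont_const.
   + apply (cont_mult (fun _ => _)); auto using cont_const. apply cont_plus; auto. }
 assert (Hint : forall n, wavg b (fun x => v x * PP x0 x ^ n) = 0).
 { intros n. rewrite <- (Hall n 0%Z 0). apply wavg_ext. intros x. unfold cs. rewrite Rmult_0_l, Rplus_0_r, cos_0. ring. }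
 set (c := v x0 / 2). assert (Hc0 : 0 < c) by (unfold c; lra).
 assert (Hd : exists d, 0 < d <= PI /\ forall x, Rabs (x - x0) < d -> c <= v x). { use (Hc x0) as Q. apply continuity_pt_filterlim in Q.
  destruct (Q c Hc0) as [a [Ha HQ]]. exists (Rmin a PI). split.
  - use PI_RGT_0. unfold Rmin. destruct (Rle_dec a PI); lra.
  - intros x Hx. destruct (Req_dec x x0) as [->|Hne]; [unfold c in *; lra|].
   assert (Hlt : Rabs (x - x0) < a) by (eapply Rlt_le_trans; [exact Hx|apply Rmin_l]).
   specialize (HQ x). simpl in HQ. unfold R_dist, D_x, no_cond in HQ.
   specialize (HQ (conj (conj I (not_eq_sym Hne)) Hlt)). apply Rabs_def2 in HQ. unfold c in *. lra. } destruct Hd as [d [[Hd0 Hd1] Hd]].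
 destruct (cont_per_bounded v Hc Hp) as [B HB]. assert (HB0 : 0 <= B) by (eapply Rle_trans; [apply Rabs_pos|apply (HB x0)]).
 set (eta := Rmin (s (x0 + d) - s x0) (s x0 - s (x0 - d))).
 use (s_incr x0 (x0 + d) ltac:(lra)) as I1. use (s_incr (x0 - d) x0 ltac:(lra)) as I2. assert (Hs_le : forall x y, x <= y -> s x <= s y).
 { intros x y [Hxy| ->]; [left; apply s_incr; auto|lra]. } assert (Hper2 : s (x0 + PI) = s (x0 - PI) + 2 * PI).
 { rewrite <- (fr_per s b Hf). f_equal. ring. } use (Hs_le (x0 + d) (x0 + PI) ltac:(lra)). use (Hs_le (x0 - PI) (x0 - d) ltac:(lra)).
 assert (He0 : 0 < eta). { unfold eta, Rmin. destruct Rle_dec; lra. } assert (He1 : eta <= s (x0 + d) - s x0) by apply Rmin_l.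
 assert (He2 : eta <= s x0 - s (x0 - d)) by apply Rmin_r. assert (HeP : eta < PI \/ eta <= PI) by (right; lra).
 assert (Hcos : cos eta < 1). { rewrite <- cos_0. apply cos_decreasing_1; lra. }
 (* [rho] bounds the bump outside the neighbourhood of [x0]. The slope [al] is chosen so that
    [al P - (al - c)] is at most [c] near [x0], where [v >= c], and at most [- B] elsewhere. *)
 set (rho := / 2 * (1 + cos eta)). assert (Hrho : rho < 1) by (unfold rho; lra).
 set (al := (c + B) / (1 - rho)). assert (Hal : c + B <= al * (1 - rho)) by (unfold al; right; field; lra).
 assert (Hal0 : 0 < al) by (unfold al; apply Rdiv_lt_0_compat; lra). assert (Hpt : forall x, al * PP x0 x - (al - c) <= v x).
 { intros x. destruct (per_reduce x (x0 - PI)) as [y [Hy E]]. rewrite <- (E v Hp), <- (E (PP x0) (proj2 (PP_Cinf x0))).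
  use (PP_range x0 y) as HR. destruct (Rlt_dec (Rabs (y - x0)) d) as [Hn|Hn].
  - specialize (Hd y Hn). nra.
  - assert (Hle : PP x0 y <= rho). { unfold PP, rho. mul_l; [lra|]. apply Rplus_le_compat_l. unfold cs.
    replace (1 * s y + - s x0) with (s y - s x0) by ring. destruct (Rle_dec x0 y) as [Hxy|Hxy].
    - rewrite Rabs_pos_eq in Hn by lra. apply cos_away; [lra|].
     use (Hs_le (x0 + d) y ltac:(lra)). use (Hs_le y (x0 + PI) ltac:(lra)). lra.
    - rewrite Rabs_left in Hn by lra. replace (s y - s x0) with (- (s x0 - s y)) by ring. rewrite cos_neg. apply cos_away; [lra|].
     use (Hs_le y (x0 - d) ltac:(lra)). use (Hs_le (x0 - PI) y ltac:(lra)). lra. }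
   specialize (HB y). apply Rabs_le_between in HB. nra. } assert (Hn : forall n, c * (2 * INR n + 2) <= al).
 (* Integrating the minorant against [P^n] bounds the ratio of consecutive moments by [1 - c / al],
    while Wallis' recursion gives the ratio [(2 n + 1) / (2 n + 2)]. *)
 { intros n. use (wallis x0 n) as W. use (wallis_pos x0 n) as Wp. use (pos_INR n). use (PPn_cont x0) as HPc.
  assert (Hin : al * wavg b (fun x => PP x0 x ^ S n) - (al - c) * wavg b (fun x => PP x0 x ^ n) <= 0).
  { rewrite <- (Hint n), <- !wavg_scal by auto. rewrite <- wavg_minus; try (apply (cont_mult (fun _ => _)); auto using cont_const).
   apply wavg_le.
   - apply (cont_minus (fun x => al * PP x0 x ^ S n) (fun x => (al - c) * PP x0 x ^ n)); apply (cont_mult (fun _ => _)); auto using cont_const.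
   - apply cont_mult; auto.
   - intros x. specialize (Hpt x). use (PP_range x0 x). assert (0 <= PP x0 x ^ n) by (apply pow_le; lra). simpl. nra. }
  set (I0 := wavg b (fun x => PP x0 x ^ n)) in *. set (I1' := wavg b (fun x => PP x0 x ^ S n)) in *.
  assert (al * ((2 * INR n + 1) * I0) <= (al - c) * ((2 * INR n + 2) * I0)). { rewrite <- W. nra. }
  apply (Rmult_le_reg_r I0); auto. nra. } destruct (INR_unbounded (al / c)) as [n Hn']. specialize (Hn n).
 assert (al / c * c = al) by (field; lra). use (pos_INR n). nra.
Qed.

Lemma cs_unique v : cont v -> per v -> (forall z p, wavg b (fun x => v x * cs s z p x) = 0) -> forall x, v x = 0.
Proof.
 intros Hc Hp Hz x. use (no_positive_value v x Hc Hp Hz) as H1. assert (H2 : ~ 0 < (fun y => (-1) * v y) x).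
 { apply (no_positive_value (fun y => (-1) * v y) x).
  - apply (cont_mult (fun _ => -1)); auto. apply cont_const.
  - intros y. cbv beta. rewrite Hp. reflexivity.
  - intros z p. rewrite (wavg_ext _ (fun y => (-1) * (v y * cs s z p y))) by (intros; ring).
   rewrite wavg_scal, Hz; [ring|]. apply cont_mult; auto. apply cs_cont. } simpl in H2. lra.
Qed.

Lemma cs_pos_span v n p : cont v -> (0 < n)%nat -> wavg b (fun x => v x * cs s (Z.of_nat n) p x) =
  (cos p * coef s b v (2 * (n - 1)) - sin p * coef s b v (2 * (n - 1) + 1)) / sqrt 2.
Proof.
 intros Hc Hn. unfold coef. assert (Hcv : forall k, cont (fun x => v x * phi s k x)) by (intros; apply cont_mult; auto; apply phi_cont).
 use sqrt2_pos.
 rewrite (wavg_ext _ (fun x => (cos p / sqrt 2) * (v x * phi s (2 * (n - 1)) x) - (sin p / sqrt 2) * (v x * phi s (2 * (n - 1) + 1) x))).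
 - rewrite wavg_minus, !wavg_scal; auto; try (apply (cont_mult (fun _ => _)); auto using cont_const). field. lra.
 - intros x. unfold phi, ee, cs. rewrite mu_even, mu_odd. replace (S (n - 1)) with n by lia.
  unfold ph. replace (Nat.even (2 * (n - 1))) with true by (symmetry; apply Nat.even_spec; exists (n - 1)%nat; lia).
  replace (Nat.even (2 * (n - 1) + 1)) with false.
  2:{ symmetry. rewrite <- Nat.negb_odd. replace (Nat.odd (2 * (n - 1) + 1)) with true; auto. symmetry. apply Nat.odd_spec. exists (n - 1)%nat; lia. }
  rewrite <- INR_IZR_INZ. set (y := INR n * s x). rewrite Rplus_0_r. assert (Es : cos (y + - (PI / 2)) = sin y).
  { change (y + - (PI / 2)) with (y - PI / 2). rewrite cos_minus, cos_PI2, sin_PI2. ring. } rewrite Es, cos_plus. field. lra.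
Qed.

Lemma cs_from_coef v : cont v -> wavg b v = 0 -> (forall k, coef s b v k = 0) -> forall z p, wavg b (fun x => v x * cs s z p x) = 0.
Proof.
 intros Hc H0 Hk z p. use sqrt2_pos. destruct (Z_lt_le_dec 0 z) as [Hz|Hz].
 - replace z with (Z.of_nat (Z.to_nat z)) by lia. rewrite cs_pos_span by (auto; lia). rewrite !Hk. field. lra.
 - destruct (Z.eq_dec z 0) as [->|Hne].
  + rewrite (wavg_ext _ (fun x => cos p * v x)); [rewrite wavg_scal, H0; auto; ring|].
   intros x. unfold cs. rewrite Rmult_0_l, Rplus_0_l. ring.
  + rewrite (wavg_ext _ (fun x => v x * cs s (Z.of_nat (Z.to_nat (- z))) (- p) x)).
   * rewrite cs_pos_span by (auto; lia). rewrite !Hk. field. lra.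
   * intros x. unfold cs. f_equal. rewrite Z2Nat.id by lia. rewrite opp_IZR. rewrite <- cos_neg. f_equal. ring.
Qed.

Theorem fourier_unique v : cont v -> per v -> wavg b v = 0 -> (forall k, coef s b v k = 0) -> forall x, v x = 0.
Proof. intros. apply cs_unique; auto. apply cs_from_coef; auto. Qed.

End Frame.

(** Free phases make the class closed under differentiation: the coefficients are multiplied by [mu]
    and the phases shifted by [PI / 2]. *)
Definition syn (x p : nat -> R) (y : R) : R := Series (fun k => x k * (sqrt 2 * cos (mu k * y + p k))).

Lemma mu_bound k : Rabs (mu k) <= 1 * w k ^ 1.
Proof. use (mu_ge1 k). rewrite Rabs_pos_eq by lra. rewrite pow_1, Rmult_1_l. apply mu_le_w. Qed.

Lemma rapid_mu x : rapid x -> rapid (fun k => mu k * x k).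
Proof. intros H. apply (rapid_mult x mu 1 1); auto. apply mu_bound. Qed.

Lemma sqrt2_cos_bound y : Rabs (sqrt 2 * cos y) <= 2.
Proof.
 rewrite Rabs_mult. use sqrt2_pos. use sqrt2_le. rewrite (Rabs_pos_eq (sqrt 2)) by lra.
 assert (Rabs (cos y) <= 1) by (apply Rabs_le, COS_bound). use (Rabs_pos (cos y)). nra.
Qed.

Lemma rapid_bounded_series x (f : nat -> R) B : rapid x -> (forall k, Rabs (f k) <= B) -> is_series (fun k => x k * f k) (Series (fun k => x k * f k)).
Proof.
 intros Hx Hf. apply rapid_is_series. apply rapid_ext with (fun k => f k * x k); [intros; ring|].
 apply (rapid_mult x f B 0); auto. intros; simpl; rewrite Rmult_1_r; auto.
Qed.

Lemma syn_derive x p y : rapid x -> is_derive (syn x p) y (syn (fun k => mu k * x k) (fun k => p k + PI / 2) y).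
Proof.
 (* Decay of order 4 pays for the factor [mu^2] in the quadratic remainder of each cosine and leaves
    the summable [1 / w^2]. *)
 intros Hx. destruct (Hx 4%nat) as [D HD]. apply (is_derive_quadratic _ _ _ (2 * (2 * D)) 1 Rlt_0_1). intros y' _. unfold syn.
 assert (S1 : forall y, is_series (fun k => x k * (sqrt 2 * cos (mu k * y + p k))) (Series (fun k => x k * (sqrt 2 * cos (mu k * y + p k))))).
 { intros. apply rapid_bounded_series with 2; auto. intros; apply sqrt2_cos_bound. }
 assert (S2 : is_series (fun k => mu k * x k * (sqrt 2 * cos (mu k * y + (p k + PI / 2)))) (Series (fun k => mu k * x k * (sqrt 2 * cos (mu k * y + (p k + PI / 2)))))).
 { intros. apply (rapid_bounded_series (fun k => mu k * x k)) with 2; [apply rapid_mu; auto|]. intros; apply sqrt2_cos_bound. }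
 rewrite <- Series_minus by (eexists; eauto). rewrite <- Series_scal_l. rewrite <- Series_minus.
 - replace (2 * (2 * D) * (y' - y) ^ 2) with (2 * (2 * D * (y' - y) ^ 2)) by ring. apply series_bound. intros k.
  replace (x k * (sqrt 2 * cos (mu k * y' + p k)) - x k * (sqrt 2 * cos (mu k * y + p k)) - (y' - y) * (mu k * x k * (sqrt 2 * cos (mu k * y + (p k + PI / 2)))))
   with (x k * sqrt 2 * (cos (mu k * y' + p k) - cos (mu k * y + p k) - (mu k * y' + p k - (mu k * y + p k)) * (- sin (mu k * y + p k)))).
  2:{ replace (mu k * y + (p k + PI / 2)) with (PI / 2 + (mu k * y + p k)) by ring. rewrite (sin_cos (mu k * y + p k)). ring. }
  rewrite !Rabs_mult. use sqrt2_pos. use sqrt2_le. rewrite (Rabs_pos_eq (sqrt 2)) by lra.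
  use (cos_taylor2 (mu k * y + p k) (mu k * y' + p k)) as T.
  replace (mu k * y' + p k - (mu k * y + p k)) with (mu k * (y' - y)) in T |- * by ring.
  specialize (HD k). use (mu_ge1 k). use (mu_le_w k). assert (T2 : (mu k * (y' - y)) ^ 2 <= w k ^ 2 * (y' - y) ^ 2).
  { rewrite Rpow_mult_distr. mul_r; [apply pow2_ge_0|]. apply pow_incr; lra. }
  eapply Rle_trans; [mul_lr; [apply Rmult_le_pos; [apply Rabs_pos|lra]|apply Rabs_pos| |eapply Rle_trans; [exact T|exact T2]]|].
  { mul_lr; [apply Rabs_pos|lra|exact HD|exact sqrt2_le]. } right. use (w_pos k). field. lra.
 - eexists. apply (is_series_minus (fun k => x k * (sqrt 2 * cos (mu k * y' + p k))) (fun k => x k * (sqrt 2 * cos (mu k * y + p k)))); eauto.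
 - apply ex_series_scal_R. eexists; eauto.
Qed.

Lemma smooth_syn x p : rapid x -> smooth (syn x p).
Proof.
 intros Hx. apply (smooth_class (fun u => exists x p, rapid x /\ u = syn x p)); [|eauto].
 intros u [x' [p' [Hx' ->]]]. eexists. split; [|intros y; apply syn_derive; auto].
 exists (fun k => mu k * x' k), (fun k => p' k + PI / 2). split; auto. apply rapid_mu; auto.
Qed.

(** * Fourier expansion and Parseval's identity for smooth functions *)

Section Expansion.
Variables s b : R -> R.
Hypothesis Hf : frame s b.

Definition synth (x : nat -> R) (t : R) : R := Series (fun k => x k * phi s k t).

Lemma synth_Cinf x : rapid x -> Cinf (synth x).
Proof.
 intros Hx. split.
 - apply (smooth_comp (syn x ph) s); [apply smooth_syn; auto|eapply smooth_s; eauto].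
 - intros t. apply Series_ext. intros k. rewrite (proj2 (phi_Cinf s b Hf k) t). reflexivity.
Qed.

Lemma phi_bound k t : Rabs (phi s k t) <= 2.
Proof. apply ee_bound. Qed.

Lemma wavg_series (a : nat -> R -> R) u B : (forall k, cont (a k)) -> (forall k x, Rabs (a k x) <= B / w k ^ 2) ->
 cont u -> (forall x, u x = Series (fun k => a k x)) -> is_series (fun k => wavg b (a k)) (wavg b u).
Proof.
 intros Ha HB Hu E. apply is_series_sm. assert (Hb : forall n, Rabs (sm (fun k => wavg b (a k)) n - wavg b u) <= (2 * B) / w n).
 { intros n. rewrite Rabs_minus_sym. assert (Es : sm (fun k => wavg b (a k)) n = wavg b (fun x => sm (fun k => a k x) n)).
  { induction n as [|n IH]; simpl; [symmetry; apply (wavg_const s b Hf)|].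
   rewrite (wavg_plus s b Hf (fun x => sm (fun k => a k x) n)), IH; auto. apply cont_sm; auto. }
  rewrite Es, <- (wavg_minus s b Hf); auto; [|apply cont_sm; auto]. apply (wavg_abs_le s b Hf).
  - apply cont_minus; auto. apply cont_sm; auto.
  - intros x. rewrite E. apply series_tail. intros; apply HB. }
 apply is_lim_seq_spec. intros eps. destruct (eventually_lt_w (2 * B) eps (cond_pos eps)) as [N HN].
 exists N. intros n Hn. eapply Rle_lt_trans; [apply Hb|apply HN; auto].
Qed.

Lemma synth_pair x v : rapid x -> Cinf v -> is_series (fun k => x k * coef s b v k) (wavg b (fun t => synth x t * v t)).
Proof.
 intros Hx Hv. destruct (cont_per_bounded v (Cinf_cont _ Hv) (proj2 Hv)) as [M HM]. destruct (Hx 2%nat) as [D HD].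
 apply is_series_ext_R with (fun k => wavg b (fun t => x k * (v t * phi s k t))).
 { intros k. rewrite (wavg_scal s b Hf); [reflexivity|]. apply cont_mult; [apply Cinf_cont; auto|apply (phi_cont s b Hf)]. }
 apply wavg_series with (D * (M * 2)).
 - intros k. apply (cont_mult (fun _ => x k)); [apply cont_const|]. apply cont_mult; [apply Cinf_cont; auto|apply (phi_cont s b Hf)].
 - intros k t. rewrite !Rabs_mult. replace (D * (M * 2) / w k ^ 2) with ((D / w k ^ 2) * (M * 2)) by (unfold Rdiv; ring).
  mul_lr; auto using Rabs_pos.
  + apply Rmult_le_pos; apply Rabs_pos.
  + mul_lr; auto using Rabs_pos, phi_bound.
 - apply cont_mult; apply Cinf_cont; auto. apply synth_Cinf; auto.
 - intros t. unfold synth. rewrite <- Series_scal_r. apply Series_ext. intros; ring.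
Qed.

Lemma coef_phi j k : coef s b (phi s j) k = dl j k.
Proof. apply (phi_orthonormal s b Hf). Qed.

Lemma coef_synth x j : rapid x -> coef s b (synth x) j = x j.
Proof.
 intros Hx. use (synth_pair x (phi s j) Hx (phi_Cinf s b Hf j)) as S. apply is_series_unique in S. unfold coef. rewrite <- S.
 rewrite (Series_ext _ (fun k => x k * dl j k)) by (intros; rewrite coef_phi; reflexivity). apply ip_dl_r.
Qed.

Lemma wavg_synth x : rapid x -> wavg b (synth x) = 0.
Proof.
 intros Hx. use (synth_pair x (fun _ => 1) Hx (Cinf_const 1)) as S. apply is_series_unique in S.
 rewrite (wavg_ext b (synth x) (fun t => synth x t * 1)) by (intros; ring). rewrite <- S.
 rewrite (Series_ext _ (fun k => 0 * x k)); [rewrite Series_scal_l; ring|].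
 intros k. unfold coef. rewrite (wavg_ext b _ (phi s k)) by (intros; ring). rewrite (wavg_phi s b Hf). ring.
Qed.

Lemma cs_decay r : forall v, Cinf v -> exists B, forall z p, Rabs (IZR z) ^ r * Rabs (wavg b (fun x => v x * cs s z p x)) <= B.
Proof.
 induction r as [|r IH]; intros v Hv.
 - destruct (cont_per_bounded v (Cinf_cont _ Hv) (proj2 Hv)) as [M HM]. exists M. intros z p. simpl. rewrite Rmult_1_l.
  apply (wavg_abs_le s b Hf).
  + apply cont_mult; [apply Cinf_cont; auto|apply (cs_cont s b Hf)].
  + intros x. rewrite Rabs_mult. assert (Rabs (cs s z p x) <= 1) by (apply Rabs_le, COS_bound).
   specialize (HM x). use (Rabs_pos (v x)). use (Rabs_pos (cs s z p x)). nra.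
 - destruct (IH (fun x => b x * Derive v x)) as [B HB]. { apply Cinf_mult; [apply Hf|apply Cinf_Derive; auto]. }
  exists B. intros z p. simpl. replace (Rabs (IZR z) * Rabs (IZR z) ^ r * Rabs (wavg b (fun x => v x * cs s z p x))) with
   (Rabs (IZR z) ^ r * Rabs (IZR z * wavg b (fun x => v x * cs s z p x))) by (rewrite Rabs_mult; ring).
  rewrite (wavg_cs_parts s b Hf z p v Hv), Rabs_Ropp. apply HB.
Qed.

Lemma coef_cs v k : cont v -> coef s b v k = sqrt 2 * wavg b (fun x => v x * cs s (muz k) (ph k) x).
Proof.
 intros Hv. unfold coef. rewrite <- (wavg_scal s b Hf); [|apply cont_mult; auto; apply (cs_cont s b Hf)].
 apply wavg_ext. intros x. rewrite phi_cs. ring.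
Qed.

Lemma coef_rapid v : Cinf v -> rapid (coef s b v).
Proof.
 intros Hv r. destruct (cs_decay r v Hv) as [B HB]. exists (2 ^ r * (2 * B)). intros k. apply le_div_w.
 rewrite coef_cs by (apply Cinf_cont; auto). rewrite Rabs_mult. use sqrt2_pos. use sqrt2_le.
 rewrite (Rabs_pos_eq (sqrt 2)) by lra. specialize (HB (muz k) (ph k)). rewrite <- mu_IZR in HB.
 use (mu_ge1 k). rewrite (Rabs_pos_eq (mu k)) in HB by lra.
 set (X := Rabs (wavg b (fun x => v x * cs s (muz k) (ph k) x))) in *. assert (0 <= X) by apply Rabs_pos.
 assert (Hw : w k ^ r <= 2 ^ r * mu k ^ r). { rewrite <- Rpow_mult_distr. apply pow_incr. split; [left; apply w_pos|apply w_le_mu]. }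
 assert (0 < 2 ^ r) by (apply pow_lt; lra). use (wp_pos k r). assert (X * w k ^ r <= 2 ^ r * B).
 { via (X * (2 ^ r * mu k ^ r)); [mul_l; auto|]. nra. } assert (0 <= X * w k ^ r) by nra. nra.
Qed.

Lemma coef_plus u v k : cont u -> cont v -> coef s b (fun x => u x + v x) k = coef s b u k + coef s b v k.
Proof.
 intros Hu Hv. unfold coef. rewrite <- (wavg_plus s b Hf); try (apply cont_mult; auto; apply (phi_cont s b Hf)).
 apply wavg_ext. intros; ring.
Qed.

Lemma coef_scal c u k : cont u -> coef s b (fun x => c * u x) k = c * coef s b u k.
Proof.
 intros Hu. unfold coef. rewrite <- (wavg_scal s b Hf); try (apply cont_mult; auto; apply (phi_cont s b Hf)). apply wavg_ext. intros; ring.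
Qed.

Lemma coef_minus u v k : cont u -> cont v -> coef s b (fun x => u x - v x) k = coef s b u k - coef s b v k.
Proof.
 intros Hu Hv. unfold coef. rewrite <- (wavg_minus s b Hf); try (apply cont_mult; auto; apply (phi_cont s b Hf)).
 apply wavg_ext. intros; ring.
Qed.

Lemma coef_const c k : coef s b (fun _ => c) k = 0.
Proof.
 unfold coef. rewrite (wavg_scal s b Hf c (phi s k)) by apply (phi_cont s b Hf). rewrite (wavg_phi s b Hf). ring.
Qed.

Lemma fourier_eq u v : cont u -> per u -> cont v -> per v -> wavg b u = wavg b v -> (forall k, coef s b u k = coef s b v k) ->
 forall x, u x = v x.
Proof.
 intros Hu Pu Hv Pv E0 Ek x. apply Rminus_diag_uniq. apply (fourier_unique s b Hf (fun x => u x - v x)).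
 - apply cont_minus; auto.
 - intros y. rewrite Pu, Pv. reflexivity.
 - rewrite (wavg_minus s b Hf); auto. rewrite E0; ring.
 - intros k. rewrite coef_minus; auto. rewrite Ek; ring.
Qed.

(** The synthesized series is smooth and has the mean and coefficients of [v]; uniqueness then
    identifies the two, and no summation kernel is involved. *)
Theorem fourier_expansion v : Cinf v -> forall x, v x = wavg b v + synth (coef s b v) x.
Proof.
 intros Hv. use (coef_rapid v Hv) as Hr. use (synth_Cinf _ Hr) as Hs. apply (fourier_eq v (fun x => wavg b v + synth (coef s b v) x)).
 - apply Cinf_cont; auto.
 - apply Hv.
 - apply cont_plus; [apply cont_const|apply Cinf_cont; auto].
 - apply (Cinf_plus (fun _ => wavg b v)); auto. apply Cinf_const.
 - rewrite (wavg_plus s b Hf (fun _ => wavg b v)), (wavg_const s b Hf), wavg_synth; auto using cont_const, Cinf_cont. ring.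
 - intros k. rewrite (coef_plus (fun _ => wavg b v)), coef_const, coef_synth; auto using cont_const, Cinf_cont. ring.
Qed.

Theorem fourier_parseval u v : Cinf u -> Cinf v -> wavg b (fun x => u x * v x) = wavg b u * wavg b v + ip (coef s b u) (coef s b v).
Proof.
 intros Hu Hv. use (coef_rapid u Hu) as Hr. use (synth_Cinf _ Hr) as Hs.
 rewrite (wavg_ext b _ (fun x => wavg b u * v x + synth (coef s b u) x * v x)).
 - rewrite (wavg_plus s b Hf (fun x => wavg b u * v x)), (wavg_scal s b Hf).
  + f_equal. symmetry. apply is_series_unique. apply synth_pair; auto.
  + apply Cinf_cont; auto.
  + apply Cinf_cont, Cinf_scal; auto.
  + apply Cinf_cont, Cinf_mult; auto.
 - intros x. rewrite (fourier_expansion u Hu x) at 1. ring.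
Qed.

End Expansion.

(** * The operators [Lr] (Lambda) and [Jr] (-i times the Hilbert transform) on real functions *)

Definition one_f (_ : R) : R := 1.
Definition id_f (x : R) : R := x.
Definition fc (u : R -> R) (k : nat) : R := avg (fun x => u x * ee k x).

(** The trivial frame gives ordinary Fourier series, so that one proof covers the expansions in [x]
    and in [s]. *)
Lemma frame_id : frame id_f one_f.
Proof.
 split.
 - apply (Cinf_const 1).
 - intros; unfold one_f; lra.
 - intros x. unfold one_f, id_f. rewrite Rinv_1. apply (is_derive_id x).
 - reflexivity.
Qed.

Lemma wavg_id u : wavg one_f u = avg u.
Proof. apply avg_ext. intros. unfold one_f. rewrite Rinv_1. ring. Qed.

Lemma coef_id u : coef id_f one_f u = fc u.
Proof. fext. intros k. unfold coef. rewrite wavg_id. reflexivity. Qed.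

Lemma ee_phi k : ee k = phi id_f k.
Proof. reflexivity. Qed.

Lemma ee_Cinf k : Cinf (ee k).
Proof. rewrite ee_phi. apply (phi_Cinf _ _ frame_id). Qed.

Lemma ee_cont k : cont (ee k).
Proof. apply Cinf_cont, ee_Cinf. Qed.

Lemma fc_rapid u : Cinf u -> rapid (fc u).
Proof. intros. rewrite <- coef_id. apply (coef_rapid _ _ frame_id); auto. Qed.

Lemma fc_plus u v k : cont u -> cont v -> fc (fun x => u x + v x) k = fc u k + fc v k.
Proof. intros. rewrite <- !coef_id. apply (coef_plus _ _ frame_id); auto. Qed.
Lemma fc_scal c u k : cont u -> fc (fun x => c * u x) k = c * fc u k.
Proof. intros. rewrite <- !coef_id. apply (coef_scal _ _ frame_id); auto. Qed.
Lemma fc_minus u v k : cont u -> cont v -> fc (fun x => u x - v x) k = fc u k - fc v k.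
Proof. intros. rewrite <- !coef_id. apply (coef_minus _ _ frame_id); auto. Qed.
Lemma fc_const c k : fc (fun _ => c) k = 0.
Proof. rewrite <- coef_id. apply (coef_const _ _ frame_id). Qed.
Lemma fc_ee j k : fc (ee j) k = dl j k.
Proof. rewrite <- coef_id. apply (coef_phi _ _ frame_id). Qed.
Lemma avg_ee k : avg (ee k) = 0.
Proof. rewrite <- wavg_id. apply (wavg_phi _ _ frame_id). Qed.

Lemma fc_eq u v : cont u -> per u -> cont v -> per v -> avg u = avg v -> (forall k, fc u k = fc v k) -> u = v.
Proof.
 intros Hu Pu Hv Pv E0 Ek. fext. apply (fourier_eq _ _ frame_id); auto; [rewrite !wavg_id; auto|rewrite !coef_id; auto].
Qed.

Lemma fc_parseval u v : Cinf u -> Cinf v -> avg (fun x => u x * v x) = avg u * avg v + ip (fc u) (fc v).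
Proof. intros. rewrite <- !coef_id, <- !wavg_id. apply (fourier_parseval _ _ frame_id); auto. Qed.

Definition Lr (u : R -> R) : R -> R := synth id_f (fun k => mu k * fc u k).
(** The conjugate function: every phase is turned back by a quarter period. The Hilbert transform of
    the development is [i] times this one. *)
Definition Jr (u : R -> R) : R -> R := syn (fc u) (fun k => ph k - PI / 2).

Lemma Lr_Cinf u : Cinf u -> Cinf (Lr u).
Proof. intros H. apply (synth_Cinf _ _ frame_id). apply rapid_mu, fc_rapid; auto. Qed.

Lemma avg_Lr u : Cinf u -> avg (Lr u) = 0.
Proof. intros H. rewrite <- wavg_id. apply (wavg_synth _ _ frame_id). apply rapid_mu, fc_rapid; auto. Qed.

Lemma fc_Lr u k : Cinf u -> fc (Lr u) k = mu k * fc u k.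
Proof. intros H. transitivity (coef id_f one_f (Lr u) k); [rewrite coef_id; reflexivity|]. apply (coef_synth _ _ frame_id). apply rapid_mu, fc_rapid; auto. Qed.

Lemma Jr_derive u x : Cinf u -> is_derive (Jr u) x (Lr u x).
Proof.
 intros H. use (syn_derive (fc u) (fun k => ph k - PI / 2) x (fc_rapid u H)) as D.
 replace (Lr u x) with (syn (fun k => mu k * fc u k) (fun k => ph k - PI / 2 + PI / 2) x); auto.
 unfold Lr, synth. apply Series_ext. intros k. unfold phi, ee, id_f. do 4 f_equal. ring.
Qed.

Lemma Jr_Cinf u : Cinf u -> Cinf (Jr u).
Proof.
 intros H. split; [apply smooth_syn, fc_rapid; auto|]. intros t. apply Series_ext. intros k. do 2 f_equal.
 use (proj2 (cs_Cinf _ _ frame_id (muz k) (ph k - PI / 2)) t) as E. unfold cs, id_f in E. rewrite <- mu_IZR in E. exact E.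
Qed.

Lemma Lr_unique u v : Cinf u -> Cinf v -> avg v = 0 -> (forall k, fc v k = mu k * fc u k) -> v = Lr u.
Proof.
 intros Hu Hv H0 Hk. use (Lr_Cinf u Hu) as HL. apply fc_eq; auto using Cinf_cont; try apply Hv; try apply HL.
 - rewrite avg_Lr; auto.
 - intros k. rewrite fc_Lr; auto.
Qed.

Lemma Lr_plus u v : Cinf u -> Cinf v -> Lr (fun x => u x + v x) = fun x => Lr u x + Lr v x.
Proof.
 intros Hu Hv. symmetry. use (Lr_Cinf u Hu). use (Lr_Cinf v Hv). apply Lr_unique.
 - apply Cinf_plus; auto.
 - apply Cinf_plus; auto.
 - rewrite avg_plus, !avg_Lr; auto using Cinf_cont. ring.
 - intros k. rewrite !fc_plus, !fc_Lr; auto using Cinf_cont. ring.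
Qed.

Lemma Lr_scal c u : Cinf u -> Lr (fun x => c * u x) = fun x => c * Lr u x.
Proof.
 intros Hu. symmetry. use (Lr_Cinf u Hu). apply Lr_unique.
 - apply Cinf_scal; auto.
 - apply Cinf_scal; auto.
 - rewrite avg_scal, !avg_Lr; auto using Cinf_cont. ring.
 - intros k. rewrite !fc_scal, !fc_Lr; auto using Cinf_cont. ring.
Qed.

Lemma Lr_ee k : Lr (ee k) = fun x => mu k * ee k x.
Proof.
 symmetry. apply Lr_unique.
 - apply ee_Cinf.
 - apply Cinf_scal, ee_Cinf.
 - rewrite avg_scal, avg_ee by apply ee_cont. ring.
 - intros j. rewrite fc_scal, fc_ee by apply ee_cont. unfold dl. destruct (Nat.eq_dec k j); [subst|]; ring.
Qed.

Lemma Lr_const c : Lr (fun _ => c) = fun _ => 0.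
Proof.
 symmetry. apply Lr_unique; try apply Cinf_const.
 - apply avg_const.
 - intros k. rewrite !fc_const. ring.
Qed.

Lemma Lr_self_adjoint u v : Cinf u -> Cinf v -> avg (fun x => Lr u x * v x) = avg (fun x => u x * Lr v x).
Proof.
 intros Hu Hv. rewrite !fc_parseval by auto using Lr_Cinf. rewrite !avg_Lr by auto. rewrite Rmult_0_l, Rmult_0_r. f_equal.
 apply Series_ext. intros k. rewrite !fc_Lr by auto. ring.
Qed.

(** Every frequency is at least 1; the second bound is a spectral gap above the constants. *)
Lemma Lr_form_pos u : Cinf u -> fc u 0%nat * fc u 0%nat <= avg (fun x => u x * Lr u x) /\ ip (fc u) (fc u) <= avg (fun x => u x * Lr u x).
Proof.
 intros Hu. rewrite fc_parseval by auto using Lr_Cinf. rewrite avg_Lr, Rmult_0_r, Rplus_0_l by auto.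
 assert (Hle : ip (fc u) (fc u) <= ip (fc u) (fc (Lr u))). { apply Series_le.
  - intros k. rewrite fc_Lr by auto. use (mu_ge1 k).
   replace (fc u k * (mu k * fc u k)) with (mu k * (fc u k * fc u k)) by ring. assert (0 <= fc u k * fc u k) by nra. nra.
  - eexists. apply ip_is_series; apply rapid_l2; apply fc_rapid; auto using Lr_Cinf. }
 split; auto. below Hle. apply ip_coord. apply rapid_l2, fc_rapid; auto.
Qed.

Lemma avg_Lr_cs u z p : Cinf u -> (0 < z)%Z -> avg (fun x => Lr u x * cs id_f z p x) = IZR z * avg (fun x => u x * cs id_f z p x).
Proof.
 intros Hu Hz. use (Lr_Cinf u Hu) as HL. rewrite <- !wavg_id.
 replace z with (Z.of_nat (Z.to_nat z)) by lia. set (n := Z.to_nat z). assert (Hn : (0 < n)%nat) by (unfold n; lia).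
 rewrite !(cs_pos_span _ _ frame_id) by (auto using Cinf_cont). rewrite !coef_id, !fc_Lr by auto.
 rewrite mu_even, mu_odd. replace (S (n - 1)) with n by lia. rewrite INR_IZR_INZ. field. use sqrt2_pos; lra.
Qed.

Lemma avg_Jr_cs u z p : Cinf u -> (0 < z)%Z -> avg (fun x => Jr u x * cs id_f z p x) = - avg (fun x => u x * cs id_f z (p - PI / 2) x).
Proof.
 intros Hu Hz. use (wavg_cs_parts _ _ frame_id z p (Jr u) (Jr_Cinf u Hu)) as E. rewrite !wavg_id in E.
 rewrite (avg_ext (fun x => one_f x * Derive (Jr u) x * cs id_f z (p - PI / 2) x) (fun x => Lr u x * cs id_f z (p - PI / 2) x)) in E.
 - rewrite avg_Lr_cs in E by auto. assert (IZR z <> 0) by (apply not_0_IZR; lia). apply (Rmult_eq_reg_l (IZR z)); auto. rewrite E. ring.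
 - intros x. unfold one_f. rewrite (is_derive_unique _ _ _ (Jr_derive u x Hu)). ring.
Qed.

(** * Real form of the Fourier multipliers [Lam] and [Hil] *)

Lemma Re_csum f n : Re (csum f n) = sm (fun k => Re (f k)) n.
Proof. induction n as [|n IH]; simpl; [reflexivity|]. unfold Re in *. rewrite <- IH. reflexivity. Qed.

Lemma Im_csum f n : Im (csum f n) = sm (fun k => Im (f k)) n.
Proof. induction n as [|n IH]; simpl; [reflexivity|]. unfold Im in *. rewrite <- IH. reflexivity. Qed.

Lemma sm_first f n : sm f (S n) = f 0%nat + sm (fun k => f (S k)) n.
Proof. induction n as [|n IH]; [simpl; ring|]. cbn [sm] in *. rewrite IH. ring. Qed.

(** The partial sums defining the multipliers run from [- M] to [M]; joining [k] with [- k] turns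
    exponentials into the cosine and sine terms of the real expansion. *)
Lemma sm_symmetric (g : Z -> R) M : sm (fun j => g (Z.of_nat j - Z.of_nat M)%Z) (2 * M + 1) =
 g 0%Z + sm (fun i => g (Z.of_nat (S i)) + g (- Z.of_nat (S i))%Z) M.
Proof.
 induction M as [|M IH]; [simpl; ring|]. replace (2 * S M + 1)%nat with (S (S (2 * M + 1))) by lia. rewrite sm_first. cbn [sm].
 rewrite (sm_ext (fun k => g (Z.of_nat (S k) - Z.of_nat (S M))%Z) (fun j => g (Z.of_nat j - Z.of_nat M)%Z)) by (intros; f_equal; lia).
 rewrite IH. replace (Z.of_nat 0 - Z.of_nat (S M))%Z with (- Z.of_nat (S M))%Z by lia.
 replace (Z.of_nat (S (2 * M + 1)) - Z.of_nat (S M))%Z with (Z.of_nat (S M)) by lia. ring.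
Qed.

Definition cav (u : R -> R) (x : R) : R := avg (fun t => u t * cos (x * t)).
Definition sav (u : R -> R) (x : R) : R := avg (fun t => u t * sin (x * t)).

Lemma cav_opp u x : cav u (- x) = cav u x.
Proof. apply avg_ext. intros t. rewrite <- cos_neg. do 2 f_equal. ring. Qed.

Lemma cont_cos_lin x : cont (fun t => cos (x * t)).
Proof. apply (is_derive_cont _ (fun t => - (x * sin (x * t)))). intros t. auto_derive; auto. ring. Qed.

Lemma cont_sin_lin x : cont (fun t => sin (x * t)).
Proof. apply (is_derive_cont _ (fun t => x * cos (x * t))). intros t. auto_derive; auto. ring. Qed.

Lemma sav_opp u x : cont u -> sav u (- x) = - sav u x.
Proof.
 intros Hu. unfold sav. rewrite (avg_ext _ (fun t => (-1) * (u t * sin (x * t)))).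
 - rewrite avg_scal; [ring|]. apply cont_mult; auto. apply cont_sin_lin.
 - intros t. replace (- x * t) with (- (x * t)) by ring. rewrite sin_neg. ring.
Qed.

Lemma uhat_avg u k : cont (fun t => Re (u t)) -> cont (fun t => Im (u t)) ->
 uhat u k = (cav (fun t => Re (u t)) (IZR k) + sav (fun t => Im (u t)) (IZR k),
       cav (fun t => Im (u t)) (IZR k) - sav (fun t => Re (u t)) (IZR k)).
Proof.
 intros H1 H2. unfold cav, sav. rewrite <- avg_plus, <- avg_minus;
  try (apply cont_mult; auto using cont_cos_lin, cont_sin_lin). reflexivity.
Qed.

Lemma even_double i : Nat.even (2 * i) = true.
Proof. apply Nat.even_spec. exists i; lia. Qed.

Lemma even_double1 i : Nat.even (2 * i + 1) = false.
Proof. rewrite <- Nat.negb_odd. replace (Nat.odd (2 * i + 1)) with true; auto. symmetry. apply Nat.odd_spec. exists i; lia. Qed.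

Lemma cos_m_PI2 y : cos (y + - (PI / 2)) = sin y.
Proof. change (y + - (PI / 2)) with (y - PI / 2). rewrite cos_minus, cos_PI2, sin_PI2. ring. Qed.

Lemma ee_even i x : ee (2 * i) x = sqrt 2 * cos (INR (S i) * x).
Proof. unfold ee, ph. rewrite mu_even, even_double, Rplus_0_r. reflexivity. Qed.

Lemma ee_odd i x : ee (2 * i + 1) x = sqrt 2 * sin (INR (S i) * x).
Proof. unfold ee, ph. rewrite mu_odd, even_double1, cos_m_PI2. reflexivity. Qed.

Lemma fc_even u i : cont u -> fc u (2 * i) = sqrt 2 * cav u (INR (S i)).
Proof.
 intros Hu. unfold fc, cav. rewrite <- avg_scal; [|apply cont_mult; auto using cont_cos_lin].
 apply avg_ext. intros t. rewrite ee_even. ring.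
Qed.

Lemma fc_odd u i : cont u -> fc u (2 * i + 1) = sqrt 2 * sav u (INR (S i)).
Proof.
 intros Hu. unfold fc, sav. rewrite <- avg_scal; [|apply cont_mult; auto using cont_sin_lin].
 apply avg_ext. intros t. rewrite ee_odd. ring.
Qed.

Lemma lim_double (a : nat -> R) l : is_series a l -> Lim_seq (fun M => sm a (2 * M)) = l.
Proof.
 intros H. apply is_lim_seq_unique. apply is_series_sm in H. apply (is_lim_seq_subseq (sm a) l (fun n => (2 * n)%nat)) in H; auto.
 apply eventually_subseq. intros; lia.
Qed.

Lemma Lr_is_series u x : Cinf u -> is_series (fun k => mu k * fc u k * ee k x) (Lr u x).
Proof.
 intros Hu. apply (rapid_bounded_series (fun k => mu k * fc u k) (fun k => ee k x) 2).
 - apply rapid_mu, fc_rapid; auto.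
 - intros; apply ee_bound.
Qed.

Lemma Jr_is_series u x : Cinf u -> is_series (fun k => fc u k * (sqrt 2 * cos (mu k * x + (ph k - PI / 2)))) (Jr u x).
Proof.
 intros Hu. apply (rapid_bounded_series (fc u) _ 2).
 - apply fc_rapid; auto.
 - intros; apply sqrt2_cos_bound.
Qed.

Lemma sgn_IZR_opp n : IZR (Z.abs (- Z.of_nat (S n))) = INR (S n).
Proof. rewrite Z.abs_opp, Z.abs_eq by lia. symmetry. apply INR_IZR_INZ. Qed.

(** The [M]-th complex partial sum is exactly the sum of the first [2 M] terms of the real series.
    As that series converges, [real (Lim_seq _)] is a genuine limit. *)
Lemma Lam_real u x : cCinf u -> Lam u x = (Lr (fun t => Re (u t)) x, Lr (fun t => Im (u t)) x).
Proof.
 intros [HU HV]. use (Cinf_cont _ HU) as CU. use (Cinf_cont _ HV) as CV. unfold Lam, fmult. f_equal.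
 - rewrite (Lim_seq_ext _ (fun M => sm (fun k => mu k * fc (fun t => Re (u t)) k * ee k x) (2 * M))).
  + rewrite (lim_double _ _ (Lr_is_series _ x HU)). reflexivity.
  + intros M. unfold psum. rewrite Re_csum.
   rewrite (sm_symmetric (fun k => Re (Cmult (Cmult (RtoC (IZR (Z.abs k))) (uhat u k)) (cexpi (IZR k * x)))) M). rewrite sm_double.
   match goal with |- ?A + ?B = ?C => replace A with 0 by (unfold Re; simpl; ring) end. rewrite Rplus_0_l. apply sm_ext. intros i _.
   rewrite !uhat_avg by auto. rewrite sgn_IZR_opp, Z.abs_eq by lia. rewrite opp_IZR, <- INR_IZR_INZ.
   rewrite !cav_opp, !sav_opp by auto. rewrite mu_even, mu_odd, fc_even, fc_odd, ee_even, ee_odd by auto.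
   unfold cexpi. replace (- INR (S i) * x) with (- (INR (S i) * x)) by ring. rewrite cos_neg, sin_neg.
   set (c1 := cav (fun t => Re (u t)) (INR (S i))). set (s1 := sav (fun t => Im (u t)) (INR (S i))).
   set (c2 := cav (fun t => Im (u t)) (INR (S i))). set (s2 := sav (fun t => Re (u t)) (INR (S i))).
   set (n := INR (S i)) in *. set (cc := cos (n * x)). set (ss := sin (n * x)). unfold Re, Cmult, RtoC; cbn [fst snd].
   transitivity (sqrt 2 * sqrt 2 * n * (c1 * cc + s2 * ss)); [rewrite sqrt2_sq|]; ring.
 - rewrite (Lim_seq_ext _ (fun M => sm (fun k => mu k * fc (fun t => Im (u t)) k * ee k x) (2 * M))).
  + rewrite (lim_double _ _ (Lr_is_series _ x HV)). reflexivity.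
  + intros M. unfold psum. rewrite Im_csum.
   rewrite (sm_symmetric (fun k => Im (Cmult (Cmult (RtoC (IZR (Z.abs k))) (uhat u k)) (cexpi (IZR k * x)))) M). rewrite sm_double.
   match goal with |- ?A + ?B = ?C => replace A with 0 by (unfold Im; simpl; ring) end. rewrite Rplus_0_l. apply sm_ext. intros i _.
   rewrite !uhat_avg by auto. rewrite sgn_IZR_opp, Z.abs_eq by lia. rewrite opp_IZR, <- INR_IZR_INZ.
   rewrite !cav_opp, !sav_opp by auto. rewrite mu_even, mu_odd, fc_even, fc_odd, ee_even, ee_odd by auto.
   unfold cexpi. replace (- INR (S i) * x) with (- (INR (S i) * x)) by ring. rewrite cos_neg, sin_neg.
   set (c1 := cav (fun t => Re (u t)) (INR (S i))). set (s1 := sav (fun t => Im (u t)) (INR (S i))).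
   set (c2 := cav (fun t => Im (u t)) (INR (S i))). set (s2 := sav (fun t => Re (u t)) (INR (S i))).
   set (n := INR (S i)) in *. set (cc := cos (n * x)). set (ss := sin (n * x)). unfold Im, Cmult, RtoC; cbn [fst snd].
   transitivity (sqrt 2 * sqrt 2 * n * (c2 * cc + s1 * ss)); [rewrite sqrt2_sq|]; ring.
Qed.

Lemma cCinf_rC u : Cinf u -> cCinf (rC u).
Proof. intros H. split; [exact H|apply (Cinf_const 0)]. Qed.

Lemma Lam_rC u x : Cinf u -> Lam (rC u) x = RtoC (Lr u x).
Proof.
 intros H. rewrite Lam_real by (apply cCinf_rC; auto). unfold RtoC. f_equal. change (Lr (fun _ => 0) x = 0). rewrite Lr_const. reflexivity.
Qed.

Lemma cav_zero x : cav (fun _ => 0) x = 0.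
Proof. unfold cav. rewrite (avg_ext _ (fun _ => 0)) by (intros; ring). apply avg_const. Qed.

Lemma sav_zero x : sav (fun _ => 0) x = 0.
Proof. unfold sav. rewrite (avg_ext _ (fun _ => 0)) by (intros; ring). apply avg_const. Qed.

Lemma uhat_rC u k : cont u -> uhat (rC u) k = (cav u (IZR k), - sav u (IZR k)).
Proof.
 intros H. rewrite uhat_avg; [|exact H|apply (cont_const 0)].
 change (fun t => Im (rC u t)) with (fun _ : R => 0). change (fun t => Re (rC u t)) with u. rewrite cav_zero, sav_zero. f_equal; ring.
Qed.

Lemma Hil_rC u x : Cinf u -> Hil (rC u) x = (0, Jr u x).
Proof.
 intros HU. use (Cinf_cont _ HU) as CU. unfold Hil, fmult. f_equal.
 - rewrite (Lim_seq_ext _ (fun _ => 0)); [rewrite Lim_seq_const; reflexivity|]. intros M. unfold psum. rewrite Re_csum.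
  rewrite (sm_symmetric (fun k => Re (Cmult (Cmult (RtoC (IZR (Z.sgn k))) (uhat (rC u) k)) (cexpi (IZR k * x)))) M). rewrite sm_zero.
  + unfold Re; simpl. ring.
  + intros i _. rewrite !uhat_rC by auto. rewrite Z.sgn_opp. replace (Z.sgn (Z.of_nat (S i))) with 1%Z by (symmetry; apply Z.sgn_pos; lia).
   rewrite !opp_IZR, <- INR_IZR_INZ, cav_opp, sav_opp by auto.
   unfold cexpi. replace (- INR (S i) * x) with (- (INR (S i) * x)) by ring. rewrite cos_neg, sin_neg.
   unfold Re, Cmult, RtoC; cbn [fst snd]. ring.
 - rewrite (Lim_seq_ext _ (fun M => sm (fun k => fc u k * (sqrt 2 * cos (mu k * x + (ph k - PI / 2)))) (2 * M))).
  + rewrite (lim_double _ _ (Jr_is_series _ x HU)). reflexivity.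
  + intros M. unfold psum. rewrite Im_csum.
   rewrite (sm_symmetric (fun k => Im (Cmult (Cmult (RtoC (IZR (Z.sgn k))) (uhat (rC u) k)) (cexpi (IZR k * x)))) M). rewrite sm_double.
   match goal with |- ?A + ?B = ?C => replace A with 0 by (unfold Im; simpl; ring) end. rewrite Rplus_0_l. apply sm_ext. intros i _.
   rewrite !uhat_rC by auto. rewrite Z.sgn_opp. replace (Z.sgn (Z.of_nat (S i))) with 1%Z by (symmetry; apply Z.sgn_pos; lia).
   rewrite !opp_IZR, <- INR_IZR_INZ, cav_opp, sav_opp by auto.
   unfold cexpi. replace (- INR (S i) * x) with (- (INR (S i) * x)) by ring. rewrite cos_neg, sin_neg.
   rewrite fc_even, fc_odd, mu_even, mu_odd by auto. unfold ph. rewrite even_double, even_double1.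
   replace (INR (S i) * x + (0 - PI / 2)) with (INR (S i) * x + - (PI / 2)) by ring.
   replace (INR (S i) * x + (- (PI / 2) - PI / 2)) with ((INR (S i) * x + - (PI / 2)) + - (PI / 2)) by ring.
   rewrite !cos_m_PI2. replace (sin (INR (S i) * x + - (PI / 2))) with (- cos (INR (S i) * x)).
   2:{ change (INR (S i) * x + - (PI / 2)) with (INR (S i) * x - PI / 2). rewrite sin_minus, cos_PI2, sin_PI2. ring. }
   unfold Im, Cmult, RtoC; cbn [fst snd].
   transitivity (sqrt 2 * sqrt 2 * (cav u (INR (S i)) * sin (INR (S i) * x) - sav u (INR (S i)) * cos (INR (S i) * x))); [rewrite sqrt2_sq|]; ring.
Qed.

Lemma uhat_fc_zero u N : cont u ->
 ((forall k, (Z.of_nat N < Z.abs k)%Z -> uhat (rC u) k = RtoC 0) <-> (forall j, (2 * N <= j)%nat -> fc u j = 0)).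
Proof.
 intros Hu. split.
 - intros H j Hj. use (Nat.div2_odd j) as E. set (i := Nat.div2 j) in *.
  assert (Hk : uhat (rC u) (Z.of_nat (S i)) = RtoC 0). { apply H. destruct (Nat.odd j); simpl in E; lia. }
  rewrite uhat_rC in Hk by auto. rewrite <- INR_IZR_INZ in Hk.  assert (H1 : cav u (INR (S i)) = 0) by exact (f_equal fst Hk).
  assert (H2 : - sav u (INR (S i)) = 0) by exact (f_equal snd Hk). destruct (Nat.odd j); simpl Nat.b2n in E.
  + rewrite E, fc_odd by auto. replace (sav u (INR (S i))) with 0 by lra. ring.
  + rewrite E, Nat.add_0_r, fc_even by auto. rewrite H1. ring.
 - intros H k Hk. rewrite uhat_rC by auto. use sqrt2_pos. pose (i := (Z.to_nat (Z.abs k) - 1)%nat). assert (E1 : cav u (INR (S i)) = 0).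
  { use (H (2 * i)%nat ltac:(unfold i; lia)) as Q. rewrite fc_even in Q by auto. nra. } assert (E2 : sav u (INR (S i)) = 0).
  { use (H (2 * i + 1)%nat ltac:(unfold i; lia)) as Q. rewrite fc_odd in Q by auto. nra. }
  assert (Ei : INR (S i) = IZR (Z.abs k)). { rewrite INR_IZR_INZ. f_equal. unfold i. lia. }
  rewrite Ei in *. destruct (Z_le_gt_dec 0 k) as [Hz|Hz].
  + rewrite Z.abs_eq in * by auto. rewrite E1, E2. unfold RtoC. f_equal; ring.
  + rewrite Z.abs_neq in * by lia. rewrite opp_IZR in *. rewrite cav_opp, sav_opp in * by auto. unfold RtoC. f_equal; lra.
Qed.

Lemma uhat_zero_avg u : cont u -> Re (uhat (rC u) 0) = avg u.
Proof.
 intros H. rewrite uhat_rC by auto. simpl. apply avg_ext. intros t. rewrite Rmult_0_l, cos_0. ring.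
Qed.

(** * The finite-rank form comparing [b Lambda b Lambda] with [(b D)^2] *)

Definition Gf (b u v : R -> R) : R := avg (fun x => b x * (Lr u x * Lr v x - Derive u x * Derive v x)).
(** The operator of the form [Gf], namely [Lambda b Lambda - D b D], so that [b * Gop] is the
    difference of [(b Lambda)^2] and [(b D)^2]. *)
Definition Gop (b v : R -> R) (x : R) : R := Lr (fun y => b y * Lr v y) x + Derive (fun y => b y * Derive v y) x.
Definition band (N : nat) (b : R -> R) : Prop := forall j, (2 * N <= j)%nat -> fc b j = 0.
Definition gee (b : R -> R) (n m : nat) : R := Gf b (ee n) (ee m).

Ltac cinf := repeat match goal with
 | H : Cinf ?u |- Cinf ?u => exact H
 | |- Cinf (fun x => ?f x) => change (Cinf f)
 | |- Cinf (Lr _) => apply Lr_Cinf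
 | |- Cinf (Jr _) => apply Jr_Cinf
 | |- Cinf (Derive _) => apply Cinf_Derive
 | |- Cinf (ee _) => apply ee_Cinf
 | |- Cinf (fun x => @?u x * @?v x) => apply (Cinf_mult u v)
 | |- Cinf (fun x => @?u x + @?v x) => apply (Cinf_plus u v)
 | |- Cinf (fun x => @?u x - @?v x) => apply (Cinf_minus u v)
 | |- Cinf (fun _ => ?c) => apply (Cinf_const c) end.
Ltac ccont := apply Cinf_cont; cinf.

Lemma Gop_Cinf b v : Cinf b -> Cinf v -> Cinf (Gop b v).
Proof. intros. unfold Gop. cinf. Qed.

Lemma avg_Gop b v : Cinf b -> Cinf v -> avg (Gop b v) = 0.
Proof.
 intros. unfold Gop. rewrite avg_plus by ccont. rewrite avg_Lr, avg_Derive; [ring|cinf|cinf].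
Qed.

Lemma Gf_op b u v : Cinf b -> Cinf u -> Cinf v -> Gf b u v = avg (fun x => u x * Gop b v x).
Proof.
 intros Hb Hu Hv. unfold Gf, Gop.
 rewrite (avg_ext _ (fun x => Lr u x * (b x * Lr v x) - Derive u x * (b x * Derive v x))) by (intros; ring). rewrite avg_minus by ccont.
 rewrite (avg_ext (fun x => u x * (_ + _)) (fun x => u x * Lr (fun y => b y * Lr v y) x + u x * Derive (fun y => b y * Derive v y) x)) by (intros; ring).
 rewrite avg_plus by ccont. rewrite (Lr_self_adjoint u (fun x => b x * Lr v x)) by cinf.
 rewrite (avg_by_parts u (fun x => b x * Derive v x)) by cinf. ring.
Qed.

Lemma Gf_sym b u v : Gf b u v = Gf b v u.
Proof. apply avg_ext. intros; ring. Qed.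

Lemma Gf_expand b u v : Cinf b -> Cinf u -> Cinf v -> is_series (fun n => fc u n * Gf b (ee n) v) (Gf b u v).
Proof.
 intros Hb Hu Hv. rewrite Gf_op by auto. rewrite fc_parseval by (auto using Gop_Cinf). rewrite avg_Gop, Rmult_0_r, Rplus_0_l by auto.
 apply is_series_ext_R with (fun n => fc u n * fc (Gop b v) n).
 - intros n. f_equal. rewrite Gf_op by (auto using ee_Cinf). apply avg_ext. intros; ring.
 - apply ip_is_series; apply rapid_l2, fc_rapid; auto using Gop_Cinf.
Qed.

Lemma cs_id z p x : cs id_f z p x = cos (IZR z * x + p).
Proof. reflexivity. Qed.

Lemma cs_id_Cinf z p : Cinf (cs id_f z p).
Proof. apply (cs_Cinf _ _ frame_id). Qed.

Lemma Derive_ee n : Derive (ee n) = fun x => mu n * (sqrt 2 * cs id_f (muz n) (ph n + PI / 2) x).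
Proof.
 apply Derive_eq. intros x. rewrite ee_phi, phi_cs. replace (mu n * (sqrt 2 * cs id_f (muz n) (ph n + PI / 2) x))
  with (sqrt 2 * (IZR (muz n) * cs id_f (muz n) (ph n + PI / 2) x * / one_f x)).
 - apply (is_derive_scal (cs id_f (muz n) (ph n))). apply (cs_derive _ _ frame_id).
 - unfold one_f. rewrite Rinv_1, mu_IZR. ring.
Qed.

Lemma cos_p_PI2 y p : cos (y + (p + PI / 2)) = - sin (y + p).
Proof. replace (y + (p + PI / 2)) with (PI / 2 + (y + p)) by ring. rewrite (sin_cos (y + p)). ring. Qed.

Lemma gee_eq b n m : Cinf b -> gee b n m = 2 * mu n * mu m * avg (fun x => b x * cs id_f (muz n + muz m) (ph n + ph m) x).
Proof.
 intros Hb. unfold gee, Gf. rewrite <- avg_scal by (apply Cinf_cont, Cinf_mult; auto using cs_id_Cinf).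
 apply avg_ext. intros x. rewrite !Lr_ee, !Derive_ee, !cs_id. unfold ee. rewrite !cos_p_PI2, plus_IZR, <- !mu_IZR.
 replace ((mu n + mu m) * x + (ph n + ph m)) with ((mu n * x + ph n) + (mu m * x + ph m)) by ring.
 set (A := mu n * x + ph n). set (B := mu m * x + ph m). rewrite cos_plus.
 transitivity (sqrt 2 * sqrt 2 * mu n * mu m * b x * (cos A * cos B - sin A * sin B)); [ring|]. rewrite sqrt2_sq. ring.
Qed.

Lemma band_cs N b z p : Cinf b -> band N b -> (Z.of_nat N < z)%Z -> avg (fun x => b x * cs id_f z p x) = 0.
Proof.
 intros Hb HN Hz. rewrite <- wavg_id. replace z with (Z.of_nat (Z.to_nat z)) by lia.
 rewrite (cs_pos_span _ _ frame_id) by (try apply Cinf_cont; auto; lia). rewrite coef_id. rewrite !HN by lia. field. use sqrt2_pos; lra.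
Qed.

Lemma gee_band N b n m : Cinf b -> band N b -> (2 * N <= n \/ 2 * N <= m)%nat -> gee b n m = 0.
Proof.
 intros Hb HN H. rewrite gee_eq by auto. rewrite (band_cs N); auto; [ring|]. unfold muz. use (div2_bounds n). use (div2_bounds m).
 generalize dependent (Nat.div2 n). generalize dependent (Nat.div2 m). intros; lia.
Qed.

Lemma series_finite (a : nat -> R) n l : is_series a l -> (forall k, (n <= k)%nat -> a k = 0) -> l = sm a n.
Proof.
 intros H H0. rewrite <- (is_series_unique _ _ H). apply is_series_unique, is_series_sm.
 apply is_lim_seq_ext_loc with (fun _ => sm a n); [|apply is_lim_seq_const].
 exists n. intros m Hm. replace m with (n + (m - n))%nat by lia. rewrite sm_add.
 rewrite (sm_zero (fun k => a (n + k)%nat)); [ring|]. intros; apply H0; lia.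
Qed.

Lemma Gf_finite N b u v : Cinf b -> band N b -> Cinf u -> Cinf v ->
 Gf b u v = sm (fun n => sm (fun m => fc u n * (fc v m * gee b n m)) (2 * N)) (2 * N).
Proof.
 intros Hb HN Hu Hv. assert (E : forall n, Gf b (ee n) v = sm (fun m => fc v m * gee b n m) (2 * N)).
 { intros n. rewrite Gf_sym. use (Gf_expand b v (ee n) Hb Hv (ee_Cinf n)) as S. apply (series_finite _ (2 * N)) in S.
  - rewrite S. apply sm_ext. intros m _. f_equal. apply Gf_sym.
  - intros m Hm. fold (gee b m n). rewrite (gee_band N) by auto. ring. }
 use (Gf_expand b u v Hb Hu Hv) as S. apply (series_finite _ (2 * N)) in S.
 - rewrite S. apply sm_ext. intros n _. rewrite E, sm_scal. reflexivity.
 - intros n Hn. rewrite E, sm_zero; [ring|]. intros m _. rewrite (gee_band N) by auto. ring.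
Qed.

(** * A bilinear identity between [b] and its conjugate function *)

Section T_identity.
Variable b : R -> R.
Hypothesis Hb : Cinf b.
Let h := Jr b.

(** This form turns out to vanish identically ([Tf_zero]), which expresses the integral of
    [h v' Lambda v] through the finite-rank form. [Top] is its operator, obtained by integration by
    parts. *)
Definition Tf (u v : R -> R) : R := avg (fun x => h x * (Derive u x * Lr v x + Derive v x * Lr u x)) + Gf b u v.
Definition Top (v : R -> R) (x : R) : R := (Lr (fun y => h y * Derive v y) x - Derive (fun y => h y * Lr v y) x) + Gop b v x.

Lemma h_Cinf : Cinf h.
Proof. apply Jr_Cinf; auto. Qed.

Lemma Top_Cinf v : Cinf v -> Cinf (Top v).
Proof. intros. use h_Cinf. use (Gop_Cinf b v Hb H). unfold Top. cinf. Qed.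

Lemma avg_Top v : Cinf v -> avg (Top v) = 0.
Proof.
 intros Hv. use h_Cinf. use (Gop_Cinf b v Hb Hv). unfold Top.
 rewrite avg_plus, avg_minus by ccont. rewrite avg_Lr, avg_Derive, avg_Gop; [ring|auto|auto|cinf|cinf].
Qed.

Lemma Tf_op u v : Cinf u -> Cinf v -> Tf u v = avg (fun x => u x * Top v x).
Proof.
 intros Hu Hv. use h_Cinf. use (Gop_Cinf b v Hb Hv). unfold Tf, Top. rewrite Gf_op by auto.
 rewrite (avg_ext (fun x => h x * _) (fun x => Derive u x * (h x * Lr v x) + Lr u x * (h x * Derive v x))) by (intros; ring).
 rewrite avg_plus by ccont. rewrite (avg_by_parts u (fun x => h x * Lr v x)) by cinf.
 rewrite (Lr_self_adjoint u (fun x => h x * Derive v x)) by cinf.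
 rewrite (avg_ext (fun x => u x * (_ + _)) (fun x => (u x * Lr (fun y => h y * Derive v y) x - u x * Derive (fun y => h y * Lr v y) x) + u x * Gop b v x)) by (intros; ring).
 rewrite avg_plus, avg_minus by ccont. ring.
Qed.

Lemma Tf_sym u v : Tf u v = Tf v u.
Proof. unfold Tf. f_equal; apply avg_ext; intros; ring. Qed.

(** Both parts reduce to a single moment at the sum of the frequencies, one of [h] and one of [b];
    conjugation relates the two by a quarter period. *)
Lemma Tf_ee n m : Tf (ee n) (ee m) = 0.
Proof.
 unfold Tf. fold (gee b n m). rewrite gee_eq by auto. assert (Hz : (0 < muz n + muz m)%Z) by (use (muz_pos n); use (muz_pos m); lia).
 use (avg_Jr_cs b (muz n + muz m) (ph n + ph m + PI / 2) Hb Hz) as E.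
 replace (ph n + ph m + PI / 2 - PI / 2) with (ph n + ph m) in E by ring.
 replace (avg (fun x => b x * cs id_f (muz n + muz m) (ph n + ph m) x)) with (- avg (fun x => Jr b x * cs id_f (muz n + muz m) (ph n + ph m + PI / 2) x)) by lra.
 fold h. rewrite <- Ropp_mult_distr_r, <- avg_scal by (apply Cinf_cont, Cinf_mult; [apply h_Cinf|apply cs_id_Cinf]).
 rewrite (avg_ext _ (fun x => 2 * mu n * mu m * (h x * cs id_f (muz n + muz m) (ph n + ph m + PI / 2) x))); [ring|].
 intros x. rewrite !Lr_ee, !Derive_ee, !cs_id. unfold ee. rewrite !cos_p_PI2, plus_IZR, <- !mu_IZR.
 replace ((mu n + mu m) * x + (ph n + ph m)) with ((mu n * x + ph n) + (mu m * x + ph m)) by ring.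
 set (A := mu n * x + ph n). set (B := mu m * x + ph m). rewrite sin_plus.
 transitivity (sqrt 2 * sqrt 2 * mu n * mu m * h x * (- (sin A * cos B + cos A * sin B))); [ring|]. rewrite sqrt2_sq. ring.
Qed.

Lemma Top_zero v : Cinf v -> (forall n, Tf (ee n) v = 0) -> Top v = fun _ => 0.
Proof.
 intros Hv H. use (Top_Cinf v Hv) as HT. apply fc_eq.
 - apply Cinf_cont; auto.
 - apply HT.
 - apply cont_const.
 - intros x; reflexivity.
 - rewrite avg_Top, avg_const by auto. reflexivity.
 - intros n. rewrite fc_const, <- (H n), Tf_op by (auto using ee_Cinf). apply avg_ext. intros; ring.
Qed.

(** Infinite bilinear expansions are avoided: if [Tf (ee n) v] vanishes for all [n], then
    [Top v = 0] by uniqueness of Fourier coefficients. This is used for basis functions [v] and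
    then, by symmetry, for all [v]. *)
Lemma Tf_zero u v : Cinf u -> Cinf v -> Tf u v = 0.
Proof.
 assert (Z : forall u v, Cinf u -> Cinf v -> Top v = (fun _ => 0) -> Tf u v = 0).
 { intros u0 v0 Hu Hv E. rewrite Tf_op by auto. rewrite E. rewrite (avg_ext _ (fun _ => 0)) by (intros; ring). apply avg_const. }
 intros Hu Hv. apply Z; auto. apply Top_zero; auto. intros n. rewrite Tf_sym. apply Z; auto using ee_Cinf.
 apply Top_zero; auto using ee_Cinf. intros m. apply Tf_ee.
Qed.

(** The left side is the time derivative of [Gf b v v] when [b] follows the flow and [v] moves by
    [v' = h v_x], as a function with constant coefficients in the moving frame does. Total
    derivatives and [(b Lambda v)_x = l v_x] reduce it to [4 l] times the mean of [h v_x Lambda v],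
    which [Tf_zero] evaluates. *)
Lemma Gf_flow_eig v l : Cinf v -> (forall x, b x * Lr v x = l * v x) ->
 Gf (fun x => h x * Derive b x - b x * Lr b x) v v + 2 * Gf b (fun x => h x * Derive v x) v = - 2 * l * Gf b v v.
Proof.
 intros Hv He. use h_Cinf as Hh. set (p := Lr v). assert (Hp : Cinf p) by (apply Lr_Cinf; auto).
 assert (Dh : Derive h = Lr b) by (apply Derive_eq; intros; apply Jr_derive; auto).
 assert (E1 : Gf b (fun x => h x * Derive v x) v = l * avg (fun x => h x * Derive v x * p x) - avg (fun x => b x * (Derive (fun x => h x * Derive v x) x * Derive v x))).
 { unfold Gf. rewrite (avg_ext _ (fun x => Lr (fun x => h x * Derive v x) x * (b x * Lr v x) - b x * (Derive (fun x => h x * Derive v x) x * Derive v x))) by (intros; ring).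
  rewrite avg_minus by ccont. f_equal. rewrite <- avg_scal by (fold p; ccont).
  rewrite (avg_ext _ (fun x => Lr (fun x => h x * Derive v x) x * (l * v x))) by (intros; rewrite He; reflexivity).
  rewrite (Lr_self_adjoint _ (fun x => l * v x)) by cinf. rewrite Lr_scal by auto. apply avg_ext. intros; unfold p; ring. }
 assert (Dhv : Derive (fun x => h x * Derive v x) = fun x => Lr b x * Derive v x + h x * Derive (Derive v) x).
 { rewrite Derive_mult_fun by cinf. rewrite Dh. reflexivity. } rewrite Dhv in E1.
 assert (E2 : Gf (fun x => h x * Derive b x - b x * Lr b x) v v =
   avg (fun x => (h x * Derive b x - b x * Lr b x) * (p x * p x)) - avg (fun x => (h x * Derive b x - b x * Lr b x) * (Derive v x * Derive v x))).
 { unfold Gf. rewrite <- avg_minus by ccont. apply avg_ext. intros; unfold p; ring. }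
 (* the derivative terms form a total derivative *)
 assert (E3 : avg (fun x => (h x * Derive b x - b x * Lr b x) * (Derive v x * Derive v x)) +
   2 * avg (fun x => b x * ((Lr b x * Derive v x + h x * Derive (Derive v) x) * Derive v x)) = 0).
 { use (avg_Derive (fun x => (b x * h x) * (Derive v x * Derive v x)) ltac:(cinf)) as Q.
  rewrite (Derive_mult_fun (fun x => b x * h x)) in Q by cinf. rewrite !Derive_mult_fun in Q by cinf. rewrite Dh in Q.
  rewrite <- avg_scal, <- avg_plus by ccont. rewrite <- Q. apply avg_ext. intros; ring. }
 assert (E4 : avg (fun x => (h x * Derive b x - b x * Lr b x) * (p x * p x)) = 2 * l * avg (fun x => h x * Derive v x * p x)).
 { assert (Dbp : forall x, Derive b x * p x + b x * Derive p x = l * Derive v x).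
  { intros x. use (Derive_mult_fun b p Hb Hp) as Q. apply (f_equal (fun g => g x)) in Q. cbv beta in Q. rewrite <- Q.
   replace (fun x => b x * p x) with (fun x => l * v x) by (fext; intros; unfold p; rewrite He; reflexivity).
   apply is_derive_unique, (is_derive_scal v x l), Cinf_is_derive; auto. }
  use (avg_Derive (fun x => (b x * h x) * (p x * p x)) ltac:(cinf)) as Q. rewrite (Derive_mult_fun (fun x => b x * h x)) in Q by cinf.
  rewrite !Derive_mult_fun in Q by cinf. rewrite Dh in Q.
  rewrite <- avg_scal by ccont. apply Rminus_diag_uniq. rewrite <- avg_minus by ccont. transitivity ((-1) * 0); [|ring]. rewrite <- Q.
  rewrite <- avg_scal by ccont. apply avg_ext. intros x. specialize (Dbp x).
  replace (2 * l * (h x * Derive v x * p x)) with (2 * h x * p x * (l * Derive v x)) by ring. rewrite <- Dbp. ring. }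
 assert (E5 : 2 * avg (fun x => h x * Derive v x * p x) + Gf b v v = 0).
 { rewrite <- (Tf_zero v v Hv Hv). unfold Tf. f_equal. rewrite <- avg_scal by ccont. apply avg_ext. intros; unfold p; ring. }
 rewrite E2, E1, E4. nra.
Qed.

End T_identity.

(** * Eigenfunctions of [b Lambda] and eigenvectors of the matrix *)

Lemma fc_Derive_even u i : Cinf u -> fc (Derive u) (2 * i) = INR (S i) * fc u (2 * i + 1).
Proof.
 intros Hu. unfold fc. rewrite (avg_by_parts u (ee (2 * i))) by (auto using ee_Cinf).
 rewrite <- avg_scal by (apply Cinf_cont, Cinf_mult; auto using ee_Cinf).
 rewrite <- (Rmult_1_l (avg (fun x => u x * Derive _ x))), Ropp_mult_distr_l.
 rewrite <- avg_scal by ccont. apply avg_ext. intros x. rewrite Derive_ee, cs_id, cos_p_PI2, ee_odd, <- mu_IZR, mu_even.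
 unfold ph. rewrite even_double, Rplus_0_r. ring.
Qed.

Lemma fc_Derive_odd u i : Cinf u -> fc (Derive u) (2 * i + 1) = - (INR (S i) * fc u (2 * i)).
Proof.
 intros Hu. unfold fc. rewrite (avg_by_parts u (ee (2 * i + 1))) by (auto using ee_Cinf).
 rewrite <- avg_scal by (apply Cinf_cont, Cinf_mult; auto using ee_Cinf).
 f_equal. apply avg_ext. intros x. rewrite Derive_ee, cs_id, ee_even, <- mu_IZR, mu_odd.
 unfold ph. rewrite even_double1. replace (INR (S i) * x + (- (PI / 2) + PI / 2)) with (INR (S i) * x) by ring. ring.
Qed.

(** At each frequency the difference of the sides is a nonnegative multiple of
    [(a - e)^2 + (c + d)^2], where [a], [c] and [d], [e] are the cosine and sine coefficients of [u]
    and of [v]. *)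
Lemma Lr_pair_ineq u v : Cinf u -> Cinf v ->
 2 * avg (fun x => u x * Derive v x) <= avg (fun x => u x * Lr u x) + avg (fun x => v x * Lr v x).
Proof.
 intros Hu Hv. rewrite !fc_parseval by cinf. rewrite !avg_Lr, avg_Derive by auto. rewrite !Rmult_0_r, !Rplus_0_l.
 assert (Hl : forall u v, Cinf u -> Cinf v -> is_lim_seq (fun n => sm (fun k => fc u k * fc v k) (2 * n)) (ip (fc u) (fc v))).
 { intros u0 v0 H1 H2. use (ip_is_series _ _ (rapid_l2 _ (fc_rapid u0 H1)) (rapid_l2 _ (fc_rapid v0 H2))) as S.
  apply is_series_sm in S. apply (is_lim_seq_subseq _ _ (fun n => (2 * n)%nat)) in S; auto. apply eventually_subseq; intros; lia. }
 use (Hl u (Derive v) Hu ltac:(cinf)) as L1. use (Hl u (Lr u) Hu ltac:(cinf)) as L2. use (Hl v (Lr v) Hv ltac:(cinf)) as L3.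
 use (is_lim_seq_plus' _ _ _ _ L2 L3) as L23. use (is_lim_seq_mult' _ _ _ _ (is_lim_seq_const 2) L1) as L1'.
 apply (fun H => is_lim_seq_le _ _ (Finite _) (Finite _) H L1' L23).
 intros n. cbv beta. rewrite !sm_double, <- sm_plus, <- sm_scal. apply sm_le. intros i _.
 rewrite fc_Derive_even, fc_Derive_odd, !fc_Lr, mu_even, mu_odd by auto. use (pos_INR (S i)).
 set (a := fc u (2 * i)). set (c := fc u (2 * i + 1)). set (d := fc v (2 * i)). set (e := fc v (2 * i + 1)).
 use (Rle_0_sqr (a - e)) as Q1. use (Rle_0_sqr (c + d)) as Q2. unfold Rsqr in Q1, Q2.
 assert (0 <= INR (S i) * ((a - e) * (a - e) + (c + d) * (c + d))) by (apply Rmult_le_pos; lra). lra.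
Qed.

Lemma Lr_zero_const u : Cinf u -> Lr u = (fun _ => 0) -> u = fun _ => avg u.
Proof.
 intros Hu E. apply fc_eq; [apply Cinf_cont; auto|apply Hu|apply cont_const|intros x; reflexivity|rewrite avg_const; auto|].
 intros k. rewrite fc_const. use (fc_Lr u k Hu) as Q. rewrite E, fc_const in Q. use (mu_ge1 k). nra.
Qed.

Section EigFrame.
Variables s b : R -> R.
Hypothesis Hf : frame s b.
Let Hb := fr_b s b Hf.

Definition Fm (k l : nat) : R := Gf b (phi s k) (phi s l).

Lemma Fm_sym j k : Fm j k = Fm k j.
Proof. unfold Fm. apply Gf_sym. Qed.

Lemma b_neq x : b x <> 0.
Proof. use (fr_pos s b Hf x). lra. Qed.

Lemma avg_to_wavg u : avg u = wavg b (fun x => b x * u x).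
Proof. apply avg_ext. intros x. field. apply b_neq. Qed.

Lemma Gf_coef u v : Cinf u -> Cinf v -> is_series (fun k => coef s b u k * Gf b (phi s k) v) (Gf b u v).
Proof.
 intros Hu Hv. use (Gop_Cinf b v Hb Hv) as HG. rewrite Gf_op by auto.
 rewrite avg_to_wavg, (wavg_ext b _ (fun x => u x * (b x * Gop b v x))) by (intros; ring).
 assert (HbG : Cinf (fun x => b x * Gop b v x)) by (apply Cinf_mult; auto).
 rewrite (fourier_parseval s b Hf) by auto. rewrite <- avg_to_wavg, avg_Gop, Rmult_0_r, Rplus_0_l by auto.
 apply is_series_ext_R with (fun k => coef s b u k * coef s b (fun x => b x * Gop b v x) k).
 - intros k. f_equal. rewrite Gf_op by (auto using (phi_Cinf s b Hf)). unfold coef. rewrite avg_to_wavg. apply wavg_ext. intros; ring.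
 - apply ip_is_series; apply rapid_l2; apply (coef_rapid s b Hf); auto.
Qed.

Lemma mv_Fm v k : Cinf v -> mv Fm (coef s b v) k = Gf b (phi s k) v.
Proof.
 intros Hv. rewrite Gf_sym. rewrite <- (is_series_unique _ _ (Gf_coef v (phi s k) Hv (phi_Cinf s b Hf k))).
 apply Series_ext. intros l. rewrite Fm_sym. unfold Fm. ring.
Qed.

Lemma Derive_phi k : Derive (phi s k) = fun x => mu k * (sqrt 2 * cs s (muz k) (ph k + PI / 2) x) * / b x.
Proof.
 apply Derive_eq. intros x. rewrite phi_cs.
 replace (mu k * (sqrt 2 * cs s (muz k) (ph k + PI / 2) x) * / b x) with (sqrt 2 * (IZR (muz k) * cs s (muz k) (ph k + PI / 2) x * / b x)) by (rewrite mu_IZR; ring).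
 apply (is_derive_scal (cs s (muz k) (ph k))). apply (cs_derive s b Hf).
Qed.

Lemma avg_b_Derive_phi v k : Cinf v -> avg (fun x => b x * (Derive v x * Derive (phi s k) x)) = mu k ^ 2 * coef s b v k.
Proof.
 intros Hv. rewrite (coef_cs s b Hf) by (apply Cinf_cont; auto). use (wavg_cs_parts s b Hf (muz k) (ph k + PI) v Hv) as E.
 replace (ph k + PI - PI / 2) with (ph k + PI / 2) in E by field. rewrite <- mu_IZR in E.
 rewrite (avg_ext _ (fun x => mu k * sqrt 2 * (b x * Derive v x * cs s (muz k) (ph k + PI / 2) x * / b x))).
 2:{ intros x. rewrite Derive_phi. ring. } rewrite avg_scal by (apply (wavg_cont s b Hf), cont_mult; [ccont|apply (cs_cont s b Hf)]).
 change (avg (fun x => b x * Derive v x * cs s (muz k) (ph k + PI / 2) x * / b x)) with (wavg b (fun x => b x * Derive v x * cs s (muz k) (ph k + PI / 2) x)).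
 replace (wavg b (fun x => b x * Derive v x * cs s (muz k) (ph k + PI / 2) x)) with (- (mu k * wavg b (fun x => v x * cs s (muz k) (ph k + PI) x))) by lra.
 rewrite (wavg_ext b (fun x => v x * cs s (muz k) (ph k + PI) x) (fun x => (-1) * (v x * cs s (muz k) (ph k) x))).
 - rewrite (wavg_scal s b Hf) by (apply cont_mult; [ccont|apply (cs_cont s b Hf)]). ring.
 - intros x. unfold cs. replace (IZR (muz k) * s x + (ph k + PI)) with (IZR (muz k) * s x + ph k + PI) by ring. rewrite neg_cos. ring.
Qed.

(** In [Gf] the term with two derivatives integrates by parts in [s] to [- mu k ^ 2] times the
    coefficient, which the diagonal compensates; the term with two [Lr] remains. *)
Lemma matrix_action v k : Cinf v -> mu k ^ 2 * coef s b v k + mv Fm (coef s b v) k = coef s b (fun x => b x * Lr (fun y => b y * Lr v y) x) k.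
Proof.
 intros Hv. use (phi_Cinf s b Hf k) as Hp. rewrite mv_Fm, <- avg_b_Derive_phi by auto. unfold Gf. rewrite <- avg_plus by ccont.
 rewrite (avg_ext _ (fun x => Lr (phi s k) x * (b x * Lr v x))) by (intros; ring).
 rewrite (Lr_self_adjoint (phi s k) (fun x => b x * Lr v x)) by cinf. unfold coef. rewrite avg_to_wavg. apply wavg_ext. intros; ring.
Qed.

Lemma wavg_eig_zero v l : Cinf v -> l <> 0 -> (forall x, b x * Lr v x = l * v x) -> wavg b v = 0.
Proof.
 intros Hv Hl He. apply (Rmult_eq_reg_l l); auto. rewrite <- (wavg_scal s b Hf) by ccont.
 rewrite (wavg_ext b _ (fun x => b x * Lr v x)) by (intros; rewrite He; reflexivity). rewrite <- avg_to_wavg, avg_Lr by auto. ring.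
Qed.

Lemma wavg_sq_zero u : Cinf u -> wavg b (fun x => u x * u x) = 0 -> forall x, u x = 0.
Proof.
 intros Hu E. rewrite (fourier_parseval s b Hf) in E by auto. use (rapid_l2 _ (coef_rapid s b Hf u Hu)) as Hl.
 use (ip_pos _ Hl) as H1. assert (E0 : wavg b u = 0) by nra. assert (E1 : ip (coef s b u) (coef s b u) = 0) by nra.
 apply (fourier_unique s b Hf); auto; [ccont|apply Hu|]. intros k. use (ip_coord _ k Hl). nra.
Qed.

(** Mean zero excludes the kernel of [Lr], hence [nu > 0]. With [l = sqrt nu], the function
    [g = b Lambda v - l v] satisfies [b Lambda g = - l g], which is impossible for a nonzero [g]
    because the form of [Lambda] is nonnegative. *)
Lemma eig_synth psi nu : rapid psi -> ip psi psi = 1 -> is_eig Fm psi nu ->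
 0 < nu /\ forall x, b x * Lr (synth s psi) x = sqrt nu * synth s psi x.
Proof.
 intros Hr H1 He. set (v := synth s psi). assert (Hv : Cinf v) by (apply (synth_Cinf s b Hf); auto).
 assert (Hc : coef s b v = psi) by (fext; intros; apply (coef_synth s b Hf); auto).
 assert (Hw : wavg b v = 0) by (apply (wavg_synth s b Hf); auto). assert (HA : Cinf (fun x => b x * Lr (fun y => b y * Lr v y) x)) by cinf.
 assert (E2 : forall x, b x * Lr (fun y => b y * Lr v y) x = nu * v x). { apply (fourier_eq s b Hf _ (fun x => nu * v x)).
  - ccont.
  - apply HA.
  - ccont.
  - apply (Cinf_scal nu v Hv).
  - rewrite <- avg_to_wavg, avg_Lr by cinf. rewrite (wavg_scal s b Hf), Hw by ccont. ring.
  - intros k. rewrite <- matrix_action, (coef_scal s b Hf) by (auto; ccont). rewrite Hc. apply He. }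
 assert (Hn1 : wavg b (fun x => v x * v x) = 1). { rewrite (fourier_parseval s b Hf), Hw, Hc, H1 by auto. ring. }
 assert (Eq : nu = wavg b (fun x => (b x * Lr v x) * (b x * Lr v x))).
 { transitivity (wavg b (fun x => nu * (v x * v x))); [rewrite (wavg_scal s b Hf), Hn1 by ccont; ring|].
  rewrite (wavg_ext b _ (fun x => b x * (Lr (fun y => b y * Lr v y) x * v x))).
  - rewrite <- avg_to_wavg, (Lr_self_adjoint (fun y => b y * Lr v y) v) by cinf. rewrite avg_to_wavg. apply wavg_ext. intros; ring.
  - intros x. rewrite <- Rmult_assoc, <- E2. ring. } assert (Hbl : Cinf (fun x => b x * Lr v x)) by cinf. assert (Hnu0 : 0 <= nu).
 { rewrite Eq, <- (wavg_const s b Hf 0). apply (wavg_le s b Hf); [apply cont_const|ccont|intros; nra]. } assert (Hnu : 0 < nu).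
 { destruct Hnu0 as [|E0]; auto. exfalso. rewrite <- E0 in Eq. symmetry in Eq. use (wavg_sq_zero _ Hbl Eq) as Z.
  assert (L0 : Lr v = fun _ => 0). { fext. intros x. specialize (Z x). use (b_neq x). cbv beta in Z. nra. }
  use (Lr_zero_const v Hv L0) as Cst. rewrite Cst, (wavg_const s b Hf) in Hw. rewrite Cst, Hw in Hn1.
  rewrite (wavg_ext b _ (fun _ => 0)) in Hn1 by (intros; ring). rewrite (wavg_const s b Hf) in Hn1. lra. }
 split; auto. set (l := sqrt nu). assert (Hl : 0 < l) by (apply sqrt_lt_R0; auto). assert (Ell : l * l = nu) by (apply sqrt_sqrt; lra).
 pose (g := fun x => b x * Lr v x - l * v x). assert (Hg : Cinf g) by (unfold g; cinf). assert (Eg : forall x, b x * Lr g x = - l * g x).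
 { intros x. unfold g. replace (fun x => b x * Lr v x - l * v x) with (fun x => b x * Lr v x + (- l) * v x) by (fext; intros; ring).
  rewrite Lr_plus, Lr_scal by cinf. rewrite Rmult_plus_distr_l, E2, <- Ell. ring. } assert (Hpos : 0 <= avg (fun x => g x * Lr g x)).
 { use (proj2 (Lr_form_pos g Hg)). use (ip_pos _ (rapid_l2 _ (fc_rapid g Hg))). lra. } assert (Hz : wavg b (fun x => g x * g x) = 0).
 { assert (E3 : avg (fun x => g x * Lr g x) = - l * wavg b (fun x => g x * g x)).
  { rewrite <- (wavg_scal s b Hf) by ccont. rewrite avg_to_wavg. apply wavg_ext. intros x.
   replace (b x * (g x * Lr g x)) with (g x * (b x * Lr g x)) by ring. rewrite Eg. ring. } assert (0 <= wavg b (fun x => g x * g x)).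
  { rewrite <- (wavg_const s b Hf 0). apply (wavg_le s b Hf); [apply cont_const|ccont|intros; nra]. } nra. }
 intros x. use (wavg_sq_zero g Hg Hz x) as Q. unfold g in Q. lra.
Qed.

(** The form of [Lambda] dominates the squared distance of [v] to its mean [c]. In the weight
    [1 / b] that distance is [1 + c^2], since [v] has weighted mean 0 and norm 1; changing the
    weight costs the factor [m]. *)
Lemma eig_lower v l m : Cinf v -> 0 < l -> (forall x, b x * Lr v x = l * v x) -> (forall x, m <= b x) -> 0 < m ->
 wavg b (fun x => v x * v x) = 1 -> m <= l.
Proof.
 intros Hv Hl He Hm Hm0 H1. use (wavg_eig_zero v l Hv ltac:(lra) He) as Hw. assert (E1 : avg (fun x => v x * Lr v x) = l).
 { rewrite avg_to_wavg, (wavg_ext b _ (fun x => l * (v x * v x))).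
  - rewrite (wavg_scal s b Hf), H1 by ccont. ring.
  - intros x. replace (b x * (v x * Lr v x)) with (v x * (b x * Lr v x)) by ring. rewrite He. ring. }
 use (proj2 (Lr_form_pos v Hv)) as B. rewrite E1 in B. pose (c := avg v).
 assert (E2 : ip (fc v) (fc v) = avg (fun x => (v x - c) * (v x - c))).
 { rewrite fc_parseval by cinf. rewrite avg_minus, avg_const by (try ccont; apply cont_const). fold c.
  replace (c - c) with 0 by ring. rewrite Rmult_0_l, Rplus_0_l. apply ip_ext; intros k;
  (rewrite fc_minus, fc_const by (try ccont; apply cont_const); ring). }
 assert (B2 : m * wavg b (fun x => (v x - c) * (v x - c)) <= avg (fun x => (v x - c) * (v x - c))).
 { rewrite <- (wavg_scal s b Hf) by ccont. rewrite avg_to_wavg. apply (wavg_le s b Hf); [ccont|ccont|].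
  intros x. mul_r; [apply Rle_0_sqr|auto]. } assert (E3 : wavg b (fun x => (v x - c) * (v x - c)) = 1 + c * c).
 { rewrite (wavg_ext b _ (fun x => v x * v x - (2 * c) * v x + c * c)) by (intros; ring).
  rewrite (wavg_plus s b Hf (fun x => v x * v x - (2 * c) * v x)), (wavg_minus s b Hf), (wavg_scal s b Hf), Hw, H1, (wavg_const s b Hf) by (try ccont; apply cont_const). ring. }
 rewrite E3 in B2. rewrite E2 in B. nra.
Qed.

Section System.
Variables (C : nat -> R) (psi : nat -> nat -> R) (lam : nat -> R).
Hypothesis HC : bdd Fm C.
Hypothesis HS : lsys Fm psi lam.

Let vv j := synth s (psi j).

Lemma vv_Cinf j : Cinf (vv j).
Proof. apply (synth_Cinf s b Hf). eapply ls_rapid; eauto. Qed.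

Lemma coef_vv j : coef s b (vv j) = psi j.
Proof. fext. intros k. apply (coef_synth s b Hf). eapply ls_rapid; eauto. Qed.

Lemma vv_eig j x : b x * Lr (vv j) x = lam j * vv j x.
Proof.
 destruct (eig_synth (psi j) (lam j ^ 2) (ls_rapid _ _ _ j HS)) as [_ E].
 - rewrite (ls_on _ _ _ j j HS). apply dl_same.
 - intros k. apply (ls_eig _ _ _ j k HS).
 - rewrite sqrt_pow2 in E by (left; apply (ls_pos _ _ _ HS)). apply E.
Qed.

Lemma wavg_vv j : wavg b (vv j) = 0.
Proof. apply (wavg_synth s b Hf). eapply ls_rapid; eauto. Qed.

Lemma vv_on i j : wavg b (fun x => vv i x * vv j x) = dl i j.
Proof.
 rewrite (fourier_parseval s b Hf) by apply vv_Cinf. rewrite !coef_vv, wavg_vv, (ls_on _ _ _ i j HS). ring.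
Qed.

Lemma lam_lower m j : 0 < m -> (forall x, m <= b x) -> m <= lam j.
Proof.
 intros H0 Hm. apply (eig_lower (vv j)); auto using vv_Cinf, vv_eig.
 - apply (ls_pos _ _ _ HS).
 - rewrite vv_on. apply dl_same.
Qed.

Lemma diag_series k : is_series (fun j => lam j * (psi j k * psi j k)) (avg (fun x => phi s k x * Lr (phi s k) x)).
Proof.
 use (phi_Cinf s b Hf k) as Hp. pose (g := fun x => b x * Lr (phi s k) x). assert (Hg : Cinf g) by (unfold g; cinf).
 assert (Hgw : wavg b g = 0) by (unfold g; rewrite <- avg_to_wavg, avg_Lr; auto).
 assert (Ek : ip (coef s b g) (dl k) = avg (fun x => phi s k x * Lr (phi s k) x)).
 { rewrite ip_dl_r. unfold coef, g. rewrite avg_to_wavg. apply wavg_ext. intros; ring. } rewrite <- Ek.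
 eapply is_series_ext_R; [|apply (parseval Fm psi lam (coef s b g) (dl k) HS); [apply (coef_rapid s b Hf); auto|apply rapid_dl]].
 intros j. simpl. rewrite (ip_sym (dl k)), ip_dl_r. assert (E : ip (coef s b g) (psi j) = lam j * psi j k).
 { rewrite <- (coef_vv j). use (fourier_parseval s b Hf g (vv j) Hg (vv_Cinf j)) as P. rewrite Hgw, Rmult_0_l, Rplus_0_l in P.
  rewrite <- P. unfold g. rewrite (wavg_ext b _ (fun x => b x * (Lr (phi s k) x * vv j x))) by (intros; ring).
  rewrite <- avg_to_wavg. rewrite (Lr_self_adjoint (phi s k) (vv j)) by (auto using vv_Cinf).
  rewrite avg_to_wavg. unfold coef. rewrite <- (wavg_scal s b Hf) by (apply cont_mult; [apply Cinf_cont, vv_Cinf|apply (phi_cont s b Hf)]).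
  apply wavg_ext. intros x. replace (b x * (phi s k x * Lr (vv j) x)) with (phi s k x * (b x * Lr (vv j) x)) by ring. rewrite vv_eig. ring. }
 rewrite E. ring.
Qed.

(** The derivative of [phi (2 i + 1)] is [(i + 1) phi (2 i) / b], so the cross term of
    [Lr_pair_ineq] is [2 (i + 1)] times the weighted norm of [phi (2 i)]. *)
Lemma diag_pair i : 2 * INR (S i) <= avg (fun x => phi s (2 * i) x * Lr (phi s (2 * i)) x) + avg (fun x => phi s (2 * i + 1) x * Lr (phi s (2 * i + 1)) x).
Proof.
 eapply Rle_trans; [|apply Lr_pair_ineq; apply (phi_Cinf s b Hf)]. right. f_equal.
 rewrite (avg_ext _ (fun x => INR (S i) * (phi s (2 * i) x * phi s (2 * i) x * / b x))).
 - rewrite avg_scal by (apply (wavg_cont s b Hf), cont_mult; apply (phi_cont s b Hf)).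
  change (avg (fun x => phi s (2 * i) x * phi s (2 * i) x * / b x)) with (wavg b (fun x => phi s (2 * i) x * phi s (2 * i) x)).
  rewrite (phi_orthonormal s b Hf), dl_same. ring.
 - intros x. rewrite Derive_phi. rewrite !phi_cs. unfold cs. rewrite <- !mu_IZR, mu_even, mu_odd. unfold ph. rewrite even_double, even_double1.
  replace (- (PI / 2) + PI / 2) with 0 by ring. ring.
Qed.

Lemma form_vv j : ip (mv Fm (psi j)) (psi j) = Gf b (vv j) (vv j).
Proof.
 rewrite <- (is_series_unique _ _ (Gf_coef (vv j) (vv j) (vv_Cinf j) (vv_Cinf j))). rewrite coef_vv. apply Series_ext. intros k.
 rewrite <- mv_Fm by apply vv_Cinf. rewrite coef_vv. ring.
Qed.

End System.

Lemma exists_system C : bdd Fm C -> exists psi lam, lsys Fm psi lam.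
Proof.
 intros HC. destruct (spectral_theorem Fm C HC Fm_sym) as [psi [nu Hs]]. assert (Hnu : forall j, 0 < nu j).
 { intros j. apply (eig_synth (psi j) (nu j) (es_rapid _ _ _ Hs j)); [rewrite (es_on _ _ _ Hs); apply dl_same|apply (es_eig _ _ _ Hs)]. }
 exists psi, (fun j => sqrt (nu j)). split.
 - replace (fun j => sqrt (nu j) ^ 2) with nu; auto. fext. intros j. rewrite pow2_sqrt; auto. left; auto.
 - intros j. apply sqrt_lt_R0; auto.
Qed.

End EigFrame.

(** * Linear dependence of complex vectors *)

Lemma csum_ext f g n : (forall k, (k < n)%nat -> f k = g k) -> csum f n = csum g n.
Proof.
 induction n as [|n IH]; intros H; simpl; [reflexivity|]. rewrite IH, (H n) by (intros; try apply H; lia). reflexivity.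
Qed.

Lemma csum_plus f g n : csum (fun k => Cplus (f k) (g k)) n = Cplus (csum f n) (csum g n).
Proof. induction n as [|n IH]; simpl; [ring|]. rewrite IH. ring. Qed.

Lemma csum_scal c f n : csum (fun k => Cmult (f k) c) n = Cmult (csum f n) c.
Proof. induction n as [|n IH]; simpl; [ring|]. rewrite IH. ring. Qed.

Lemma csum_zero f n : (forall k, (k < n)%nat -> f k = RtoC 0) -> csum f n = RtoC 0.
Proof.
 induction n as [|n IH]; intros H; simpl; [reflexivity|]. rewrite IH, (H n) by (intros; try apply H; lia). ring.
Qed.

Lemma csum_exchange (c : nat -> C) (M : nat -> nat -> C) (V : nat -> C) n d :
 csum (fun i => csum (fun k => Cmult (Cmult (c i) (M i k)) (V k)) d) n =
 csum (fun k => Cmult (csum (fun i => Cmult (c i) (M i k)) n) (V k)) d.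
Proof.
 induction d as [|d IH]; simpl; [apply csum_zero; reflexivity|]. rewrite csum_plus, IH. f_equal. apply csum_scal.
Qed.

(** The increasing enumeration of the indices different from [i]. *)
Definition skip (i k : nat) : nat := if le_lt_dec i k then S k else k.

Lemma csum_skip f i n : (i <= n)%nat -> csum f (S n) = Cplus (f i) (csum (fun k => f (skip i k)) n).
Proof.
 induction n as [|n IH]; intros Hi.
 - replace i with 0%nat by lia. simpl. ring.
 - destruct (Nat.eq_dec i (S n)) as [->|Hne].
  + cbn [csum]. rewrite (csum_ext (fun k => f (skip (S n) k)) f).
   * unfold skip. destruct (le_lt_dec (S n) n); [lia|]. ring.
   * intros k Hk. unfold skip. destruct (le_lt_dec (S n) k); [lia|reflexivity].
  + change (csum f (S (S n))) with (Cplus (csum f (S n)) (f (S n))). rewrite IH by lia. cbn [csum].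
   unfold skip at 3. destruct (le_lt_dec i n); [ring|lia].
Qed.

(** Gaussian elimination by induction on the number of columns: a row with nonzero last entry clears
    that column in the other rows and is itself left out. *)
Lemma dependent_rows d : forall n (M : nat -> nat -> C), (d < n)%nat -> exists c : nat -> C, (exists i, (i < n)%nat /\ c i <> RtoC 0) /\
  forall j, (j < d)%nat -> csum (fun i => Cmult (c i) (M i j)) n = RtoC 0.
Proof.
 induction d as [|d IH]; intros n M Hn.
 - exists (fun _ => RtoC 1). split; [|intros; lia]. exists 0%nat. split; [lia|]. apply C1_nz.
 - destruct (classic (exists i, (i < n)%nat /\ M i d <> RtoC 0)) as [[i0 [Hi0 Hp]]|Hno].
  + destruct n as [|n]; [lia|].
   destruct (IH n (fun k j => Cminus (M (skip i0 k) j) (Cmult (Cmult (M (skip i0 k) d) (Cinv (M i0 d))) (M i0 j))) ltac:(lia))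
    as [c [[k [Hk Hck]] Hc]]. pose (c0 := Copp (Cmult (csum (fun k => Cmult (c k) (M (skip i0 k) d)) n) (Cinv (M i0 d)))).
   pose (c' := fun i => if Nat.eq_dec i i0 then c0 else if le_lt_dec i0 i then c (i - 1)%nat else c i).
   assert (Es : forall k, c' (skip i0 k) = c k). { intros l. unfold c', skip. destruct (le_lt_dec i0 l).
    - destruct (Nat.eq_dec (S l) i0); [lia|]. destruct (le_lt_dec i0 (S l)); [|lia]. f_equal. lia.
    - destruct (Nat.eq_dec l i0); [lia|]. destruct (le_lt_dec i0 l); [lia|]. reflexivity. }
   assert (E0 : c' i0 = c0) by (unfold c'; destruct (Nat.eq_dec i0 i0); [reflexivity|lia]). exists c'. split.
   * exists (skip i0 k). split; [unfold skip; destruct (le_lt_dec i0 k); lia|]. rewrite Es. exact Hck.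
   * intros j Hj. rewrite (csum_skip _ i0) by lia. rewrite E0.
    rewrite (csum_ext _ (fun k => Cmult (c k) (M (skip i0 k) j))) by (intros; rewrite Es; reflexivity).
    destruct (Nat.eq_dec j d) as [->|Hjd].
    -- unfold c0. field. exact Hp.
    -- specialize (Hc j ltac:(lia)). assert (Hsplit : csum (fun k => Cmult (c k) (M (skip i0 k) j)) n =
       Cplus (csum (fun i => Cmult (c i) (Cminus (M (skip i0 i) j) (Cmult (Cmult (M (skip i0 i) d) (Cinv (M i0 d))) (M i0 j)))) n)
        (Cmult (csum (fun k => Cmult (c k) (M (skip i0 k) d)) n) (Cmult (Cinv (M i0 d)) (M i0 j)))).
      { rewrite <- csum_scal, <- csum_plus. apply csum_ext. intros; ring. } rewrite Hsplit, Hc. unfold c0. ring.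
  + destruct (IH n M ltac:(lia)) as [c [Hc1 Hc2]]. exists c. split; auto.
   intros j Hj. destruct (Nat.eq_dec j d) as [->|]; [|apply Hc2; lia].
   apply csum_zero. intros i Hi. destruct (classic (M i d = RtoC 0)) as [->|Hne]; [ring|]. exfalso. apply Hno. eauto.
Qed.

(** * The constructed eigenvalues enumerate the spectrum of [b^{1/2} Lambda b^{1/2}] *)

Section EigSeq.
Variables (s b : R -> R) (C0 : nat -> R) (psi : nat -> nat -> R) (lam : nat -> R).
Hypothesis Hf : frame s b.
Hypothesis HC : bdd (Fm s b) C0.
Hypothesis HS : lsys (Fm s b) psi lam.
Let vv j := synth s (psi j).
Let Hb := fr_b s b Hf.

Lemma sqrt_b_Cinf : Cinf (fun x => sqrt (b x)).
Proof. apply Cinf_sqrt; auto. apply (fr_pos s b Hf). Qed.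

Lemma sqrt_b_pos x : 0 < sqrt (b x).
Proof. apply sqrt_lt_R0, (fr_pos s b Hf). Qed.

Lemma sqrt_b_sq x : sqrt (b x) * sqrt (b x) = b x.
Proof. apply sqrt_sqrt. left; apply (fr_pos s b Hf). Qed.

(** With [v = sqrt b u] the equation becomes [b Lambda v = x v], and as the operator is real it
    splits into real and imaginary parts. *)
Lemma eigsp_iff x u : eigsp b x u <-> cCinf u /\ (forall t, b t * Lr (fun y => sqrt (b y) * Re (u y)) t = x * (sqrt (b t) * Re (u t))) /\
 (forall t, b t * Lr (fun y => sqrt (b y) * Im (u y)) t = x * (sqrt (b t) * Im (u t))).
Proof.
 unfold eigsp. assert (Q : cCinf u -> forall t, Cmult (RtoC (sqrt (b t))) (Lam (fun y => Cmult (RtoC (sqrt (b y))) (u y)) t) =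
   (sqrt (b t) * Lr (fun y => sqrt (b y) * Re (u y)) t, sqrt (b t) * Lr (fun y => sqrt (b y) * Im (u y)) t)). { intros [H1 H2] t.
  assert (E1 : (fun y => Re (Cmult (RtoC (sqrt (b y))) (u y))) = fun y => sqrt (b y) * Re (u y)).
  { fext. intros y. unfold Re; simpl. ring. }
  assert (E2 : (fun y => Im (Cmult (RtoC (sqrt (b y))) (u y))) = fun y => sqrt (b y) * Im (u y)).
  { fext. intros y. unfold Im; simpl. ring. } rewrite Lam_real.
  - rewrite E1, E2. unfold Cmult, RtoC; simpl. f_equal; ring.
  - split; [rewrite E1|rewrite E2]; apply (Cinf_mult (fun y => sqrt (b y))); auto using sqrt_b_Cinf. }
 assert (Alg : forall t L r : R, sqrt (b t) * L = x * r <-> b t * L = x * (sqrt (b t) * r)).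
 { intros t L r. use (sqrt_b_pos t). rewrite <- (sqrt_b_sq t) at 2. split; intros E.
  - replace (sqrt (b t) * sqrt (b t) * L) with (sqrt (b t) * (sqrt (b t) * L)) by ring. rewrite E. ring.
  - apply (Rmult_eq_reg_l (sqrt (b t))); [|lra]. replace (sqrt (b t) * (x * r)) with (x * (sqrt (b t) * r)) by ring. rewrite <- E. ring. }
 assert (RX : forall t, Cmult (RtoC x) (u t) = (x * Re (u t), x * Im (u t))).
 { intros t. unfold Cmult, RtoC, Re, Im; simpl. f_equal; ring. } split.
 - intros [H1 H2]. split; auto. split; intros t; specialize (H2 t); rewrite Q, RX in H2 by auto; apply Alg.
  + exact (f_equal fst H2).
  + exact (f_equal snd H2).
 - intros [H1 [H2 H3]]. split; auto. intros t. rewrite Q, RX by auto. f_equal; apply Alg; auto.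
Qed.

(** Symmetry for the weight [1 / b] removes the components whose eigenvalue differs from [x]. The
    difference between [g] and its finite expansion has mean zero and is orthogonal to all
    eigenvectors, so completeness makes it vanish. *)
Lemma real_eig_expand x g m : Cinf g -> 0 < x -> (forall t, b t * Lr g t = x * g t) -> (forall j, (m <= j)%nat -> lam j <> x) ->
 (forall j, lam j <> x -> wavg b (fun t => g t * vv j t) = 0) /\ forall t, g t = sm (fun j => wavg b (fun t => g t * vv j t) * vv j t) m.
Proof.
 intros Hg Hx He Hm. assert (Hv : forall j, Cinf (vv j)) by (intros; apply (vv_Cinf s b Hf psi lam HS)).
 assert (Z : forall j, lam j <> x -> wavg b (fun t => g t * vv j t) = 0). { intros j Hj.
  assert (E : lam j * wavg b (fun t => g t * vv j t) = x * wavg b (fun t => g t * vv j t)).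
  { rewrite <- !(wavg_scal s b Hf) by (apply Cinf_cont, Cinf_mult; auto). rewrite (wavg_ext b _ (fun t => b t * (g t * Lr (vv j) t))).
   - rewrite (wavg_ext b (fun t => x * _) (fun t => b t * (Lr g t * vv j t))).
    + rewrite <- !(avg_to_wavg s b Hf). symmetry. apply Lr_self_adjoint; auto.
    + intros t. rewrite <- Rmult_assoc, <- He. ring.
   - intros t. use (vv_eig s b Hf psi lam HS j t) as Q.
    replace (lam j * (g t * vv j t)) with (g t * (lam j * vv j t)) by ring. unfold vv at 1. rewrite <- Q. unfold vv. ring. } nra. }
 split; auto. set (c := fun j => wavg b (fun t => g t * vv j t)) in *. pose (r := fun t => g t - sm (fun j => c j * vv j t) m).
 assert (HsC : Cinf (fun t => sm (fun j => c j * vv j t) m)). { apply (Cinf_sm (fun j t => c j * vv j t)). intros; apply Cinf_scal; auto. }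
 assert (Hr : Cinf r) by (apply Cinf_minus; auto). assert (Hwg : wavg b g = 0) by (apply (wavg_eig_zero s b Hf g x); auto; lra).
 assert (Hws : forall u, Cinf u -> wavg b (fun t => sm (fun j => c j * vv j t) m * u t) = sm (fun j => c j * wavg b (fun t => vv j t * u t)) m).
 { intros u Hu. clear - Hf Hv Hu. induction m as [|m IH]; simpl.
  - rewrite (wavg_ext b _ (fun _ => 0)) by (intros; ring). apply (wavg_const s b Hf).
  - rewrite (wavg_ext b _ (fun t => sm (fun j => c j * vv j t) m * u t + c m * (vv m t * u t))) by (intros; ring).
   rewrite (wavg_plus s b Hf), (wavg_scal s b Hf), IH; auto.
   + apply Cinf_cont, Cinf_mult; auto.
   + apply Cinf_cont, Cinf_mult; auto. apply (Cinf_sm (fun j t => c j * vv j t)). intros; apply Cinf_scal; auto.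
   + apply Cinf_cont, Cinf_scal, Cinf_mult; auto. } assert (Hwr : wavg b r = 0).
 { unfold r. rewrite (wavg_minus s b Hf), Hwg by (apply Cinf_cont; auto).
  rewrite (wavg_ext b (fun t => sm (fun j => c j * vv j t) m) (fun t => sm (fun j => c j * vv j t) m * 1)) by (intros; ring).
  rewrite (Hws (fun _ => 1) (Cinf_const 1)). rewrite sm_zero; [ring|]. intros j _.
  rewrite (wavg_ext b _ (vv j)) by (intros; ring). unfold vv. rewrite (wavg_vv s b Hf psi lam HS). ring. }
 assert (Hrj : forall j, wavg b (fun t => r t * vv j t) = 0).
 { intros j. unfold r. rewrite (wavg_ext b _ (fun t => g t * vv j t - sm (fun j => c j * vv j t) m * vv j t)) by (intros; ring).
  rewrite (wavg_minus s b Hf), Hws by (try (apply Cinf_cont, Cinf_mult); auto). fold (c j). destruct (le_lt_dec m j) as [Hj|Hj].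
  - rewrite sm_zero; [unfold c; rewrite Z by auto; ring|]. intros i Hi. unfold vv. rewrite (vv_on s b Hf psi lam HS), dl_diff by lia. ring.
  - rewrite (sm_single _ _ j); auto.
   + unfold vv. rewrite (vv_on s b Hf psi lam HS), dl_same. ring.
   + intros i _ Hij. unfold vv. rewrite (vv_on s b Hf psi lam HS), dl_diff by lia. ring. } assert (Hz : forall t, r t = 0).
 { apply (wavg_sq_zero s b Hf); auto. rewrite (fourier_parseval s b Hf) by auto. rewrite Hwr, Rmult_0_l, Rplus_0_l.
  use (es_complete _ _ _ (ls_sys _ _ _ HS) _ (coef_rapid s b Hf r Hr)) as S.
  rewrite <- (is_series_unique _ _ S). rewrite (Series_ext _ (fun _ => 0 * 0)); [rewrite Series_scal_l; ring|].
  intros j. assert (E : ip (coef s b r) (psi j) = 0). { rewrite <- (coef_vv s b Hf psi lam HS j). fold (vv j).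
   use (fourier_parseval s b Hf r (vv j) Hr (Hv j)) as P. rewrite Hwr, Hrj, Rmult_0_l, Rplus_0_l in P. auto. } rewrite E. ring. }
 intros t. specialize (Hz t). unfold r in Hz. change (g t = sm (fun j => c j * vv j t) m). lra.
Qed.

Lemma sm_complex (p q : nat -> R) (u : nat -> R) n :
 csum (fun j => Cmult (p j, q j) (RtoC (u j))) n = (sm (fun j => p j * u j) n, sm (fun j => q j * u j) n).
Proof.
 induction n as [|n IH]; simpl; [reflexivity|]. rewrite IH. unfold Cplus, Cmult, RtoC; simpl. f_equal; ring.
Qed.

Lemma sm_list (f : nat -> R) (x : R) m : (forall j, lam j <> x -> f j = 0) ->
 sm f m = sm (fun i => f (nth i (filter (fun j => if Req_EM_T (lam j) x then true else false) (seq 0 m)) 0%nat))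
  (length (filter (fun j => if Req_EM_T (lam j) x then true else false) (seq 0 m))).
Proof.
 intros H. induction m as [|m IH]; [reflexivity|].
 rewrite seq_S, filter_app, length_app. cbn [sm Nat.add]. rewrite IH. set (L := filter _ (seq 0 m)) in *.
 cbn [filter]. destruct (Req_EM_T (lam m) x) as [E|E].
 - cbn [length]. rewrite Nat.add_1_r. cbn [sm].
  rewrite (sm_ext (fun i => f (nth i (L ++ m :: nil) 0%nat)) (fun i => f (nth i L 0%nat))) by (intros; rewrite app_nth1; auto).
  rewrite nth_middle. reflexivity.
 - cbn [length]. rewrite Nat.add_0_r, app_nil_r. rewrite (H m E). ring.
Qed.

Theorem system_eig_seq : eig_seq b lam.
Proof.
 assert (Hv : forall j, Cinf (vv j)) by (intros; apply (vv_Cinf s b Hf psi lam HS)).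
 split; [apply (ls_pos _ _ _ HS)|]. split; [intros; eapply ls_mono; eauto|]. intros x n Hx. split.
 - intros [g [Hinj Hg]]. pose (f := fun i t => RtoC (/ sqrt (b t) * vv (g i) t)). exists f. split.
  + intros i Hi. apply eigsp_iff. split; [|split].
   * split; [|apply (Cinf_const 0)]. change (Cinf (fun t => / sqrt (b t) * vv (g i) t)). apply (Cinf_mult (fun t => / sqrt (b t))); auto.
    apply Cinf_inv; [apply sqrt_b_pos|apply sqrt_b_Cinf].
   * intros t. assert (E : (fun y => sqrt (b y) * Re (f i y)) = vv (g i)).
    { fext. intros y. use (sqrt_b_pos y). unfold f, Re, RtoC; simpl. field. lra. }
    rewrite E. use (vv_eig s b Hf psi lam HS (g i) t : b t * Lr (vv (g i)) t = lam (g i) * vv (g i) t) as Q. rewrite Q, (Hg i Hi).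
    use (sqrt_b_pos t). unfold f, Re, RtoC; simpl. field. lra.
   * intros t. assert (E : (fun y => sqrt (b y) * Im (f i y)) = fun _ => 0). { fext. intros y. unfold f, Im, RtoC; simpl. ring. }
    rewrite E, Lr_const. unfold f, Im, RtoC; simpl. ring.
  + intros c Hc. assert (Hs : forall t, sm (fun i => Re (c i) * vv (g i) t) n = 0 /\ sm (fun i => Im (c i) * vv (g i) t) n = 0).
   { intros t. specialize (Hc t). unfold f in Hc.
    rewrite (csum_ext _ (fun i => Cmult (Re (c i), Im (c i)) (RtoC (/ sqrt (b t) * vv (g i) t)))) in Hc
     by (intros; destruct (c k); reflexivity). rewrite sm_complex in Hc. use (sqrt_b_pos t) as Hp.
    assert (Q : forall h : nat -> R, sm (fun j => h j * (/ sqrt (b t) * vv (g j) t)) n = 0 -> sm (fun i => h i * vv (g i) t) n = 0).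
    { intros h E. rewrite (sm_ext _ (fun j => sqrt (b t) * (h j * (/ sqrt (b t) * vv (g j) t)))) by (intros; field; lra).
     rewrite sm_scal, E. ring. } split; apply Q; [exact (f_equal fst Hc)|exact (f_equal snd Hc)]. }
   assert (Z : forall h : nat -> R, (forall t, sm (fun i => h i * vv (g i) t) n = 0) -> forall i, (i < n)%nat -> h i = 0).
   { intros h Hh i Hi.
    assert (E : wavg b (fun t => sm (fun i => h i * vv (g i) t) n * vv (g i) t) = sm (fun k => h k * wavg b (fun t => vv (g k) t * vv (g i) t)) n).
    { clear - Hf Hv. induction n as [|n IH]; simpl.
     - rewrite (wavg_ext b _ (fun _ => 0)) by (intros; ring). apply (wavg_const s b Hf).
     - rewrite (wavg_ext b _ (fun t => sm (fun k => h k * vv (g k) t) n * vv (g i) t + h n * (vv (g n) t * vv (g i) t))) by (intros; ring).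
      rewrite (wavg_plus s b Hf), (wavg_scal s b Hf), IH; auto.
      + apply Cinf_cont, Cinf_mult; auto.
      + apply Cinf_cont, Cinf_mult; auto. apply (Cinf_sm (fun j t => h j * vv (g j) t)). intros; apply Cinf_scal; auto.
      + apply Cinf_cont, Cinf_scal, Cinf_mult; auto. }
    rewrite (wavg_ext b _ (fun _ => 0)) in E by (intros; rewrite Hh; ring). rewrite (wavg_const s b Hf) in E.
    rewrite (sm_single _ _ i) in E; auto.
    - unfold vv in E. rewrite (vv_on s b Hf psi lam HS), dl_same in E. lra.
    - intros k Hk Hki. unfold vv. rewrite (vv_on s b Hf psi lam HS), dl_diff; [ring|]. intros Eg. apply Hki. apply Hinj; auto. }
   intros i Hi. use (Z (fun i => Re (c i)) (fun t => proj1 (Hs t)) i Hi) as Z1.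
   use (Z (fun i => Im (c i)) (fun t => proj2 (Hs t)) i Hi) as Z2. cbv beta in Z1, Z2.
   rewrite (surjective_pairing (c i)). unfold Re, Im in *. rewrite Z1, Z2. reflexivity.
 (* Only finitely many indices carry the eigenvalue [x]. Were there fewer than [n], the coefficient
    rows of [n] eigenfunctions would be dependent, and so would the eigenfunctions. *)
 - intros [f [Hfe Hind]]. destruct (ls_cut (Fm s b) psi lam C0 (x + 1) HC HS) as [m Hm].
  assert (Hmx : forall j, (m <= j)%nat -> lam j <> x). { intros j Hj E. assert (Hlt : lam j < x + 1) by lra. apply Hm in Hlt. lia. }
  set (L := filter (fun j => if Req_EM_T (lam j) x then true else false) (seq 0 m)).
  assert (HL : forall i, (i < length L)%nat -> lam (nth i L 0%nat) = x).
  { intros i Hi. use (nth_In L 0%nat Hi) as Hin. unfold L in Hin. apply filter_In in Hin. destruct Hin as [_ Hin].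
   fold L in Hin. destruct (Req_EM_T (lam (nth i L 0%nat)) x); auto. discriminate. }
  assert (HN : NoDup L) by (apply NoDup_filter, seq_NoDup). destruct (le_lt_dec n (length L)) as [Hle|Hlt].
  + exists (fun i => nth i L 0%nat). split.
   * intros i j Hi Hj. apply (proj1 (NoDup_nth L 0%nat) HN); lia.
   * intros i Hi. apply HL. lia.
  + exfalso. pose (re := fun i j => wavg b (fun t => (sqrt (b t) * Re (f i t)) * vv j t)).
   pose (im := fun i j => wavg b (fun t => (sqrt (b t) * Im (f i t)) * vv j t)).
   destruct (dependent_rows (length L) n (fun i k => (re i (nth k L 0%nat), im i (nth k L 0%nat))) Hlt) as [c [[i0 [Hi0 Hc0]] Hc]].
   apply Hc0. apply Hind; auto. assert (Hexp : forall i t, (i < n)%nat -> Cmult (RtoC (sqrt (b t))) (f i t) =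
     csum (fun k => Cmult (re i (nth k L 0%nat), im i (nth k L 0%nat)) (RtoC (vv (nth k L 0%nat) t))) (length L)).
   { intros i t Hi. destruct (proj1 (eigsp_iff x (f i)) (Hfe i Hi)) as [[C1 C2] [E1 E2]].
    assert (D1 : Cinf (fun t => sqrt (b t) * Re (f i t))) by (apply (Cinf_mult (fun t => sqrt (b t))); auto using sqrt_b_Cinf).
    assert (D2 : Cinf (fun t => sqrt (b t) * Im (f i t))) by (apply (Cinf_mult (fun t => sqrt (b t))); auto using sqrt_b_Cinf).
    destruct (real_eig_expand x _ m D1 Hx E1 Hmx) as [Z1 S1]. destruct (real_eig_expand x _ m D2 Hx E2 Hmx) as [Z2 S2].
    rewrite sm_complex.
    assert (Q1 : sm (fun j => re i j * vv j t) m = sm (fun k => re i (nth k L 0%nat) * vv (nth k L 0%nat) t) (length L)).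
    { apply (sm_list (fun j => re i j * vv j t) x m). intros j Hj. unfold re. rewrite Z1 by auto. ring. }
    assert (Q2 : sm (fun j => im i j * vv j t) m = sm (fun k => im i (nth k L 0%nat) * vv (nth k L 0%nat) t) (length L)).
    { apply (sm_list (fun j => im i j * vv j t) x m). intros j Hj. unfold im. rewrite Z2 by auto. ring. } rewrite <- Q1, <- Q2.
    transitivity (sqrt (b t) * Re (f i t), sqrt (b t) * Im (f i t)).
    - unfold Cmult, RtoC, Re, Im; simpl. f_equal; ring.
    - f_equal; [apply S1|apply S2]. } intros t. use (sqrt_b_pos t) as Hp.
   assert (Hnz : RtoC (sqrt (b t)) <> RtoC 0) by (intros E; apply RtoC_inj in E; lra).
   assert (Eq : Cmult (csum (fun i => Cmult (c i) (f i t)) n) (RtoC (sqrt (b t))) = RtoC 0). { rewrite <- csum_scal.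
    rewrite (csum_ext _ (fun i => csum (fun k => Cmult (Cmult (c i) (re i (nth k L 0%nat), im i (nth k L 0%nat))) (RtoC (vv (nth k L 0%nat) t))) (length L))).
    - etransitivity; [apply (csum_exchange c (fun i k => (re i (nth k L 0%nat), im i (nth k L 0%nat))) (fun k => RtoC (vv (nth k L 0%nat) t)))|].
     apply csum_zero. intros k Hk. rewrite Hc by auto. ring.
    - intros i Hi. replace (Cmult (Cmult (c i) (f i t)) (RtoC (sqrt (b t)))) with (Cmult (Cmult (RtoC (sqrt (b t))) (f i t)) (c i)) by ring.
     rewrite (Hexp i t Hi), <- csum_scal. apply csum_ext. intros; ring. }
   replace (csum (fun i => Cmult (c i) (f i t)) n) with (Cmult (Cmult (csum (fun i => Cmult (c i) (f i t)) n) (RtoC (sqrt (b t)))) (Cinv (RtoC (sqrt (b t))))).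
   * rewrite Eq. ring.
   * field. exact Hnz.
Qed.

End EigSeq.

(** * Picard iteration for a bounded Lipschitz vector field *)

Lemma lipschitz_cont (f : R -> R) K : (forall x y, Rabs (f x - f y) <= K * Rabs (x - y)) -> cont f.
Proof.
 intros H x. apply continuity_pt_filterlim. intros eps He.
 assert (HK : 0 <= K). { specialize (H 1 0). rewrite Rminus_0_r, Rabs_R1 in H. use (Rabs_pos (f 1 - f 0)). lra. }
 assert (Hd : 0 < eps / (K + 1)) by (apply Rdiv_lt_0_compat; lra).
 exists (eps / (K + 1)). split; auto. intros y [_ Hy]. simpl in *. unfold R_dist in *. apply Rle_lt_trans with (K * Rabs (y - x)); auto.
 apply Rle_lt_trans with ((K + 1) * Rabs (y - x)); [use (Rabs_pos (y - x)); nra|].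
 apply (Rmult_lt_compat_l (K + 1)) in Hy; [|lra]. replace ((K + 1) * (eps / (K + 1))) with eps in Hy by (field; lra). lra.
Qed.

Lemma RInt_diff_le (f g h : R -> R) t : 0 <= t -> cont f -> cont g -> cont h ->
 (forall s, 0 <= s <= t -> Rabs (f s - g s) <= h s) -> Rabs (RInt f 0 t - RInt g 0 t) <= RInt h 0 t.
Proof.
 intros Ht Hf Hg Hh H. assert (E : RInt f 0 t - RInt g 0 t = RInt (fun s => f s - g s) 0 t).
 { symmetry. apply (RInt_minus f g); apply cont_ex_RInt; auto. } rewrite E. apply Rabs_le. split.
 - replace (- RInt h 0 t) with (RInt (fun s => - h s) 0 t).
  + apply RInt_le; auto.
   * apply (ex_RInt_opp h). apply cont_ex_RInt; auto.
   * apply cont_ex_RInt, cont_minus; auto.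
   * intros s Hs. specialize (H s ltac:(lra)). apply Rabs_le_between in H. lra.
  + apply (RInt_opp h). apply cont_ex_RInt; auto.
 - apply RInt_le; auto.
  + apply cont_ex_RInt, cont_minus; auto.
  + apply cont_ex_RInt; auto.
  + intros s Hs. specialize (H s ltac:(lra)). apply Rabs_le_between in H. lra.
Qed.

Lemma Rmax0_lip x y : Rabs (Rmax x 0 - Rmax y 0) <= Rabs (x - y).
Proof. unfold Rmax. destruct (Rle_dec x 0); destruct (Rle_dec y 0); unfold Rabs; repeat destruct Rcase_abs; lra. Qed.

Section Picard.
Variables (d : nat) (X : (nat -> R) -> nat -> R) (M L : R) (x0 : nat -> R).
Hypothesis HM : 0 <= M.
Hypothesis HL : 0 <= L.
Hypothesis Xbound : forall x j, (j < d)%nat -> Rabs (X x j) <= M.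
Hypothesis Xlip : forall x y j, (j < d)%nat -> Rabs (X x j - X y j) <= L * sm (fun k => Rabs (x k - y k)) d.

(** [Rmax t 0] freezes the iterates for negative times, so that they are Lipschitz on the whole
    line; coordinates from [d] on stay constant. *)
Fixpoint pic (n : nat) (t : R) (j : nat) : R := match n with
 | O => x0 j
 | S m => if le_lt_dec d j then x0 j else x0 j + RInt (fun s => X (pic m s) j) 0 (Rmax t 0) end.

Lemma primitive_lip (f : R -> R) : cont f -> (forall s, Rabs (f s) <= M) ->
 forall t t', Rabs (RInt f 0 (Rmax t 0) - RInt f 0 (Rmax t' 0)) <= M * Rabs (t - t').
Proof.
 intros Hf HB t t'. replace (RInt f 0 (Rmax t 0) - RInt f 0 (Rmax t' 0)) with (RInt f (Rmax t' 0) (Rmax t 0)).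
 2:{ assert (Ch : RInt f 0 (Rmax t' 0) + RInt f (Rmax t' 0) (Rmax t 0) = RInt f 0 (Rmax t 0))
    by (apply (RInt_Chasles f 0 (Rmax t' 0) (Rmax t 0)); apply cont_ex_RInt; auto). lra. }
 via (M * Rabs (Rmax t 0 - Rmax t' 0)); [|mul_l; auto; apply Rmax0_lip].
 assert (Q : forall a b, a <= b -> Rabs (RInt f a b) <= M * Rabs (b - a)).
 { intros a b Hab. rewrite (Rabs_pos_eq (b - a)), Rmult_comm by lra. apply (abs_RInt_le_const f a b M); auto. apply cont_ex_RInt; auto. }
 destruct (Rle_dec (Rmax t' 0) (Rmax t 0)) as [Hl|Hl]; [apply Q; auto|]. rewrite <- (opp_RInt_swap f); [|apply cont_ex_RInt; auto].
 change (opp (RInt f (Rmax t 0) (Rmax t' 0))) with (- RInt f (Rmax t 0) (Rmax t' 0)). rewrite Rabs_Ropp, Rabs_minus_sym. apply Q. lra.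
Qed.

Lemma X_cont (u : R -> nat -> R) j : (j < d)%nat -> (forall k t t', Rabs (u t k - u t' k) <= M * Rabs (t - t')) -> cont (fun s => X (u s) j).
Proof.
 intros Hj Hu. apply lipschitz_cont with (L * (INR d * M)). intros x y. eapply Rle_trans; [apply Xlip; auto|].
 rewrite Rmult_assoc. mul_l; auto. rewrite Rmult_assoc, <- sm_const. apply sm_le. intros; apply Hu.
Qed.

Lemma pic_lip n j t t' : Rabs (pic n t j - pic n t' j) <= M * Rabs (t - t').
Proof.
 revert j t t'. induction n as [|n IH]; intros j t t'; simpl.
 - rewrite Rminus_diag_eq, Rabs_R0 by reflexivity. apply Rmult_le_pos; auto. apply Rabs_pos.
 - destruct (le_lt_dec d j) as [Hj|Hj].
  + rewrite Rminus_diag_eq, Rabs_R0 by reflexivity. apply Rmult_le_pos; auto. apply Rabs_pos.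
  + match goal with |- Rabs (_ + ?a - (_ + ?b)) <= _ => replace (x0 j + a - (x0 j + b)) with (a - b) by ring end.
   apply primitive_lip; [apply X_cont; auto|intros; apply Xbound; auto].
Qed.

(** In the norm weighted by [exp (- 2 L1 t)] one iteration contracts by the factor 1/2; the summand
    1 keeps the rate positive. *)
Let L1 := INR d * L + 1.
Let A := INR d * M.

Lemma L1_pos : 1 <= L1.
Proof. unfold L1. use (pos_INR d). nra. Qed.

Lemma exp_RInt t : 0 <= t -> RInt (fun s => exp (2 * L1 * s)) 0 t <= exp (2 * L1 * t) / (2 * L1).
Proof.
 intros Ht. use L1_pos.
 assert (Q : is_RInt (fun s => exp (2 * L1 * s)) 0 t (minus (exp (2 * L1 * t) / (2 * L1)) (exp (2 * L1 * 0) / (2 * L1)))).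
 { apply (is_RInt_derive (fun s => exp (2 * L1 * s) / (2 * L1))).
  - intros x _. auto_derive; auto. field. lra.
  - intros x _. apply (ex_derive_continuous (fun s => exp (2 * L1 * s))). auto_derive; auto. }
 rewrite (is_RInt_unique _ _ _ _ Q). unfold minus, plus, opp; simpl. rewrite Rmult_0_r, exp_0.
 assert (0 < 1 / (2 * L1)) by (apply Rdiv_lt_0_compat; lra). lra.
Qed.

Lemma exp_cont c : cont (fun s => c * exp (2 * L1 * s)).
Proof. apply (is_derive_cont _ (fun s => c * (2 * L1 * exp (2 * L1 * s)))). intros x. auto_derive; auto. ring. Qed.

Lemma pic_step n t j : 0 <= t -> (j < d)%nat -> sm (fun k => Rabs (pic (S n) t k - pic n t k)) d <= A * exp (2 * L1 * t) / 2 ^ n.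
Proof.
 intros Ht _. revert t Ht. use L1_pos as HL1. use (pos_INR d) as Hd. induction n as [|n IH]; intros t Ht.
 - rewrite pow_O. unfold Rdiv. rewrite Rinv_1, Rmult_1_r. unfold A. rewrite Rmult_assoc, <- sm_const.
  apply sm_le. intros k Hk. simpl. destruct (le_lt_dec d k); [lia|]. rewrite Rplus_minus_l.
  rewrite RInt_const. unfold scal; simpl; unfold mult; simpl. rewrite Rmax_left, Rminus_0_r, Rabs_mult by auto.
  rewrite (Rabs_pos_eq t) by auto. rewrite Rmult_comm. mul_lr; auto using Rabs_pos. use (exp_ineq1_le (2 * L1 * t)). nra.
 - via (sm (fun _ => L * (A / 2 ^ n * (exp (2 * L1 * t) / (2 * L1)))) d).
  + apply sm_le. intros k Hk. change (pic (S (S n)) t k) with (if le_lt_dec d k then x0 k else x0 k + RInt (fun s => X (pic (S n) s) k) 0 (Rmax t 0)).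
   change (pic (S n) t k) with (if le_lt_dec d k then x0 k else x0 k + RInt (fun s => X (pic n s) k) 0 (Rmax t 0)).
   destruct (le_lt_dec d k); [lia|]. rewrite Rmax_left by auto.
   match goal with |- Rabs (_ + ?a - (_ + ?b)) <= _ => replace (x0 k + a - (x0 k + b)) with (a - b) by ring end.
   eapply Rle_trans; [apply (RInt_diff_le _ _ (fun s => (L * (A / 2 ^ n)) * exp (2 * L1 * s))); auto|].
   * apply X_cont; auto. intros; apply pic_lip.
   * apply X_cont; auto. intros; apply pic_lip.
   * apply exp_cont.
   * intros s Hs. eapply Rle_trans; [apply Xlip; auto|]. rewrite Rmult_assoc. mul_l; auto.
    eapply Rle_trans; [apply IH; lra|]. right. unfold Rdiv. ring.
   * rewrite (RInt_scal (fun s => exp (2 * L1 * s))).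
    -- unfold scal; simpl; unfold mult; simpl. rewrite (Rmult_assoc L). mul_l; auto.
      mul_l; [apply Rle_mult_inv_pos; [unfold A; nra|apply pow_lt; lra]|]. apply exp_RInt; auto.
    -- apply (ex_RInt_ext (fun s => 1 * exp (2 * L1 * s))); [intros; apply Rmult_1_l|]. apply cont_ex_RInt, exp_cont.
  + rewrite sm_const. simpl pow. use (exp_pos (2 * L1 * t)). assert (Hp : 0 < 2 ^ n) by (apply pow_lt; lra).
   replace (A * exp (2 * L1 * t) / (2 * 2 ^ n)) with ((A / 2 ^ n * (exp (2 * L1 * t) / (2 * L1))) * L1) by (field; lra).
   rewrite <- Rmult_assoc, Rmult_comm. mul_l; [|unfold L1; lra]. apply Rmult_le_pos; apply Rle_mult_inv_pos; auto; unfold A; nra.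
Qed.

Lemma pic_cauchy n p t j : 0 <= t -> (j < d)%nat -> Rabs (pic (p + n) t j - pic n t j) <= 2 * A * exp (2 * L1 * t) * (/ 2 ^ n - / 2 ^ (p + n)).
Proof.
 intros Ht Hj. induction p as [|p IH]; simpl Nat.add.
 - rewrite Rminus_diag_eq, Rabs_R0 by reflexivity. lra.
 - replace (pic (S (p + n)) t j - pic n t j) with ((pic (S (p + n)) t j - pic (p + n) t j) + (pic (p + n) t j - pic n t j)) by ring.
  upto Rabs_triang. use (pic_step (p + n) t j Ht Hj) as B.
  assert (B2 : Rabs (pic (S (p + n)) t j - pic (p + n) t j) <= A * exp (2 * L1 * t) / 2 ^ (p + n)). { below B.
   use (sm_mono (fun k => Rabs (pic (S (p + n)) t k - pic (p + n) t k)) (S j) d ltac:(intros; apply Rabs_pos) ltac:(lia)) as Q.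
   below Q. cbn [sm]. use (sm_pos (fun k => Rabs (pic (S (p + n)) t k - pic (p + n) t k)) j ltac:(intros; apply Rabs_pos)). lra. }
  assert (Hp : 0 < 2 ^ (p + n)) by (apply pow_lt; lra). simpl pow.
  assert (E : 2 * A * exp (2 * L1 * t) * (/ 2 ^ n - / (2 * 2 ^ (p + n))) =
    A * exp (2 * L1 * t) / 2 ^ (p + n) + 2 * A * exp (2 * L1 * t) * (/ 2 ^ n - / 2 ^ (p + n))).
  { field. split; [lra|apply pow_nonzero; lra]. } rewrite E. lra.
Qed.

Definition picl (t : R) (j : nat) : R := real (Lim_seq (fun n => pic n t j)).

Lemma half_pow_small (B eps : R) : 0 < eps -> exists N, forall n, (N <= n)%nat -> Rabs B / 2 ^ n < eps.
Proof.
 intros He. destruct (eventually_lt_w (Rabs B) eps He) as [N HN]. exists N. intros n Hn. specialize (HN n Hn).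
 eapply Rle_lt_trans; [|exact HN]. mul_l; [apply Rabs_pos|]. apply Rinv_le_contravar; [apply w_pos|].
 clear. unfold w. induction n as [|n IH]; [simpl; lra|]. rewrite S_INR. simpl pow. assert (1 <= 2 ^ n) by (apply pow_R1_Rle; lra). lra.
Qed.

Lemma picl_lim t j : is_lim_seq (fun n => pic n t j) (picl t j).
Proof.
 apply Lim_seq_correct'. destruct (le_lt_dec d j) as [Hj|Hj].
 - exists (x0 j). apply is_lim_seq_ext with (fun _ => x0 j); [|apply is_lim_seq_const].
  intros [|n]; simpl; auto. destruct (le_lt_dec d j); [reflexivity|lia].
 - assert (Hn : forall t, 0 <= t -> ex_finite_lim_seq (fun n => pic n t j)).
  { clear t. intros t Ht. apply ex_lim_seq_cauchy_corr. intros eps.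
   destruct (half_pow_small (2 * A * exp (2 * L1 * t)) eps (cond_pos eps)) as [N HN]. assert (HAE : 0 <= 2 * A * exp (2 * L1 * t)).
   { use (exp_pos (2 * L1 * t)). use (pos_INR d). unfold A. apply Rmult_le_pos; [|lra]. nra. }
   assert (Q : forall n m, (N <= n)%nat -> (n <= m)%nat -> Rabs (pic m t j - pic n t j) < eps).
   { intros n m Hn Hm. replace m with ((m - n) + n)%nat by lia. eapply Rle_lt_trans; [apply pic_cauchy; auto|].
    specialize (HN n Hn). rewrite Rabs_pos_eq in HN by auto. eapply Rle_lt_trans; [|exact HN].
    mul_l; auto. assert (0 < / 2 ^ (m - n + n)) by (apply Rinv_0_lt_compat, pow_lt; lra). lra. }
   exists N. intros n m Hn Hm. destruct (le_lt_dec n m).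
   - rewrite Rabs_minus_sym. apply Q; auto.
   - apply Q; auto. lia. } destruct (Rle_dec 0 t) as [Ht|Ht]; [apply Hn; auto|].
  destruct (Hn 0 (Rle_refl 0)) as [l Hl]. exists l. eapply is_lim_seq_ext; [|exact Hl].
  intros [|n]; simpl; auto. rewrite (Rmax_right t 0), (Rmax_right 0 0) by lra. reflexivity.
Qed.

Lemma picl_close n t j : 0 <= t -> (j < d)%nat -> Rabs (pic n t j - picl t j) <= 2 * A * exp (2 * L1 * t) / 2 ^ n.
Proof.
 intros Ht Hj. assert (Hl : is_lim_seq (fun p => Rabs (pic n t j - pic (p + n) t j)) (Rabs (pic n t j - picl t j))).
 { apply (is_lim_seq_abs _ (pic n t j - picl t j)). apply is_lim_seq_minus'; [apply is_lim_seq_const|].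
  apply (is_lim_seq_incr_n (fun p => pic p t j)). apply picl_lim. }
 apply (fun H => is_lim_seq_le _ _ (Finite _) (Finite _) H Hl (is_lim_seq_const (2 * A * exp (2 * L1 * t) / 2 ^ n))).
 intros p. rewrite Rabs_minus_sym. eapply Rle_trans; [apply pic_cauchy; auto|]. unfold Rdiv. mul_l.
 - use (exp_pos (2 * L1 * t)). use (pos_INR d). unfold A. apply Rmult_le_pos; [|lra]. nra.
 - assert (0 < / 2 ^ (p + n)) by (apply Rinv_0_lt_compat, pow_lt; lra). lra.
Qed.

Lemma picl_lip j t t' : Rabs (picl t j - picl t' j) <= M * Rabs (t - t').
Proof.
 assert (Hl : is_lim_seq (fun n => Rabs (pic n t j - pic n t' j)) (Rabs (picl t j - picl t' j))).
 { apply (is_lim_seq_abs _ (picl t j - picl t' j)). apply is_lim_seq_minus'; apply picl_lim. }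
 apply (fun H => is_lim_seq_le _ _ (Finite _) (Finite _) H Hl (is_lim_seq_const (M * Rabs (t - t')))). intros n. apply pic_lip.
Qed.

Lemma picl_integral t j : 0 <= t -> (j < d)%nat -> picl t j = x0 j + RInt (fun s => X (picl s) j) 0 t.
Proof.
 intros Ht Hj. apply Rminus_diag_uniq. set (I0 := RInt (fun s => X (picl s) j) 0 t).
 use (pos_INR d) as Hd. use (exp_pos (2 * L1 * t)) as He. assert (HA : 0 <= A) by (unfold A; nra).
 pose (B := (1 + t * L * INR d) * (2 * A * exp (2 * L1 * t))). assert (HtL : 0 <= t * L * INR d) by (apply Rmult_le_pos; [nra|auto]).
 assert (HB : 0 <= B) by (unfold B; apply Rmult_le_pos; [lra|apply Rmult_le_pos; lra]).
 assert (Hn : forall n, Rabs (picl t j - (x0 j + I0)) <= B / 2 ^ n). { intros n. assert (Hp : 0 < 2 ^ n) by (apply pow_lt; lra).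
  use (picl_close (S n) t j Ht Hj) as B1. assert (B1' : Rabs (pic (S n) t j - picl t j) <= 2 * A * exp (2 * L1 * t) / 2 ^ n).
  { upto B1. unfold Rdiv. mul_l; [nra|]. apply Rinv_le_contravar; auto. simpl. lra. }
  simpl in B1'. destruct (le_lt_dec d j) as [|_] in B1'; [lia|]. rewrite Rmax_left in B1' by auto.
  assert (B2 : Rabs (RInt (fun s => X (pic n s) j) 0 t - I0) <= t * L * INR d * (2 * A * exp (2 * L1 * t)) / 2 ^ n).
  { unfold I0. eapply Rle_trans; [apply (RInt_diff_le _ _ (fun _ => L * (INR d * (2 * A * exp (2 * L1 * t) / 2 ^ n)))); auto|].
   - apply X_cont; auto. intros; apply pic_lip.
   - apply X_cont; auto. intros; apply picl_lip.
   - apply cont_const.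
   - intros s Hs. eapply Rle_trans; [apply Xlip; auto|]. mul_l; auto.
    rewrite <- sm_const. apply sm_le. intros k Hk. eapply Rle_trans; [apply picl_close; auto; lra|].
    unfold Rdiv. mul_r; [left; apply Rinv_0_lt_compat; auto|]. mul_l; [lra|].
    use L1_pos. destruct (proj2 Hs) as [Hlt| ->]; [left; apply exp_increasing; nra|lra].
   - rewrite RInt_const. unfold scal; simpl; unfold mult; simpl. right. field. lra. }
  replace (picl t j - (x0 j + I0)) with (- (x0 j + RInt (fun s => X (pic n s) j) 0 t - picl t j) + (RInt (fun s => X (pic n s) j) 0 t - I0)) by ring.
  upto Rabs_triang. rewrite Rabs_Ropp. unfold B.
  replace ((1 + t * L * INR d) * (2 * A * exp (2 * L1 * t)) / 2 ^ n) with (2 * A * exp (2 * L1 * t) / 2 ^ n + t * L * INR d * (2 * A * exp (2 * L1 * t)) / 2 ^ n) by (field; lra).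
  lra. } destruct (Req_dec (picl t j - (x0 j + I0)) 0) as [|Hne]; auto. exfalso.
 destruct (half_pow_small B _ (Rabs_pos_lt _ Hne)) as [N HN]. specialize (HN N (Nat.le_refl _)). rewrite Rabs_pos_eq in HN by auto.
 specialize (Hn N). lra.
Qed.

Lemma picl_neg t j : t <= 0 -> picl t j = x0 j.
Proof.
 intros Ht. unfold picl. rewrite (Lim_seq_ext _ (fun _ => x0 j)); [rewrite Lim_seq_const; reflexivity|].
 intros [|n]; simpl; auto. destruct (le_lt_dec d j); [reflexivity|]. rewrite Rmax_right, RInt_point by auto. apply Rplus_0_r.
Qed.

Lemma picl_derive t j : 0 < t -> (j < d)%nat -> is_derive (fun t => picl t j) t (X (picl t) j).
Proof.
 intros Ht Hj. apply (is_derive_ext_loc (fun t => x0 j + RInt (fun s => X (picl s) j) 0 t)).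
 - exists (mkposreal t Ht). intros y Hy. symmetry. apply picl_integral; auto.
  assert (Rabs (y - t) < t) by exact Hy. apply Rabs_def2 in H. lra.
 - replace (X (picl t) j) with (0 + X (picl t) j) by ring.
  apply (is_derive_plus (fun _ : R => x0 j) (fun t : R => RInt (fun s => X (picl s) j) 0 t) t 0); [exact (is_derive_const (x0 j) t)|].
  apply (is_derive_RInt (fun s => X (picl s) j) (fun t => RInt (fun s => X (picl s) j) 0 t) 0 t).
  + exists (mkposreal 1 Rlt_0_1). intros y _. apply (RInt_correct (fun s => X (picl s) j)).
   apply cont_ex_RInt, X_cont; auto. intros; apply picl_lip.
  + apply X_cont; auto. intros; apply picl_lip.
Qed.

End Picard.

Theorem picard_solution (d : nat) (X : (nat -> R) -> nat -> R) (M L : R) (x0 : nat -> R) : 0 <= M -> 0 <= L ->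
 (forall x j, (j < d)%nat -> Rabs (X x j) <= M) ->
 (forall x y j, (j < d)%nat -> Rabs (X x j - X y j) <= L * sm (fun k => Rabs (x k - y k)) d) ->
 exists u : R -> nat -> R, (forall t j, t <= 0 -> u t j = x0 j) /\ (forall t t' j, Rabs (u t j - u t' j) <= M * Rabs (t - t')) /\
  forall t j, 0 < t -> (j < d)%nat -> is_derive (fun t => u t j) t (X (u t) j).
Proof.
 intros HM HL H1 H2. exists (picl d X x0). split; [|split].
 - intros t j Ht. apply picl_neg; auto.
 - intros t t' j. apply (picl_lip d X M L); auto.
 - intros t j Ht Hj. apply (picl_derive d X M L); auto.
Qed.

(** * The flow on trigonometric polynomials *)

Definition fl (u : R -> R) (x : R) : R := Jr u x * Derive u x - u x * Lr u x.

Definition crd (u : R -> R) (j : nat) : R := match j with O => avg u | S k => fc u k end.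

Definition EE (j : nat) (x : R) : R := match j with O => 1 | S k => ee k x end.

Definition JE (j : nat) (x : R) : R := match j with O => 0 | S k => sqrt 2 * cos (mu k * x + (ph k - PI / 2)) end.

(* [JE k * EE l' - EE k * Lr (EE l)]: only the difference of the two frequencies survives,
  which is why the flow preserves trigonometric polynomials of degree [N]. *)
Definition WW (k l : nat) (x : R) : R := match k, l with
 | _, O => 0
 | O, S l => - mu l * ee l x
 | S k, S l => (-2 * mu l) * cs id_f (muz k - muz l) (ph k - ph l) x end.

Definition bb (N : nat) (be : nat -> R) (x : R) : R := sm (fun j => be j * EE j x) (2 * N + 1).

(** The flow in coordinates, where coordinate 0 is the mean: a quadratic vector field with structure
    constants [crd (WW k l) j]. *)
Definition XX (N : nat) (be : nat -> R) (j : nat) : R := sm (fun k => sm (fun l => be k * be l * crd (WW k l) j) (2 * N + 1)) (2 * N + 1).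

Lemma EE_Cinf j : Cinf (EE j).
Proof. destruct j; [exact (Cinf_const 1)|exact (ee_Cinf j)]. Qed.

Lemma EE_bound j x : Rabs (EE j x) <= 2.
Proof. destruct j; simpl; [rewrite Rabs_R1; lra|apply ee_bound]. Qed.

Lemma WW_Cinf k l : Cinf (WW k l).
Proof.
 destruct l as [|l]; [destruct k; exact (Cinf_const 0)|]. destruct k as [|k].
 - apply (Cinf_scal (- mu l)), ee_Cinf.
 - apply (Cinf_scal (-2 * mu l)), cs_id_Cinf.
Qed.

Lemma bb_Cinf N be : Cinf (bb N be).
Proof. apply (Cinf_sm (fun j x => be j * EE j x)). intros. apply Cinf_scal, EE_Cinf. Qed.

Lemma crd_scal c u j : Cinf u -> crd (fun x => c * u x) j = c * crd u j.
Proof. intros Hu. use (Cinf_cont _ Hu). destruct j; [apply avg_scal; auto|apply fc_scal; auto]. Qed.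

Lemma crd_plus u v j : Cinf u -> Cinf v -> crd (fun x => u x + v x) j = crd u j + crd v j.
Proof.
 intros Hu Hv. use (Cinf_cont _ Hu). use (Cinf_cont _ Hv). destruct j; [apply avg_plus; auto|apply fc_plus; auto].
Qed.

Lemma crd_sm (u : nat -> R -> R) n j : (forall k, Cinf (u k)) -> crd (fun x => sm (fun k => u k x) n) j = sm (fun k => crd (u k) j) n.
Proof.
 intros H. induction n as [|n IH]; cbn [sm].
 - destruct j; [apply avg_const|apply fc_const].
 - rewrite (crd_plus (fun x => sm (fun k => u k x) n) (u n)), IH; auto. apply (Cinf_sm u). auto.
Qed.

Lemma crd_EE k j : crd (EE k) j = dl k j.
Proof.
 destruct j as [|j]; destruct k as [|k]; cbn [crd].
 - rewrite dl_same. apply (avg_const 1).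
 - rewrite dl_diff by lia. exact (avg_ee k).
 - rewrite dl_diff by lia. exact (fc_const 1 j).
 - change (EE (S k)) with (ee k). rewrite fc_ee. unfold dl. destruct (Nat.eq_dec k j), (Nat.eq_dec (S k) (S j)); auto; lia.
Qed.

Lemma crd_bb N be j : crd (bb N be) j = if lt_dec j (2 * N + 1) then be j else 0.
Proof.
 unfold bb. rewrite (crd_sm (fun k x => be k * EE k x)) by (intros; apply Cinf_scal, EE_Cinf).
 rewrite (sm_ext _ (fun k => be k * dl k j)) by (intros; rewrite crd_scal, crd_EE by apply EE_Cinf; reflexivity).
 destruct (lt_dec j (2 * N + 1)) as [H|H].
 - rewrite (sm_single _ _ j); auto; [rewrite dl_same; ring|]. intros k _ Hk. rewrite dl_diff by auto. ring.
 - apply sm_zero. intros k Hk. rewrite dl_diff by lia. ring.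
Qed.

Lemma bb_band N be : band N (bb N be).
Proof. intros j Hj. use (crd_bb N be (S j)) as E. destruct (lt_dec (S j) (2 * N + 1)); [lia|exact E]. Qed.

Lemma crd_eq u v : Cinf u -> Cinf v -> (forall j, crd u j = crd v j) -> u = v.
Proof.
 intros Hu Hv H. apply fc_eq; auto using Cinf_cont; try apply Hu; try apply Hv; [exact (H 0%nat)|intros k; exact (H (S k))].
Qed.

Lemma bb_crd N u : Cinf u -> band N u -> u = bb N (crd u).
Proof.
 intros Hu HN. apply crd_eq; auto; [apply bb_Cinf|]. intros j. rewrite crd_bb.
 destruct (lt_dec j (2 * N + 1)); auto. destruct j; [lia|]. apply HN. lia.
Qed.

Lemma shift_sum (be f : nat -> R) N : f 0%nat = 0 -> sm (fun j => be j * f j) (2 * N + 1) = sm (fun k => be (S k) * f (S k)) (2 * N).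
Proof. intros H. rewrite Nat.add_1_r, sm_first, H. ring. Qed.

Lemma fc_bb N be k : (k < 2 * N)%nat -> fc (bb N be) k = be (S k).
Proof. intros Hk. use (crd_bb N be (S k)) as E. destruct (lt_dec (S k) (2 * N + 1)); [exact E|lia]. Qed.

Lemma Jr_bb N be x : Jr (bb N be) x = sm (fun j => be j * JE j x) (2 * N + 1).
Proof.
 rewrite (shift_sum be (fun j => JE j x)) by reflexivity. rewrite (series_finite _ (2 * N) _ (Jr_is_series _ x (bb_Cinf N be))).
 - apply sm_ext. intros k Hk. rewrite fc_bb by auto. reflexivity.
 - intros k Hk. rewrite (bb_band N be k Hk). ring.
Qed.

Lemma Lr_bb N be x : Lr (bb N be) x = sm (fun j => be j * Lr (EE j) x) (2 * N + 1).
Proof.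
 rewrite (shift_sum be (fun j => Lr (EE j) x)) by (change (EE 0) with (fun _ : R => 1); rewrite Lr_const; reflexivity).
 rewrite (series_finite _ (2 * N) _ (Lr_is_series _ x (bb_Cinf N be))).
 - apply sm_ext. intros k Hk. rewrite fc_bb by auto. change (EE (S k)) with (ee k). rewrite Lr_ee. ring.
 - intros k Hk. rewrite (bb_band N be k Hk). ring.
Qed.

Lemma is_derive_sm (u v : nat -> R -> R) n x : (forall k, (k < n)%nat -> is_derive (u k) x (v k x)) ->
 is_derive (fun y => sm (fun k => u k y) n) x (sm (fun k => v k x) n).
Proof.
 intros H. induction n as [|n IH]; cbn [sm]; [exact (is_derive_const 0 x)|].
 apply (is_derive_plus (fun y => sm (fun k => u k y) n) (u n)); auto.
Qed.

Lemma Derive_bb N be x : Derive (bb N be) x = sm (fun j => be j * Derive (EE j) x) (2 * N + 1).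
Proof.
 apply is_derive_unique. apply (is_derive_sm (fun j y => be j * EE j y) (fun j y => be j * Derive (EE j) y)).
 intros k _. apply (is_derive_scal (EE k)), Cinf_is_derive, EE_Cinf.
Qed.

Lemma WW_eq k l x : JE k x * Derive (EE l) x - EE k x * Lr (EE l) x = WW k l x.
Proof.
 destruct l as [|l].
 - change (EE 0) with (fun _ : R => 1). rewrite Lr_const, Derive_const. destruct k; simpl; ring.
 - change (EE (S l)) with (ee l). rewrite Lr_ee, Derive_ee. destruct k as [|k]; cbn [JE EE WW]; [ring|].
  unfold ee. rewrite !cs_id, minus_IZR, <- !mu_IZR.
  replace (mu k * x + (ph k - PI / 2)) with (mu k * x + ph k + - (PI / 2)) by ring. rewrite cos_m_PI2, cos_p_PI2.
  replace ((mu k - mu l) * x + (ph k - ph l)) with ((mu k * x + ph k) - (mu l * x + ph l)) by ring. rewrite cos_minus.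
  transitivity (- (sqrt 2 * sqrt 2) * mu l * (cos (mu k * x + ph k) * cos (mu l * x + ph l) + sin (mu k * x + ph k) * sin (mu l * x + ph l))); [ring|].
  rewrite sqrt2_sq. ring.
Qed.

Lemma fl_bb N be x : fl (bb N be) x = sm (fun k => sm (fun l => be k * be l * WW k l x) (2 * N + 1)) (2 * N + 1).
Proof.
 unfold fl. rewrite Jr_bb, Lr_bb, Derive_bb. unfold bb. rewrite <- !sm_scal_r, <- sm_minus. apply sm_ext. intros k _.
 rewrite <- !sm_scal, <- sm_minus. apply sm_ext. intros l _. rewrite <- WW_eq. ring.
Qed.

Lemma fl_Cinf u : Cinf u -> Cinf (fl u).
Proof. intros H. unfold fl. cinf. Qed.

Lemma crd_fl N be j : crd (fl (bb N be)) j = XX N be j.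
Proof.
 replace (fl (bb N be)) with (fun x => sm (fun k => sm (fun l => be k * be l * WW k l x) (2 * N + 1)) (2 * N + 1)).
 2:{ fext. intros x. symmetry. apply fl_bb. } rewrite (crd_sm (fun k x => sm (fun l => be k * be l * WW k l x) (2 * N + 1))).
 - apply sm_ext. intros k _. rewrite (crd_sm (fun l x => be k * be l * WW k l x)).
  + apply sm_ext. intros l _. apply crd_scal, WW_Cinf.
  + intros. apply Cinf_scal, WW_Cinf.
 - intros k. apply (Cinf_sm (fun l x => be k * be l * WW k l x)). intros. apply Cinf_scal, WW_Cinf.
Qed.

Lemma muz_le k N : (k < 2 * N)%nat -> (muz k <= Z.of_nat N)%Z.
Proof. intros H. unfold muz. use (div2_bounds k). lia. Qed.

Lemma muz_gt k N : (2 * N <= k)%nat -> (Z.of_nat N < muz k)%Z.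
Proof. intros H. unfold muz. use (div2_bounds k). lia. Qed.

Lemma WW_band N k l : (k < 2 * N + 1)%nat -> (l < 2 * N + 1)%nat -> band N (WW k l).
Proof.
 intros Hk Hl j Hj. destruct l as [|l]. { transitivity (fc (fun _ => 0) j); [destruct k; reflexivity|apply fc_const]. } destruct k as [|k].
 - change (WW 0 (S l)) with (fun x => - mu l * ee l x). rewrite fc_scal, fc_ee, dl_diff by (apply ee_cont || lia). ring.
 - change (WW (S k) (S l)) with (fun x => (-2 * mu l) * cs id_f (muz k - muz l) (ph k - ph l) x).
  rewrite fc_scal by (apply Cinf_cont, cs_id_Cinf). use (muz_le k N ltac:(lia)). use (muz_le l N ltac:(lia)). use (muz_gt j N Hj).
  use (muz_pos k). use (muz_pos l). enough (E : fc (cs id_f (muz k - muz l) (ph k - ph l)) j = 0) by (rewrite E; ring).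
  rewrite <- coef_id, (coef_cs id_f one_f frame_id) by (apply Cinf_cont, cs_id_Cinf).
  erewrite (wavg_ext one_f) by (intros x; apply cs_mult).
  rewrite (wavg_scal id_f one_f frame_id), (wavg_plus id_f one_f frame_id), !(wavg_cs id_f one_f frame_id) by
   (try lia; try apply cont_plus; apply Cinf_cont, cs_id_Cinf). ring.
Qed.

Lemma XX_high N be j : (2 * N + 1 <= j)%nat -> XX N be j = 0.
Proof.
 intros Hj. apply sm_zero. intros k Hk. apply sm_zero. intros l Hl. destruct j as [|j]; [lia|].
 cbn [crd]. rewrite (WW_band N k l Hk Hl j) by lia. ring.
Qed.

Lemma fl_bb_XX N be : fl (bb N be) = bb N (XX N be).
Proof.
 apply crd_eq; [apply fl_Cinf|..]; try apply bb_Cinf. intros j. rewrite crd_fl, crd_bb.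
 destruct (lt_dec j (2 * N + 1)); auto. apply XX_high. lia.
Qed.

Lemma bb_lin N be be' c x : bb N (fun j => be j + c * be' j) x = bb N be x + c * bb N be' x.
Proof. unfold bb. rewrite <- sm_scal, <- sm_plus. apply sm_ext. intros; ring. Qed.

Lemma bb_bound N be B x : (forall j, (j < 2 * N + 1)%nat -> Rabs (be j) <= B) -> Rabs (bb N be x) <= INR (2 * N + 1) * (B * 2).
Proof.
 intros H. unfold bb. upto sm_abs. rewrite <- sm_const. apply sm_le. intros j Hj. rewrite Rabs_mult. mul_lr; auto using Rabs_pos, EE_bound.
Qed.

(** * Global existence and positivity *)

Lemma avg_fl u : Cinf u -> avg (fl u) = - 2 * avg (fun x => u x * Lr u x).
Proof.
 intros Hu. unfold fl. rewrite (avg_minus (fun x => Jr u x * Derive u x) (fun x => u x * Lr u x)) by ccont.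
 rewrite (avg_ext (fun x => Jr u x * Derive u x) (fun x => Derive u x * Jr u x)) by (intros; ring). rewrite avg_by_parts by cinf.
 rewrite (avg_ext (fun x => u x * Derive (Jr u) x) (fun x => u x * Lr u x)); [ring|].
 intros x. rewrite (is_derive_unique _ _ _ (Jr_derive u x Hu)). reflexivity.
Qed.

Lemma avg_fl_nonpos u : Cinf u -> avg (fl u) <= 0.
Proof. intros Hu. rewrite avg_fl by auto. destruct (Lr_form_pos u Hu) as [H _]. use (Rle_0_sqr (fc u 0)). unfold Rsqr in *. lra. Qed.

(** For a nonnegative function the mean controls every coefficient. As the flow does not increase
    the mean, this is the a priori bound that excludes blow-up. *)
Lemma crd_le_avg u j : Cinf u -> (forall x, 0 <= u x) -> Rabs (crd u j) <= 2 * avg u.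
Proof.
 intros Hu Hp. use (Cinf_cont _ Hu) as Hc. assert (H0 : 0 <= avg u) by (rewrite <- (avg_const 0); apply avg_le; auto using cont_const).
 destruct j as [|k]; cbn [crd]; [rewrite Rabs_pos_eq by auto; lra|]. unfold fc.
 assert (Hk : cont (fun x => u x * ee k x)) by (apply cont_mult; auto using ee_cont).
 assert (Q : forall x, Rabs (u x * ee k x) <= 2 * u x).
 { intros x. rewrite Rabs_mult, (Rabs_pos_eq (u x)) by auto. use (ee_bound k x). specialize (Hp x). nra. }
 assert (c2 : forall c, cont (fun x => c * u x)) by (intros; apply cont_mult; auto using cont_const). apply Rabs_le. split.
 - replace (- (2 * avg u)) with (avg (fun x => -2 * u x)) by (rewrite avg_scal by auto; ring). apply avg_le; auto.
  intros x. specialize (Q x). apply Rabs_le_between in Q. lra.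
 - rewrite <- avg_scal by auto. apply avg_le; auto. intros x. specialize (Q x). apply Rabs_le_between in Q. lra.
Qed.

Lemma per_minimum u : Cinf u -> exists x, (forall y, u x <= u y) /\ Derive u x = 0.
Proof.
 intros Hu. use two_pi_pos. destruct (continuity_ab_min u 0 (2 * PI) ltac:(lra)) as [x [Hx _]].
 { intros c _. apply continuity_pt_filterlim, (Cinf_cont _ Hu). } assert (Hm : forall y, u x <= u y).
 { intros y. destruct (per_reduce y 0) as [z [Hz E]]. rewrite <- (E u (proj2 Hu)). apply Hx. lra. } exists x. split; auto.
 assert (pr : derivable_pt u x) by (apply ex_derive_Reals_0; eexists; apply Cinf_is_derive; auto).
 rewrite <- (Derive_Reals u x pr). apply (deriv_minimum u (x - 1) (x + 1) x pr); auto; lra.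
Qed.

Lemma exp_le x y : x <= y -> exp x <= exp y.
Proof. intros [H| ->]; [left; apply exp_increasing; auto|lra]. Qed.

(** Clamping the coordinates to [[- K, K]] makes the quadratic field bounded and globally Lipschitz,
    as the Picard iteration demands. *)
Definition cl (K x : R) : R := Rmax (- K) (Rmin K x).

Lemma cl_bound K x : 0 <= K -> Rabs (cl K x) <= K.
Proof. intros H. unfold cl, Rmax, Rmin. apply Rabs_le. repeat destruct Rle_dec; lra. Qed.

Lemma cl_id K x : Rabs x <= K -> cl K x = x.
Proof. intros H. apply Rabs_le_between in H. unfold cl, Rmax, Rmin. repeat destruct Rle_dec; lra. Qed.

Lemma cl_lip K x y : Rabs (cl K x - cl K y) <= Rabs (x - y).
Proof. unfold cl, Rmax, Rmin. repeat destruct Rle_dec; unfold Rabs; repeat destruct Rcase_abs; lra. Qed.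

Lemma sm_le_elem (f : nat -> R) n j : (forall k, 0 <= f k) -> (j < n)%nat -> f j <= sm f n.
Proof.
 intros H Hj. use (sm_mono f (S j) n H ltac:(lia)) as Q. cbn [sm] in Q. use (sm_pos f j ltac:(auto)). lra.
Qed.

Section XXbounds.
Variable N : nat.
Let d := (2 * N + 1)%nat.

Definition Gam : R := sm (fun j => sm (fun k => sm (fun l => Rabs (crd (WW k l) j)) d) d) d.

Lemma Gam_row j : (j < d)%nat -> sm (fun k => sm (fun l => Rabs (crd (WW k l) j)) d) d <= Gam.
Proof.
 intros Hj. apply (sm_le_elem (fun j => sm (fun k => sm (fun l => Rabs (crd (WW k l) j)) d) d)); auto.
 intros. apply sm_pos. intros. apply sm_pos. intros. apply Rabs_pos.
Qed.

Lemma Gam_pos : 0 <= Gam.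
Proof. apply sm_pos. intros. apply sm_pos. intros. apply sm_pos. intros. apply Rabs_pos. Qed.

Lemma sm_abs2 (f g : nat -> nat -> R) B : (forall k l, (k < d)%nat -> (l < d)%nat -> Rabs (f k l) <= B * Rabs (g k l)) ->
 Rabs (sm (fun k => sm (fun l => f k l) d) d) <= B * sm (fun k => sm (fun l => Rabs (g k l)) d) d.
Proof.
 intros H. upto sm_abs. rewrite <- sm_scal. apply sm_le. intros k Hk. upto sm_abs. rewrite <- sm_scal. apply sm_le. auto.
Qed.

Lemma XX_bound K be j : 0 <= K -> (forall k, (k < d)%nat -> Rabs (be k) <= K) -> (j < d)%nat -> Rabs (XX N be j) <= K * K * Gam.
Proof.
 intros HK H Hj. unfold XX. eapply Rle_trans.
 - apply (sm_abs2 _ (fun k l => crd (WW k l) j) (K * K)). intros k l Hk Hl. rewrite !Rabs_mult.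
  mul_r; [apply Rabs_pos|]. mul_lr; auto using Rabs_pos.
 - mul_l; [nra|apply Gam_row; auto].
Qed.

Lemma XX_lip K be ga j : 0 <= K -> (forall k, (k < d)%nat -> Rabs (be k) <= K) -> (forall k, (k < d)%nat -> Rabs (ga k) <= K) ->
 (j < d)%nat -> Rabs (XX N be j - XX N ga j) <= 2 * K * Gam * sm (fun k => Rabs (be k - ga k)) d.
Proof.
 intros HK H1 H2 Hj. unfold XX. rewrite <- sm_minus. fold d.
 rewrite (sm_ext _ (fun k => sm (fun l => (be k * be l - ga k * ga l) * crd (WW k l) j) d)).
 2:{ intros k _. rewrite <- sm_minus. apply sm_ext. intros; ring. } set (S0 := sm (fun k => Rabs (be k - ga k)) d).
 assert (HS : forall k, (k < d)%nat -> Rabs (be k - ga k) <= S0).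
 { intros k Hk. apply (sm_le_elem (fun k => Rabs (be k - ga k))); auto. intros; apply Rabs_pos. }
 assert (HS0 : 0 <= S0) by (apply sm_pos; intros; apply Rabs_pos). eapply Rle_trans.
 - apply (sm_abs2 _ (fun k l => crd (WW k l) j) (2 * K * S0)). intros k l Hk Hl. rewrite Rabs_mult. mul_r; [apply Rabs_pos|].
  replace (be k * be l - ga k * ga l) with (be k * (be l - ga l) + (be k - ga k) * ga l) by ring. upto Rabs_triang. rewrite !Rabs_mult.
  replace (2 * K * S0) with (K * S0 + S0 * K) by ring. apply Rplus_le_compat; mul_lr; auto using Rabs_pos.
 - replace (2 * K * Gam * S0) with (2 * K * S0 * Gam) by ring. mul_l; [|apply Gam_row; auto]. apply Rmult_le_pos; lra.
Qed.

End XXbounds.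

Lemma MVT_open (f f' : R -> R) a b : a < b -> (forall x, a < x < b -> is_derive f x (f' x)) -> (forall x, a <= x <= b -> continuous f x) ->
 exists c, a < c < b /\ f b - f a = f' c * (b - a).
Proof.
 intros Hab Hd Hc. assert (pr1 : forall c, a < c < b -> derivable_pt f c) by (intros c Hcc; exists (f' c); apply is_derive_Reals; auto).
 assert (pr2 : forall c, a < c < b -> derivable_pt id c) by (intros; apply derivable_pt_id).
 destruct (MVT f id a b pr1 pr2 Hab) as [c [P E]].
 - intros c Hcc. apply continuity_pt_filterlim, Hc; auto.
 - intros c _. apply derivable_continuous_pt, derivable_pt_id.
 - exists c. split; auto. rewrite (Rminus_def (f b)) in *. unfold id in *.
  assert (E1 : derive_pt f c (pr1 c P) = f' c) by (apply derive_pt_eq_0, is_derive_Reals, Hd; auto).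
  assert (E2 : derive_pt (fun x => x) c (pr2 c P) = 1) by (apply derive_pt_eq_0, derivable_pt_lim_id). rewrite E1, E2 in E. lra.
Qed.

(** * Continuation of the clamped flow *)

Section Global.
Variables (N : nat) (a : R -> R).
Hypothesis Ha : Cinf a.
Hypothesis Hband : band N a.
Hypothesis Hpos : forall x, 0 < a x.
Let d := (2 * N + 1)%nat.
(** One unit above the a priori bound [2 avg a], so that the clamp remains inactive for some time
    after every good time. *)
Let K := 2 * avg a + 1.
Let M := K * K * Gam N.
Let L := 2 * K * Gam N.
Let Xc (be : nat -> R) (j : nat) : R := XX N (fun k => cl K (be k)) j.

Lemma avg_a_pos : 0 <= avg a.
Proof. rewrite <- (avg_const 0). apply avg_le; [apply cont_const|apply Cinf_cont; auto|intros; left; auto]. Qed.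

Lemma K_pos : 1 <= K.
Proof. unfold K. use avg_a_pos. lra. Qed.

Lemma L_pos : 0 <= L.
Proof. unfold L. use K_pos. use (Gam_pos N). nra. Qed.

Lemma M_pos : 0 <= M.
Proof. unfold M. use K_pos. use (Gam_pos N). apply Rmult_le_pos; nra. Qed.

Lemma Xc_bound x j : (j < d)%nat -> Rabs (Xc x j) <= M.
Proof. intros Hj. use K_pos. apply XX_bound; auto; try lra. intros. apply cl_bound. lra. Qed.

Lemma Xc_lip x y j : (j < d)%nat -> Rabs (Xc x j - Xc y j) <= L * sm (fun k => Rabs (x k - y k)) d.
Proof.
 intros Hj. use K_pos. use L_pos. upto (XX_lip N K); auto; try lra; try (intros; apply cl_bound; lra).
 fold L. mul_l; auto. apply sm_le. intros. apply cl_lip.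
Qed.

Section Trajectory.
Variable be : R -> nat -> R.
Hypothesis be0 : forall t j, t <= 0 -> be t j = crd a j.
Hypothesis belip : forall t t' j, Rabs (be t j - be t' j) <= M * Rabs (t - t').
Hypothesis bede : forall t j, 0 < t -> (j < d)%nat -> is_derive (fun t => be t j) t (Xc (be t) j).

(** Up to time [t] the clamp is inactive and the polynomial nonnegative. Strict positivity is
    regained from [good_min], which makes room for the next step. *)
Let good (t : R) := forall s, s <= t -> (forall j, (j < d)%nat -> Rabs (be s j) <= K) /\ forall x, 0 <= bb N (be s) x.

Lemma be_cont j : cont (fun t => be t j).
Proof. apply lipschitz_cont with M. intros; apply belip. Qed.

Lemma Xc_good t s j : good t -> s <= t -> Xc (be s) j = XX N (be s) j.
Proof.
 intros G Hs. destruct (G s Hs) as [H _]. unfold Xc, XX. apply sm_ext. intros k Hk. apply sm_ext. intros l Hl.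
 rewrite !cl_id by auto. reflexivity.
Qed.

Lemma bb_0 t : t <= 0 -> bb N (be t) = a.
Proof.
 intros Ht. rewrite (bb_crd N a Ha Hband). fext. intros x. apply sm_ext. intros j _. rewrite be0 by auto. reflexivity.
Qed.

Lemma good_avg t : 0 <= t -> good t -> be t 0%nat <= avg a.
Proof.
 intros Ht G. destruct Ht as [Ht|<-]; [|rewrite be0 by lra; simpl; lra].
 destruct (MVT_open (fun t => be t 0%nat) (fun t => Xc (be t) 0) 0 t Ht) as [c [Hc E]].
 - intros x Hx. apply bede; [lra|unfold d; lia].
 - intros x _. apply be_cont.
 - rewrite (be0 0) in E by lra. cbn [crd] in E. rewrite (Xc_good t) in E by (auto; lra).
  use (avg_fl_nonpos (bb N (be c)) (bb_Cinf _ _)) as Q. use (crd_fl N (be c) 0) as Q2. cbn [crd] in Q2. nra.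
Qed.

Lemma good_bound t j : 0 <= t -> good t -> (j < d)%nat -> Rabs (be t j) <= K - 1.
Proof.
 intros Ht G Hj. use (crd_le_avg (bb N (be t)) j (bb_Cinf _ _) (proj2 (G t (Rle_refl t)))) as Q.
 use (crd_bb N (be t) j) as E. use (crd_bb N (be t) 0) as E0. fold d in E, E0.
 destruct (lt_dec j d); [|lia]. destruct (lt_dec 0 d); [|unfold d in *; lia]. cbn [crd] in E0.
 rewrite E, E0 in Q. use (good_avg t Ht G). unfold K. lra.
Qed.

(** The expansion is centred at the later time, because [good_min] evaluates the field at a minimum
    point of the later polynomial. *)
Lemma be_taylor a' b' j : 0 <= a' -> a' < b' -> (j < d)%nat ->
 Rabs (be b' j - be a' j - (b' - a') * Xc (be b') j) <= L * (INR d * M) * (b' - a') ^ 2.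
Proof.
 intros H0 Hab Hj. destruct (MVT_open (fun t => be t j) (fun t => Xc (be t) j) a' b' Hab) as [c [Hc E]].
 - intros x Hx. apply bede; auto; lra.
 - intros x _. apply be_cont.
 - cbv beta in E. rewrite E. replace (Xc (be c) j * (b' - a') - (b' - a') * Xc (be b') j) with ((Xc (be c) j - Xc (be b') j) * (b' - a')) by ring.
  rewrite Rabs_mult, (Rabs_pos_eq (b' - a')) by lra. use L_pos. use M_pos.
  replace (L * (INR d * M) * (b' - a') ^ 2) with (L * (INR d * (M * (b' - a'))) * (b' - a')) by ring.
  mul_r; [lra|]. eapply Rle_trans; [apply Xc_lip; auto|]. mul_l; auto.
  rewrite <- sm_const. apply sm_le. intros k _. upto belip. mul_l; auto. unfold Rabs; destruct Rcase_abs; lra.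
Qed.

Let L2 := sm (fun j => K * (2 * w j)) d.

Lemma Lr_EE_bound j x : Rabs (Lr (EE j) x) <= 2 * w j.
Proof.
 use (w_pos j). destruct j as [|k].
 - change (EE 0) with (fun _ : R => 1). rewrite Lr_const, Rabs_R0. lra.
 - change (EE (S k)) with (ee k). rewrite Lr_ee, Rabs_mult. use (mu_le_w k). use (mu_ge1 k). use (ee_bound k x).
  rewrite (Rabs_pos_eq (mu k)) by lra. use (Rabs_pos (ee k x)). rewrite w_S in *. nra.
Qed.

Lemma good_Lr t x : good t -> Lr (bb N (be t)) x <= L2.
Proof.
 intros G. rewrite Lr_bb. upto Rle_abs. upto sm_abs. apply sm_le. intros j Hj.
 rewrite Rabs_mult. mul_lr; auto using Rabs_pos, Lr_EE_bound. apply (G t); auto. lra.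
Qed.

Lemma L2_pos : 0 <= L2.
Proof. apply sm_pos. intros k _. use K_pos. use (w_pos k). nra. Qed.

Lemma good_mono t s : good t -> s <= t -> good s.
Proof. intros G H r Hr. apply G. lra. Qed.

(* At a minimum the transport term vanishes, so the minimum decays at most exponentially. *)
Lemma good_min m t x : (forall y, m <= a y) -> 0 <= t -> good t -> m * exp (- (L2 * t)) <= bb N (be t) x.
Proof.
 intros Hm Ht G.
 assert (W : forall s, exists y, (forall z, bb N (be s) y <= bb N (be s) z) /\ Derive (bb N (be s)) y = 0) by (intros; apply per_minimum, bb_Cinf).
 destruct (choice _ W) as [y Hy]. clear W. pose (C1 := INR d * (L * (INR d * M) * 2) * exp (L2 * t)).
 assert (Q : - (bb N (be t) (y t) * exp (L2 * t)) <= - (bb N (be 0) (y 0) * exp (L2 * 0))).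
 (* The minimum need not be differentiable in time. The minimum at the earlier time [u] is at most
    the value there at the later minimum point [y v], which gives a one-sided estimate of the
    increment. *)
 { apply (quadratic_decrease (fun s => - (bb N (be s) (y s) * exp (L2 * s))) t C1 Ht).
  intros u v Hu Huv Hv. destruct (Hy v) as [_ Hd]. use (proj1 (Hy u) (y v)) as H1. destruct (G v Hv) as [_ Hp]. specialize (Hp (y v)).
  assert (E : bb N (be u) (y v) - bb N (be v) (y v) + (v - u) * bb N (XX N (be v)) (y v) <= INR d * (L * (INR d * M) * (v - u) ^ 2 * 2)).
  { rewrite <- (Rmult_1_l (bb N (be v) (y v))).
   replace (bb N (be u) (y v) - 1 * bb N (be v) (y v) + (v - u) * bb N (XX N (be v)) (y v)) with
    (bb N (be u) (y v) + (-1) * bb N (be v) (y v) + (v - u) * bb N (XX N (be v)) (y v)) by ring.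
   rewrite <- !bb_lin. upto Rle_abs. apply bb_bound. intros j Hj. fold d in Hj. rewrite <- (Xc_good t) by auto.
   replace (be u j + -1 * be v j + (v - u) * Xc (be v) j) with (- (be v j - be u j - (v - u) * Xc (be v) j)) by ring.
   rewrite Rabs_Ropp. apply be_taylor; auto. } rewrite <- fl_bb_XX in E. unfold fl in E. rewrite Hd in E.
  use (good_Lr v (y v) (good_mono t v G Hv)) as HL. use (exp_ineq1_le (L2 * (v - u))) as He.
  assert (E2 : bb N (be u) (y u) <= bb N (be v) (y v) * exp (L2 * (v - u)) + INR d * (L * (INR d * M) * (v - u) ^ 2 * 2)).
  { use (Rmult_le_compat_l _ _ _ Hp He) as P1.
   use (Rmult_le_compat_l _ _ _ Hp (Rmult_le_compat_l (v - u) _ _ ltac:(lra) HL)) as P2. lra. }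
  assert (Ev : exp (L2 * v) = exp (L2 * (v - u)) * exp (L2 * u)) by (rewrite <- exp_plus; f_equal; ring).
  assert (Eu : exp (L2 * u) <= exp (L2 * t)). { use L2_pos. apply exp_le. nra. } use (exp_pos (L2 * u)) as Hu0. rewrite Ev.
  apply (Rmult_le_compat_r (exp (L2 * u))) in E2; [|lra]. assert (0 <= INR d * (L * (INR d * M) * (v - u) ^ 2 * 2)).
  { use (pos_INR d). use L_pos. use M_pos. assert (0 <= (v - u) ^ 2) by apply pow2_ge_0.
   apply Rmult_le_pos; auto. apply Rmult_le_pos; [|lra]. apply Rmult_le_pos; auto. apply Rmult_le_pos; auto. apply Rmult_le_pos; auto. }
  unfold C1. nra. } rewrite (bb_0 0 (Rle_refl 0)), Rmult_0_r, exp_0 in Q.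
 assert (Q2 : m <= bb N (be t) (y t) * exp (L2 * t)) by (specialize (Hm (y 0)); lra). below (proj1 (Hy t) x).
 apply (Rmult_le_reg_r (exp (L2 * t))); [apply exp_pos|]. rewrite Rmult_assoc, <- exp_plus.
 replace (- (L2 * t) + L2 * t) with 0 by ring. rewrite exp_0. lra.
Qed.

(** Continuation with a fixed step. [D] collects the speeds so that during [eps] the coordinates
    move by at most 1 and the values by at most [m exp (- L2 t)], the lower bound for the minimum on
    the whole interval. *)
Lemma good_all t : good t.
Proof.
 destruct (per_minimum a Ha) as [x0 [Hm _]]. pose (m := a x0). assert (Hm0 : 0 < m) by apply Hpos. assert (G0 : good 0).
 { intros s Hs. rewrite bb_0 by auto. split; [|intros; left; auto]. intros j _. rewrite be0 by auto.
  eapply Rle_trans; [apply crd_le_avg; auto; intros; left; auto|]. unfold K. lra. }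
 destruct (Rle_dec t 0) as [Hn|Hn]; [apply (good_mono 0); auto|]. assert (Ht : 0 < t) by lra.
 use M_pos as HM. use (pos_INR d) as Hd. use L2_pos as HL2. assert (Hexp : 0 < exp (- (L2 * t))) by apply exp_pos.
 pose (D := M + INR d * M * 2 + 1). assert (HD : 0 < D) by (unfold D; nra). pose (eps := Rmin 1 (m * exp (- (L2 * t))) / D).
 assert (Hq : 0 < Rmin 1 (m * exp (- (L2 * t)))) by (apply Rmin_glb_lt; [lra|apply Rmult_lt_0_compat; auto]).
 assert (Heps : 0 < eps) by (apply Rdiv_lt_0_compat; auto). assert (HeD : eps * D <= 1 /\ eps * D <= m * exp (- (L2 * t))).
 { unfold eps, Rdiv. rewrite Rmult_assoc, Rinv_l, Rmult_1_r by lra. split; [apply Rmin_l|apply Rmin_r]. }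
 assert (St : forall s, 0 <= s <= t -> good s -> good (s + eps)).
 { intros s Hs G r Hr. destruct (Rle_dec r s) as [Hrs|Hrs]; [apply G; auto|]. assert (Hl : forall j, Rabs (be r j - be s j) <= M * eps).
  { intros j. upto belip. mul_l; auto. rewrite Rabs_pos_eq; lra. } split.
  - intros j Hj. use (good_bound s j ltac:(lra) G Hj) as B. specialize (Hl j).
   replace (be r j) with (be s j + (be r j - be s j)) by ring. upto Rabs_triang. unfold D in HeD. nra.
  - intros x. use (good_min m s x Hm ltac:(lra) G) as B. assert (B2 : m * exp (- (L2 * t)) <= m * exp (- (L2 * s))).
   { mul_l; [lra|]. apply exp_le. nra. } assert (B3 : Rabs (bb N (fun j => be r j + (-1) * be s j) x) <= INR d * (M * eps * 2)).
   { apply bb_bound. intros j _. replace (be r j + -1 * be s j) with (be r j - be s j) by ring. apply Hl. }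
   rewrite bb_lin in B3. apply Rabs_le_between in B3. unfold D in HeD. nra. } assert (Hn2 : forall n, good (Rmin (INR n * eps) t)).
 { induction n as [|n IH].
  - simpl. rewrite Rmult_0_l, Rmin_left by lra. auto.
  - apply good_mono with (Rmin (INR n * eps) t + eps).
   + apply St; auto. split; [|apply Rmin_r]. apply Rmin_glb; [|lra]. use (pos_INR n). nra.
   + rewrite S_INR. unfold Rmin. repeat destruct Rle_dec; lra. }
 destruct (INR_unbounded (t / eps)) as [n Hn3]. apply good_mono with (Rmin (INR n * eps) t); auto.
 apply Rmin_glb; [|lra]. apply (Rmult_lt_compat_r eps) in Hn3; auto. unfold Rdiv in Hn3. rewrite Rmult_assoc, Rinv_l in Hn3; lra.
Qed.

End Trajectory.

Theorem flow_exists : exists be : R -> nat -> R, (forall t j, t <= 0 -> be t j = crd a j) /\ (forall j, cont (fun t => be t j)) /\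
 (forall t j, 0 < t -> (j < 2 * N + 1)%nat -> is_derive (fun t => be t j) t (XX N (be t) j)) /\
 (forall T, exists m, 0 < m /\ forall t x, t <= T -> m <= bb N (be t) x) /\ (forall t, avg (bb N (be t)) <= avg a).
Proof.
 destruct (picard_solution d Xc M L (crd a) M_pos L_pos) as [be [H0 [H1 H2]]].
 { intros; apply Xc_bound; auto. } { intros; apply Xc_lip; auto. } use (good_all be H0 H1 H2) as G. exists be.
 split; [auto|]. split; [apply be_cont; auto|]. split; [|split].
 - intros t j Ht Hj. rewrite <- (Xc_good be t t j (G t) (Rle_refl t)). auto.
 - intros T. destruct (per_minimum a Ha) as [x0 [Hm _]]. use (L2_pos) as HL2. match type of HL2 with 0 <= ?l => set (L2 := l) in * end.
  exists (a x0 * exp (- (L2 * Rmax T 0))). split; [apply Rmult_lt_0_compat; [auto|apply exp_pos]|].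
  assert (Q : forall t x, 0 <= t -> t <= Rmax T 0 -> a x0 * exp (- (L2 * Rmax T 0)) <= bb N (be t) x).
  { intros t x Ht HtT. below (good_min be H0 H1 H2 (a x0) t x Hm Ht (G t)).
   mul_l; [left; auto|]. apply exp_le. use (Rmult_le_compat_l L2 _ _ HL2 HtT). fold L2. lra. }
  intros t x Ht. destruct (Rle_dec t 0) as [Hn|Hn].
  + replace (bb N (be t)) with (bb N (be 0)) by (rewrite !(bb_0 be H0) by lra; reflexivity). apply Q; [lra|apply Rmax_r].
  + apply Q; [lra|]. eapply Rle_trans; [exact Ht|apply Rmax_l].
 - intros t. destruct (Rle_dec t 0) as [Ht|Ht]; [rewrite (bb_0 be H0) by auto; lra|].
  use (crd_bb N (be t) 0) as E0. destruct (lt_dec 0 (2 * N + 1)); [|lia]. cbn [crd] in E0. rewrite E0.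
  exact (good_avg be H0 H1 H2 t ltac:(lra) (G t)).
Qed.

End Global.

(** * Algebras of functions of time and angle *)

(** If the generators are locally bounded and their derivatives lie in the generated algebra, the
    same holds for all elements, and then for derivatives of any order. This spares separate
    regularity proofs for derived quantities. *)
Inductive alg (A : (R -> R -> R) -> Prop) : (R -> R -> R) -> Prop :=
| alg_gen g : A g -> alg A g
| alg_const c : alg A (fun _ _ => c)
| alg_plus f g : alg A f -> alg A g -> alg A (fun t x => f t x + g t x)
| alg_mult f g : alg A f -> alg A g -> alg A (fun t x => f t x * g t x).

(* Time derivatives are only available for [t > 0]; freezing the functions for
  [t <= 0] makes them continuous on the whole line. *)
Record reg (A : (R -> R -> R) -> Prop) (g : R -> R -> R) : Prop := {
 reg_x : exists gx, alg A gx /\ forall t x, is_derive (g t) x (gx t x);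
 reg_t : exists gt, alg A gt /\ forall t x, 0 < t -> is_derive (fun t => g t x) t (gt t x);
 reg_cont : forall x, cont (fun t => g t x);
 reg_bound : forall T, exists K, forall t x, t <= T -> Rabs (g t x) <= K;
 reg_per : forall t, per (g t);
 reg_neg : forall t x, t <= 0 -> g t x = g 0 x }.

Ltac Rring := match goal with |- ?u = ?v => change (@eq R u v) end; cbv beta; ring.

Lemma is_derive_mult_R (f g : R -> R) x f' g' : is_derive f x f' -> is_derive g x g' ->
 is_derive (fun y => f y * g y) x (f' * g x + f x * g').
Proof. intros Hf Hg. apply (is_derive_mult f g x f' g' Hf Hg). intros; apply Rmult_comm. Qed.

Lemma reg_plus A f g : reg A f -> reg A g -> reg A (fun t x => f t x + g t x).
Proof.
 intros [[fx [Hf1 Hf2]] [ft [Hf3 Hf4]] Hf5 Hf6 Hf7 Hf8] [[gx [Hg1 Hg2]] [gt [Hg3 Hg4]] Hg5 Hg6 Hg7 Hg8]. split.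
 - exists (fun t x => fx t x + gx t x). split; [apply alg_plus; auto|]. intros t x. apply (is_derive_plus (f t) (g t)); auto.
 - exists (fun t x => ft t x + gt t x). split; [apply alg_plus; auto|].
  intros t x Ht. apply (is_derive_plus (fun t => f t x) (fun t => g t x)); auto.
 - intros x. apply (cont_plus (fun t => f t x) (fun t => g t x)); auto.
 - intros T. destruct (Hf6 T) as [K1 H1]. destruct (Hg6 T) as [K2 H2]. exists (K1 + K2). intros t x Ht.
  upto Rabs_triang. apply Rplus_le_compat; auto.
 - intros t x. rewrite Hf7, Hg7. reflexivity.
 - intros t x Ht. rewrite Hf8, Hg8 by auto. reflexivity.
Qed.

Lemma reg_mult A f g : alg A f -> alg A g -> reg A f -> reg A g -> reg A (fun t x => f t x * g t x).
Proof.
 intros Af Ag [[fx [Hf1 Hf2]] [ft [Hf3 Hf4]] Hf5 Hf6 Hf7 Hf8] [[gx [Hg1 Hg2]] [gt [Hg3 Hg4]] Hg5 Hg6 Hg7 Hg8]. split.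
 - exists (fun t x => fx t x * g t x + f t x * gx t x). split; [apply alg_plus; apply alg_mult; auto|].
  intros t x. apply (is_derive_mult_R (f t) (g t)); auto.
 - exists (fun t x => ft t x * g t x + f t x * gt t x). split; [apply alg_plus; apply alg_mult; auto|].
  intros t x Ht. apply (is_derive_mult_R (fun t => f t x) (fun t => g t x)); auto.
 - intros x. apply (cont_mult (fun t => f t x) (fun t => g t x)); auto.
 - intros T. destruct (Hf6 T) as [K1 H1]. destruct (Hg6 T) as [K2 H2]. exists (K1 * K2). intros t x Ht.
  rewrite Rabs_mult. mul_lr; auto using Rabs_pos.
 - intros t x. rewrite Hf7, Hg7. reflexivity.
 - intros t x Ht. rewrite Hf8, Hg8 by auto. reflexivity.
Qed.

Lemma reg_const A c : reg A (fun _ _ => c).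
Proof.
 split; try (exists (fun _ _ => 0); split; [apply alg_const|intros; exact (is_derive_const c _)]).
 - intros. apply cont_const.
 - intros. exists (Rabs c). intros; lra.
 - intros t x. reflexivity.
 - reflexivity.
Qed.

Lemma alg_sub (A B : (R -> R -> R) -> Prop) g : (forall f, A f -> B f) -> alg A g -> alg B g.
Proof. intros H. induction 1; [apply alg_gen; auto|apply alg_const|apply alg_plus; auto|apply alg_mult; auto]. Qed.

Lemma reg_sub (A B : (R -> R -> R) -> Prop) g : (forall f, A f -> B f) -> reg A g -> reg B g.
Proof.
 intros H [[gx [H1 H2]] [gt [H3 H4]] H5 H6 H7 H8]. split; auto.
 - exists gx. split; auto. apply (alg_sub A); auto.
 - exists gt. split; auto. apply (alg_sub A); auto.
Qed.

Lemma alg_sm A (f : nat -> R -> R -> R) n : (forall k, (k < n)%nat -> alg A (f k)) -> alg A (fun t x => sm (fun k => f k t x) n).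
Proof.
 intros H. induction n as [|n IH]; cbn [sm]; [apply alg_const|]. apply (alg_plus A (fun t x => sm (fun k => f k t x) n) (f n)); auto.
Qed.

Lemma alg_ext A f g : (forall t x, f t x = g t x) -> alg A f -> alg A g.
Proof. intros H Hf. replace g with f; auto. fext; intros t. fext; auto. Qed.

Create HintDb alg.

Ltac alga := repeat match goal with
 | |- alg _ (fun t x => @?f t x + @?g t x) => apply (alg_plus _ f g)
 | |- alg _ (fun t x => @?f t x * @?g t x) => apply (alg_mult _ f g)
 | |- alg _ (fun _ _ => ?c) => apply (alg_const _ c) end; auto with alg.

Lemma cont_half (f : R -> R) : (forall t, t <= 0 -> f t = f 0) ->
 (forall T, exists K, forall a b, 0 <= a <= T -> 0 <= b <= T -> Rabs (f b - f a) <= K * Rabs (b - a)) -> cont f.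
Proof.
 intros H0 H t. destruct (H (Rabs t + 1)) as [K HK]. use (Rabs_pos t) as Ht0. use (Rle_abs t) as Ht1.
 assert (E : forall u, f u = f (Rmax u 0)). { intros u. unfold Rmax. destruct (Rle_dec u 0); auto. }
 assert (HK0 : 0 <= K). { specialize (HK 0 1 ltac:(lra) ltac:(lra)). rewrite Rminus_0_r, Rabs_R1 in HK. use (Rabs_pos (f 1 - f 0)). lra. }
 apply continuity_pt_filterlim. intros eps He. assert (Hd : 0 < eps / (K + 1)) by (apply Rdiv_lt_0_compat; lra).
 exists (Rmin 1 (eps / (K + 1))). split; [apply Rmin_glb_lt; lra|]. intros y [_ Hy]. simpl in *. unfold R_dist in *.
 use (Rlt_le_trans _ _ _ Hy (Rmin_l _ _)) as Hy1. use (Rlt_le_trans _ _ _ Hy (Rmin_r _ _)) as Hy2.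
 apply Rabs_def2 in Hy1. rewrite (E y), (E t).
 assert (Hb : forall u, u <= Rabs t + 1 -> 0 <= Rmax u 0 <= Rabs t + 1) by (intros u Hu; split; [apply Rmax_r|apply Rmax_lub; lra]).
 eapply Rle_lt_trans; [apply HK; apply Hb; lra|]. apply Rle_lt_trans with (K * Rabs (y - t)); [mul_l; auto; apply Rmax0_lip|].
 apply Rle_lt_trans with ((K + 1) * Rabs (y - t)); [use (Rabs_pos (y - t)); nra|].
 apply (Rmult_lt_compat_l (K + 1)) in Hy2; [|lra]. replace ((K + 1) * (eps / (K + 1))) with eps in Hy2 by (field; lra). lra.
Qed.

Section Algebra.
Variable A : (R -> R -> R) -> Prop.
Hypothesis HA : forall g, A g -> reg A g.

Lemma alg_reg g : alg A g -> reg A g.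
Proof. induction 1; auto; [apply reg_const|apply reg_plus; auto|apply reg_mult; auto]. Qed.

Lemma alg_Cinf g t : alg A g -> Cinf (g t).
Proof.
 intros Hg. split; [|apply (reg_per A g), alg_reg; auto]. apply (smooth_class (fun u => exists f, alg A f /\ u = f t)); [|exists g; auto].
 intros u [f [Hf ->]]. destruct (reg_x A f (alg_reg f Hf)) as [fx [H1 H2]]. exists (fx t). split; eauto.
Qed.

Lemma alg_cont g t : alg A g -> cont (g t).
Proof. intros; apply Cinf_cont, alg_Cinf; auto. Qed.

(** The second time derivative lies again in the algebra, hence is bounded uniformly in the angle;
    continuity carries the estimate down to time 0. *)
Lemma alg_taylor g gt : alg A g -> alg A gt -> (forall t x, 0 < t -> is_derive (fun t => g t x) t (gt t x)) ->
 forall T, exists K, 0 <= K /\ forall a b x, 0 <= a <= T -> 0 <= b <= T -> Rabs (g b x - g a x - (b - a) * gt a x) <= K * (b - a) ^ 2.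
Proof.
 intros Hg Hgt Hd T. destruct (reg_t A gt (alg_reg gt Hgt)) as [gtt [H1 H2]].
 destruct (reg_bound A gtt (alg_reg gtt H1) T) as [K HK]. exists K. split.
 { eapply Rle_trans; [apply Rabs_pos|apply (HK T 0 (Rle_refl T))]. }
 intros a b x Ha Hb. apply (taylor2 (fun t => g t x) (fun t => gt t x) (fun t => gtt t x)).
 - intros t Ht. apply Hd. eapply Rle_lt_trans; [|apply Ht]. apply Rmin_glb; lra.
 - intros t Ht. apply H2. eapply Rle_lt_trans; [|apply Ht]. apply Rmin_glb; lra.
 - intros t _. apply (reg_cont A g (alg_reg g Hg) x t).
 - intros t _. apply (reg_cont A gt (alg_reg gt Hgt) x t).
 - intros t Ht. apply HK. upto Ht. apply Rmax_lub; lra.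
Qed.

Lemma alg_avg_taylor g gt : alg A g -> alg A gt -> (forall t x, 0 < t -> is_derive (fun t => g t x) t (gt t x)) ->
 forall T, exists K, 0 <= K /\ forall a b, 0 <= a <= T -> 0 <= b <= T -> Rabs (avg (g b) - avg (g a) - (b - a) * avg (gt a)) <= K * (b - a) ^ 2.
Proof.
 intros Hg Hgt Hd T. destruct (alg_taylor g gt Hg Hgt Hd T) as [K [HK H]]. exists K. split; auto. intros a b Ha Hb.
 assert (c1 : cont (g a)) by (apply alg_cont; auto). assert (c2 : cont (g b)) by (apply alg_cont; auto).
 assert (c3 : cont (gt a)) by (apply alg_cont; auto).
 assert (c4 : cont (fun x => (b - a) * gt a x)) by (apply cont_mult; auto using cont_const).
 rewrite <- avg_scal, <- avg_minus, <- avg_minus by auto using cont_minus.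
 apply avg_abs_le; [auto using cont_minus|]. intros x. apply H; auto.
Qed.

Lemma alg_avg g gt : alg A g -> alg A gt -> (forall t x, 0 < t -> is_derive (fun t => g t x) t (gt t x)) ->
 cont (fun t => avg (g t)) /\ forall t, 0 < t -> is_derive (fun t => avg (g t)) t (avg (gt t)).
Proof.
 intros Hg Hgt Hd. use (alg_avg_taylor g gt Hg Hgt Hd) as TT. split.
 - apply cont_half.
  + intros t Ht. apply avg_ext. intros x. apply (reg_neg A g (alg_reg g Hg)); auto.
  + intros T. destruct (TT T) as [K [HK H]]. destruct (reg_bound A gt (alg_reg gt Hgt) T) as [K1 H1].
   exists (K * T + K1). intros a b Ha Hb. specialize (H a b Ha Hb).
   assert (B : Rabs (avg (gt a)) <= K1) by (apply avg_abs_le; [apply alg_cont; auto|intros; apply H1; lra]).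
   replace (avg (g b) - avg (g a)) with ((avg (g b) - avg (g a) - (b - a) * avg (gt a)) + (b - a) * avg (gt a)) by ring.
   upto Rabs_triang. rewrite Rabs_mult, Rmult_plus_distr_r. apply Rplus_le_compat; [|rewrite Rmult_comm; mul_r; auto using Rabs_pos].
   upto H. rewrite <- (pow2_abs (b - a)). assert (Rabs (b - a) <= T) by (apply Rabs_le; lra). use (Rabs_pos (b - a)).
   replace (K * Rabs (b - a) ^ 2) with (K * Rabs (b - a) * Rabs (b - a)) by ring. mul_r; auto. mul_l; auto.
 - intros t Ht. destruct (TT (t + 1)) as [K [HK H]].
  apply (is_derive_quadratic (fun t => avg (g t)) t _ K (Rmin t 1)); [apply Rmin_glb_lt; lra|].
  intros y Hy. apply H; [lra|]. use (Rmin_l t 1). use (Rmin_r t 1). apply Rabs_def2 in Hy. lra.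
Qed.

Lemma alg_RInt g gx X : 0 <= X -> alg A g -> alg A gx -> (forall t x, is_derive (g t) x (gx t x)) ->
 forall x, is_derive (fun x => RInt (fun t => g t x) 0 X) x (RInt (fun t => gx t x) 0 X).
Proof.
 intros HX Hg Hgx Hd x. destruct (reg_x A gx (alg_reg gx Hgx)) as [gxx [H1 H2]]. destruct (reg_bound A gxx (alg_reg gxx H1) X) as [K HK].
 use (reg_cont A g (alg_reg g Hg)) as c1. use (reg_cont A gx (alg_reg gx Hgx)) as c2.
 apply (is_derive_quadratic (fun x => RInt (fun t => g t x) 0 X) x _ (K * X) 1 Rlt_0_1). intros y _.
 assert (cc : cont (fun t => (y - x) * gx t x)) by (apply cont_mult; auto using cont_const).
 assert (E : RInt (fun t => g t y) 0 X - RInt (fun t => g t x) 0 X - (y - x) * RInt (fun t => gx t x) 0 X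
   = RInt (fun t => (g t y - g t x) - (y - x) * gx t x) 0 X).
 { symmetry. transitivity (RInt (fun t => g t y - g t x) 0 X - RInt (fun t => (y - x) * gx t x) 0 X).
  - apply (RInt_minus (fun t => g t y - g t x) (fun t => (y - x) * gx t x)); apply cont_ex_RInt; auto. apply (cont_minus (fun t => g t y)); auto.
  - f_equal; [apply (RInt_minus (fun t => g t y) (fun t => g t x)); apply cont_ex_RInt; auto|].
   apply (RInt_scal (fun t => gx t x)). apply cont_ex_RInt; auto. }
 rewrite E. replace (K * X * (y - x) ^ 2) with ((X - 0) * (K * (y - x) ^ 2)) by ring. apply abs_RInt_le_const; auto.
 - apply cont_ex_RInt. apply (cont_minus (fun t => g t y - g t x)); auto. apply (cont_minus (fun t => g t y)); auto.
 - intros t Ht. apply (taylor2 (g t) (gx t) (gxx t)); auto.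
  + intros z _. apply (alg_cont g t Hg z).
  + intros z _. apply (alg_cont gx t Hgx z).
  + intros z _. apply HK. lra.
Qed.

End Algebra.

(** * Smoothness in time and uniqueness *)

Lemma Cinf_Derive_n u k : Cinf u -> Cinf (Derive_n u k).
Proof. intros H. induction k as [|k IH]; [exact H|]. exact (Cinf_Derive _ IH). Qed.

Lemma Derive_n_bb N ga k : Derive_n (bb N ga) k = fun x => sm (fun j => ga j * Derive_n (EE j) k x) (2 * N + 1).
Proof.
 induction k as [|k IH]; [reflexivity|]. change (Derive_n (bb N ga) (S k)) with (Derive (Derive_n (bb N ga) k)). rewrite IH.
 apply Derive_eq. intros x. apply (is_derive_sm (fun j y => ga j * Derive_n (EE j) k y) (fun j y => ga j * Derive_n (EE j) (S k) y)).
 intros j _. apply (is_derive_scal (Derive_n (EE j) k)). apply (Cinf_is_derive (Derive_n (EE j) k)), Cinf_Derive_n, EE_Cinf.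
Qed.

Lemma finite_bound (P : nat -> R -> Prop) n : (forall j K K', P j K -> K <= K' -> P j K') ->
 (forall j, (j < n)%nat -> exists K, P j K) -> exists K, 0 <= K /\ forall j, (j < n)%nat -> P j K.
Proof.
 intros Hm. induction n as [|n IH]; intros H; [exists 0; split; [lra|intros; lia]|].
 destruct IH as [K1 [H0 H1]]; [intros; apply H; lia|]. destruct (H n ltac:(lia)) as [K2 H2].
 exists (Rmax K1 K2). split; [eapply Rle_trans; [exact H0|apply Rmax_l]|]. intros j Hj.
 destruct (Nat.eq_dec j n) as [->|Hne]; [apply (Hm _ K2); auto; apply Rmax_r|apply (Hm _ K1); [apply H1; lia|apply Rmax_l]].
Qed.

(** On polynomials of degree [N] every seminorm is controlled by the coordinates, so statements
    about curves in the Frechet topology become statements about finitely many real functions. *)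
Lemma bb_Derive_n_bound N k : exists C, 0 <= C /\ forall ga B x, (forall j, (j < 2 * N + 1)%nat -> Rabs (ga j) <= B) -> Rabs (Derive_n (bb N ga) k x) <= C * B.
Proof.
 destruct (finite_bound (fun j K => forall x, Rabs (Derive_n (EE j) k x) <= K) (2 * N + 1)) as [K [HK H]].
 - intros j K K' H HK x. specialize (H x). lra.
 - intros j _. use (Cinf_Derive_n (EE j) k (EE_Cinf j)) as Hc. apply cont_per_bounded; [apply Cinf_cont; auto|apply Hc].
 - exists (INR (2 * N + 1) * K). split; [apply Rmult_le_pos; auto; apply pos_INR|]. intros ga B x Hg. rewrite Derive_n_bb.
  upto sm_abs. rewrite Rmult_assoc, <- sm_const. apply sm_le. intros j Hj. rewrite Rabs_mult, Rmult_comm. mul_lr; auto using Rabs_pos.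
Qed.

Lemma crd_bound u j B : Cinf u -> (forall x, Rabs (u x) <= B) -> Rabs (crd u j) <= 2 * B.
Proof.
 intros Hu H. use (Cinf_cont _ Hu). assert (0 <= B) by (eapply Rle_trans; [apply Rabs_pos|apply (H 0)]). destruct j as [|k]; cbn [crd].
 - eapply Rle_trans; [apply avg_abs_le; eauto|]. lra.
 - apply avg_abs_le; [apply cont_mult; auto using ee_cont|]. intros x. rewrite Rabs_mult, Rmult_comm.
  mul_lr; auto using Rabs_pos, ee_bound.
Qed.

Lemma Cinf_div u c : Cinf u -> Cinf (fun x => u x / c).
Proof. intros H. apply (Cinf_ext (fun x => / c * u x)); [intros; unfold Rdiv; ring|]. apply Cinf_scal; auto. Qed.

Lemma crd_minus u v j : Cinf u -> Cinf v -> crd (fun x => u x - v x) j = crd u j - crd v j.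
Proof.
 intros Hu Hv. use (Cinf_cont _ Hu). use (Cinf_cont _ Hv). destruct j; [apply (avg_minus u v); auto|apply (fc_minus u v); auto].
Qed.

Lemma crd_quotient u v z h j : Cinf u -> Cinf v -> Cinf z -> crd (fun x => (u x - v x) / h - z x) j = (crd u j - crd v j) / h - crd z j.
Proof.
 intros Hu Hv Hz. rewrite (crd_minus (fun x => (u x - v x) / h) z) by (auto; apply (Cinf_div (fun x => u x - v x)), Cinf_minus; auto).
 replace (fun x => (u x - v x) / h) with (fun x => / h * (u x - v x)) by (fext; intros; unfold Rdiv; ring).
 rewrite (crd_scal (/ h) (fun x => u x - v x)), (crd_minus u v) by (auto; apply Cinf_minus; auto). unfold Rdiv. ring.
Qed.

Lemma sol_field al x : Cinf al -> Cplus (Copp (Cmult (RtoC (al x)) (Lam (rC al) x))) (Cmult (Hil (rC al) x) (Dop al x)) = RtoC (fl al x).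
Proof.
 intros H. rewrite Lam_rC, Hil_rC by auto. unfold fl, Dop, Cplus, Copp, Cmult, RtoC. simpl. f_equal; ring.
Qed.

(** * The moving frame of the flow *)

Record flow (N : nat) (a : R -> R) (be : R -> nat -> R) : Prop := {
 fw_a : Cinf a;
 fw_band : band N a;
 fw_neg : forall t j, t <= 0 -> be t j = crd a j;
 fw_cont : forall j, cont (fun t => be t j);
 fw_der : forall t j, 0 < t -> (j < 2 * N + 1)%nat -> is_derive (fun t => be t j) t (XX N (be t) j);
 fw_low : forall T, exists m, 0 < m /\ forall t x, t <= T -> m <= bb N (be t) x }.

Arguments fw_a {N a be}.
Arguments fw_band {N a be}.
Arguments fw_neg {N a be}.
Arguments fw_cont {N a be}.
Arguments fw_der {N a be}.
Arguments fw_low {N a be}.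

Section Flow.
Variables (N : nat) (a : R -> R) (be : R -> nat -> R).
Hypothesis Hw : flow N a be.

Definition bt (t x : R) : R := bb N (be t) x.
Definition ht (t x : R) : R := Jr (bt t) x.
Definition ib (t x : R) : R := / bt t x.

(** [Ab] contains the time dependent coefficients and serves smoothness in time; [A0] adds the
    functions of the angle and [1 / b], out of which the velocity of the moving coordinate is
    built. *)
Definition Ab (g : R -> R -> R) : Prop := exists j, (j < 2 * N + 1)%nat /\ g = fun t _ => be t j.
Definition A0 (g : R -> R -> R) : Prop := Ab g \/ (exists z p, g = fun _ x => cos (IZR z * x + p)) \/ g = ib.

Lemma bt_pos t x : 0 < bt t x.
Proof. destruct (fw_low Hw t) as [m [Hm H]]. eapply Rlt_le_trans; [exact Hm|apply H; lra]. Qed.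

Lemma bt_Cinf t : Cinf (bt t).
Proof. apply bb_Cinf. Qed.

Lemma bt_neg t : t <= 0 -> bt t = a.
Proof.
 intros Ht. rewrite (bb_crd N a (fw_a Hw) (fw_band Hw)). fext. intros x. apply sm_ext. intros j _.
 rewrite (fw_neg Hw) by auto. reflexivity.
Qed.

Lemma alg_be (A : (R -> R -> R) -> Prop) j : (forall g, Ab g -> A g) -> (j < 2 * N + 1)%nat -> alg A (fun t _ => be t j).
Proof. intros H Hj. apply alg_gen, H. exists j. auto. Qed.

Lemma alg_XX (A : (R -> R -> R) -> Prop) j : (forall g, Ab g -> A g) -> alg A (fun t _ => XX N (be t) j).
Proof.
 intros H. apply (alg_sm A (fun k t _ => sm (fun l => be t k * be t l * crd (WW k l) j) (2 * N + 1))). intros k Hk.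
 apply (alg_sm A (fun l t _ => be t k * be t l * crd (WW k l) j)). intros l Hl. alga; apply alg_be; auto.
Qed.

Lemma Ab_reg g : Ab g -> reg Ab g.
Proof.
 intros [j [Hj ->]]. use (fw_cont Hw j) as Hc. split.
 - exists (fun _ _ => 0). split; [apply alg_const|]. intros t x. exact (is_derive_const (be t j) x).
 - exists (fun t _ => XX N (be t) j). split; [apply alg_XX; auto|]. intros t x Ht. apply (fw_der Hw); auto.
 - intros _. exact Hc.
 - intros T. destruct (continuity_ab_maj (fun t => Rabs (be t j)) 0 (Rmax T 0)) as [M [HM _]]; [apply Rmax_r| |].
  + intros c _. apply continuity_pt_filterlim. apply (continuous_comp (fun t => be t j) Rabs); [apply Hc|apply continuous_Rabs].
  + exists (Rabs (be M j)). intros t _ Ht. destruct (Rle_dec t 0) as [Hn|Hn].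
   * rewrite (fw_neg Hw t), <- (fw_neg Hw 0) by lra. apply HM. split; [lra|apply Rmax_r].
   * apply HM. split; [lra|]. eapply Rle_trans; [exact Ht|apply Rmax_l].
 - intros t x. reflexivity.
 - intros t _ Ht. rewrite !(fw_neg Hw) by lra. reflexivity.
Qed.

Lemma alg_cos z p : alg A0 (fun _ x => cos (IZR z * x + p)).
Proof. apply alg_gen. right. left. eauto. Qed.

Lemma alg_ib : alg A0 ib.
Proof. apply alg_gen. right. right. reflexivity. Qed.

#[local] Hint Resolve alg_cos alg_ib : alg.

Lemma alg_EE j : alg A0 (fun _ x => EE j x).
Proof.
 destruct j as [|k]; [exact (alg_const A0 1)|]. apply (alg_ext A0 (fun _ x => sqrt 2 * cos (IZR (muz k) * x + ph k))).
 - intros _ x. unfold EE, ee. rewrite mu_IZR. reflexivity.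
 - alga.
Qed.

Lemma alg_DEE j : alg A0 (fun _ x => Derive (EE j) x).
Proof.
 destruct j as [|k].
 - apply (alg_ext A0 (fun _ _ => 0)); [|apply alg_const]. intros. symmetry. apply (Derive_const 1).
 - apply (alg_ext A0 (fun _ x => mu k * (sqrt 2 * cos (IZR (muz k) * x + (ph k + PI / 2))))).
  + intros _ x. change (EE (S k)) with (ee k). rewrite Derive_ee, cs_id. reflexivity.
  + alga.
Qed.

Lemma alg_comb (c : nat -> R -> R) (f : nat -> R -> R) : (forall j, (j < 2 * N + 1)%nat -> alg A0 (fun t _ => c j t)) -> (forall j, alg A0 (fun _ x => f j x)) ->
 alg A0 (fun t x => sm (fun j => c j t * f j x) (2 * N + 1)).
Proof.
 intros H1 H2. apply (alg_sm A0 (fun j t x => c j t * f j x)). intros j Hj. alga.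
Qed.

Lemma alg_be0 j : (j < 2 * N + 1)%nat -> alg A0 (fun t _ => be t j).
Proof. apply alg_be. intros; left; auto. Qed.

Lemma alg_bt : alg A0 bt.
Proof. apply (alg_comb (fun j t => be t j) EE); [apply alg_be0|apply alg_EE]. Qed.

Definition btd (t x : R) : R := fl (bt t) x.

Lemma alg_btd : alg A0 btd.
Proof.
 apply (alg_ext A0 (fun t x => sm (fun j => XX N (be t) j * EE j x) (2 * N + 1))).
 - intros t x. unfold btd, bt. rewrite fl_bb_XX. reflexivity.
 - apply (alg_comb (fun j t => XX N (be t) j) EE); [|apply alg_EE]. intros; apply alg_XX. intros; left; auto.
Qed.

Lemma bt_t t x : 0 < t -> is_derive (fun t => bt t x) t (btd t x).
Proof.
 intros Ht. unfold btd, bt. rewrite fl_bb_XX.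
 apply (is_derive_sm (fun j t => be t j * EE j x) (fun j t => XX N (be t) j * EE j x)). intros j Hj.
 apply (is_derive_ext (fun t => EE j x * be t j)); [intros; apply Rmult_comm|]. rewrite Rmult_comm.
 apply (is_derive_scal (fun t => be t j)). apply (fw_der Hw); auto.
Qed.

#[local] Hint Resolve alg_EE alg_DEE alg_bt alg_btd : alg.

Definition btx (t x : R) : R := Derive (bt t) x.

Lemma alg_btx : alg A0 btx.
Proof.
 apply (alg_ext A0 (fun t x => sm (fun j => be t j * Derive (EE j) x) (2 * N + 1))); [intros; symmetry; apply Derive_bb|].
 apply (alg_comb (fun j t => be t j) (fun j => Derive (EE j))); [apply alg_be0|apply alg_DEE].
Qed.

#[local] Hint Resolve alg_btx : alg.

Lemma bt_x t x : is_derive (bt t) x (btx t x).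
Proof. apply Cinf_is_derive, bt_Cinf. Qed.

Lemma ib_der (f : R -> R) y f' : (forall z, 0 < f z) -> is_derive f y f' -> is_derive (fun z => / f z) y ((-1) * f' * (/ f y * / f y)).
Proof.
 intros Hp Hd. use (Hp y). replace (-1 * f' * (/ f y * / f y)) with (- f' / f y ^ 2) by (field; lra). apply is_derive_inv; auto. lra.
Qed.

Lemma bt_cont x : cont (fun t => bt t x).
Proof. apply (cont_sm (fun j t => be t j * EE j x)). intros k. apply cont_mult; [apply (fw_cont Hw)|apply cont_const]. Qed.

Lemma A0_reg g : A0 g -> reg A0 g.
Proof.
 intros [Hb|[[z [p ->]]| ->]].
 - apply (reg_sub Ab); [intros; left; auto|apply Ab_reg; auto].
 - split.
  + exists (fun _ x => IZR z * cos (IZR z * x + (p + PI / 2))). split.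
   * alga.
   * intros _ x. rewrite cos_p_PI2. auto_derive; auto. ring.
  + exists (fun _ _ => 0). split; [apply alg_const|]. intros t x _. exact (is_derive_const (cos (IZR z * x + p)) t).
  + intros x. apply cont_const.
  + intros T. exists 1. intros t x _. apply Rabs_le, COS_bound.
  + intros t. apply (cs_id_Cinf z p).
  + reflexivity.
 - split.
  + exists (fun t x => (-1) * btx t x * (ib t x * ib t x)). split.
   * alga.
   * intros t x. apply (ib_der (bt t)); [apply bt_pos|apply bt_x].
  + exists (fun t x => (-1) * btd t x * (ib t x * ib t x)). split.
   * alga.
   * intros t x Ht. apply (ib_der (fun t => bt t x)); [intros; apply bt_pos|apply bt_t; auto].
  + intros x t. apply (continuous_Rinv_comp (fun t => bt t x)); [apply bt_cont|]. apply Rgt_not_eq, bt_pos.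
  + intros T. destruct (fw_low Hw T) as [m [Hm H]]. exists (/ m). intros t x Ht. unfold ib.
   rewrite Rabs_pos_eq by (left; apply Rinv_0_lt_compat, bt_pos). apply Rinv_le_contravar; auto. apply H; auto.
  + intros t x. unfold ib. rewrite (proj2 (bt_Cinf t) x). reflexivity.
  + intros t x Ht. unfold ib. rewrite !bt_neg by lra. reflexivity.
Qed.

Lemma alg_ht : alg A0 ht.
Proof.
 apply (alg_ext A0 (fun t x => sm (fun j => be t j * JE j x) (2 * N + 1))); [intros; symmetry; apply Jr_bb|].
 apply (alg_comb (fun j t => be t j) JE); [apply alg_be0|]. intros [|k]; [exact (alg_const A0 0)|].
 apply (alg_ext A0 (fun _ x => sqrt 2 * cos (IZR (muz k) * x + (ph k - PI / 2)))).
 - intros _ x. cbn [JE]. rewrite mu_IZR. reflexivity.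
 - alga.
Qed.

Lemma ht_x t x : is_derive (ht t) x (Lr (bt t) x).
Proof. apply Jr_derive, bt_Cinf. Qed.

#[local] Hint Resolve alg_ht : alg.

(** [hb] is the velocity of the moving coordinate, and [ibd] is the time derivative of [1 / b]. *)
Definition hb (t x : R) : R := ht t x * ib t x.
Definition ibd (t x : R) : R := (-1) * btd t x * (ib t x * ib t x).

Lemma alg_hb : alg A0 hb.
Proof. apply alg_mult; [apply alg_ht|apply alg_ib]. Qed.

Lemma alg_ibd : alg A0 ibd.
Proof. unfold ibd. alga. Qed.

Lemma hb_x t x : is_derive (hb t) x (ibd t x).
Proof.
 replace (ibd t x) with (Lr (bt t) x * ib t x + ht t x * ((-1) * btx t x * (ib t x * ib t x))).
 - apply (is_derive_mult_R (ht t) (ib t)); [apply ht_x|]. apply (ib_der (bt t)); [apply bt_pos|apply bt_x].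
 - unfold ibd, btd, fl, btx, ib. fold (ht t x). use (bt_pos t x). field. lra.
Qed.

(** The solution of the transport equation [s_t = h s_x], written as the initial coordinate plus the
    integral of its velocity. *)
Definition st (t x : R) : R := RInt (fun y => / a y) 0 x + RInt (fun r => hb r x) 0 (Rmax t 0).

Lemma hb_cont x : cont (fun t => hb t x).
Proof. apply (reg_cont A0 hb), alg_reg; [exact A0_reg|apply alg_hb]. Qed.

Lemma a_inv_cont : cont (fun y => / a y).
Proof.
 apply Cinf_cont, Cinf_inv; [|apply (fw_a Hw)]. intros x. rewrite <- (bt_neg 0 (Rle_refl 0)). apply bt_pos.
Qed.

Lemma is_derive_eq (f : R -> R) x l l' : l = l' -> is_derive f x l -> is_derive f x l'.
Proof. intros ->. auto. Qed.

Lemma is_derive_RInt_cont (f : R -> R) x : cont f -> is_derive (fun x => RInt f 0 x) x (f x).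
Proof.
 intros Hf. apply (is_derive_RInt f (fun x => RInt f 0 x) 0 x); [|apply Hf].
 exists (mkposreal 1 Rlt_0_1). intros y _. apply (RInt_correct f). apply cont_ex_RInt; auto.
Qed.

(* Together with [hb_x] this is the conservation law d(1/b)/dt = d(h/b)/dx. *)
Lemma RInt_ibd t x : 0 <= t -> RInt (fun r => ibd r x) 0 t = ib t x - ib 0 x.
Proof.
 intros Ht. use (alg_reg A0 A0_reg ib alg_ib) as R1. use (alg_reg A0 A0_reg ibd alg_ibd) as R2.
 destruct Ht as [Ht|<-]; [|rewrite RInt_point; unfold zero; simpl; ring].
 destruct (MVT_open (fun t => ib t x - RInt (fun r => ibd r x) 0 t) (fun _ => 0) 0 t Ht) as [c [_ E]].
 - intros u Hu. apply (is_derive_eq _ _ (ibd u x - ibd u x)); [apply Rminus_diag|].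
  apply (is_derive_minus (fun t => ib t x) (fun t => RInt (fun r => ibd r x) 0 t)).
  + apply (ib_der (fun t => bt t x)); [intros; apply bt_pos|apply bt_t; lra].
  + apply (is_derive_RInt_cont (fun r => ibd r x)). apply (reg_cont A0 ibd R2).
 - intros u _. apply (continuous_minus (fun t => ib t x) (fun t => RInt (fun r => ibd r x) 0 t)); [apply (reg_cont A0 ib R1)|].
  apply (ex_derive_continuous (fun t => RInt (fun r => ibd r x) 0 t)). eexists. apply (is_derive_RInt_cont (fun r => ibd r x)). apply (reg_cont A0 ibd R2).
 - rewrite RInt_point in E. unfold zero in E; simpl in E. lra.
Qed.

Lemma st_x t x : is_derive (st t) x (ib t x).
Proof.
 assert (E : ib t x = / a x + RInt (fun r => ibd r x) 0 (Rmax t 0)).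
 { rewrite RInt_ibd by apply Rmax_r. unfold ib. rewrite (bt_neg 0) by lra. unfold Rmax. destruct (Rle_dec t 0); [rewrite !bt_neg by lra; ring|ring]. }
 rewrite E. apply (is_derive_plus (fun x => RInt (fun y => / a y) 0 x) (fun x => RInt (fun r => hb r x) 0 (Rmax t 0))).
 - apply (is_derive_RInt_cont (fun y => / a y)), a_inv_cont.
 - apply (alg_RInt A0 A0_reg hb ibd); [apply Rmax_r|apply alg_hb|apply alg_ibd|apply hb_x].
Qed.

Lemma st_t t x : 0 < t -> is_derive (fun t => st t x) t (hb t x).
Proof.
 intros Ht. apply (is_derive_ext_loc (fun t => RInt (fun y => / a y) 0 x + RInt (fun r => hb r x) 0 t)).
 - exists (mkposreal t Ht). intros y Hy. assert (H : Rabs (y - t) < t) by exact Hy. apply Rabs_def2 in H.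
  unfold st. rewrite Rmax_left by lra. reflexivity.
 - replace (hb t x) with (0 + hb t x) by ring.
  apply (is_derive_plus (fun _ : R => RInt (fun y => / a y) 0 x) (fun t => RInt (fun r => hb r x) 0 t)); [exact (is_derive_const (RInt (fun y => / a y) 0 x) t)|].
  apply (is_derive_RInt_cont (fun r => hb r x)), hb_cont.
Qed.

Lemma st_neg t x : t <= 0 -> st t x = st 0 x.
Proof. intros H. unfold st. rewrite !Rmax_right by lra. reflexivity. Qed.

Lemma st_cont x : cont (fun t => st t x).
Proof.
 apply cont_half; [intros; apply st_neg; auto|]. intros T.
 destruct (reg_bound A0 hb (alg_reg A0 A0_reg hb alg_hb) T) as [K HK]. exists K. intros u v Hu Hv. unfold st. rewrite !Rmax_left by lra.
 assert (Ch : RInt (fun r => hb r x) 0 u + RInt (fun r => hb r x) u v = RInt (fun r => hb r x) 0 v)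
  by (apply (RInt_Chasles (fun r => hb r x) 0 u v); apply cont_ex_RInt, hb_cont).
 replace (RInt (fun y => / a y) 0 x + RInt (fun r => hb r x) 0 v - (RInt (fun y => / a y) 0 x + RInt (fun r => hb r x) 0 u)) with (RInt (fun r => hb r x) u v) by lra.
 assert (Q : forall u v, 0 <= u -> u <= v -> v <= T -> Rabs (RInt (fun r => hb r x) u v) <= K * Rabs (v - u)).
 { clear u v Hu Hv Ch. intros u v Hu Huv Hv. rewrite (Rabs_pos_eq (v - u)), Rmult_comm by lra.
  apply (abs_RInt_le_const (fun r => hb r x)); auto; [apply cont_ex_RInt, hb_cont|]. intros; apply HK; lra. }
 destruct (Rle_dec u v); [apply Q; lra|]. rewrite <- (opp_RInt_swap (fun r => hb r x)) by (apply cont_ex_RInt, hb_cont).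
 change (opp (RInt (fun r => hb r x) v u)) with (- RInt (fun r => hb r x) v u). rewrite Rabs_Ropp, Rabs_minus_sym. apply Q; lra.
Qed.

Hypothesis Hnorm : RInt (fun t => / a t) 0 (2 * PI) = 2 * PI.

Lemma st_frame t : frame (st t) (bt t).
Proof.
 split; [apply bt_Cinf|apply bt_pos|apply st_x|]. intros x. unfold st.
 replace (RInt (fun r => hb r (x + 2 * PI)) 0 (Rmax t 0)) with (RInt (fun r => hb r x) 0 (Rmax t 0)).
 2:{ apply RInt_ext. intros r _. symmetry. apply (reg_per A0 hb (alg_reg A0 A0_reg hb alg_hb)). } set (I := RInt (fun y => / a y) 0).
 assert (D : forall y, is_derive (fun y => I (y + 2 * PI) - I y) y 0).
 { intros y. replace 0 with (1 * / a (y + 2 * PI) - / a y) by (rewrite (proj2 (fw_a Hw) y); ring).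
  apply (is_derive_minus (fun y => I (y + 2 * PI)) I); [|apply (is_derive_RInt_cont (fun y => / a y)), a_inv_cont].
  apply (is_derive_comp I (fun y => y + 2 * PI)); [apply (is_derive_RInt_cont (fun y => / a y)), a_inv_cont|]. auto_derive; auto. }
 assert (E : I (x + 2 * PI) - I x = I (0 + 2 * PI) - I 0). { destruct (Req_dec x 0) as [->|Hx]; auto.
  assert (Q : forall u v, u < v -> I (u + 2 * PI) - I u = I (v + 2 * PI) - I v).
  { intros u v Huv. destruct (MVT_open (fun y => I (y + 2 * PI) - I y) (fun _ => 0) u v Huv) as [c [_ E]]; [intros; apply D| |lra].
   intros z _. apply (ex_derive_continuous (fun y => I (y + 2 * PI) - I y)). eexists; apply D. }
  destruct (Rtotal_order x 0) as [H|[H|H]]; [apply Q; auto|lra|symmetry; apply Q; auto]. }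
 assert (E0 : I 0 = 0) by exact (RInt_point 0 (fun y => / a y)). assert (E1 : I (0 + 2 * PI) = 2 * PI) by (rewrite Rplus_0_l; exact Hnorm).
 lra.
Qed.

Lemma ib_norm t : RInt (fun x => / bt t x) 0 (2 * PI) = 2 * PI.
Proof.
 use (wavg_one (st t) (bt t) (st_frame t)) as E. unfold wavg, avg in E. use two_pi_pos.
 rewrite (RInt_ext _ (fun x => / bt t x)) in E by (intros; apply Rmult_1_l).
 apply (Rmult_eq_reg_l (/ (2 * PI))); [|apply Rinv_neq_0_compat; lra]. rewrite E. symmetry. apply Rinv_l. lra.
Qed.

Theorem flow_sol : sol a N (fun t => bb N (be t)).
Proof.
 assert (F0 : forall g : R -> R -> R, exists gt, alg Ab g -> alg Ab gt /\ forall t x, 0 < t -> is_derive (fun t => g t x) t (gt t x)).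
 { intros g. destruct (classic (alg Ab g)) as [Hg|Hg]; [|exists g; contradiction].
  destruct (reg_t _ _ (alg_reg _ Ab_reg g Hg)) as [gt Hgt]. exists gt. auto. } destruct (choice _ F0) as [F HF]. clear F0.
 (* [D n j] is the [n]-th time derivative of the [j]-th coordinate, chosen inside the algebra
    generated by the coordinates; its angle argument is a dummy, set to 0 below. *)
 pose (D := fun n j => match n with O => fun t (_ : R) => be t j | S n => Nat.iter n F (fun t _ => XX N (be t) j) end).
 assert (HD : forall n j, (j < 2 * N + 1)%nat -> alg Ab (D n j)).
 { intros [|n] j Hj; [apply (alg_be Ab); auto|]. unfold D. induction n as [|n IH]; [apply (alg_XX Ab); auto|]. apply HF; auto. }
 assert (HDd : forall n j t x, (j < 2 * N + 1)%nat -> 0 < t -> is_derive (fun t => D n j t x) t (D (S n) j t x)).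
 { intros [|n] j t x Hj Ht; [apply (fw_der Hw); auto|]. apply (HF _ (HD (S n) j Hj)); auto. }
 pose (B := fun n t => bb N (fun j => D n j t 0)).
 assert (TT : forall n T, exists K, 0 <= K /\ forall j, (j < 2 * N + 1)%nat -> forall u v, 0 <= u <= T -> 0 <= v <= T ->
   Rabs (D n j v 0 - D n j u 0 - (v - u) * D (S n) j u 0) <= K * (v - u) ^ 2).
 { intros n T. apply (finite_bound (fun j K => forall u v, 0 <= u <= T -> 0 <= v <= T -> Rabs (D n j v 0 - D n j u 0 - (v - u) * D (S n) j u 0) <= K * (v - u) ^ 2)).
  - intros j K K' H HK u v Hu Hv. eapply Rle_trans; [apply H; auto|]. mul_r; auto. apply pow2_ge_0.
  - intros j Hj. destruct (alg_taylor _ Ab_reg _ _ (HD n j Hj) (HD (S n) j Hj) (fun t x => HDd n j t x Hj) T) as [K [_ H]].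
   exists K. intros; apply H; auto. } split; [|split; [|split]].
 - exists B. split; [split; [|split; [|split]]|].
  + reflexivity.
  + intros. apply bb_Cinf.
  + intros n tau Htau k eps He. destruct (bb_Derive_n_bound N k) as [C [HC HCb]]. destruct (TT n (tau + 1)) as [K [HK HT]].
   destruct (finite_bound (fun j K1 => Rabs (D (S n) j tau 0) <= K1) (2 * N + 1)) as [K1 [HK1 H1]]; [intros; lra|intros; eexists; apply Rle_refl|].
   assert (HP : 0 <= C * (K + K1)) by (apply Rmult_le_pos; lra).
   exists (Rmin 1 (eps / (C * (K + K1) + 1))). split; [apply Rmin_glb_lt; [lra|apply Rdiv_lt_0_compat; lra]|]. intros u Hu Hlt th.
   use (Rlt_le_trans _ _ _ Hlt (Rmin_l _ _)) as G1. use (Rlt_le_trans _ _ _ Hlt (Rmin_r _ _)) as G2. use (Rabs_pos (u - tau)).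
   replace (fun t => B n u t - B n tau t) with (bb N (fun j => D n j u 0 + (-1) * D n j tau 0)).
   2:{ fext. intros x. rewrite bb_lin. unfold B. ring. } upto (HCb _ ((K + K1) * Rabs (u - tau))).
   * intros j Hj. specialize (H1 j Hj). apply Rabs_def2 in G1 as G3. specialize (HT j Hj tau u ltac:(lra) ltac:(lra)).
    replace (D n j u 0 + -1 * D n j tau 0) with ((D n j u 0 - D n j tau 0 - (u - tau) * D (S n) j tau 0) + (u - tau) * D (S n) j tau 0) by ring.
    upto Rabs_triang. rewrite Rabs_mult. rewrite <- (pow2_abs (u - tau)) in HT.
    assert (K * Rabs (u - tau) ^ 2 <= K * Rabs (u - tau)) by (mul_l; nra). nra.
   * apply (Rmult_lt_compat_r (C * (K + K1) + 1)) in G2; [|lra]. replace (eps / (C * (K + K1) + 1) * (C * (K + K1) + 1)) with eps in G2 by (field; lra). nra.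
  + intros n tau Htau k eps He. destruct (bb_Derive_n_bound N k) as [C [HC HCb]]. destruct (TT n (tau + 1)) as [K [HK HT]].
   assert (HCK : 0 <= C * K) by (apply Rmult_le_pos; auto).
   assert (Hd : 0 < Rmin 1 (eps / (C * K + 1))) by (apply Rmin_glb_lt; [lra|apply Rdiv_lt_0_compat; lra]).
   exists (Rmin 1 (eps / (C * K + 1))). split; auto. intros h Hh Hlt Hth th.
   use (Rlt_le_trans _ _ _ Hlt (Rmin_l _ _)) as H1. use (Rlt_le_trans _ _ _ Hlt (Rmin_r _ _)) as H2.
   replace (fun t => (B n (tau + h) t - B n tau t) / h - B (S n) tau t) with
    (bb N (fun j => (D n j (tau + h) 0 - D n j tau 0) / h - D (S n) j tau 0)).
   2:{ fext. intros x. unfold B, bb, Rdiv. rewrite <- sm_minus, <- sm_scal_r, <- sm_minus. apply sm_ext. intros; ring. }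
   upto (HCb _ (K * Rabs h)).
   * intros j Hj. apply Rabs_def2 in H1. specialize (HT j Hj tau (tau + h) ltac:(lra) ltac:(lra)). replace (tau + h - tau) with h in HT by ring.
    replace ((D n j (tau + h) 0 - D n j tau 0) / h - D (S n) j tau 0) with ((D n j (tau + h) 0 - D n j tau 0 - h * D (S n) j tau 0) / h) by (field; auto).
    unfold Rdiv. rewrite Rabs_mult, Rabs_inv. use (Rabs_pos_lt h Hh). apply (Rmult_le_reg_r (Rabs h)); auto.
    rewrite Rmult_assoc, Rinv_l, Rmult_1_r by lra. upto HT. rewrite <- (pow2_abs h). right. ring.
   * apply (Rmult_lt_compat_r (C * K + 1)) in H2; [|lra]. replace (eps / (C * K + 1) * (C * K + 1)) with eps in H2 by (field; lra).
    use (Rabs_pos h). nra.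
  + intros tau th Htau. rewrite (sol_field (bb N (be tau))) by apply bb_Cinf. rewrite fl_bb_XX. reflexivity.
 - intros. apply bt_pos.
 - apply bt_neg. lra.
 - intros tau k _. revert k. apply uhat_fc_zero; [apply Cinf_cont, bb_Cinf|apply bb_band].
Qed.

Lemma sm_square (f : nat -> R) n : sm f n * sm f n <= INR n * sm (fun k => f k * f k) n.
Proof.
 rewrite <- (sm_scal (INR n)). via (sm (fun i => sm (fun k => / 2 * (f i * f i + f k * f k)) n) n).
 - rewrite <- (sm_scal_r (sm f n)). apply sm_le. intros i _. rewrite <- sm_scal. apply sm_le. intros k _.
  use (Rle_0_sqr (f i - f k)) as Q. unfold Rsqr in Q. lra.
 - rewrite (sm_ext _ (fun i => / 2 * (INR n * (f i * f i)) + / 2 * sm (fun k => f k * f k) n)).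
  + rewrite sm_plus, sm_const, !sm_scal. lra.
  + intros i _. rewrite sm_scal, sm_plus, sm_const. ring.
Qed.

(** Gronwall's argument in coordinates: both trajectories are bounded on [[0, T]], where the
    quadratic field is Lipschitz, so the squared distance [E] satisfies [E' <= C E] and starts at
    0. *)
Lemma sol_unique al : sol a N al -> forall tau, 0 <= tau -> al tau = bb N (be tau).
Proof.
 intros [[B [[B0 [BC [Bf Bd]]] Beq]] [_ [al0 alb]]].
 assert (aC : forall t, 0 <= t -> Cinf (al t)) by (intros t Ht; rewrite <- B0 by auto; auto).
 assert (aB : forall t, 0 <= t -> band N (al t)).
 { intros t Ht. exact (proj1 (uhat_fc_zero (al t) N (Cinf_cont _ (aC t Ht))) (fun k => alb t k Ht)). }
 assert (B1 : forall t, 0 <= t -> B 1%nat t = fl (al t)).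
 { intros t Ht. fext. intros x. specialize (Beq t x Ht). rewrite sol_field in Beq by auto. apply (f_equal Re) in Beq. exact Beq. }
 pose (ga := fun t j => crd (al (Rmax t 0)) j). assert (gc : forall j, cont (fun t => ga t j)).
 { intros j t. apply continuity_pt_filterlim. intros eps He.
  destruct (Bf 0%nat (Rmax t 0) (Rmax_r _ _) 0%nat (eps / 4) ltac:(lra)) as [d [Hd H]]. exists d. split; auto.
  intros y [_ Hy]. simpl in Hy |- *. unfold R_dist in *. unfold ga.
  rewrite <- (crd_minus (al (Rmax y 0)) (al (Rmax t 0))) by apply aC, Rmax_r.
  eapply Rle_lt_trans; [apply (crd_bound (fun x => al (Rmax y 0) x - al (Rmax t 0) x) j (eps / 4))|lra].
  - apply Cinf_minus; apply aC, Rmax_r.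
  - intros x. specialize (H (Rmax y 0) (Rmax_r _ _)). rewrite !B0 in H by apply Rmax_r. simpl in H.
   apply H. eapply Rle_lt_trans; [apply Rmax0_lip|exact Hy]. }
 assert (gd : forall t j, 0 < t -> is_derive (fun t => ga t j) t (XX N (ga t) j)).
 { intros t j Ht. replace (XX N (ga t) j) with (crd (B 1%nat t) j).
  2:{ rewrite B1 by lra. rewrite (bb_crd N (al t)) by (auto; apply aC || apply aB; lra). rewrite crd_fl.
    unfold ga. rewrite Rmax_left by lra. reflexivity. }
  apply is_derive_Reals. intros eps He. destruct (Bd 0%nat t ltac:(lra) 0%nat (eps / 4) ltac:(lra)) as [d [Hd H]].
  assert (Hd2 : 0 < Rmin d t) by (apply Rmin_glb_lt; lra). exists (mkposreal _ Hd2). intros h Hh Hlt. simpl in Hlt.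
  use (Rlt_le_trans _ _ _ Hlt (Rmin_l _ _)) as H1. use (Rlt_le_trans _ _ _ Hlt (Rmin_r _ _)) as H2. apply Rabs_def2 in H2.
  unfold ga. rewrite !Rmax_left by lra. specialize (H h Hh H1 ltac:(lra)). rewrite !B0 in H by lra. simpl in H.
  assert (C1 : Cinf (al (t + h))) by (apply aC; lra). assert (C2 : Cinf (al t)) by (apply aC; lra). assert (C3 : Cinf (B 1%nat t)) by (apply BC; lra).
  rewrite <- (crd_quotient (al (t + h)) (al t) (B 1%nat t) h j C1 C2 C3).
  eapply Rle_lt_trans; [apply (crd_bound (fun x => (al (t + h) x - al t x) / h - B 1%nat t x) j (eps / 4))|lra].
  - apply (Cinf_minus (fun x => (al (t + h) x - al t x) / h)); auto. apply (Cinf_div (fun x => al (t + h) x - al t x)), Cinf_minus; auto.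
  - exact H. } intros T HT. pose (d := (2 * N + 1)%nat).
 assert (bnd : forall f : R -> nat -> R, (forall j, cont (fun t => f t j)) -> exists K, 0 <= K /\ forall j, (j < d)%nat -> forall t, 0 <= t <= T -> Rabs (f t j) <= K).
 { intros f Hf. apply (finite_bound (fun j K => forall t, 0 <= t <= T -> Rabs (f t j) <= K)).
  - intros j K K' H HK t Ht. specialize (H t Ht). lra.
  - intros j _. destruct (continuity_ab_maj (fun t => Rabs (f t j)) 0 T HT) as [M [HM _]].
   + intros c _. apply continuity_pt_filterlim. apply (continuous_comp (fun t => f t j) Rabs); [apply Hf|apply continuous_Rabs].
   + exists (Rabs (f M j)). exact HM. } destruct (bnd ga gc) as [K1 [HK1 Bga]]. destruct (bnd be (fw_cont Hw)) as [K2 [HK2 Bbe]].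
 pose (K := K1 + K2). pose (de := fun t j => ga t j - be t j). pose (C := 2 * (INR d * (2 * K * Gam N))).
 pose (E := fun t => sm (fun j => de t j * de t j) d).
 pose (E1 := fun t => sm (fun j => 2 * (de t j * (XX N (ga t) j - XX N (be t) j))) d).
 assert (HE : forall t, 0 < t -> is_derive E t (E1 t)).
 { intros t Ht. apply (is_derive_sm (fun j t => de t j * de t j) (fun j t => 2 * (de t j * (XX N (ga t) j - XX N (be t) j)))).
  intros j Hj. assert (Hdd : is_derive (fun t => de t j) t (XX N (ga t) j - XX N (be t) j)).
  { apply (is_derive_minus (fun t => ga t j) (fun t => be t j)); [apply gd; auto|apply (fw_der Hw); auto]. }
  eapply is_derive_eq; [|apply (is_derive_mult_R (fun t => de t j) (fun t => de t j)); exact Hdd]. Rring. }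
 assert (HEle : forall t, 0 <= t <= T -> E1 t <= C * E t).
 { intros t Ht. pose (S0 := sm (fun j => Rabs (de t j)) d). assert (0 <= Gam N) by apply Gam_pos.
  via (sm (fun j => 2 * (2 * K * Gam N * S0) * Rabs (de t j)) d).
  - apply sm_le. intros j Hj. use (XX_lip N K (ga t) (be t) j ltac:(unfold K; lra)
    ltac:(intros k Hk; specialize (Bga k Hk t Ht); unfold K; lra) ltac:(intros k Hk; specialize (Bbe k Hk t Ht); unfold K; lra) Hj) as Q.
   fold d in Q. change (sm (fun k => Rabs (ga t k - be t k)) d) with S0 in Q.
   assert (de t j * (XX N (ga t) j - XX N (be t) j) <= Rabs (de t j) * (2 * K * Gam N * S0)); [|lra].
   upto Rle_abs. rewrite Rabs_mult. mul_l; auto using Rabs_pos.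
  - rewrite sm_scal. fold S0. use (sm_square (fun j => Rabs (de t j)) d) as Q. cbv beta in Q. fold S0 in Q.
   rewrite (sm_ext _ (fun j => de t j * de t j)) in Q by (intros; rewrite <- Rabs_mult; apply Rabs_pos_eq, Rle_0_sqr). fold (E t) in Q.
   assert (0 <= 2 * K * Gam N) by (unfold K; apply Rmult_le_pos; lra). unfold C. nra. } assert (E0 : E 0 = 0).
 { apply sm_zero. intros j _. unfold de, ga. rewrite Rmax_left, al0, (fw_neg Hw) by lra. ring. } assert (ET : E T <= 0).
 { destruct HT as [HT|<-]; [|lra].
  destruct (MVT_open (fun t => E t * exp (- C * t)) (fun t => E1 t * exp (- C * t) + E t * (- C * exp (- C * t))) 0 T HT) as [c [Hc Q]].
  - intros t Ht. apply (is_derive_mult_R E (fun t => exp (- C * t))); [apply HE; lra|]. auto_derive; auto. ring.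
  - intros t _. apply (cont_mult E (fun t => exp (- C * t))).
   + apply (cont_sm (fun j t => de t j * de t j)). intros j. assert (cont (fun t => de t j)) by (apply cont_minus; [apply gc|apply (fw_cont Hw)]).
    apply cont_mult; auto.
   + apply (is_derive_cont _ (fun t => - C * exp (- C * t))). intros y. auto_derive; auto. ring.
  - rewrite E0 in Q. use (exp_pos (- C * c)). use (exp_pos (- C * T)). specialize (HEle c ltac:(lra)).
   assert (0 <= (C * E c - E1 c) * exp (- C * c)) by (apply Rmult_le_pos; lra). nra. }
 rewrite (bb_crd N (al T)) by auto. fext. intros x. apply sm_ext. intros j Hj.
 use (sm_le_elem (fun j => de T j * de T j) d j ltac:(intros; apply Rle_0_sqr) Hj) as Q. fold (E T) in Q.
 assert (Z : de T j = 0) by (use (Rle_0_sqr (de T j)); unfold Rsqr in *; nra).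
 unfold de, ga in Z. rewrite Rmax_left in Z by auto. assert (Z2 : crd (al T) j = be T j) by lra. rewrite Z2. reflexivity.
Qed.

(** * Moments in the moving frame *)

Let A0r : forall g, A0 g -> reg A0 g := A0_reg.
Let fra : forall t, frame (st t) (bt t) := st_frame.

Definition A1 (g : R -> R -> R) : Prop := A0 g \/ exists z p, g = fun t x => cos (IZR z * st t x + p).

Lemma alg01 g : alg A0 g -> alg A1 g.
Proof. apply alg_sub. left; auto. Qed.

Lemma alg_ph z p : alg A1 (fun t x => cos (IZR z * st t x + p)).
Proof. apply alg_gen. right. eauto. Qed.

#[local] Hint Resolve alg01 alg_ph alg_hb : alg.

Lemma cos_chain (f : R -> R) y l z p : is_derive f y l -> is_derive (fun y => cos (z * f y + p)) y (z * cos (z * f y + (p + PI / 2)) * l).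
Proof.
 intros H. rewrite cos_p_PI2. apply (is_derive_eq _ _ ((z * l) * (- sin (z * f y + p)))); [Rring|].
 apply (is_derive_comp cos (fun y => z * f y + p)); [apply is_derive_cos|].
 apply (is_derive_eq _ _ (z * l + 0)); [Rring|]. apply (is_derive_plus (fun y => z * f y) (fun _ => p)); [apply (is_derive_scal f); auto|].
 exact (is_derive_const p y).
Qed.

Lemma A1_reg g : A1 g -> reg A1 g.
Proof.
 intros [H|[z [p ->]]]; [apply (reg_sub A0); [left; auto|auto]|]. split.
 - exists (fun t x => IZR z * cos (IZR z * st t x + (p + PI / 2)) * ib t x). split.
  + alga.
  + intros t x. apply (cos_chain (st t)). apply st_x.
 - exists (fun t x => IZR z * cos (IZR z * st t x + (p + PI / 2)) * hb t x). split.
  + alga.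
  + intros t x Ht. apply (cos_chain (fun t => st t x)). apply st_t; auto.
 - intros x t. apply (continuous_comp (fun t => IZR z * st t x + p) cos).
  + apply (cont_plus (fun t => IZR z * st t x) (fun _ => p)); [|apply cont_const].
   apply (cont_mult (fun _ => IZR z) (fun t => st t x)); [apply cont_const|apply st_cont].
  + apply (ex_derive_continuous cos). eexists. apply is_derive_cos.
 - intros T. exists 1. intros t x _. apply Rabs_le, COS_bound.
 - intros t. apply (cs_Cinf (st t) (bt t) (fra t) z p).
 - intros t x Ht. rewrite st_neg by auto. reflexivity.
Qed.

Definition mo (y : R -> R -> R) (z : Z) (p t : R) : R := avg (fun x => y t x * cs (st t) z p x).

(** One integration by parts in [s] replaces the amplitude [y] by the angle derivative of [y b].
    This lies again in [A0] and does not involve the frequency, so the bounds are uniform in [z],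
    [p] and [t <= T]. *)
Lemma mo_decay r : forall y, alg A0 y -> forall T, exists B, forall t z p, t <= T -> Rabs (IZR z) ^ r * Rabs (mo y z p t) <= B.
Proof.
 induction r as [|r IH]; intros y Hy T.
 - destruct (reg_bound A0 y (alg_reg A0 A0r y Hy) T) as [K HK]. exists K. intros t z p Ht. rewrite pow_O, Rmult_1_l. apply avg_abs_le.
  + apply cont_mult; [apply (alg_cont A0 A0r); auto|apply (cs_cont _ _ (fra t))].
  + intros x. rewrite Rabs_mult. use (HK t x Ht). assert (Rabs (cs (st t) z p x) <= 1) by (apply Rabs_le, COS_bound).
   use (Rabs_pos (y t x)). use (Rabs_pos (cs (st t) z p x)). nra.
 - assert (Hyb : alg A0 (fun t x => y t x * bt t x)) by alga.
  destruct (reg_x A0 _ (alg_reg A0 A0r _ Hyb)) as [Y [HY HYd]]. destruct (IH Y HY T) as [B HB]. exists B. intros t z p Ht.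
  assert (E : IZR z * mo y z p t = - mo Y z (p - PI / 2) t).
  { use (wavg_cs_parts _ _ (fra t) z p (fun x => y t x * bt t x) (alg_Cinf A0 A0r _ t Hyb)) as Q. unfold wavg in Q.
   unfold mo. rewrite (avg_ext _ (fun x => y t x * bt t x * cs (st t) z p x * / bt t x)), Q.
   - f_equal. apply avg_ext. intros x. rewrite (is_derive_unique _ _ _ (HYd t x)). field. apply Rgt_not_eq, bt_pos.
   - intros x. field. apply Rgt_not_eq, bt_pos. }
  specialize (HB t z (p - PI / 2) Ht). rewrite <- (Rabs_Ropp (mo Y z (p - PI / 2) t)), <- E, Rabs_mult in HB. simpl pow.
  rewrite (Rmult_comm (Rabs (IZR z))), Rmult_assoc. exact HB.
Qed.

Definition pm (y : R -> R -> R) (t : R) (k : nat) : R := avg (fun x => phi (st t) k x * y t x).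

Lemma pm_mo y t k : alg A0 y -> pm y t k = sqrt 2 * mo y (muz k) (ph k) t.
Proof.
 intros Hy. unfold pm, mo. rewrite <- avg_scal.
 - apply avg_ext. intros x. rewrite phi_cs. ring.
 - apply cont_mult; [apply (alg_cont A0 A0r); auto|apply (cs_cont _ _ (fra t))].
Qed.

Lemma pm_decay y T r : alg A0 y -> exists B, forall t k, t <= T -> Rabs (pm y t k) <= B / w k ^ r.
Proof.
 intros Hy. destruct (mo_decay r y Hy T) as [B HB]. exists (sqrt 2 * (2 ^ r * B)). intros t k Ht.
 rewrite pm_mo, Rabs_mult by auto. use sqrt2_pos. rewrite (Rabs_pos_eq (sqrt 2)) by lra.
 specialize (HB t (muz k) (ph k) Ht). rewrite <- mu_IZR in HB. use (mu_ge1 k). rewrite (Rabs_pos_eq (mu k)) in HB by lra.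
 unfold Rdiv. rewrite Rmult_assoc. mul_l; [lra|].
 apply (Rmult_le_reg_r (w k ^ r)); [apply wp_pos|]. rewrite Rmult_assoc, Rinv_l, Rmult_1_r by (apply Rgt_not_eq, wp_pos).
 via (2 ^ r * (mu k ^ r * Rabs (mo y (muz k) (ph k) t))).
 - rewrite <- Rmult_assoc, <- Rpow_mult_distr, Rmult_comm. mul_r; [apply Rabs_pos|]. apply pow_incr. use (w_pos k). use (w_le_mu k). lra.
 - mul_l; auto. left. apply pow_lt. lra.
Qed.

(** As [s_t = h s_x], the time derivative of [phi (st t) k] is [h] times its angle derivative, and
    integration by parts moves it onto the amplitude. The derivative is therefore again a moment of
    a function in [A0], with the same rapid decay in [k]. *)
Lemma pm_der y yt wx : alg A0 y -> alg A0 yt -> alg A0 wx -> (forall t x, 0 < t -> is_derive (fun t => y t x) t (yt t x)) ->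
 (forall t x, is_derive (fun x => ht t x * y t x) x (wx t x)) -> forall k,
 cont (fun t => pm y t k) /\ forall t, 0 < t -> is_derive (fun t => pm y t k) t (pm (fun t x => yt t x - wx t x) t k).
Proof.
 intros Hy Hyt Hwx Hd Hwd k. pose (phd := fun t x => sqrt 2 * (mu k * cos (mu k * st t x + (ph k + PI / 2)))).
 assert (alp : alg A1 (fun t x => phi (st t) k x)). { apply (alg_ext A1 (fun t x => sqrt 2 * cos (IZR (muz k) * st t x + ph k))).
  - intros t x. rewrite phi_cs. reflexivity.
  - alga. } assert (alpd : alg A1 phd). { unfold phd. rewrite mu_IZR. alga. }
 assert (pt : forall t x, 0 < t -> is_derive (fun t => phi (st t) k x) t (phd t x * hb t x)).
 { intros t x Ht. unfold phd, phi, ee. rewrite Rmult_assoc. apply (is_derive_scal (fun t => cos (mu k * st t x + ph k))).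
  apply (cos_chain (fun t => st t x)). apply st_t; auto. } assert (px : forall t x, Derive (phi (st t) k) x = phd t x * ib t x).
 { intros t x. apply is_derive_unique. unfold phd, phi, ee. rewrite Rmult_assoc. apply (is_derive_scal (fun x => cos (mu k * st t x + ph k))).
  apply (cos_chain (st t)). apply st_x. } pose (gt := fun t x => phd t x * hb t x * y t x + phi (st t) k x * yt t x).
 destruct (alg_avg A1 A1_reg (fun t x => phi (st t) k x * y t x) gt) as [H1 H2].
 - alga.
 - unfold gt. alga.
 - intros t x Ht. apply (is_derive_mult_R (fun t => phi (st t) k x) (fun t => y t x)); auto.
 - split; auto. intros t Ht. eapply is_derive_eq; [|apply H2; auto].
  assert (Cy : Cinf (y t)) by (apply (alg_Cinf A0 A0r); auto). assert (Cyt : Cinf (yt t)) by (apply (alg_Cinf A0 A0r); auto).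
  assert (Cw : Cinf (wx t)) by (apply (alg_Cinf A0 A0r); auto). assert (Cp : Cinf (phi (st t) k)) by (apply (phi_Cinf _ _ (fra t))).
  assert (Ch : Cinf (ht t)) by (apply Jr_Cinf, bt_Cinf). assert (Chy : Cinf (fun x => ht t x * y t x)) by cinf.
  use (avg_by_parts (phi (st t) k) (fun x => ht t x * y t x) Cp Chy) as Q.
  unfold gt, pm. rewrite (avg_ext _ (fun x => Derive (phi (st t) k) x * (ht t x * y t x) + phi (st t) k x * yt t x)).
  + rewrite (avg_plus (fun x => Derive (phi (st t) k) x * (ht t x * y t x))) by ccont. rewrite Q.
   rewrite (avg_ext (fun x => phi (st t) k x * Derive (fun x => ht t x * y t x) x) (fun x => phi (st t) k x * wx t x)).
   * rewrite (avg_ext (fun x => phi (st t) k x * (yt t x - wx t x)) (fun x => phi (st t) k x * yt t x - phi (st t) k x * wx t x)) by (intros; ring).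
    rewrite (avg_minus (fun x => phi (st t) k x * yt t x)) by ccont. Rring.
   * intros x. f_equal. exact (is_derive_unique _ _ _ (Hwd t x)).
  + intros x. rewrite px. change (hb t x) with (ht t x * ib t x). ring.
Qed.

(** * Families of matrices of finite rank with rapidly decaying entries *)

(** The families obtained from the finite expansion of [Gf] in the fixed basis [ee]: a moment in
    each matrix index times a mean. By the product rule the class is closed under differentiation in
    time. *)
Inductive tri : (R -> nat -> nat -> R) -> Prop :=
| tri_base y y' z : alg A0 y -> alg A0 y' -> alg A0 z -> tri (fun t k l => pm y t k * (pm y' t l * avg (z t)))
| tri_plus u v : tri u -> tri v -> tri (fun t k l => u t k l + v t k l).

Lemma tri_ext u v : (forall t k l, u t k l = v t k l) -> tri u -> tri v.
Proof.
 intros H Hu. replace v with u; auto. fext; intros t. fext; intros k. fext; auto.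
Qed.

Lemma tri_sm (u : nat -> R -> nat -> nat -> R) n : (forall i, (i < n)%nat -> tri (u i)) -> tri (fun t k l => sm (fun i => u i t k l) n).
Proof.
 intros H. induction n as [|n IH]; cbn [sm].
 - apply (tri_ext (fun t k l => pm (fun _ _ => 0) t k * (pm (fun _ _ => 0) t l * avg ((fun _ _ => 0) t)))).
  + intros t k l. cbv beta. rewrite avg_const. ring.
  + apply (tri_base (fun _ _ => 0) (fun _ _ => 0) (fun _ _ => 0)); apply alg_const.
 - apply (tri_plus (fun t k l => sm (fun i => u i t k l) n) (u n)); auto.
Qed.

Lemma alg_E y : alg A0 y -> exists y1, alg A0 y1 /\ forall k, cont (fun t => pm y t k) /\ forall t, 0 < t -> is_derive (fun t => pm y t k) t (pm y1 t k).
Proof.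
 intros Hy. destruct (reg_t A0 y (alg_reg A0 A0r y Hy)) as [yt [H1 H2]]. assert (Hhy : alg A0 (fun t x => ht t x * y t x)) by alga.
 destruct (reg_x A0 _ (alg_reg A0 A0r _ Hhy)) as [wx [H3 H4]]. exists (fun t x => yt t x - wx t x). split; [|apply pm_der; auto].
 apply (alg_ext A0 (fun t x => yt t x + (-1) * wx t x)); [intros; ring|]. alga.
Qed.

Lemma tri_der u : tri u -> (forall k l, cont (fun t => u t k l)) /\
 exists u1, tri u1 /\ forall t k l, 0 < t -> is_derive (fun t => u t k l) t (u1 t k l).
Proof.
 induction 1 as [y y' z Hy Hy' Hz|u v Hu [cu [u1 [T1 D1]]] Hv [cv [v1 [T2 D2]]]].
 - destruct (alg_E y Hy) as [y1 [A1y D1]]. destruct (alg_E y' Hy') as [y1' [A2 D2]].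
  destruct (reg_t A0 z (alg_reg A0 A0r z Hz)) as [zt [A3 Hzt]]. destruct (alg_avg A0 A0r z zt Hz A3 Hzt) as [c3 D3]. split.
  + intros k l. apply (cont_mult (fun t => pm y t k) (fun t => pm y' t l * avg (z t))); [apply D1|].
   apply (cont_mult (fun t => pm y' t l) (fun t => avg (z t))); [apply D2|auto].
  + exists (fun t k l => pm y1 t k * (pm y' t l * avg (z t)) + (pm y t k * (pm y1' t l * avg (z t)) + pm y t k * (pm y' t l * avg (zt t)))). split.
   * apply (tri_plus (fun t k l => pm y1 t k * (pm y' t l * avg (z t)))); [apply tri_base; auto|].
    apply (tri_plus (fun t k l => pm y t k * (pm y1' t l * avg (z t)))); apply tri_base; auto.
   * intros t k l Ht. eapply is_derive_eq; [|apply (is_derive_mult_R (fun t => pm y t k) (fun t => pm y' t l * avg (z t))); [apply D1; auto|]].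
    2:{ apply (is_derive_mult_R (fun t => pm y' t l) (fun t => avg (z t))); [apply D2; auto|apply D3; auto]. } Rring.
 - split; [intros; apply (cont_plus (fun t => u t k l) (fun t => v t k l)); auto|].
  exists (fun t k l => u1 t k l + v1 t k l). split; [apply tri_plus; auto|]. intros t k l Ht.
  apply (is_derive_plus (fun t => u t k l) (fun t => v t k l)); auto.
Qed.

Lemma tri_bdd u T : tri u -> exists C, forall t, t <= T -> bdd (u t) C.
Proof.
 induction 1 as [y y' z Hy Hy' Hz|u v Hu [C1 H1] Hv [C2 H2]].
 - destruct (choice _ (fun r => pm_decay y T r Hy)) as [B1 H1]. destruct (choice _ (fun r => pm_decay y' T r Hy')) as [B2 H2].
  destruct (reg_bound A0 z (alg_reg A0 A0r z Hz) T) as [K HK]. exists (fun r => B1 r * (B2 r * K)). intros t Ht r k l.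
  specialize (H1 r t k Ht). specialize (H2 r t l Ht).
  assert (H3 : Rabs (avg (z t)) <= K) by (apply avg_abs_le; [apply (alg_cont A0 A0r); auto|intros; apply HK; auto]).
  rewrite !Rabs_mult. use (wp_pos k r). use (wp_pos l r).
  replace (B1 r * (B2 r * K) / (w k ^ r * w l ^ r)) with ((B1 r / w k ^ r) * ((B2 r / w l ^ r) * K)) by (field; lra).
  mul_lr; auto using Rabs_pos; [apply Rmult_le_pos; apply Rabs_pos|]. mul_lr; auto using Rabs_pos.
 - exists (fun r => C1 r + C2 r). intros t Ht r k l. upto Rabs_triang.
  unfold Rdiv. rewrite Rmult_plus_distr_r. apply Rplus_le_compat; [apply H1|apply H2]; auto.
Qed.

Lemma tri_taylor u u1 T : tri u -> tri u1 -> (forall t k l, 0 < t -> is_derive (fun t => u t k l) t (u1 t k l)) ->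
 exists C, forall c d t, 0 <= c -> c < d -> d <= T -> t = c \/ t = d -> bdd (fun k l => u d k l - u c k l - (d - c) * u1 t k l) (fun r => C r * (d - c) ^ 2).
Proof.
 intros Hu Hu1 Hd. destruct (tri_der u1 Hu1) as [c1 [u2 [T2 D2]]]. destruct (tri_der u Hu) as [c0 _].
 destruct (tri_bdd u2 T T2) as [C HC]. exists C.
 assert (Q : forall r k l c d, 0 <= c <= T -> 0 <= d <= T -> Rabs (u d k l - u c k l - (d - c) * u1 c k l) <= C r / (w k ^ r * w l ^ r) * (d - c) ^ 2).
 { intros r k l c d Hc Hd'. apply (taylor2 (fun t => u t k l) (fun t => u1 t k l) (fun t => u2 t k l)).
  - intros t Ht. apply Hd. eapply Rle_lt_trans; [|apply Ht]. apply Rmin_glb; lra.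
  - intros t Ht. apply D2. eapply Rle_lt_trans; [|apply Ht]. apply Rmin_glb; lra.
  - intros t _. apply c0.
  - intros t _. apply c1.
  - intros t Ht. apply HC. upto Ht. apply Rmax_lub; lra. } intros c d t Hc Hcd Hd' Ht r k l.
 replace (C r * (d - c) ^ 2 / (w k ^ r * w l ^ r)) with (C r / (w k ^ r * w l ^ r) * (d - c) ^ 2) by (unfold Rdiv; ring).
 destruct Ht as [->| ->]; [apply Q; lra|]. specialize (Q r k l d c ltac:(lra) ltac:(lra)). rewrite Rabs_minus_sym in Q.
 replace ((c - d) * u1 d k l - (u c k l - u d k l)) with (u d k l - u c k l - (d - c) * u1 d k l) in Q by ring.
 replace ((c - d) ^ 2) with ((d - c) ^ 2) in Q by ring. exact Q.
Qed.

(** * Monotonicity of the spectral sums along the flow *)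

Section QuadraticForm.
Variable psi : nat -> R.
Hypothesis Hpsi : l2 psi.

(** Convergence and square summability accompany the value because [Series] is total and additive
    only for convergent series. *)
Definition qform (M : nat -> nat -> R) (q : R) : Prop :=
 (forall k, is_series (fun l => M k l * psi l) (mv M psi k)) /\ l2 (mv M psi) /\ ip (mv M psi) psi = q.

Lemma qform_base x y c : l2 x -> l2 y -> qform (fun k l => x k * (y l * c)) (ip x psi * (ip y psi * c)).
Proof.
 intros Hx Hy. assert (S0 : forall k, is_series (fun l => x k * (y l * c) * psi l) ((c * ip y psi) * x k)).
 { intros k. apply (is_series_ext_R (fun l => (x k * c) * (y l * psi l))); [intros; ring|].
  replace (c * ip y psi * x k) with ((x k * c) * ip y psi) by ring. apply (is_series_scal (x k * c) (fun l => y l * psi l) (ip y psi)). apply ip_is_series; auto. }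
 assert (E : forall k, mv (fun k l => x k * (y l * c)) psi k = (c * ip y psi) * x k) by (intros; apply is_series_unique, S0).
 split; [intros k; rewrite E; auto|]. split.
 - apply (l2_ext (fun k => (c * ip y psi) * x k)); [auto|]. apply l2_scal; auto.
 - rewrite (ip_ext _ (fun k => (c * ip y psi) * x k) _ psi) by auto. rewrite ip_scal_l. ring.
Qed.

Lemma qform_plus M M' q q' : qform M q -> qform M' q' -> qform (fun k l => M k l + M' k l) (q + q').
Proof.
 intros [S1 [L1 E1]] [S2 [L2 E2]]. assert (S0 : forall k, is_series (fun l => (M k l + M' k l) * psi l) (mv M psi k + mv M' psi k)).
 { intros k. apply (is_series_ext_R (fun l => M k l * psi l + M' k l * psi l)); [intros; ring|]. apply (is_series_plus (fun l => M k l * psi l)); auto. }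
 assert (E : forall k, mv (fun k l => M k l + M' k l) psi k = mv M psi k + mv M' psi k) by (intros; apply is_series_unique, S0).
 split; [intros k; rewrite E; auto|]. split.
 - apply (l2_ext (fun k => mv M psi k + mv M' psi k)); auto. apply l2_plus; auto.
 - rewrite (ip_ext _ (fun k => mv M psi k + mv M' psi k) _ psi) by auto. rewrite ip_plus_l by auto. lra.
Qed.

Lemma qform_sm (M : nat -> nat -> nat -> R) q n : (forall i, (i < n)%nat -> qform (M i) (q i)) -> qform (fun k l => sm (fun i => M i k l) n) (sm q n).
Proof.
 intros H. induction n as [|n IH]; cbn [sm].
 - assert (Z : l2 (fun _ => 0)) by (apply (l2_ext (fun k => 0 * psi k)); [intros; ring|apply l2_scal; auto]).
  use (qform_base (fun _ => 0) (fun _ => 0) 0 Z Z) as Q.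
  replace (fun _ _ : nat => 0) with (fun _ _ : nat => 0 * (0 * 0)) by (fext; intros; fext; intros; ring).
  replace (ip (fun _ => 0) psi * (ip (fun _ => 0) psi * 0)) with 0 in Q by ring. exact Q.
 - apply (qform_plus (fun k l => sm (fun i => M i k l) n) (M n)); auto.
Qed.

End QuadraticForm.

Definition y0 (n : nat) (_ x : R) : R := ee n x.
(** The amplitude of the time derivative of [pm (y0 n)], namely minus the angle derivative of
    [h * ee n]. *)
Definition y1 (n : nat) (t x : R) : R := 0 - (Lr (bt t) x * ee n x + ht t x * Derive (ee n) x).
Definition qq (n m : nat) (x : R) : R := Lr (ee n) x * Lr (ee m) x - Derive (ee n) x * Derive (ee m) x.
Definition Zb (n m : nat) (t x : R) : R := bt t x * qq n m x.
Definition Zd (n m : nat) (t x : R) : R := btd t x * qq n m x.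

Lemma alg_y0 n : alg A0 (y0 n).
Proof. exact (alg_EE (S n)). Qed.

#[local] Hint Resolve alg_y0 : alg.

Lemma alg_DE n : alg A0 (fun _ x => Derive (ee n) x).
Proof. exact (alg_DEE (S n)). Qed.

Lemma alg_ee n : alg A0 (fun _ x => ee n x).
Proof. exact (alg_EE (S n)). Qed.

#[local] Hint Resolve alg_DE alg_ee : alg.

Lemma alg_Lb : alg A0 (fun t x => Lr (bt t) x).
Proof.
 apply (alg_ext A0 (fun t x => sm (fun j => be t j * Lr (EE j) x) (2 * N + 1))); [intros; symmetry; apply Lr_bb|].
 apply (alg_comb (fun j t => be t j) (fun j => Lr (EE j))); [apply alg_be0|]. intros [|k].
 - apply (alg_ext A0 (fun _ _ => 0)); [|apply alg_const]. intros t x. change (EE 0) with (fun _ : R => 1). rewrite Lr_const. reflexivity.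
 - apply (alg_ext A0 (fun _ x => mu k * ee k x)); [intros; change (EE (S k)) with (ee k); rewrite Lr_ee; reflexivity|]. alga.
Qed.

#[local] Hint Resolve alg_Lb : alg.

Lemma alg_y1 n : alg A0 (y1 n).
Proof. apply (alg_ext A0 (fun t x => (-1) * (Lr (bt t) x * ee n x + ht t x * Derive (ee n) x))); [intros; unfold y1; ring|alga]. Qed.

Lemma alg_qq n m : alg A0 (fun _ x => qq n m x).
Proof.
 apply (alg_ext A0 (fun _ x => (mu n * ee n x) * (mu m * ee m x) + (-1) * (Derive (ee n) x * Derive (ee m) x))); [|alga].
 intros _ x. unfold qq. rewrite !Lr_ee. ring.
Qed.

#[local] Hint Resolve alg_y1 alg_qq : alg.

Lemma alg_Zb n m : alg A0 (Zb n m).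
Proof. unfold Zb. alga. Qed.

Lemma alg_Zd n m : alg A0 (Zd n m).
Proof. unfold Zd. alga. Qed.

#[local] Hint Resolve alg_Zb alg_Zd : alg.

Definition FF (t : R) (k l : nat) : R := Fm (st t) (bt t) k l.

Definition FF0 (n m : nat) (t : R) (k l : nat) : R := pm (y0 n) t k * (pm (y0 m) t l * avg (Zb n m t)).
Definition FF1t (n m : nat) (t : R) (k l : nat) : R :=
 pm (y1 n) t k * (pm (y0 m) t l * avg (Zb n m t)) + (pm (y0 n) t k * (pm (y1 m) t l * avg (Zb n m t)) + pm (y0 n) t k * (pm (y0 m) t l * avg (Zd n m t))).
Definition FF1 (t : R) (k l : nat) : R := sm (fun n => sm (fun m => FF1t n m t k l) (2 * N)) (2 * N).

Lemma FF_sum t k l : FF t k l = sm (fun n => sm (fun m => FF0 n m t k l) (2 * N)) (2 * N).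
Proof.
 unfold FF, Fm.
 rewrite (Gf_finite N (bt t) (phi (st t) k) (phi (st t) l) (bt_Cinf t) (bb_band N (be t)) (phi_Cinf _ _ (fra t) k) (phi_Cinf _ _ (fra t) l)).
 apply sm_ext. intros n _. apply sm_ext. intros m _. reflexivity.
Qed.

Lemma tri_FF : tri FF.
Proof.
 apply (tri_ext (fun t k l => sm (fun n => sm (fun m => FF0 n m t k l) (2 * N)) (2 * N))); [intros; symmetry; apply FF_sum|].
 apply (tri_sm (fun n t k l => sm (fun m => FF0 n m t k l) (2 * N))). intros n _.
 apply (tri_sm (fun m t k l => FF0 n m t k l)). intros m _. apply (tri_base (y0 n) (y0 m) (Zb n m)); auto with alg.
Qed.

Lemma tri_FF1 : tri FF1.
Proof.
 apply (tri_sm (fun n t k l => sm (fun m => FF1t n m t k l) (2 * N))). intros n _.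
 apply (tri_sm (fun m t k l => FF1t n m t k l)). intros m _.
 apply (tri_plus (fun t k l => pm (y1 n) t k * (pm (y0 m) t l * avg (Zb n m t)))); [apply tri_base; auto using alg_y0, alg_y1, alg_Zb|].
 apply (tri_plus (fun t k l => pm (y0 n) t k * (pm (y1 m) t l * avg (Zb n m t)))); apply tri_base; auto with alg.
Qed.

Lemma pm_y0_der n k t : 0 < t -> is_derive (fun t => pm (y0 n) t k) t (pm (y1 n) t k).
Proof.
 apply (pm_der (y0 n) (fun _ _ => 0) (fun t x => Lr (bt t) x * ee n x + ht t x * Derive (ee n) x)); alga.
 - intros u x _. exact (is_derive_const (ee n x) u).
 - intros u x. apply (is_derive_mult_R (ht u) (ee n)); [apply ht_x|apply Cinf_is_derive, ee_Cinf].
Qed.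

Lemma Zb_der n m t : 0 < t -> is_derive (fun t => avg (Zb n m t)) t (avg (Zd n m t)).
Proof.
 apply (alg_avg A0 A0r (Zb n m) (Zd n m)); [apply alg_Zb|apply alg_Zd|]. intros u x Hu.
 apply (is_derive_ext (fun u => qq n m x * bt u x)); [intros; apply Rmult_comm|]. unfold Zd. rewrite Rmult_comm.
 apply (is_derive_scal (fun u => bt u x)). apply bt_t; auto.
Qed.

Lemma FF_der t k l : 0 < t -> is_derive (fun t => FF t k l) t (FF1 t k l).
Proof.
 intros Ht. apply (is_derive_ext (fun t => sm (fun n => sm (fun m => FF0 n m t k l) (2 * N)) (2 * N))); [intros; symmetry; apply FF_sum|].
 apply (is_derive_sm (fun n t => sm (fun m => FF0 n m t k l) (2 * N)) (fun n t => sm (fun m => FF1t n m t k l) (2 * N))). intros n _.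
 apply (is_derive_sm (fun m t => FF0 n m t k l) (fun m t => FF1t n m t k l)). intros m _.
 eapply is_derive_eq; [|apply (is_derive_mult_R (fun t => pm (y0 n) t k) (fun t => pm (y0 m) t l * avg (Zb n m t))); [apply pm_y0_der; auto|]].
 2:{ apply (is_derive_mult_R (fun t => pm (y0 m) t l) (fun t => avg (Zb n m t))); [apply pm_y0_der; auto|apply Zb_der; auto]. }
 unfold FF1t. Rring.
Qed.

Lemma pm_rapid y t : alg A0 y -> rapid (pm y t).
Proof. intros Hy r. destruct (pm_decay y t r Hy) as [B HB]. exists B. intros k. apply HB. lra. Qed.

Lemma pm_pair y t psi : alg A0 y -> rapid psi -> ip (pm y t) psi = avg (fun x => synth (st t) psi x * y t x).
Proof.
 intros Hy Hp. assert (Cy : Cinf (y t)) by (apply (alg_Cinf A0 A0r); auto). use (bt_Cinf t) as Cb.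
 use (synth_pair _ _ (fra t) psi (fun x => bt t x * y t x) Hp ltac:(cinf)) as Q.
 assert (Hn : forall x, bt t x <> 0) by (intros; apply Rgt_not_eq, bt_pos).
 replace (avg (fun x => synth (st t) psi x * y t x)) with (wavg (bt t) (fun x => synth (st t) psi x * (bt t x * y t x))).
 - apply is_series_unique. eapply is_series_ext_R; [|exact Q]. intros k. cbv beta. rewrite Rmult_comm. f_equal.
  change (pm y t k) with (avg (fun x => phi (st t) k x * y t x)). unfold coef, wavg. apply avg_ext. intros x. field. auto.
 - unfold wavg. apply avg_ext. intros x. field. auto.
Qed.

(** With the coefficients [psi j] held fixed, the eigenfunction [v] moves by [h v_x]. The left side
    is thus [Gf] with [b'] in place of [b], plus twice [Gf b (h v_x) v], and [Gf_flow_eig]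
    applies. *)
Lemma FF1_form t psi lam j : lsys (FF t) psi lam -> ip (mv (FF1 t) (psi j)) (psi j) = - 2 * lam j * ip (mv (FF t) (psi j)) (psi j).
Proof.
 intros HS. destruct (tri_bdd FF t tri_FF) as [C HC]. specialize (HC t (Rle_refl t)).
 use (ls_rapid _ _ _ j HS) as Hr. use (rapid_l2 _ Hr) as Hl. pose (v := synth (st t) (psi j)). use (bt_Cinf t) as Cb.
 assert (Cv : Cinf v) by (exact (vv_Cinf _ _ (fra t) psi lam HS j)). assert (Ch : Cinf (ht t)) by (apply Jr_Cinf; auto).
 change (mv (FF t) (psi j)) with (mv (Fm (st t) (bt t)) (psi j)). rewrite (form_vv _ _ (fra t) psi lam HS j). fold v.
 rewrite <- (Gf_flow_eig (bt t) Cb v (lam j) Cv (vv_eig _ _ (fra t) psi lam HS j)).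
 assert (E0 : forall n, ip (pm (y0 n) t) (psi j) = fc v n) by (intros; rewrite pm_pair by (auto; apply alg_y0); reflexivity).
 assert (E1 : forall n, ip (pm (y1 n) t) (psi j) = fc (fun x => ht t x * Derive v x) n).
 { intros n. rewrite pm_pair by (auto; apply alg_y1). fold v. unfold fc.
  assert (Ce : Cinf (ee n)) by apply ee_Cinf. assert (Che : Cinf (fun x => ht t x * ee n x)) by cinf.
  rewrite (avg_ext (fun x => ht t x * Derive v x * ee n x) (fun x => Derive v x * (ht t x * ee n x))) by (intros; ring). rewrite (avg_by_parts v (fun x => ht t x * ee n x)) by auto.
  rewrite (avg_ext _ (fun x => (-1) * (v x * Derive (fun x => ht t x * ee n x) x))).
  - rewrite avg_scal by ccont. ring.
  - intros x. rewrite (Derive_mult_fun (ht t) (ee n)) by auto. rewrite (is_derive_unique (ht t) x _ (ht_x t x)). unfold y1. ring. }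
 assert (Q : qform (psi j) (FF1 t) (sm (fun n => sm (fun m =>
   fc (fun x => ht t x * Derive v x) n * (fc v m * avg (Zb n m t)) + (fc v n * (fc (fun x => ht t x * Derive v x) m * avg (Zb n m t)) + fc v n * (fc v m * avg (Zd n m t)))) (2 * N)) (2 * N))).
 { apply (qform_sm (psi j) Hl (fun n k l => sm (fun m => FF1t n m t k l) (2 * N))). intros n _.
  apply (qform_sm (psi j) Hl (fun m k l => FF1t n m t k l)). intros m _. rewrite <- !E0, <- !E1. unfold FF1t.
  assert (l20 : forall n, l2 (pm (y0 n) t)) by (intros; apply rapid_l2, pm_rapid, alg_y0).
  assert (l21 : forall n, l2 (pm (y1 n) t)) by (intros; apply rapid_l2, pm_rapid, alg_y1).
  apply (qform_plus (psi j) Hl (fun k l => pm (y1 n) t k * (pm (y0 m) t l * avg (Zb n m t)))); [apply qform_base; auto|].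
  apply (qform_plus (psi j) Hl (fun k l => pm (y0 n) t k * (pm (y1 m) t l * avg (Zb n m t)))); apply qform_base; auto. }
 destruct Q as [_ [_ Q]]. rewrite Q.
 assert (Bd : band N (btd t)) by (change (btd t) with (fl (bb N (be t))); rewrite fl_bb_XX; apply bb_band).
 assert (Cbd : Cinf (btd t)) by (apply fl_Cinf; auto). change (fun x => Jr (bt t) x * Derive (bt t) x - bt t x * Lr (bt t) x) with (btd t).
 change (fun x => Jr (bt t) x * Derive v x) with (fun x => ht t x * Derive v x).
 assert (Chv : Cinf (fun x => ht t x * Derive v x)) by cinf.
 replace (2 * Gf (bt t) (fun x => ht t x * Derive v x) v) with (Gf (bt t) (fun x => ht t x * Derive v x) v + Gf (bt t) v (fun x => ht t x * Derive v x))
  by (rewrite (Gf_sym (bt t) v); ring).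
 rewrite (Gf_finite N (btd t) v v Cbd Bd Cv Cv), (Gf_finite N (bt t) _ v Cb (bb_band N (be t)) Chv Cv), (Gf_finite N (bt t) v _ Cb (bb_band N (be t)) Cv Chv).
 rewrite <- !sm_plus. apply sm_ext. intros n _. rewrite <- !sm_plus. apply sm_ext. intros m _.
 change (gee (bt t) n m) with (avg (Zb n m t)). change (gee (btd t) n m) with (avg (Zd n m t)). ring.
Qed.

(** The eigensystem is chosen at every time separately; Klein's inequality compares any two choices.
    The minimum of [b] on [[0, T]] supplies the lower bound [ell]. *)
Theorem flow_spectrum : exists lam : R -> nat -> R,
 (forall t, eig_seq (bt t) (lam t)) /\ (forall t p, rapid (fun j => lam t j ^ p - mu j ^ p)) /\
 (forall T m, 0 <= T -> spec_sum lam (2 * S m) T <= spec_sum lam (2 * S m) 0) /\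
 (forall T, 0 <= T -> spec_sum lam 1 T <= spec_sum lam 1 0).
Proof.
 assert (HB : forall t, exists C, bdd (FF t) C). { intros t. destruct (tri_bdd FF t tri_FF) as [C HC]. exists C. apply HC. lra. }
 assert (HS : forall t, exists pl : (nat -> nat -> R) * (nat -> R), lsys (FF t) (fst pl) (snd pl)).
 { intros t. destruct (HB t) as [C HC]. destruct (exists_system _ _ (fra t) C HC) as [psi [lam H]]. exists (psi, lam). exact H. }
 destruct (choice _ HS) as [pl Hpl]. clear HS. pose (psi := fun t => fst (pl t)). pose (lam := fun t => snd (pl t)).
 assert (HS : forall t, lsys (FF t) (psi t) (lam t)) by exact Hpl.
 assert (Main : forall T, 0 <= T -> (forall m, spec_sum lam (2 * S m) T <= spec_sum lam (2 * S m) 0) /\ spec_sum lam 1 T <= spec_sum lam 1 0).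
 { intros T HT. destruct (fw_low Hw T) as [ell [Hell Hlow]]. destruct (tri_bdd FF T tri_FF) as [C HC].
  destruct (tri_taylor FF FF1 T tri_FF tri_FF1 FF_der) as [CR HCR].
  pose (Ak := fun t k => avg (fun x => phi (st t) k x * Lr (phi (st t) k) x)).
  assert (h1 : forall t, 0 <= t <= T -> bdd (FF t) C) by (intros; apply HC; lra).
  assert (h2 : forall t j k, FF t j k = FF t k j) by (intros; unfold FF; apply Fm_sym).
  assert (h3 : forall t, 0 <= t <= T -> exists C1, bdd (FF1 t) C1).
  { intros t _. destruct (tri_bdd FF1 t tri_FF1) as [C1 H1]. exists C1. apply H1. lra. }
  assert (h4 : forall t j, 0 <= t <= T -> ip (mv (FF1 t) (psi t j)) (psi t j) = - 2 * lam t j * ip (mv (FF t) (psi t j)) (psi t j)).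
  { intros t j _. apply FF1_form; auto. } assert (h5 : forall t j, 0 <= t <= T -> ell <= lam t j).
  { intros t j Ht. apply (lam_lower _ _ (fra t) (psi t) (lam t) (HS t)); auto. intros x. apply Hlow; lra. }
  assert (h6 : forall t k, 0 <= t <= T -> is_series (fun j => lam t j * (psi t j k * psi t j k)) (Ak t k)).
  { intros t k Ht. apply (diag_series _ _ (fra t) (psi t) (lam t) (HS t)). }
  assert (h7 : forall t i, 0 <= t <= T -> 2 * INR (S i) <= Ak t (2 * i)%nat + Ak t (2 * i + 1)%nat).
  { intros t i _. apply (diag_pair _ _ (fra t)). } split.
  - intros m. apply (spec_sum_even T FF FF1 psi lam Ak C CR); auto.
  - apply (spec_sum_one T ell FF FF1 psi lam Ak C CR); auto. } exists lam. split; [|split; [|split]].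
 - intros t. destruct (HB t) as [C HC]. apply (system_eig_seq _ _ C (psi t) (lam t) (fra t) HC (HS t)).
 - intros t p. destruct (HB t) as [C HC]. eapply lam_pow_rapid; eauto.
 - intros T m HT. apply Main; auto.
 - intros T HT. apply Main; auto.
Qed.

End Flow.

(** * Differences of zeta functions *)

Definition ce (z : C) : C := (exp (Re z) * cos (Im z), exp (Re z) * sin (Im z)).

Lemma ce_plus z v : ce (z + v)%C = (ce z * ce v)%C.
Proof.
 unfold ce, Cplus, Cmult; simpl. unfold Re, Im. rewrite exp_plus, cos_plus, sin_plus. f_equal; ring.
Qed.

Lemma Cmod_le_sum z : Cmod z <= Rabs (Re z) + Rabs (Im z).
Proof.
 destruct z as [x y]. unfold Re, Im; simpl. replace (x, y) with (RtoC x + (0, y))%C by (unfold Cplus, RtoC; simpl; f_equal; ring).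
 upto Cmod_triangle. rewrite Cmod_R. apply Rplus_le_compat_l. unfold Cmod; simpl.
 replace (0 * (0 * 1) + y * (y * 1)) with (y ^ 2) by ring. rewrite <- pow2_abs, sqrt_pow2 by apply Rabs_pos. lra.
Qed.

Lemma Im_le_Cmod z : Rabs (Im z) <= Cmod z.
Proof. below Rmax_Cmod. apply Rmax_r. Qed.

Lemma ce_bound z : Cmod (ce z) <= exp (Cmod z).
Proof.
 replace (Cmod (ce z)) with (exp (Re z)).
 - apply exp_le. eapply Rle_trans; [apply Rle_abs|apply re_le_Cmod].
 - unfold Cmod, ce; simpl. replace (exp (Re z) * cos (Im z) * (exp (Re z) * cos (Im z) * 1) + exp (Re z) * sin (Im z) * (exp (Re z) * sin (Im z) * 1))
   with (exp (Re z) ^ 2 * (Rsqr (sin (Im z)) + Rsqr (cos (Im z)))) by (unfold Rsqr; ring).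
  rewrite sin2_cos2, Rmult_1_r, sqrt_pow2; auto. left; apply exp_pos.
Qed.

(** Real and imaginary part are both of the form [exp x cos (y + p)], with [p = 0] and
    [p = - PI / 2], and are expanded along the segment from 0 to [z]. *)
Lemma ce_taylor z : Cmod (ce z - 1 - z) <= 4 * Cmod z ^ 2 * exp (2 * Cmod z).
Proof.
 use (Cmod_ge_0 z) as H0. use (re_le_Cmod z) as Hx. use (Im_le_Cmod z) as Hy. destruct z as [x y]. unfold Re, Im in *; simpl in Hx, Hy.
 set (r := Cmod (x, y)) in *. use (Rabs_pos x). use (Rabs_pos y).
 assert (B : forall p, Rabs (exp x * cos (y + p) - cos p - (x * cos p - y * sin p)) <= 2 * r ^ 2 * exp (2 * r)).
 { intros p. use (taylor2 (fun t => exp (t * x) * cos (t * y + p)) (fun t => exp (t * x) * (x * cos (t * y + p) - y * sin (t * y + p)))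
   (fun t => exp (t * x) * ((x * x - y * y) * cos (t * y + p) - 2 * (x * y) * sin (t * y + p))) 0 1 (2 * r ^ 2 * exp (2 * r))) as Q.
  rewrite Rmin_left, Rmax_right, !Rmult_1_l, !Rmult_0_l, !Rplus_0_l, exp_0, Rminus_0_r, !Rmult_1_l, pow1, Rmult_1_r in Q by lra. apply Q.
  - intros t _. auto_derive; auto. ring.
  - intros t _. auto_derive; auto. ring.
  - intros t _. apply (ex_derive_continuous (fun t => exp (t * x) * cos (t * y + p))). auto_derive; auto.
  - intros t _. apply (ex_derive_continuous (fun t => exp (t * x) * (x * cos (t * y + p) - y * sin (t * y + p)))). auto_derive; auto.
  - intros t Ht. rewrite Rabs_mult, (Rabs_pos_eq (exp (t * x))), Rmult_comm by (left; apply exp_pos).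
   mul_lr; [apply Rabs_pos|left; apply exp_pos| |].
   + assert (c1 : Rabs (cos (t * y + p)) <= 1) by apply Rabs_le, COS_bound. assert (s1 : Rabs (sin (t * y + p)) <= 1) by apply Rabs_le, SIN_bound.
    upto Rabs_triang. rewrite Rabs_Ropp, !Rabs_mult, (Rabs_pos_eq 2) by lra. assert (Rabs (x * x - y * y) <= r ^ 2).
    { assert (x * x = Rabs x * Rabs x /\ y * y = Rabs y * Rabs y) as [-> ->] by (rewrite <- !Rabs_mult; split; symmetry; apply Rabs_pos_eq, Rle_0_sqr).
     apply Rabs_le. nra. } assert (Hr : x * x + y * y = r ^ 2). { unfold r. rewrite Cmod2_alt. unfold Re, Im; simpl. ring. }
    assert (2 * (Rabs x * Rabs y) <= r ^ 2). { rewrite <- Hr. use (Rle_0_sqr (Rabs x - Rabs y)) as Q2. unfold Rsqr in Q2.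
     assert (x * x = Rabs x * Rabs x /\ y * y = Rabs y * Rabs y) as [-> ->] by (rewrite <- !Rabs_mult; split; symmetry; apply Rabs_pos_eq, Rle_0_sqr). lra. }
    use (Rabs_pos (x * x - y * y)). use (Rabs_pos (cos (t * y + p))). use (Rabs_pos (sin (t * y + p))).
    assert (0 <= Rabs x * Rabs y) by (apply Rmult_le_pos; auto). nra.
   + apply exp_le. apply Rabs_le_between in Hx. nra. } upto Cmod_le_sum. unfold Re, Im; simpl.
 use (B 0) as B1. rewrite Rplus_0_r, cos_0, sin_0 in B1. use (B (- (PI / 2))) as B2.
 rewrite cos_m_PI2, cos_neg, cos_PI2, sin_neg, sin_PI2 in B2.
 replace (exp x * cos y + - (1) + - x) with (exp x * cos y - 1 - (x * 1 - y * 0)) by ring.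
 replace (exp x * sin y + - 0 + - y) with (exp x * sin y - 0 - (x * 0 - y * - (1))) by ring. lra.
Qed.

Lemma ce_bounds z B : Cmod z <= B -> 1 <= B -> let X := exp B in
 Cmod (ce z) <= X /\ Cmod (ce z - 1) <= Cmod z * X ^ 6 /\ Cmod (ce z - 1 - z) <= Cmod z ^ 2 * X ^ 6.
Proof.
 intros Hz HB X. use (Cmod_ge_0 z) as H0. use (ce_taylor z) as T. assert (HX : B + 1 <= X) by (unfold X; use (exp_ineq1_le B); lra).
 assert (E2 : exp (2 * Cmod z) <= X ^ 2).
 { replace (X ^ 2) with (exp (2 * B)) by (unfold X; replace (2 * B) with (B + B) by ring; rewrite exp_plus; ring). apply exp_le. lra. }
 assert (P4 : 4 <= X ^ 2) by nra. assert (P : 0 <= Cmod z ^ 2) by apply pow2_ge_0. assert (T2 : Cmod (ce z - 1 - z) <= Cmod z ^ 2 * X ^ 4).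
 { upto T. rewrite (Rmult_comm 4), Rmult_assoc. mul_l; auto.
  replace (X ^ 4) with (X ^ 2 * X ^ 2) by ring. mul_lr; auto; [lra|left; apply exp_pos]. }
 assert (P5 : X ^ 4 <= X ^ 5) by (apply Rle_pow; lra || lia). assert (P6 : X ^ 5 + X ^ 5 <= X ^ 6).
 { replace (X ^ 6) with (X ^ 5 * X) by ring. assert (0 <= X ^ 5) by (apply pow_le; lra). nra. }
 assert (P1 : 1 <= X ^ 5) by (apply pow_R1_Rle; lra). split; [eapply Rle_trans; [apply ce_bound|apply exp_le; auto]|]. split.
 - replace (ce z - 1)%C with ((ce z - 1 - z) + z)%C by ring. upto Cmod_triangle.
  assert (Cmod z * X ^ 4 <= X ^ 5) by (replace (X ^ 5) with (X * X ^ 4) by ring; mul_r; [apply pow_le|]; lra). nra.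
 - upto T2. mul_l; lra.
Qed.

(** One term of the difference of two zeta functions, in terms of the logarithms of the eigenvalues;
    [ut'] is its derivative in [s]. *)
Definition ut (L0 L1 : R) (s : C) : C := (ce (- (s * RtoC L1)) - ce (- (s * RtoC L0)))%C.
Definition ut' (L0 L1 : R) (s : C) : C := (RtoC L0 * ce (- (s * RtoC L0)) - RtoC L1 * ce (- (s * RtoC L1)))%C.

(* All estimates are absorbed in powers of [exp (sg * Lb)]; what matters is the factor [L1 - L0]. *)
Lemma ut_estimates L0 L1 Lb sg s : Rabs L0 <= Lb -> Rabs L1 <= Lb -> Rabs (L1 - L0) <= Lb -> 1 <= Lb -> Cmod s <= sg -> 1 <= sg ->
 let Q := Rabs (L1 - L0) * exp (sg * Lb) ^ 17 in Cmod (ut L0 L1 s) <= Q /\ Cmod (ut' L0 L1 s) <= Q /\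
 forall h, Cmod h <= 1 -> Cmod (ut L0 L1 (s + h) - ut L0 L1 s - h * ut' L0 L1 s) <= Q * Cmod h ^ 2.
Proof.
 intros H0 H1 Hd HL Hs Hsg. set (B := sg * Lb). set (X := exp B). set (de := Rabs (L1 - L0)) in *. intros Q.
 assert (HB : 1 <= B) by (unfold B; nra). assert (HX : B + 1 <= X) by (unfold X; use (exp_ineq1_le B); lra).
 assert (HLB : Lb <= B) by (unfold B; nra). assert (HsB : sg <= B) by (unfold B; nra). assert (Hde : 0 <= de) by apply Rabs_pos.
 assert (Xp : forall n, 0 <= X ^ n) by (intros; apply pow_le; lra).
 assert (Xle : forall n m, (n <= m)%nat -> X ^ n <= X ^ m) by (intros; apply Rle_pow; auto; lra).
 assert (Xdbl : forall n, X ^ n + X ^ n <= X ^ S n) by (intros n; simpl; specialize (Xp n); nra).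
 assert (cb : forall (h : C) x, Cmod h <= sg -> Rabs x <= Lb -> Cmod (- (h * RtoC x)) = Cmod h * Rabs x /\ Cmod (- (h * RtoC x)) <= B).
 { intros h x Hh Hx. rewrite Cmod_opp, Cmod_mult, Cmod_R. split; auto. mul_lr; auto using Cmod_ge_0, Rabs_pos. }
 destruct (ce_bounds _ B (proj2 (cb s L0 Hs H0)) HB) as [a0 _]. destruct (ce_bounds _ B (proj2 (cb s L1 Hs H1)) HB) as [a1 _].
 destruct (ce_bounds _ B (proj2 (cb s _ Hs Hd)) HB) as [_ [ad _]]. rewrite (proj1 (cb s _ Hs Hd)) in ad. fold X in a0, a1, ad. fold de in ad.
 assert (u8 : Cmod (ut L0 L1 s) <= de * X ^ 8). { replace (ut L0 L1 s) with (ce (- (s * L0)) * (ce (- (s * RtoC (L1 - L0))) - 1))%C.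
  - rewrite Cmod_mult. replace (de * X ^ 8) with (X * (X * de * X ^ 6)) by ring. mul_lr; auto using Cmod_ge_0.
   upto ad. mul_r; auto. mul_r; lra.
  - unfold ut. replace (- (s * L1))%C with (- (s * L0) + - (s * RtoC (L1 - L0)))%C by (rewrite RtoC_minus; ring). rewrite ce_plus. ring. }
 split; [upto u8; mul_l; auto; apply Xle; lia|]. split.
 - replace (ut' L0 L1 s) with (- (RtoC (L1 - L0) * ce (- (s * L1))) + - (L0 * ut L0 L1 s))%C by (unfold ut, ut'; rewrite RtoC_minus; ring).
  upto Cmod_triangle. rewrite !Cmod_opp, !Cmod_mult, !Cmod_R. fold de. via (de * X ^ 9 + de * X ^ 9).
  + apply Rplus_le_compat.
   * mul_l; auto. upto a1. rewrite <- (pow_1 X) at 1. apply Xle; lia.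
   * replace (de * X ^ 9) with (X * (de * X ^ 8)) by ring. mul_lr; auto using Cmod_ge_0, Rabs_pos. lra.
  + rewrite <- Rmult_plus_distr_l. mul_l; auto. eapply Rle_trans; [apply Xdbl|apply Xle; lia].
 - intros h Hh. assert (Hh' : Cmod h <= sg) by lra. use (Cmod_ge_0 h) as Hh0.
  set (z0 := (- (h * RtoC L0))%C). set (dz := (- (h * RtoC (L1 - L0)))%C).
  assert (Ez : (- (h * RtoC L1))%C = (z0 + dz)%C) by (unfold z0, dz; rewrite RtoC_minus; ring).
  (* The decomposition is arranged so that every term contains the factor [L1 - L0], through [dz] or
     through [ut L0 L1 s]. *)
  replace (ut L0 L1 (s + h) - ut L0 L1 s - h * ut' L0 L1 s)%C with
   (ce (- (s * L1)) * (ce z0 * (ce dz - 1 - dz) + (ce z0 - 1) * dz) + ut L0 L1 s * (ce z0 - 1 - z0))%C.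
  2:{ unfold ut, ut'. replace (- ((s + h) * L1))%C with (- (s * L1) + (z0 + dz))%C by (rewrite <- Ez; ring).
    replace (- ((s + h) * L0))%C with (- (s * L0) + z0)%C by (unfold z0; ring). rewrite !ce_plus.
    replace (h * (L0 * ce (- (s * L0)) - L1 * ce (- (s * L1))))%C with ((z0 + dz) * ce (- (s * L1)) - z0 * ce (- (s * L0)))%C by (rewrite <- Ez; unfold z0; ring). ring. }
  destruct (ce_bounds z0 B (proj2 (cb h L0 Hh' H0)) HB) as [b2 [b3 b4]]. destruct (ce_bounds dz B (proj2 (cb h _ Hh' Hd)) HB) as [_ [_ b5]].
  assert (m0 : Cmod z0 <= Cmod h * X) by (unfold z0; rewrite (proj1 (cb h L0 Hh' H0)); mul_l; lra).
  assert (md : Cmod dz = Cmod h * de) by apply (cb h _ Hh' Hd). rewrite md in b5. fold X in b2, b3, b4, b5.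
  pose (Y := Cmod h ^ 2 * de). assert (HY : 0 <= Y) by (apply Rmult_le_pos; auto; apply pow2_ge_0).
  assert (t1 : Cmod (ce z0 * (ce dz - 1 - dz)) <= Y * X ^ 8).
  { rewrite Cmod_mult. replace (Y * X ^ 8) with (X * (Y * X * X ^ 6)) by ring. mul_lr; auto using Cmod_ge_0.
   upto b5. mul_r; auto. replace ((Cmod h * de) ^ 2) with (Y * de) by (unfold Y; ring). mul_l; lra. }
  assert (t2 : Cmod ((ce z0 - 1) * dz) <= Y * X ^ 8). { rewrite Cmod_mult, md. via ((Cmod h * X * X ^ 6) * (Cmod h * de)).
   - mul_r; [apply Rmult_le_pos; auto|]. upto b3. mul_r; auto.
   - replace (Cmod h * X * X ^ 6 * (Cmod h * de)) with (Y * X ^ 7) by (unfold Y; ring). mul_l; auto. }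
  assert (t3 : Cmod (ut L0 L1 s * (ce z0 - 1 - z0)) <= Y * X ^ 16).
  { rewrite Cmod_mult. replace (Y * X ^ 16) with ((de * X ^ 8) * ((Cmod h * X) ^ 2 * X ^ 6)) by (unfold Y; ring). mul_lr; auto using Cmod_ge_0.
   upto b4. mul_r; auto. apply pow_incr. split; auto using Cmod_ge_0. }
  assert (t4 : Cmod (ce (- (s * L1)) * (ce z0 * (ce dz - 1 - dz) + (ce z0 - 1) * dz)) <= Y * X ^ 16).
  { rewrite Cmod_mult. via (X * (Y * X ^ 9)).
   - mul_lr; auto using Cmod_ge_0. upto Cmod_triangle. specialize (Xdbl 8%nat). nra.
   - replace (X * (Y * X ^ 9)) with (Y * X ^ 10) by ring. mul_l; auto. apply Xle; lia. }
  upto Cmod_triangle. replace (Q * Cmod h ^ 2) with (Y * X ^ 17) by (unfold Q, Y; ring). specialize (Xdbl 16%nat). nra.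
Qed.

Lemma is_series_C (u : nat -> C) (x y : R) : is_series (fun k => Re (u k)) x -> is_series (fun k => Im (u k)) y ->
 is_series (K := C_AbsRing) (V := C_NormedModule) u (x, y).
Proof.
 intros Hx Hy P [eps HP].
 assert (E : forall n, sum_n (G := C_AbelianMonoid) u n = (sum_n (fun k => Re (u k)) n, sum_n (fun k => Im (u k)) n)).
 { induction n as [|n IH]; [rewrite !sum_O; destruct (u O); reflexivity|]. rewrite !sum_Sn, IH. reflexivity. }
 destruct (Hx (fun v => ball x eps v) (ex_intro _ eps (fun _ H => H))) as [n1 H1].
 destruct (Hy (fun v => ball y eps v) (ex_intro _ eps (fun _ H => H))) as [n2 H2].
 exists (Nat.max n1 n2). intros n Hn. apply HP. rewrite E. split; [apply H1|apply H2]; lia.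
Qed.

Lemma is_derive_C_quadratic (f : C -> C) (s l : C) B : (forall h, Cmod h <= 1 -> Cmod (f (s + h)%C - f s - h * l) <= B * Cmod h ^ 2) ->
 is_derive (K := C_AbsRing) (V := C_NormedModule) f s l.
Proof.
 intros H. split; [apply is_linear_scal_l|]. intros x Hx.
 assert (x = s) as -> by (symmetry; apply (is_filter_lim_locally_unique (K := C_AbsRing) (V := AbsRing_NormedModule C_AbsRing)); exact Hx).
 intros eps. assert (HB : 0 <= B).
 { specialize (H (RtoC 1)). rewrite Cmod_1 in H. specialize (H (Rle_refl 1)). use (Cmod_ge_0 (f (s + 1)%C - f s - 1 * l)). lra. }
 use (cond_pos eps) as He. assert (Hd : 0 < Rmin 1 (eps / (B + 1))) by (apply Rmin_glb_lt; [lra|apply Rdiv_lt_0_compat; lra]).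
 exists (mkposreal _ Hd).
 assert (Q : forall y : C, Cmod (y - s) < Rmin 1 (eps / (B + 1)) -> Cmod (f y - f s - (y - s) * l) <= eps * Cmod (y - s)).
 { intros y Hy. use (Rlt_le_trans _ _ _ Hy (Rmin_l _ _)) as H1. use (Rlt_le_trans _ _ _ Hy (Rmin_r _ _)) as H2.
  specialize (H (y - s)%C ltac:(lra)). replace (s + (y - s))%C with y in H by ring. upto H.
  use (Cmod_ge_0 (y - s)). replace (B * Cmod (y - s) ^ 2) with (B * Cmod (y - s) * Cmod (y - s)) by ring.
  mul_r; auto. via ((B + 1) * Cmod (y - s)); [nra|].
  apply (Rmult_lt_compat_l (B + 1)) in H2; [|lra]. replace ((B + 1) * (eps / (B + 1))) with (pos eps) in H2 by (field; lra). lra. }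
 intros y Hy. exact (Q y Hy).
Qed.

Lemma cpow_ce x s : cpow x (- s)%C = ce (- (s * RtoC (ln x)))%C.
Proof. destruct s as [u v]. unfold cpow, ce, Cmult, Copp, RtoC, cexpi, Re, Im; simpl. f_equal; ring_simplify;
 replace (- (u * ln x) + v * 0) with (- u * ln x) by ring; replace (- (u * 0) + - (v * ln x)) with (- v * ln x) by ring; f_equal; try ring; f_equal; ring. Qed.

Lemma ln_le_abs x A : 0 < x -> x <= A -> / x <= A -> Rabs (ln x) <= ln A.
Proof.
 intros Hx H1 H2. apply Rabs_le. split; [|apply ln_le; auto]. apply ln_le in H2; [|apply Rinv_0_lt_compat; auto]. rewrite ln_Rinv in H2 by auto. lra.
Qed.

Lemma ln_lipschitz x y m : 0 < m -> m <= x -> m <= y -> Rabs (ln x - ln y) <= / m * Rabs (x - y).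
Proof.
 intros Hm Hx Hy. assert (Q : forall u v, m <= u -> m <= v -> ln u - ln v <= / m * Rabs (u - v)).
 { intros u v Hu Hv. rewrite <- ln_div by lra. assert (Huv : 0 < u / v) by (apply Rdiv_lt_0_compat; lra).
  use (exp_ineq1_le (ln (u / v))) as E. rewrite exp_ln in E by auto. replace (u / v) with (1 + / v * (u - v)) in E at 2 by (field; lra).
  assert (/ v * (u - v) <= / v * Rabs (u - v)) by (mul_l; [left; apply Rinv_0_lt_compat; lra|apply Rle_abs]).
  assert (/ v * Rabs (u - v) <= / m * Rabs (u - v)) by (mul_r; [apply Rabs_pos|apply Rinv_le_contravar; auto]). lra. }
 apply Rabs_le. use (Q x y Hx Hy). use (Q y x Hy Hx) as Q2. rewrite (Rabs_minus_sym y x) in Q2. lra.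
Qed.

Section Difference.
Variables (l0 l1 : nat -> R) (m : R).
Hypothesis Hm : 0 < m.
Hypothesis Hl0 : forall j, m <= l0 j.
Hypothesis Hl1 : forall j, m <= l1 j.
Hypothesis Hr0 : rapid (fun j => l0 j - mu j).
Hypothesis Hr1 : rapid (fun j => l1 j - mu j).

Let u j := ut (ln (l0 j)) (ln (l1 j)).
Let u' j := ut' (ln (l0 j)) (ln (l1 j)).

(** The logarithms grow like [ln w], so [exp (sg * Lb) ^ 17] grows polynomially, of degree [34 sg]
    in [w j]. The rapid decrease of [l1 - l0] outweighs it at every [s], which makes the difference
    entire. *)
Lemma term_bounds s : exists K, forall j, Cmod (u j s) <= K / w j ^ 2 /\ Cmod (u' j s) <= K / w j ^ 2 /\
 forall h, Cmod h <= 1 -> Cmod (u j (s + h)%C - u j s - h * u' j s) <= K / w j ^ 2 * Cmod h ^ 2.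
Proof.
 assert (Up : forall l, rapid (fun j => l j - mu j) -> exists A, forall j, l j <= A * w j).
 { intros l Hl. destruct (Hl 0%nat) as [D HD]. exists (Rabs D + 1). intros j. specialize (HD j). rewrite pow_O, Rdiv_1_r in HD.
  apply Rabs_le_between in HD. use (mu_le_w j). use (w_ge1 j). use (Rle_abs D). use (Rabs_pos D). nra. }
 destruct (Up l0 Hr0) as [A0 HA0]. destruct (Up l1 Hr1) as [A1 HA1].
 pose (A := Rabs A0 + Rabs A1 + / m + 1). assert (Him : 0 < / m) by (apply Rinv_0_lt_compat; auto).
 use (Rabs_pos A0). use (Rabs_pos A1). use (Rle_abs A0). use (Rle_abs A1). assert (HA : 1 <= A) by (unfold A; lra).
 assert (HAw : forall j, 1 <= A * w j) by (intros j; use (w_ge1 j); nra).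
 assert (HL : forall j, Rabs (ln (l0 j)) <= ln (A * w j) /\ Rabs (ln (l1 j)) <= ln (A * w j)).
 { intros j. use (w_ge1 j). specialize (HA0 j). specialize (HA1 j). specialize (Hl0 j). specialize (Hl1 j).
  assert (/ l0 j <= / m) by (apply Rinv_le_contravar; auto). assert (/ l1 j <= / m) by (apply Rinv_le_contravar; auto).
  split; apply ln_le_abs; try lra; unfold A; nra. }
 pose (sg := Cmod s + 1). assert (Hsg : 1 <= sg) by (unfold sg; use (Cmod_ge_0 s); lra). destruct (INR_unbounded (34 * sg)) as [n Hn].
 assert (Hde : rapid (fun j => (exp (17 * sg) * (A * w j) ^ n * / m) * (l1 j - l0 j))).
 { apply (rapid_mult (fun j => l1 j - l0 j) (fun j => exp (17 * sg) * (A * w j) ^ n * / m) (exp (17 * sg) * A ^ n * / m) n).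
  - apply (rapid_ext (fun j => (l1 j - mu j) - (l0 j - mu j))); [intros; ring|]. apply rapid_minus; auto.
  - intros j. rewrite Rabs_pos_eq; [rewrite Rpow_mult_distr; right; ring|]. use (exp_pos (17 * sg)).
   assert (0 <= (A * w j) ^ n) by (apply pow_le; specialize (HAw j); lra). repeat apply Rmult_le_pos; lra. }
 destruct (Hde 2%nat) as [K HK]. exists K. intros j. specialize (HK j). destruct (HL j) as [h0 h1]. specialize (HAw j).
 pose (Lb := 1 + 2 * ln (A * w j)). assert (Hln : 0 <= ln (A * w j)) by (rewrite <- ln_1; apply ln_le; lra).
 assert (gd : Rabs (ln (l1 j) - ln (l0 j)) <= Lb). { upto Rabs_triang. rewrite Rabs_Ropp. unfold Lb; lra. }
 destruct (ut_estimates (ln (l0 j)) (ln (l1 j)) Lb sg s) as [b1 [b2 b3]]; auto; try (unfold Lb, sg; lra).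
 assert (F : Rabs (ln (l1 j) - ln (l0 j)) * exp (sg * Lb) ^ 17 <= K / w j ^ 2).
 { below HK. use (exp_pos (17 * sg)). assert (0 <= (A * w j) ^ n) by (apply pow_le; lra).
  rewrite Rabs_mult, (Rabs_pos_eq (_ * / m)), Rmult_comm, (Rmult_assoc (_ * _ ^ n)) by (repeat apply Rmult_le_pos; lra).
  mul_lr; auto using Rabs_pos; [apply pow_le; left; apply exp_pos| |apply ln_lipschitz; auto].
  rewrite <- !Rpower_pow by (lra || apply exp_pos). unfold Rpower. rewrite ln_exp, <- exp_plus. apply exp_le. unfold Lb.
  replace (INR 17) with 17 by (simpl; ring). nra. }
 split; [exact (Rle_trans _ _ _ b1 F)|]. split; [exact (Rle_trans _ _ _ b2 F)|]. intros h Hh. eapply Rle_trans; [apply b3; auto|]. mul_r; [apply pow2_ge_0|exact F].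
Qed.

Definition Du (s : C) : C := (Series (fun j => Re (u j s)), Series (fun j => Im (u j s))).
Definition Du' (s : C) : C := (Series (fun j => Re (u' j s)), Series (fun j => Im (u' j s))).

Lemma Du_series s : is_series (fun j => Re (u j s)) (Re (Du s)) /\ is_series (fun j => Im (u j s)) (Im (Du s)).
Proof.
 destruct (term_bounds s) as [K HK].
 split; apply is_series_w2 with K; intros j; (below (proj1 (HK j))); [apply re_le_Cmod|apply Im_le_Cmod].
Qed.

Lemma Du'_series s : is_series (fun j => Re (u' j s)) (Re (Du' s)) /\ is_series (fun j => Im (u' j s)) (Im (Du' s)).
Proof.
 destruct (term_bounds s) as [K HK].
 split; apply is_series_w2 with K; intros j; (below (proj1 (proj2 (HK j)))); [apply re_le_Cmod|apply Im_le_Cmod].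
Qed.

Lemma is_series_lin3 (x y z v : nat -> R) a b c d p q : is_series x a -> is_series y b -> is_series z c -> is_series v d ->
 is_series (fun k => x k - y k - (p * z k + q * v k)) (a - b - (p * c + q * d)).
Proof.
 intros Hx Hy Hz Hv. apply (is_series_minus (fun k => x k - y k) (fun k => p * z k + q * v k)); [apply (is_series_minus x y); auto|].
 apply (is_series_plus (fun k => p * z k) (fun k => q * v k)); [apply (is_series_scal p z c)|apply (is_series_scal q v d)]; auto.
Qed.

Lemma Du_derive s : is_derive (K := C_AbsRing) (V := C_NormedModule) Du s (Du' s).
Proof.
 destruct (term_bounds s) as [K HK]. apply is_derive_C_quadratic with (4 * K). intros h Hh.
 destruct (Du_series s) as [a1 a2]. destruct (Du_series (s + h)%C) as [b1 b2]. destruct (Du'_series s) as [c1 c2].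
 use (pow2_ge_0 (Cmod h)) as Hh2. assert (T : forall j, Cmod (u j (s + h)%C - u j s - h * u' j s) <= K * Cmod h ^ 2 / w j ^ 2).
 { intros j. replace (K * Cmod h ^ 2 / w j ^ 2) with (K / w j ^ 2 * Cmod h ^ 2) by (unfold Rdiv; ring). apply HK; auto. } upto Cmod_le_sum.
 assert (R1 : Re (Du (s + h) - Du s - h * Du' s) = Series (fun j => Re (u j (s + h)%C - u j s - h * u' j s))).
 { symmetry. apply is_series_unique. use (is_series_lin3 _ _ _ _ _ _ _ _ (Re h) (- Im h) b1 a1 c1 c2) as Q.
  replace (Re (Du (s + h) - Du s - h * Du' s)) with (Re (Du (s + h)) - Re (Du s) - (Re h * Re (Du' s) + - Im h * Im (Du' s))) by (unfold Re, Im; simpl; ring).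
  eapply is_series_ext_R; [|exact Q]. intros j. unfold Re, Im; simpl. ring. }
 assert (I1 : Im (Du (s + h) - Du s - h * Du' s) = Series (fun j => Im (u j (s + h)%C - u j s - h * u' j s))).
 { symmetry. apply is_series_unique. use (is_series_lin3 _ _ _ _ _ _ _ _ (Re h) (Im h) b2 a2 c2 c1) as Q.
  replace (Im (Du (s + h) - Du s - h * Du' s)) with (Im (Du (s + h)) - Im (Du s) - (Re h * Im (Du' s) + Im h * Re (Du' s))) by (unfold Re, Im; simpl; ring).
  eapply is_series_ext_R; [|exact Q]. intros j. unfold Re, Im; simpl. ring. } rewrite R1, I1.
 assert (X1 : Rabs (Series (fun j => Re (u j (s + h)%C - u j s - h * u' j s))) <= 2 * (K * Cmod h ^ 2)).
 { apply series_bound. intros j. eapply Rle_trans; [apply re_le_Cmod|apply T]. }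
 assert (X2 : Rabs (Series (fun j => Im (u j (s + h)%C - u j s - h * u' j s))) <= 2 * (K * Cmod h ^ 2)).
 { apply series_bound. intros j. eapply Rle_trans; [apply Im_le_Cmod|apply T]. } lra.
Qed.

Lemma u_real (p : nat) j : u j (RtoC (- INR p)) = RtoC (l1 j ^ p - l0 j ^ p).
Proof.
 assert (Q : forall x, 0 < x -> ce (- (RtoC (- INR p) * RtoC (ln x)))%C = RtoC (x ^ p)).
 { intros x Hx. rewrite <- Rpower_pow by auto. unfold ce, Rpower, Cmult, Copp, RtoC, Re, Im; simpl.
  replace (- (- INR p * ln x - 0 * 0)) with (INR p * ln x) by ring. replace (- (- INR p * 0 + 0 * ln x)) with 0 by ring.
  rewrite cos_0, sin_0. f_equal; ring. } unfold u, ut. use (Hl0 j). use (Hl1 j). rewrite !Q by lra. rewrite RtoC_minus. reflexivity.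
Qed.

End Difference.

(** * Uniqueness of the eigenvalue sequence and transfer of zeta bounds *)

Lemma least_index (P : nat -> Prop) k : P k -> exists i, (i <= k)%nat /\ P i /\ forall j, (j < i)%nat -> ~ P j.
Proof.
 induction k as [k IH] using lt_wf_ind. intros Hk. destruct (classic (exists j, (j < k)%nat /\ P j)) as [[j [Hj HP]]|H].
 - destruct (IH j Hj HP) as [i [Hi Q]]. exists i. split; [lia|exact Q].
 - exists k. split; [lia|]. split; auto. intros j Hj HP. apply H. eauto.
Qed.

Lemma nondecreasing_le (l : nat -> R) : (forall k, l k <= l (S k)) -> forall i j, (i <= j)%nat -> l i <= l j.
Proof. intros H i j Hij. induction Hij; [lra|]. eapply Rle_trans; [exact IHHij|apply H]. Qed.

(** [zeta_at] hides its enumeration, which must be identified with the constructed one. At a first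
    disagreement [f k < g k], let [i0] be the first index where [f] takes the value [f k]. Then [g]
    takes this value at [k + 1 - i0] indices, all of which lie among the [k - i0] indices from [i0]
    to [k - 1]. *)
Lemma eig_seq_unique b l l' : eig_seq b l -> eig_seq b l' -> l = l'.
Proof.
 intros [P1 [M1 E1]] [P2 [M2 E2]]. fext. intros k. induction k as [k IH] using lt_wf_ind.
 assert (Q : forall f g : nat -> R, (forall k, f k <= f (S k)) -> (forall k, g k <= g (S k)) -> (forall i, (i < k)%nat -> f i = g i) ->
  (forall n, idx_ge f (f k) n -> idx_ge g (f k) n) -> ~ f k < g k).
 { intros f g Mf Mg Hfg Hix Hlt. destruct (least_index (fun i => f i = f k) k eq_refl) as [i0 [Hi0 [Ei0 Hmin]]].
  destruct (Hix (S k - i0)%nat) as [h [Hinj Hv]].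
  { exists (fun i => i0 + i)%nat. split; [intros; lia|]. intros i Hi. apply Rle_antisym; [apply nondecreasing_le; auto; lia|].
   rewrite <- Ei0 at 1. apply nondecreasing_le; auto; lia. } assert (Hin : incl (map h (seq 0 (S k - i0))) (seq i0 (k - i0))).
  { intros y Hy. apply in_map_iff in Hy. destruct Hy as [i [<- Hi]]. apply in_seq in Hi. specialize (Hv i ltac:(lia)). apply in_seq.
   assert (Hk : (h i < k)%nat). { apply Nat.nle_gt. intros Hc. use (nondecreasing_le g Mg _ _ Hc). lra. }
   split; [|lia]. apply Nat.nlt_ge. intros Hc. apply (Hmin _ Hc). rewrite Hfg by auto. exact Hv. }
  assert (Hnd : NoDup (map h (seq 0 (S k - i0)))).
  { apply NoDup_map_NoDup_ForallPairs; [|apply seq_NoDup]. intros i j Hi Hj. apply in_seq in Hi. apply in_seq in Hj. apply Hinj; lia. }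
  use (NoDup_incl_length Hnd Hin) as Hlen. rewrite length_map, !length_seq in Hlen. lia. }
 use (Q l l' M1 M2 IH (fun n H => proj2 (E2 _ n (P1 k)) (proj1 (E1 _ n (P1 k)) H))) as Q1.
 use (Q l' l M2 M1 (fun i Hi => eq_sym (IH i Hi)) (fun n H => proj2 (E1 _ n (P2 k)) (proj1 (E2 _ n (P2 k)) H))) as Q2. lra.
Qed.

(* The two zeta functions differ by an entire function, so no knowledge of the
  meromorphic continuation itself is needed. *)
Theorem zeta_le_transfer a b l0 l1 p c : eig_seq a l0 -> eig_seq b l1 ->
 (forall q, rapid (fun j => l0 j ^ q - mu j ^ q)) -> (forall q, rapid (fun j => l1 j ^ q - mu j ^ q)) ->
 Series (fun j => l1 j ^ p - mu j ^ p) <= Series (fun j => l0 j ^ p - mu j ^ p) -> zeta_le a (- INR p) c -> zeta_le b (- INR p) c.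
Proof.
 intros S0 S1 Rp0 Rp1 Hle [z [[lam [HS [P [Z [sig [HP [Hs0 [Hd [Hser HZ]]]]]]]]] [Hi Hr]]].
 rewrite (eig_seq_unique a lam l0 HS S0) in Hser. clear HS lam. destruct S0 as [p0 [m0 e0]]. destruct S1 as [p1 [m1 e1]].
 pose (m := Rmin (l0 0%nat) (l1 0%nat)). assert (Hm : 0 < m) by (apply Rmin_glb_lt; auto).
 assert (Hm0 : forall j, m <= l0 j) by (intros j; eapply Rle_trans; [apply Rmin_l|apply nondecreasing_le; auto; lia]).
 assert (Hm1 : forall j, m <= l1 j) by (intros j; eapply Rle_trans; [apply Rmin_r|apply nondecreasing_le; auto; lia]).
 assert (R0 : rapid (fun j => l0 j - mu j)) by (apply (rapid_ext (fun j => l0 j ^ 1 - mu j ^ 1)); [intros; ring|auto]).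
 assert (R1 : rapid (fun j => l1 j - mu j)) by (apply (rapid_ext (fun j => l1 j ^ 1 - mu j ^ 1)); [intros; ring|auto]).
 pose (D := Du l0 l1).
 assert (HD : D (RtoC (- INR p)) = RtoC (Series (fun j => l1 j ^ p - mu j ^ p) - Series (fun j => l0 j ^ p - mu j ^ p))).
 { unfold D, Du. unfold RtoC at 3. f_equal.
  - rewrite <- Series_minus by (eexists; apply rapid_is_series; auto). apply Series_ext. intros j. rewrite (u_real l0 l1 m Hm Hm0 Hm1). simpl. ring.
  - rewrite (Series_ext _ (fun _ => 0 * 0)) by (intros j; rewrite (u_real l0 l1 m Hm Hm0 Hm1); simpl; ring). rewrite Series_scal_l. ring. }
 (* At [s = - p] the entire difference equals the real number given by the two spectral sums, which
    is at most 0; the imaginary part of the value therefore stays 0. *)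
 exists (z + D (RtoC (- INR p)))%C. split; [|rewrite HD; destruct z as [x y]; unfold Im, Re in *; simpl in *; lra].
 exists l1. split; [split; auto|]. exists P, (fun s => (Z s + D s)%C), sig. split; auto. split; auto. split; [|split].
 - intros s Hs. destruct (Hd s Hs) as [dz Hdz]. eexists. apply (is_derive_plus (K := C_AbsRing) (V := C_NormedModule) Z D); [exact Hdz|].
  apply (Du_derive l0 l1 m); auto.
 - intros s Hs. destruct (Hser s Hs) as [Hps Hss]. split; auto. destruct (Du_series l0 l1 m Hm Hm0 Hm1 R0 R1 s) as [D1 D2].
  eapply is_series_ext; [|apply (is_series_plus (K := C_AbsRing) (V := C_NormedModule) _ _ _ _ Hss (is_series_C _ _ _ D1 D2))].
  intros k. transitivity (cpow (l0 k) (- s) + ut (ln (l0 k)) (ln (l1 k)) s)%C; [reflexivity|]. rewrite !cpow_ce. unfold ut.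
  match goal with |- ?x = ?y => change (@eq C x y) end. ring.
 - rewrite HZ. reflexivity.
Qed.

Theorem theorem6p2 (a : R -> R) (N : nat) : Cinf a -> (forall th, 0 < a th) -> RInt (fun t => / a t) 0 (2 * PI) = 2 * PI ->
 (forall k : Z, (Z.of_nat N < Z.abs k)%Z -> uhat (rC a) k = RtoC 0) -> exists al : R -> R -> R, sol a N al /\
  (forall be, sol a N be -> forall tau, 0 <= tau -> be tau = al tau) /\ (forall c : nat -> R, (forall k, 0 < c k) ->
    Re (uhat (rC a) 0) <= c 0%nat -> zeta_le a (-1) (c 1%nat) -> (forall m : nat, (1 <= m)%nat -> zeta_le a (- 2 * INR m) (c (S m))) ->
    forall tau, 0 <= tau -> Kc c (al tau)).
Proof.
 intros Ha Hpos Hnorm Huhat. assert (Hband : band N a) by exact (proj1 (uhat_fc_zero a N (Cinf_cont _ Ha)) Huhat).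
 destruct (flow_exists N a Ha Hband Hpos) as [be [H0 [H1 [H2 [H3 H4]]]]]. assert (Hw : flow N a be) by (split; auto).
 exists (fun t => bb N (be t)). split; [apply flow_sol; auto|]. split; [apply sol_unique; auto|]. intros c _ c0 c1 cm tau Htau.
 destruct (flow_spectrum N a be Hw Hnorm) as [lam [L1 [L2 [L3 L4]]]].
 assert (E0 : eig_seq a (lam 0)) by (rewrite <- (bt_neg N a be Hw 0 (Rle_refl 0)); apply L1).
 assert (Tr : forall p c, spec_sum lam p tau <= spec_sum lam p 0 -> zeta_le a (- INR p) c -> zeta_le (bb N (be tau)) (- INR p) c).
 { intros p c' Hle Hz. apply (zeta_le_transfer a _ (lam 0) (lam tau)); auto. exact (L1 tau). }
 split; [apply bb_Cinf|]. split; [intros; apply (bt_pos N a be Hw)|]. split; [exact (ib_norm N a be Hw Hnorm tau)|]. split; [|split].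
 - rewrite uhat_zero_avg in * by (apply Cinf_cont; auto; apply bb_Cinf). specialize (H4 tau). lra.
 - replace (-1) with (- INR 1) in * by (simpl; ring). apply Tr; auto.
 - intros [|m] Hm; [lia|]. specialize (cm (S m) Hm).
  replace (- 2 * INR (S m)) with (- INR (2 * S m)) in * by (rewrite mult_INR; simpl; ring). apply Tr; auto.
Qed.
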